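(* Let $\mathcal{D}$ be a separable unital strongly self-absorbing $C^*$-algebra. If $[\mathbf{1}_{\mathcal{D}}]=0$ in $K_0(\mathcal{D})$, then $\mathcal{D}\cong\mathcal{O}_2$.
   Context: $\mathcal{O}_2$ is the Cuntz algebra generated by two isometries $s_1,s_2$ with $s_1s_1^*+s_2s_2^*=\mathbf{1}$. Two $*$-homomorphisms $\sigma,\gamma:C\to B$ with $B$ unital are approximately unitarily equivalent, $\sigma\approx_{\mathrm{u}}\gamma$, if there is a sequence $(u_n)_{n\in\mathbb{N}}$ of unitaries in $B$ with $\|u_n\sigma(c)u_n^*-\gamma(c)\|\to 0$ for every $c\in C$. A separable unital $C^*$-algebra $\mathcal{D}$ is strongly self-absorbing if $\mathcal{D}\neq\mathbb{C}$ and there is an isomorphism $\varphi:\mathcal{D}\to\mathcal{D}\otimes\mathcal{D}$ such that $\varphi\approx_{\mathrm{u}}\mathrm{id}_{\mathcal{D}}\otimes\mathbf{1}_{\mathcal{D}}$, where $\mathrm{id}_{\mathcal{D}}\otimes\mathbf{1}_{\mathcal{D}}$ is the map $d\mapsto d\otimes\mathbf{1}_{\mathcal{D}}$. Strongly self-absorbing $C^*$-algebras are known to be simple and nuclear, so $C^*$-tensor products with $\mathcal{D}$ are unambiguous. *)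

(* Defs.v *)
From HB Require Import structures.
From mathcomp Require Import all_boot all_order all_algebra.
From mathcomp Require Import generic_quotient.
From mathcomp Require Import boolp classical_sets functions cardinality.
From mathcomp Require Import reals topology normedtype.
From mathcomp.real_closed Require Import complex.
Set Implicit Arguments.
Unset Strict Implicit.
Unset Printing Implicit Defensive.
Import Order.TTheory GRing.Theory Num.Theory.
Import numFieldNormedType.Exports.
Local Open Scope classical_set_scope.
Local Open Scope ring_scope.
Local Open Scope complex_scope.
Local Open Scope quotient_scope.

(* Unital *-algebras over R[i].  GRing.Algebra requires 1 <> 0, so the zero
   algebra is not one of them. *)
HB.mixin Record hasStar (R : realType) A of GRing.Algebra R[i] A := {
  star : A -> A;
  starK : involutive star;
  starD : {morph star : x y / x + y};
  starZ : forall (a : R[i]) x, star (a *: x) = conjc a *: star x;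
  starM : forall x y, star (x * y) = star y * star x
}.

#[short(type="starAlgType")]
HB.structure Definition StarAlgebra (R : realType) :=
  {A of GRing.Algebra R[i] A & hasStar R A}.

(* The norm is real-valued and is not the norm of normedModType, because
   HB cannot join NormedModule with Algebra (they already meet in NumDomain). *)
HB.mixin Record hasCStarNorm (R : realType) A of StarAlgebra R A := {
  cnorm : A -> R;
  cnorm0_eq0 : forall x, cnorm x = 0 -> x = 0;
  cnormD : forall x y, cnorm (x + y) <= cnorm x + cnorm y;
  cnormZ : forall (a : R[i]) x, cnorm (a *: x) = complex.Re `|a| * cnorm x;
  cnormM : forall x y, cnorm (x * y) <= cnorm x * cnorm y;
  cstar_identity : forall x, cnorm (star x * x) = cnorm x ^+ 2;
  cnorm_complete : forall u : nat -> A,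
    (forall e, 0 < e -> exists N, forall m n, (N <= m)%N -> (N <= n)%N ->
       cnorm (u m - u n) < e) ->
    exists l, cnorm (u n - l) @[n --> \oo] --> (0 : R)
}.

#[short(type="cstarAlgType")]
HB.structure Definition CStarAlgebra (R : realType) :=
  {A of StarAlgebra R A & hasCStarNorm R A}.

Lemma conjc_star_scale (R : realType) (a : R[i]) (x : R[i]^o) :
  conjc (a *: x) = conjc a *: (conjc x : R[i]^o).
Proof. exact: rmorphM. Qed.

Lemma conjc_star_mul (R : realType) (x y : R[i]^o) :
  conjc (x * y) = conjc y * conjc x.
Proof. by rewrite rmorphM mulrC. Qed.

HB.instance Definition _ (R : realType) := hasStar.Build R R[i]^o
  (@conjcK R) (rmorphD (@conjc R)) (@conjc_star_scale R) (@conjc_star_mul R).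

Section Morphisms.
Variable R : realType.

Definition star_hom (A B : starAlgType R) (f : A -> B) : Prop :=
  [/\ linear f, {morph f : x y / x * y} & {morph f : x / star x}].

Definition star_iso (A B : starAlgType R) (f : A -> B) : Prop :=
  star_hom f /\ bijective f.

Definition star_isomorphic (A B : starAlgType R) : Prop :=
  exists f : A -> B, star_iso f.

Definition isometry (A : starAlgType R) (s : A) : Prop := star s * s = 1.

Definition unitary (A : starAlgType R) (u : A) : Prop :=
  star u * u = 1 /\ u * star u = 1.

Definition approx_unitarily_equiv (C : starAlgType R) (B : cstarAlgType R)
    (sigma gamma : C -> B) : Prop :=
  exists u : nat -> B, (forall n, unitary (u n)) /\
    forall c, cnorm (u n * sigma c * star (u n) - gamma c) @[n --> \oo]
                --> (0 : R).

End Morphisms.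

Section NormTopology.
Variables (R : realType) (A : cstarAlgType R).

Definition norm_closure (S : set A) : set A :=
  [set x | forall e : R, 0 < e -> exists2 y, S y & cnorm (x - y) < e].

Definition separable : Prop :=
  exists S : set A, countable S /\ norm_closure S = setT.

Definition cstar_subalgebra (S : set A) : Prop :=
  [/\ S 0, forall (a : R[i]) x y, S x -> S y -> S (a *: x + y),
      forall x y, S x -> S y -> S (x * y), forall x, S x -> S (star x)
    & norm_closure S `<=` S].

Definition cstar_generated_by (G : set A) : Prop :=
  forall S, cstar_subalgebra S -> G `<=` S -> S = setT.

(* By Cuntz's uniqueness theorem this determines A up to isomorphism. *)
Definition is_Cuntz_O2 : Prop :=
  exists s1 s2 : A,
    [/\ isometry s1, isometry s2, s1 * star s1 + s2 * star s2 = 1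
      & cstar_generated_by [set s1; s2]].

End NormTopology.
Arguments separable {R} A.
Arguments is_Cuntz_O2 {R} A.

Section TensorProduct.
Variables (R : realType) (A B : cstarAlgType R).

Definition bilinear_map (V : lmodType R[i]) (f : A -> B -> V) : Prop :=
  (forall b, linear (f^~ b)) /\ (forall a, linear (f a)).

(* The sequence xs of pairs (a, b) stands for the sum of the a ⊗ b in the
   algebraic tensor product A ⊙ B.  By the universal property, that sum is zero
   when every bilinear map sends it to zero. *)
Definition alg_tensor_eq0 (xs : seq (A * B)) : Prop :=
  forall (V : lmodType R[i]) (f : A -> B -> V), bilinear_map f ->
    \sum_(x <- xs) f x.1 x.2 = 0.

Definition tensor_sum (T : cstarAlgType R) (iA : A -> T) (iB : B -> T)
    (xs : seq (A * B)) : T := \sum_(x <- xs) iA x.1 * iB x.2.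

(* T is the completion of A ⊙ B in some C*-norm, with iA a = a ⊗ 1 and
   iB b = 1 ⊗ b. *)
Definition is_cstar_tensor (T : cstarAlgType R) (iA : A -> T) (iB : B -> T)
    : Prop :=
  [/\ star_hom iA /\ iA 1 = 1, star_hom iB /\ iB 1 = 1,
      forall a b, iA a * iB b = iB b * iA a,
      forall xs, tensor_sum iA iB xs = 0 -> alg_tensor_eq0 xs
    & norm_closure (range (tensor_sum iA iB)) = setT].

(* The norm of T is the least C*-norm on A ⊙ B. *)
Definition is_min_cstar_tensor (T : cstarAlgType R) (iA : A -> T) (iB : B -> T)
    : Prop :=
  is_cstar_tensor iA iB /\
  forall (T' : cstarAlgType R) (jA : A -> T') (jB : B -> T'),
    is_cstar_tensor jA jB ->
    forall xs, cnorm (tensor_sum iA iB xs) <= cnorm (tensor_sum jA jB xs).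

End TensorProduct.

Definition strongly_self_absorbing (R : realType) (D : cstarAlgType R) : Prop :=
  ~ star_isomorphic D R[i]^o /\
  exists (DD : cstarAlgType R) (i1 i2 : D -> DD),
    is_min_cstar_tensor i1 i2 /\
    exists phi : D -> DD, star_iso phi /\ approx_unitarily_equiv phi i1.

Section Grothendieck.
Variable M : nmodType.

Definition groth_eq (x y : M * M) : bool :=
  `[< exists r, x.1 + y.2 + r = y.1 + x.2 + r >].

Lemma groth_eq_refl : reflexive groth_eq.
Proof. by move=> x; apply/asboolP; exists 0. Qed.

Lemma groth_eq_sym : symmetric groth_eq.
Proof. by move=> x y; apply/asboolP/asboolP=> -[r e]; exists r. Qed.

Lemma groth_eq_trans : transitive groth_eq.
Proof.
move=> y x z /asboolP[r e] /asboolP[s f]; apply/asboolP.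
exists (y.1 + y.2 + r + s).
transitivity ((x.1 + y.2 + r) + (y.1 + z.2 + s)).
  rewrite -!addrA; congr (_ + _).
  by rewrite (AC (1*(1*(1*(1*1)))) (3*4*2*1*5))/= -!addrA.
rewrite e f (AC ((1*1*1)*(1*1*1)) ((4*2)*(1*5*3*6)))/=.
by [].
Qed.

Canonical groth_equiv := EquivRel groth_eq groth_eq_refl groth_eq_sym
  groth_eq_trans.

Definition groth := {eq_quot groth_equiv}.
HB.instance Definition _ := Choice.on groth.
HB.instance Definition _ := EqQuotient.on groth.

Definition groth_pi (x : M * M) : groth := \pi_groth x.

Lemma groth_piP (x y : M * M) :
  reflect (exists r, x.1 + y.2 + r = y.1 + x.2 + r) (groth_pi x == groth_pi y).
Proof. by rewrite eqmodE; exact: asboolP. Qed.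

Lemma groth_piK (x : groth) : groth_pi (repr x) = x.
Proof. exact: reprK. Qed.

Definition groth_add (x y : groth) : groth :=
  groth_pi ((repr x).1 + (repr y).1, (repr x).2 + (repr y).2).
Definition groth_opp (x : groth) : groth := groth_pi ((repr x).2, (repr x).1).

Lemma groth_reprP (x : M * M) :
  exists r, (repr (groth_pi x)).1 + x.2 + r = x.1 + (repr (groth_pi x)).2 + r.
Proof. by apply/groth_piP; rewrite groth_piK. Qed.

Lemma groth_add_pi (x y : M * M) :
  groth_add (groth_pi x) (groth_pi y) = groth_pi (x.1 + y.1, x.2 + y.2).
Proof.
apply/eqP/groth_piP => /=.
have [r e] := groth_reprP x; have [s f] := groth_reprP y.
move: (repr _) (repr _) e f => [a1 a2] [b1 b2] /= e f; exists (r + s).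
rewrite (AC ((1*1)*(1*1)*(1*1)) ((1*3*5)*(2*4*6)))/= e f.
by rewrite (AC ((1*1*1)*(1*1*1)) (((1*4)*(2*5))*(3*6)))/=.
Qed.

Lemma groth_opp_pi (x : M * M) : groth_opp (groth_pi x) = groth_pi (x.2, x.1).
Proof.
apply/eqP/groth_piP => /=; have [r e] := groth_reprP x.
by exists r; rewrite [_.2 + _]addrC -e [x.2 + _]addrC.
Qed.

Lemma groth_addA : associative groth_add.
Proof.
move=> x y z; rewrite -[x]groth_piK -[y]groth_piK -[z]groth_piK.
move: (repr x) (repr y) (repr z) => {}x {}y {}z.
rewrite (groth_add_pi y z) (groth_add_pi x y).
by rewrite (groth_add_pi x (_, _)) (groth_add_pi (_, _) z) /= !addrA.
Qed.

Lemma groth_addC : commutative groth_add.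
Proof.
move=> x y; rewrite -[x]groth_piK -[y]groth_piK.
move: (repr x) (repr y) => {}x {}y; rewrite (groth_add_pi x y) (groth_add_pi y x).
by rewrite [x.1 + _]addrC [x.2 + _]addrC.
Qed.

Lemma groth_add0 : left_id (groth_pi (0, 0)) groth_add.
Proof.
move=> x; rewrite -[x]groth_piK; move: (repr x) => {}x.
by rewrite (groth_add_pi (0, 0) x) /= !add0r -surjective_pairing.
Qed.

Lemma groth_addN : left_inverse (groth_pi (0, 0)) groth_opp groth_add.
Proof.
move=> x; rewrite -[x]groth_piK; move: (repr x) => {}x.
rewrite (groth_opp_pi x) (groth_add_pi (_, _) x); apply/eqP/groth_piP => /=.
by exists 0; rewrite !addr0 add0r addrC.
Qed.

HB.instance Definition _ := GRing.isZmodule.Build groth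
  groth_addA groth_addC groth_add0 groth_addN.

Definition groth_class (x : M) : groth := groth_pi (x, 0).

End Grothendieck.

Section MurrayVonNeumann.
Variables (R : realType) (A : starAlgType R).

Definition adj m n (x : 'M[A]_(m, n)) : 'M[A]_(n, m) := map_mx star x^T.

Lemma star0 : star (0 : A) = 0.
Proof. by apply: (addrI (star (0 : A))); rewrite -starD !addr0. Qed.

Lemma adjK m n (x : 'M[A]_(m, n)) : adj (adj x) = x.
Proof. by apply/matrixP=> i j; rewrite !mxE starK. Qed.

Lemma adj0 m n : adj (0 : 'M[A]_(m, n)) = 0.
Proof. by apply/matrixP=> i j; rewrite !mxE star0. Qed.

Lemma adjM m n p (x : 'M[A]_(m, n)) (y : 'M[A]_(n, p)) :
  adj (x *m y) = adj y *m adj x.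
Proof.
apply/matrixP=> i j; rewrite !mxE (big_morph _ (@starD _ _) star0).
by apply: eq_bigr => k _; rewrite !mxE starM.
Qed.

Lemma adj_block m1 m2 n1 n2 (a : 'M[A]_(m1, n1)) (b : 'M[A]_(m1, n2))
    (c : 'M[A]_(m2, n1)) (d : 'M[A]_(m2, n2)) :
  adj (block_mx a b c d) = block_mx (adj a) (adj c) (adj b) (adj d).
Proof. by rewrite /adj tr_block_mx map_block_mx. Qed.

Definition is_proj (p : {n : nat & 'M[A]_n}) : bool :=
  (adj (tagged p) == tagged p) && (tagged p *m tagged p == tagged p).

(* Projections in matrix algebras over A of arbitrary size. *)
Definition proj := {p : {n : nat & 'M[A]_n} | is_proj p}.

Definition psize (p : proj) : nat := tag (val p).
Definition pmx (p : proj) : 'M[A]_(psize p) := tagged (val p).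

Lemma pmx_adj (p : proj) : adj (pmx p) = pmx p.
Proof. by case/andP: (valP p) => /eqP. Qed.

Lemma pmx_idem (p : proj) : pmx p *m pmx p = pmx p.
Proof. by case/andP: (valP p) => _ /eqP. Qed.

Lemma is_projP n (p : 'M[A]_n) :
  adj p = p -> p *m p = p -> is_proj (Tagged (fun n => 'M[A]_n) p).
Proof. by move=> e f; rewrite /is_proj /= e f !eqxx. Qed.

Definition mkproj n (p : 'M[A]_n) (e : adj p = p) (f : p *m p = p) : proj :=
  exist (fun p => is_proj p) _ (is_projP e f).

(* The partial isometry v may be rectangular, so that projections of different
   sizes are compared directly. *)
Definition mvn (p q : proj) : bool :=
  `[< exists v : 'M[A]_(psize q, psize p),
        adj v *m v = pmx p /\ v *m adj v = pmx q >].

Lemma mvn_refl : reflexive mvn.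
Proof. by move=> p; apply/asboolP; exists (pmx p); rewrite pmx_adj pmx_idem. Qed.

Lemma mvn_sym : symmetric mvn.
Proof.
by move=> p q; apply/asboolP/asboolP=> -[v [e f]]; exists (adj v); rewrite adjK.
Qed.

Lemma mvn_trans : transitive mvn.
Proof.
move=> q p r /asboolP[v [vp vq]] /asboolP[w [wq wr]]; apply/asboolP.
exists (w *m v); rewrite adjM; split.
  by rewrite mulmxA -(mulmxA (adj v)) wq -vq mulmxA vp -mulmxA vp pmx_idem.
by rewrite mulmxA -(mulmxA w) vq -wq mulmxA wr -mulmxA wr pmx_idem.
Qed.

Canonical mvn_equiv := EquivRel mvn mvn_refl mvn_sym mvn_trans.

Definition mvn_monoid := {eq_quot mvn_equiv}.
HB.instance Definition _ := Choice.on mvn_monoid.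
HB.instance Definition _ := EqQuotient.on mvn_monoid.

Lemma proj0_adj : adj (0 : 'M[A]_0) = 0. Proof. exact: adj0. Qed.
Lemma proj0_idem : (0 : 'M[A]_0) *m (0 : 'M[A]_0) = 0. Proof. exact: mul0mx. Qed.
Definition proj0 : proj := mkproj proj0_adj proj0_idem.

Lemma dsum_adj (p q : proj) :
  adj (block_mx (pmx p) 0 0 (pmx q)) = block_mx (pmx p) 0 0 (pmx q).
Proof. by rewrite adj_block !pmx_adj !adj0. Qed.

Lemma dsum_idem (p q : proj) :
  block_mx (pmx p) 0 0 (pmx q) *m block_mx (pmx p) 0 0 (pmx q)
  = block_mx (pmx p) 0 0 (pmx q).
Proof.
by rewrite mulmx_block !pmx_idem !(mulmx0, mul0mx) !(addr0, add0r).
Qed.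

Definition dsum (p q : proj) : proj := mkproj (dsum_adj p q) (dsum_idem p q).

Lemma mvn_dsum p p' q q' : mvn p p' -> mvn q q' -> mvn (dsum p q) (dsum p' q').
Proof.
move=> /asboolP[v [v1 v2]] /asboolP[w [w1 w2]]; apply/asboolP.
exists (block_mx v 0 0 w); rewrite adj_block !adj0 /pmx /=.
by rewrite !mulmx_block v1 v2 w1 w2 !(mulmx0, mul0mx) !(addr0, add0r).
Qed.

Lemma mvn_dsumC p q : mvn (dsum p q) (dsum q p).
Proof.
apply/asboolP; exists (block_mx 0 (pmx q) (pmx p) 0).
rewrite adj_block !adj0 !pmx_adj /pmx /= !mulmx_block !pmx_idem.
by rewrite !(mulmx0, mul0mx) !(addr0, add0r).
Qed.

Lemma mvn_dsum0 p : mvn (dsum proj0 p) p.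
Proof.
apply/asboolP; exists (row_mx (0 : 'M_(_, 0)) (pmx p)).
have -> : adj (row_mx (0 : 'M_(_, 0)) (pmx p)) = col_mx 0 (pmx p).
  by rewrite /adj tr_row_mx map_col_mx -!/(adj _) adj0 pmx_adj.
rewrite mul_col_row mul_row_col !(mulmx0, mul0mx) add0r pmx_idem.
by split.
Qed.

Lemma mvn_cast m n (e : m = n) (p : 'M[A]_m) (q : 'M[A]_n)
    (pa : adj p = p) (pi : p *m p = p) (qa : adj q = q) (qi : q *m q = q) :
  castmx (e, e) p = q -> mvn (mkproj pa pi) (mkproj qa qi).
Proof.
case: n / e q qa qi => q qa qi; rewrite castmx_id => e; subst q.
by apply/asboolP; exists p; rewrite /pmx /= pa pi.
Qed.

Lemma mvn_dsumA p q r : mvn (dsum p (dsum q r)) (dsum (dsum p q) r).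
Proof.
apply: (mvn_cast (e := addnA (psize p) (psize q) (psize r))).
have e := @block_mxA _ _ _ _ _ _ _
  (pmx p) 0 0 0 (pmx q) 0 0 0 (pmx r).
rewrite /= !row_mx0 !col_mx0 in e.
apply: (etrans (congr1 (castmx _) e)).
by rewrite castmx_comp castmx_id.
Qed.

Definition mvn_pi (p : proj) : mvn_monoid := \pi_mvn_monoid p.

Lemma mvn_piP (p q : proj) : reflect (mvn_pi p = mvn_pi q) (mvn p q).
Proof. by apply: (iffP idP) => [|/eqP]; [move=> h; apply/eqP|]; rewrite eqmodE. Qed.

Lemma mvn_piK (x : mvn_monoid) : mvn_pi (repr x) = x.
Proof. exact: reprK. Qed.

Definition mvn_add (x y : mvn_monoid) : mvn_monoid :=
  mvn_pi (dsum (repr x) (repr y)).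

Lemma mvn_add_pi (p q : proj) :
  mvn_add (mvn_pi p) (mvn_pi q) = mvn_pi (dsum p q).
Proof. by apply/mvn_piP/mvn_dsum; apply/mvn_piP; rewrite mvn_piK. Qed.

Lemma mvn_addA : associative mvn_add.
Proof.
move=> x y z; rewrite -[x]mvn_piK -[y]mvn_piK -[z]mvn_piK.
move: (repr x) (repr y) (repr z) => p q r.
rewrite (mvn_add_pi q r) (mvn_add_pi p q) (mvn_add_pi p (dsum q r)).
by rewrite (mvn_add_pi (dsum p q) r); apply/mvn_piP/mvn_dsumA.
Qed.

Lemma mvn_addC : commutative mvn_add.
Proof.
move=> x y; rewrite -[x]mvn_piK -[y]mvn_piK.
move: (repr x) (repr y) => p q; rewrite (mvn_add_pi p q) (mvn_add_pi q p).
exact/mvn_piP/mvn_dsumC.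
Qed.

Lemma mvn_add0 : left_id (mvn_pi proj0) mvn_add.
Proof.
move=> x; rewrite -[x]mvn_piK; move: (repr x) => p.
by rewrite (mvn_add_pi proj0 p); apply/mvn_piP/mvn_dsum0.
Qed.

HB.instance Definition _ := GRing.isNmodule.Build mvn_monoid
  mvn_addA mvn_addC mvn_add0.

(* For unital A, K_0(A) is the Grothendieck group of the monoid of Murray-von
   Neumann classes of projections in matrices over A. *)
Definition K0 := groth mvn_monoid.
HB.instance Definition _ := GRing.Zmodule.on K0.

Definition K0_class (p : proj) : K0 := groth_class (mvn_pi p).

Lemma star1 : star (1 : A) = 1.
Proof. by rewrite -[LHS]mulr1 -{2}(starK (1 : A)) -starM mulr1 starK. Qed.

Lemma unit_proj_adj : adj (1%:M : 'M[A]_1) = 1%:M.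
Proof.
by apply/matrixP=> i j; rewrite !mxE eq_sym; case: eqP => _; rewrite ?star1 ?star0.
Qed.

Lemma unit_proj_idem : (1%:M : 'M[A]_1) *m 1%:M = 1%:M.
Proof. exact: mulmx1. Qed.

Definition unit_proj : proj := mkproj unit_proj_adj unit_proj_idem.

End MurrayVonNeumann.
Arguments K0 {R} A.
Arguments unit_proj {R} A.

(* Main.v *)
(* A strongly self-absorbing [D] has commuting unital copies [al], [be] inside itself
   such that the identity, [al] and [be] are approximately unitarily equivalent and the
   flip [al a * be b |-> al b * be a] is approximately inner. Elements that excise a
   state give slice maps and show that the norm on [al(D) be(D)] is a tensor norm.

   Since [1] has trivial class, [D^(n+1)] and [D^n] are isomorphic for some [n]. Slicing
   approximate flip unitaries spreads any nonzero element over many orthogonal copies of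
   the unit, so [D^n] embeds in [D], and [D] contains a Cuntz pair, hence a copy of [O2].

   Any two Cuntz pairs [r], [t] in a C*-algebra are approximately unitarily equivalent:
   the shift [Lam x = \sum_i r_i x r_i^*] is approximately inner, because
   [\sum_(i, j) r_i r_j r_i^* r_j^*] is a self-adjoint unitary, and averaging along the
   shift produces approximate intertwiners.

   Compressing left multiplication to a finite-dimensional space of GNS vectors, and
   realising this space by isometries of [O2], gives contractions [rho : D -> O2]. The
   same compression of an approximate flip unitary [W] gives approximately a partial
   isometry that commutes with [rho] and on whose initial projection [rho] is
   multiplicative. A Cuntz-algebra dilation then turns [rho] into approximate unital homomorphisms
   [D -> O2]. As [O2] lies in [D], conjugating by [W] moves finite subsets of [D]
   approximately into [O2] while almost fixing finite subsets of [O2], and a one-sided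
   approximate intertwining turns the inclusion of [O2] into an isomorphism. *)
From HB Require Import structures.
From mathcomp Require Import all_boot all_order all_algebra.
From mathcomp Require Import generic_quotient.
From mathcomp Require Import boolp classical_sets functions cardinality.
From mathcomp Require Import reals topology normedtype sequences.
From mathcomp.real_closed Require Import complex.
From mathcomp Require Import zify ring lra.
From Stdlib Require Ncring Ncring_tac.
Require Import Defs.
Set Implicit Arguments.
Unset Strict Implicit.
Unset Printing Implicit Defensive.
Import Order.TTheory GRing.Theory Num.Theory.
Import numFieldNormedType.Exports.
Local Open Scope ring_scope.
Local Open Scope complex_scope.

(** Every estimate is algebraic. Positive means square of a self-adjoint element, roots come from an
    iteration for [1 - sqrt (1 - y)], and norm bounds come from completing a self-adjoint element to
    a multiple of a unitary; no spectrum enters. A state is a limit of excisions: [e k * g * e k] is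
    close to [w g *: (e k * e k)]. Inner products of GNS vectors are thus visible inside the
    algebra, and a compression by such vectors is bounded by norms in [D], where a tensor is a
    product [al a * be b]. The obstacle in the second half is that compressions preserve the star
    and are contractive but not multiplicative, while the definition of strong self-absorption
    contains no finite-dimensional approximation. The approximate flip supplies it: [star W * be d]
    is close to [al d * star W], so products split along two commuting legs, and the compression is
    nearly multiplicative next to a compressed [star W]. Room kept free in [O2] beside the range of
    that operator is what the dilation uses. Statements up to null sequences become exact identities
    in a quotient of bounded sequences, where only the star-algebra structure is used. *)

Notation "‖[ x ]‖" := (cnorm x) (at level 0, x at level 99, format "‖[ x ]‖").

(** * Noncommutative ring normalisation, stars and norms *)

Section NcRing.
Variable A : nzRingType.

#[export] Instance nc_ops : @Ncring.Ring_ops A 0 1 (@GRing.add A)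
  (@GRing.mul A) (fun x y => x - y) (@GRing.opp A) eq := {}.

#[export] Instance nc_ring : Ncring.Ring (Ro := nc_ops).
Proof.
split; [exact: RelationClasses.eq_equivalence
  | rewrite /= /Algebra_syntax.equality /Ncring.eq_notation
      /Algebra_syntax.addition /Ncring.add_notation
      /Algebra_syntax.multiplication ..].
- by move=> x _ <- y _ <-.
- by move=> x _ <- y _ <-.
- by move=> x _ <- y _ <-.
- by move=> x _ <-.
- exact: add0r.
- exact: addrC.
- exact: addrA.
- exact: mul1r.
- exact: mulr1.
- exact: mulrA.
- by move=> x y z; exact: mulrDl.
- by move=> x y z; exact: mulrDr.
- by [].
- exact: subrr.
Qed.

End NcRing.

(** The [refine] restates the goal over the carrier of a nonzero ring, so that the instance above is
    found for every richer structure. *)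
Ltac ncring :=
  lazymatch goal with |- @eq _ ?x ?y =>
    refine (_ : @eq (GRing.NzRing.sort _) x y) end;
  Ncring_tac.non_commutative_ring.

Section StarBasics.
Variables (R : realType) (A : starAlgType R).
Implicit Types x y : A.

Lemma starN x : star (- x) = - star x.
Proof. by apply: (addrI (star x)); rewrite -starD !subrr star0. Qed.

Lemma starB x y : star (x - y) = star x - star y.
Proof. by rewrite starD starN. Qed.

Lemma star_sum I (r : seq I) (P : pred I) (F : I -> A) :
  star (\sum_(i <- r | P i) F i) = \sum_(i <- r | P i) star (F i).
Proof. exact: (big_morph _ (@starD _ _) (@star0 _ _)). Qed.

Lemma starX x n : star (x ^+ n) = star x ^+ n.
Proof.
elim: n => [|n IH]; first by rewrite !expr0 star1.
by rewrite exprS starM IH -exprSr.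
Qed.

Lemma starZr (a : R) x : star (a%:C *: x) = a%:C *: star x.
Proof. by rewrite starZ /conjc /= oppr0. Qed.

Lemma unitary_iso x : unitary x -> isometry x. Proof. by case. Qed.
Lemma unitary_star x : unitary x -> unitary (star x).
Proof. by case=> h k; split; rewrite starK. Qed.

Lemma unitaryM x y : unitary x -> unitary y -> unitary (x * y).
Proof.
move=> [h k] [h' k']; rewrite /unitary starM; split.
  by rewrite mulrA -(mulrA (star y)) h mulr1.
by rewrite mulrA -(mulrA x) k' mulr1.
Qed.

Lemma unitary1 : unitary (1 : A). Proof. by rewrite /unitary star1 mulr1. Qed.

End StarBasics.

Section NormBasics.
Variables (R : realType) (A : cstarAlgType R).
Implicit Types x y z : A.

Lemma Re_norm_ge0 (a : R[i]) : 0 <= complex.Re `|a|.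
Proof. by rewrite normc_def /= sqrtr_ge0. Qed.

Lemma cnormN x : ‖[- x]‖ = ‖[x]‖.
Proof. by rewrite -scaleN1r cnormZ normrN normr1 /= mul1r. Qed.

Lemma cnorm0 : ‖[0 : A]‖ = 0.
Proof. by rewrite -(scale0r (0 : A)) cnormZ normr0 mul0r. Qed.

Lemma cnorm_ge0 x : 0 <= ‖[x]‖.
Proof. by have := cnormD x (- x); rewrite subrr cnorm0 cnormN; lra. Qed.

Lemma cnormB x y : ‖[x - y]‖ <= ‖[x]‖ + ‖[y]‖.
Proof. by rewrite -(cnormN y) cnormD. Qed.

Lemma cnormBC x y : ‖[x - y]‖ = ‖[y - x]‖.
Proof. by rewrite -cnormN opprB. Qed.

Lemma cnorm_tri z x y : ‖[x - y]‖ <= ‖[x - z]‖ + ‖[z - y]‖.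
Proof.
have -> : x - y = (x - z) + (z - y) by rewrite addrA subrK.
exact: cnormD.
Qed.

Lemma cnormB_ge x y : ‖[x]‖ - ‖[y]‖ <= ‖[x - y]‖.
Proof. by have := cnormD (x - y) y; rewrite subrK; lra. Qed.

Lemma cnormZr (a : R) x : ‖[a%:C *: x]‖ = `|a| * ‖[x]‖.
Proof. by rewrite cnormZ normc_def /= expr0n /= addr0 sqrtr_sqr. Qed.

Lemma cnorm_eq0 x : ‖[x]‖ = 0 -> x = 0. Proof. exact: cnorm0_eq0. Qed.

Lemma cnorm_gt0 x : x <> 0 -> 0 < ‖[x]‖.
Proof.
move=> x0; rewrite lt_neqAle cnorm_ge0 andbT eq_sym; apply/eqP => h.
exact/x0/cnorm_eq0.
Qed.

Lemma cnorm_le0 x : ‖[x]‖ <= 0 -> x = 0.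
Proof. by move=> h; apply: cnorm_eq0; have := cnorm_ge0 x; lra. Qed.

Lemma cnorm_small x : (forall e, 0 < e -> ‖[x]‖ <= e) -> x = 0.
Proof.
move=> h; apply: cnorm_le0; apply/ler_addgt0Pl => e e0; rewrite addr0; exact: h.
Qed.

Lemma cnorm_star x : ‖[star x]‖ = ‖[x]‖.
Proof.
have h z : ‖[z]‖ <= ‖[star z]‖.
  have [->|/eqP z0] := eqVneq z 0; first by rewrite star0.
  have zp := cnorm_gt0 z0.
  by have := cnormM (star z) z; rewrite cstar_identity expr2 ler_pM2r.
by apply/eqP; rewrite eq_le h andbT -{2}(starK x) h.
Qed.

Lemma cstar_identityr x : ‖[x * star x]‖ = ‖[x]‖ ^+ 2.
Proof. by rewrite -{1}(starK x) cstar_identity cnorm_star. Qed.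

Lemma cnorm1 : ‖[1 : A]‖ = 1.
Proof.
have n0 : ‖[1 : A]‖ != 0.
  by apply/eqP => /cnorm_eq0/eqP; rewrite oner_eq0.
apply: (mulfI n0); rewrite mulr1 -expr2 -cstar_identity star1.
by rewrite mulr1.
Qed.

Lemma cnormX x n : ‖[x ^+ n]‖ <= ‖[x]‖ ^+ n.
Proof.
elim: n => [|n IH]; first by rewrite !expr0 cnorm1.
rewrite !exprS (le_trans (cnormM _ _)) // ler_wpM2l ?cnorm_ge0 //.
Qed.

Lemma cnorm_sum I (r : seq I) (P : pred I) (F : I -> A) :
  ‖[\sum_(i <- r | P i) F i]‖ <= \sum_(i <- r | P i) ‖[F i]‖.
Proof.
elim/big_rec2: _ => [|i y x _ h]; first by rewrite cnorm0.
by rewrite (le_trans (cnormD _ _)) // lerD2l.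
Qed.

Lemma cnorm_isometry x : isometry x -> ‖[x]‖ = 1.
Proof.
move=> h; have := cstar_identity x; rewrite h cnorm1 => e.
by apply/eqP; rewrite -sqrp_eq1 ?cnorm_ge0 // -e.
Qed.

Lemma cnorm_isoMl u x : isometry u -> ‖[u * x]‖ = ‖[x]‖.
Proof.
move=> h; apply: (@pexpIrn _ 2) => //; rewrite ?nnegrE ?cnorm_ge0 //.
by rewrite -!cstar_identity starM mulrA -(mulrA (star x)) h mulr1.
Qed.

Lemma cnorm_isoMr u x : isometry u -> ‖[x * star u]‖ = ‖[x]‖.
Proof. by move=> h; rewrite -cnorm_star starM starK cnorm_isoMl // cnorm_star. Qed.

Lemma cnormM_le x y (a b : R) : ‖[x]‖ <= a -> ‖[y]‖ <= b -> ‖[x * y]‖ <= a * b.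
Proof. by move=> h k; rewrite (le_trans (cnormM _ _)) // ler_pM ?cnorm_ge0. Qed.

Lemma cnormM_le1 x y (b : R) : ‖[x]‖ <= 1 -> ‖[y]‖ <= b -> ‖[x * y]‖ <= b.
Proof. by move=> h k; rewrite -[b]mul1r cnormM_le. Qed.

Lemma cnormM_le1r x y (b : R) : ‖[x]‖ <= b -> ‖[y]‖ <= 1 -> ‖[x * y]‖ <= b.
Proof. by move=> h k; rewrite -[b]mulr1 cnormM_le. Qed.

Lemma cnorm_conj u x : unitary u -> ‖[u * x * star u]‖ = ‖[x]‖.
Proof. by move=> h; rewrite cnorm_isoMr ?cnorm_isoMl //; exact: unitary_iso. Qed.

Definition lim_to (x : nat -> A) (l : A) :=
  forall e : R, 0 < e -> exists N, forall n, (N <= n)%N -> ‖[x n - l]‖ < e.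

Lemma lim_toP (x : nat -> A) l :
  ((fun n => ‖[x n - l]‖) @ \oo --> (0 : R))%classic <-> lim_to x l.
Proof.
split.
  move=> /cvgrPdist_lt h e e0; have [N _ hN] := h e e0.
  exists N => n /hN /=; rewrite sub0r normrN ger0_norm //; exact: cnorm_ge0.
move=> h; apply/cvgrPdist_lt => e e0; have [N hN] := h e e0.
exists N => // n /= /hN; rewrite sub0r normrN ger0_norm //; exact: cnorm_ge0.
Qed.

Lemma cauchy_lim (x : nat -> A) :
  (forall e : R, 0 < e -> exists N, forall m n, (N <= m)%N -> (N <= n)%N ->
     ‖[x m - x n]‖ < e) -> exists l, lim_to x l.
Proof. by move=> /cnorm_complete[l] /lim_toP h; exists l. Qed.

Lemma lim_to_uniq (x : nat -> A) l l' : lim_to x l -> lim_to x l' -> l = l'.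
Proof.
move=> h h'; apply/eqP; rewrite -subr_eq0; apply/eqP/cnorm_small => e e0.
have e2 : 0 < e / 2 by lra.
have [N hN] := h _ e2; have [M hM] := h' _ e2.
have := hN (maxn N M) (leq_maxl _ _); have := hM (maxn N M) (leq_maxr _ _).
by move=> a b; have := cnorm_tri (x (maxn N M)) l l'; rewrite (cnormBC l (x _)); lra.
Qed.

Lemma lim_to_le (x : nat -> A) l y (c : R) :
  lim_to x l -> (exists N, forall n, (N <= n)%N -> ‖[x n - y]‖ <= c) ->
  ‖[l - y]‖ <= c.
Proof.
move=> h [N hN]; apply/ler_addgt0Pl => e e0.
have [M hM] := h _ e0.
have := hN (maxn N M) (leq_maxl _ _); have := hM (maxn N M) (leq_maxr _ _).
by move=> a b; have := cnorm_tri (x (maxn N M)) l y; rewrite (cnormBC l (x _)); lra.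
Qed.

End NormBasics.

(** * Square roots and positive elements *)

Section Sqrt.
Variables (R : realType) (A : cstarAlgType R).
Implicit Types x y z a b s : A.

(** Iteration for [x = (y + x * x) / 2], solved by [x = 1 - sqrt (1 - y)]. Each iterate is a
    polynomial in [y] with nonnegative coefficients, so its scalar value [sqrt_sc] at [y = 1] bounds
    norms and increments for all [‖[y]‖ <= 1], the boundary included. *)
Fixpoint sqrt_it y n : A :=
  if n is m.+1 then 2^-1%:C *: (y + sqrt_it y m * sqrt_it y m) else 0.

Fixpoint sqrt_sc n : R :=
  if n is m.+1 then (1 + sqrt_sc m ^+ 2) / 2 else 0.

Lemma sqrt_scS n : sqrt_sc n.+1 = (1 + sqrt_sc n ^+ 2) / 2. Proof. by []. Qed.

Lemma sqrt_itS y n :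
  sqrt_it y n.+1 = 2^-1%:C *: (y + sqrt_it y n * sqrt_it y n).
Proof. by []. Qed.

Lemma sqrt_sc_bound n : 0 <= sqrt_sc n <= 1.
Proof. by elim: n => [|n /andP[h k]] /=; [rewrite lexx ler01|nra]. Qed.

Lemma sqrt_sc_mono n : sqrt_sc n <= sqrt_sc n.+1.
Proof. by rewrite /=; have /andP[h k] := sqrt_sc_bound n; nra. Qed.

Lemma sqrt_sc_lim n : 1 - sqrt_sc n <= 2 / n.+1%:R.
(* The gap [g = 1 - sqrt_sc n] evolves by [g |-> g * (1 - g / 2)], increasing on [[0, 1]], and
   [2 / M * (1 - 1 / M) <= 2 / (M + 1)]. Two initial cases are split off so that [M >= 2].
   Convergence is not geometric here, hence the explicit rate. *)
Proof.
elim: n => [|[|n] IH]; [by rewrite /=; lra|by rewrite /=; lra|].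
set m := n.+1 in IH *; rewrite /= -/(sqrt_sc m).
have /andP[h k] := sqrt_sc_bound m.
have m0 : (0 : R) < m.+1%:R by rewrite ltr0n.
have m1 : (2 : R) <= m.+1%:R by rewrite ler_nat.
rewrite ler_pdivlMr // in IH; rewrite ler_pdivlMr ?ltr0n //.
rewrite -(natr1 m.+1).
set b := sqrt_sc m in h k IH *; set M := m.+1%:R in IH m0 m1 *.
have -> : 1 - (1 + b ^+ 2) / 2 = (1 - b) * (1 - (1 - b) / 2) by field.
set g := 1 - b in IH *; have g0 : 0 <= g by rewrite /g; lra.
have g1 : g <= 1 by rewrite /g; lra.
have : 0 <= (2 - g * M) * (M * (2 - g) - g * (M + 1) + 2 * g).
  apply: mulr_ge0; first by lra.
  by nra.
by nra.
Qed.

Lemma sqrt_it_comm y z n : y * z = z * y -> sqrt_it y n * z = z * sqrt_it y n.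
Proof.
move=> yz; elim: n => [|n IH] /=; first by rewrite mul0r mulr0.
by rewrite -scalerAl -scalerAr mulrDl mulrDr yz -mulrA IH mulrA IH mulrA.
Qed.

Lemma sqrt_it_star y n : star y = y -> star (sqrt_it y n) = sqrt_it y n.
Proof.
by move=> sy; elim: n => [|n IH] /=; [exact: star0|rewrite starZr starD starM IH sy].
Qed.

Lemma cnorm_half x : ‖[2^-1%:C *: x]‖ = ‖[x]‖ / 2.
Proof. by rewrite cnormZr ger0_norm ?invr_ge0 // mulrC. Qed.

Lemma sqrt_it_norm y n : ‖[y]‖ <= 1 -> ‖[sqrt_it y n]‖ <= sqrt_sc n.
Proof.
move=> y1; elim: n => [|n IH] /=; first by rewrite cnorm0.
rewrite cnorm_half ler_wpM2r ?invr_ge0 // (le_trans (cnormD _ _)) // lerD //.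
by rewrite expr2 cnormM_le.
Qed.

Lemma sqrt_it_step y n : ‖[y]‖ <= 1 ->
  ‖[sqrt_it y n.+1 - sqrt_it y n]‖ <= sqrt_sc n.+1 - sqrt_sc n.
Proof.
move=> y1; elim: n => [|n IH].
  by rewrite /= mulr0 !addr0 !subr0 cnorm_half expr0n /= addr0 ler_wpM2r ?invr_ge0.
set b := sqrt_it y n.+1 in IH *; set c := sqrt_it y n in IH.
set b' := sqrt_sc n.+1 in IH *; set c' := sqrt_sc n in IH.
have -> : sqrt_it y n.+2 - b = 2^-1%:C *: ((b - c) * (b + c)).
  rewrite sqrt_itS -/b {3}/b sqrt_itS -/c -scalerBr; congr (_ *: _).
  have e : b * c = c * b by apply: sqrt_it_comm; apply/esym/sqrt_it_comm.
  have -> : (b - c) * (b + c) = b * b + b * c - c * b - c * c by ncring.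
  by rewrite e; ncring.
have -> : sqrt_sc n.+2 - b' = (b' - c') * (b' + c') / 2.
  by rewrite sqrt_scS -/b' {2}/b' sqrt_scS -/c'; field.
rewrite cnorm_half ler_wpM2r ?invr_ge0 // cnormM_le //.
by rewrite (le_trans (cnormD _ _)) // lerD // sqrt_it_norm.
Qed.

Lemma sqrt_it_dist y n m : ‖[y]‖ <= 1 -> (n <= m)%N ->
  ‖[sqrt_it y m - sqrt_it y n]‖ <= sqrt_sc m - sqrt_sc n.
Proof.
move=> y1; elim: m => [|m IH].
  by rewrite leqn0 => /eqP ->; rewrite !subrr cnorm0.
rewrite leq_eqVlt => /predU1P[->|]; first by rewrite !subrr cnorm0.
rewrite ltnS => /IH h; have k := sqrt_it_step m y1.
by have := cnorm_tri (sqrt_it y m) (sqrt_it y m.+1) (sqrt_it y n); lra.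
Qed.

Lemma inv_small (e : R) : 0 < e -> exists N : nat, 2 / N.+1%:R < e.
Proof.
move=> e0; exists (Num.truncn (2 / e)).
rewrite ltr_pdivrMr ?ltr0n // mulrC -ltr_pdivrMr //.
have := truncnS_gt (2 / e); by [].
Qed.

(** The square root of [1 - y]. It is used for [‖[y]‖ <= 1], where [sqrt_it_lim] provides the limit;
    [xget] defaults to 0 if there is none. *)
Definition sqrt1m y : A := 1 - xget 0 [set l | lim_to (sqrt_it y) l]%classic.

Lemma sqrt_it_lim y : ‖[y]‖ <= 1 ->
  lim_to (sqrt_it y) (xget 0 [set l | lim_to (sqrt_it y) l]%classic).
Proof.
move=> y1; suff [l hl] : exists l, lim_to (sqrt_it y) l by exact: (xgetPex 0 (ex_intro _ l hl)).
apply: cauchy_lim => e e0; have [N hN] := inv_small e0; exists N.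
have h m k : (N <= m)%N -> (m <= k)%N -> ‖[sqrt_it y k - sqrt_it y m]‖ < e.
  move=> Nm mk; apply: le_lt_trans (sqrt_it_dist y1 mk) _.
  apply: le_lt_trans hN; apply: le_trans (sqrt_sc_lim N).
  have /andP[_ c1] := sqrt_sc_bound k.
  have : sqrt_sc N <= sqrt_sc m.
    elim: m Nm {mk} => [|m IH]; first by rewrite leqn0 => /eqP ->.
    rewrite leq_eqVlt => /predU1P[->//|/IH]; have := sqrt_sc_mono m; lra.
  by lra.
by move=> m k Nm Nk; case/orP: (leq_total m k) => mk; [rewrite cnormBC|]; exact: h.
Qed.

Lemma sqrt1m_it y n : ‖[y]‖ <= 1 ->
  ‖[sqrt1m y - (1 - sqrt_it y n)]‖ <= 2 / n.+1%:R.
Proof.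
move=> y1; rewrite /sqrt1m; set l := xget _ _.
have -> : 1 - l - (1 - sqrt_it y n) = sqrt_it y n - l by ncring.
rewrite cnormBC; apply: (lim_to_le (sqrt_it_lim y1)); exists n => m nm.
apply: le_trans (sqrt_it_dist y1 nm) _.
apply: le_trans (sqrt_sc_lim n).
by have /andP[] := sqrt_sc_bound m; lra.
Qed.

Lemma sqrt1m_lim y : ‖[y]‖ <= 1 -> lim_to (fun n => 1 - sqrt_it y n) (sqrt1m y).
Proof.
move=> y1 e e0; have [N hN] := inv_small e0; exists N => n Nn.
rewrite cnormBC; apply: le_lt_trans (sqrt1m_it n y1) _.
apply: le_lt_trans hN; rewrite ler_wpM2l // lef_pV2 ?posrE ?ltr0n //.
by rewrite ler_nat.
Qed.

Lemma lim_comm (x : nat -> A) l z :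
  lim_to x l -> (forall n, x n * z = z * x n) -> l * z = z * l.
Proof.
move=> h c; apply/eqP; rewrite -subr_eq0; apply/eqP/cnorm_small => e e0.
have K : 0 < 2 * (‖[z]‖ + 1) by have := cnorm_ge0 z; lra.
have [N hN] := h _ (divr_gt0 e0 K); have := hN N (leqnn N) => {}hN.
have -> : l * z - z * l = z * (x N - l) - (x N - l) * z.
  transitivity (l * z - z * l + (z * x N - x N * z)); last by ncring.
  by rewrite c subrr addr0.
have h1 := cnormM z (x N - l); have h2 := cnormM (x N - l) z.
rewrite ltr_pdivlMr // in hN.
have z0 := cnorm_ge0 z; have d0 := cnorm_ge0 (x N - l).
have := cnormB (z * (x N - l)) ((x N - l) * z); by nra.
Qed.

Lemma sqrt1m_comm y z : ‖[y]‖ <= 1 -> y * z = z * y ->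
  sqrt1m y * z = z * sqrt1m y.
Proof.
move=> y1 yz; apply: (lim_comm (sqrt1m_lim y1)) => n.
by rewrite mulrBl mulrBr mul1r mulr1 sqrt_it_comm.
Qed.

Lemma lim_star (x : nat -> A) l :
  lim_to x l -> (forall n, star (x n) = x n) -> star l = l.
Proof.
move=> h c; apply: (lim_to_uniq _ h) => e /h[N hN]; exists N => n /hN.
have -> : x n - star l = star (x n - l) by rewrite starB c.
by rewrite cnorm_star.
Qed.

Lemma sqrt1m_star y : ‖[y]‖ <= 1 -> star y = y -> star (sqrt1m y) = sqrt1m y.
Proof.
move=> y1 sy; apply: (lim_star (sqrt1m_lim y1)) => n.
by rewrite starB star1 sqrt_it_star.
Qed.

Lemma scaler_half2 x : 2^-1%:C *: x + 2^-1%:C *: x = x.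
Proof.
rewrite -scalerDl; have -> : 2^-1%:C + 2^-1%:C = 1 :> R[i].
  by apply/eqP; rewrite eq_complex /=; apply/andP; split; apply/eqP; lra.
exact: scale1r.
Qed.

Lemma sqrt1m_sqr y : ‖[y]‖ <= 1 -> sqrt1m y * sqrt1m y = 1 - y.
Proof.
move=> y1; apply/eqP; rewrite -subr_eq0; apply/eqP/cnorm_small => e e0.
have e8 : 0 < e / 8 by lra.
have [N hN] := inv_small e8.
have hb k : ‖[1 - sqrt_it y k]‖ <= 2.
  have := sqrt_it_norm k y1; have := cnormB 1 (sqrt_it y k).
  by have /andP[] := sqrt_sc_bound k; rewrite cnorm1; lra.
set s := sqrt1m y; set t := 1 - sqrt_it y N.
have st : ‖[s - t]‖ <= e / 8 by exact: le_trans (sqrt1m_it N y1) (ltW hN).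
have s2 : ‖[s]‖ <= 2.
  have := lim_to_le (y := 0) (c := 2) (sqrt1m_lim y1); rewrite subr0; apply.
  by exists 0%N => n _; rewrite subr0.
have st1 : ‖[t - (1 - sqrt_it y N.+1)]‖ <= e / 8.
  have -> : t - (1 - sqrt_it y N.+1) = sqrt_it y N.+1 - sqrt_it y N.
    by rewrite /t; ncring.
  apply: le_trans (sqrt_it_step N y1) _.
  have := le_lt_trans (sqrt_sc_lim N) hN.
  by have /andP[] := sqrt_sc_bound N.+1; lra.
have tt : t * t - (1 - y) = (t - (1 - sqrt_it y N.+1)) + (t - (1 - sqrt_it y N.+1)).
  set h := sqrt_it y N.+1; have hE : h + h = y + sqrt_it y N * sqrt_it y N.
    by rewrite /h /= scaler_half2.
  have -> : t - (1 - h) + (t - (1 - h)) = t + t - 1 - 1 + (h + h) by ncring.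
  by rewrite hE /t; ncring.
have -> : s * s - (1 - y) = s * (s - t) + (s - t) * t + (t * t - (1 - y)) by ncring.
rewrite tt.
have h1 := cnormM_le s2 st; have h2 := cnormM_le st (hb N : ‖[t]‖ <= 2).
have h3 := cnormD (t - (1 - sqrt_it y N.+1)) (t - (1 - sqrt_it y N.+1)).
have h4 := cnormD (s * (s - t)) ((s - t) * t).
have := cnormD (s * (s - t) + (s - t) * t) (t - (1 - sqrt_it y N.+1) + (t - (1 - sqrt_it y N.+1))).
by lra.
Qed.

End Sqrt.

Section Positive.
Variables (R : realType) (A : cstarAlgType R).
Implicit Types a b s t x y z : A.

Lemma scaleM (c d : R) a b : (c%:C *: a) * (d%:C *: b) = (c * d)%:C *: (a * b).
Proof. by rewrite -scalerAl -scalerAr scalerA (rmorphM (real_complex R)). Qed.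

Lemma cnorm_scale (c : R) a : 0 <= c -> ‖[c%:C *: a]‖ = c * ‖[a]‖.
Proof. by move=> c0; rewrite cnormZr ger0_norm. Qed.

Lemma scale1C a : (1 : R)%:C *: a = a. Proof. exact: scale1r. Qed.

Lemma scaleCA (c d : R) a : c%:C *: (d%:C *: a) = (c * d)%:C *: a.
Proof. by rewrite scalerA (rmorphM (real_complex R)). Qed.

Lemma cnorm_sqr_sa a : star a = a -> ‖[a * a]‖ = ‖[a]‖ ^+ 2.
Proof. by move=> sa; rewrite -{1}sa cstar_identity. Qed.

Lemma conjc_i : conjc ('i : R[i]) = - 'i.
Proof. by apply/eqP; rewrite eq_complex /= oppr0 !eqxx. Qed.

(** [a + 'i *: s] is unitary and [a] is the mean of it and its adjoint. This takes the place of the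
    spectral radius in the norm bounds for self-adjoint elements. *)
Lemma circle_norm a s : star a = a -> star s = s -> a * s = s * a ->
  a * a + s * s = 1 -> ‖[a]‖ <= 1.
Proof.
move=> sa ss c e; set u := a + 'i *: s.
have su : star u = a - 'i *: s.
  by rewrite /u starD starZ sa ss conjc_i scaleNr.
have i2 : ('i *: s) * ('i *: s) = - (s * s).
  rewrite -scalerAl -scalerAr scalerA -expr2 sqr_i scaleN1r //.
have c1 : a * ('i *: s) = 'i *: (a * s) by rewrite scalerAr.
have c2 : ('i *: s) * a = 'i *: (a * s) by rewrite -scalerAl c.
have uu : star u * u = 1.
  rewrite su /u; transitivity (a * a + (a * ('i *: s) - ('i *: s) * a) - ('i *: s) * ('i *: s)).
    by ncring.
  by rewrite c1 c2 i2 subrr addr0 opprK.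
have u1 := cnorm_isometry uu.
have -> : a = 2^-1%:C *: (u + star u).
  rewrite su /u -[LHS]scaler_half2 -scalerDr; congr (_ *: _); by ncring.
by rewrite cnorm_half; have := cnormD u (star u); rewrite cnorm_star u1; lra.
Qed.

Lemma sqrtrM_id (c : R) : 0 <= c -> Num.sqrt c * Num.sqrt c = c.
Proof. by move=> c0; rewrite -expr2 sqr_sqrtr. Qed.

(** The form with a self-adjoint root makes roots and commutation accessible at once; that every
    [star x * x] qualifies is [pos_starM]. *)
Definition pos a := exists2 s, star s = s & a = s * s.

Lemma pos_star a : pos a -> star a = a.
Proof. by case=> s ss ->; rewrite starM ss. Qed.

Lemma pos_sqr s : star s = s -> pos (s * s). Proof. by exists s. Qed.

Lemma pos0 : pos 0. Proof. by exists 0; rewrite ?mulr0 ?star0. Qed.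

Lemma pos_scale (c : R) a : 0 <= c -> pos a -> pos (c%:C *: a).
Proof.
move=> c0 [s ss ->]; exists ((Num.sqrt c)%:C *: s); first by rewrite starZr ss.
by rewrite scaleM sqrtrM_id.
Qed.

Lemma pos_alg (c : R) : 0 <= c -> pos (c%:C *: (1 : A)).
Proof. by move=> c0; apply: pos_scale => //; exists 1; rewrite ?star1 ?mulr1. Qed.

(** After scaling to [c = 1], [a = t * t], the element [1 - t * t] is the square of
    [sqrt1m (t * t)], which lies on the circle with [t]. With the converse [norm_pos], positivity
    becomes a ball condition, and [posD] is the triangle inequality. *)
Lemma pos_norm a (c : R) : pos a -> ‖[a]‖ <= c -> ‖[c%:C *: 1 - a]‖ <= c.
Proof.
move=> [s ss ->]; rewrite (cnorm_sqr_sa ss) => sc.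
have [c0|c0] := leP c 0.
  have s0 : s = 0 by apply: cnorm_eq0; apply/eqP; rewrite -sqrf_eq0 eq_le sqr_ge0 (le_trans sc).
  have -> : c = 0 by move: sc; rewrite s0 cnorm0 expr0n /= => ?; apply/eqP; rewrite eq_le c0.
  by rewrite s0 mulr0 scale0r subr0 cnorm0.
pose r := Num.sqrt c; have r0 : 0 < r by rewrite sqrtr_gt0.
have c0' := ltW c0; have ri0 : 0 <= r^-1 by rewrite invr_ge0 ltW.
have rr : r * r = c by exact: sqrtrM_id.
pose t : A := r^-1%:C *: s.
have st : star t = t by rewrite starZr ss.
have tn : ‖[t * t]‖ <= 1.
  rewrite cnorm_sqr_sa // cnorm_scale // exprMn exprVn.
  by rewrite [r ^+ 2]expr2 rr mulrC ler_pdivrMr // mul1r.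
have ex : c%:C *: 1 - s * s = c%:C *: (1 - t * t).
  by rewrite scalerBr scaleM scaleCA -invfM rr mulfV ?gt_eqF // scale1C.
rewrite ex cnorm_scale // -[leRHS]mulr1 ler_wpM2l //.
have sw := sqrt1m_star tn (_ : star (t * t) = t * t).
rewrite -(sqrt1m_sqr tn) cnorm_sqr_sa ?sw ?starM ?st //.
rewrite -(expr1n _ 2) lerXn2r ?nnegrE ?cnorm_ge0 //.
apply: (@circle_norm _ t) => //; first by rewrite sw ?starM ?st.
  by apply: sqrt1m_comm => //; rewrite mulrA.
by rewrite sqrt1m_sqr // subrK.
Qed.

Lemma norm_pos_sqrt a (c : R) : star a = a -> 0 < c -> ‖[c%:C *: 1 - a]‖ <= c ->
  exists s, [/\ star s = s, ‖[(Num.sqrt c)%:C *: 1 - s]‖ <= Num.sqrt c, a = s * s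
    & forall z, a * z = z * a -> s * z = z * s].
Proof.
move=> sa c0 h; pose r := Num.sqrt c.
have ci0 : 0 <= c^-1 by rewrite invr_ge0 ltW.
have rr : r * r = c by exact: sqrtrM_id (ltW c0).
pose y : A := 1 - c^-1%:C *: a.
have ey : y = c^-1%:C *: (c%:C *: 1 - a).
  by rewrite scalerBr scaleCA mulVf ?gt_eqF // scale1C.
have y1 : ‖[y]‖ <= 1.
  by rewrite ey cnorm_scale // mulrC ler_pdivrMr // mul1r.
have sy : star y = y by rewrite starB star1 starZr sa.
exists (r%:C *: sqrt1m y); split.
- by rewrite starZr sqrt1m_star.
- have r0 : 0 <= r by exact: sqrtr_ge0.
  rewrite -/r -scalerBr cnorm_scale // -[leRHS]mulr1 ler_wpM2l //.
  have -> : 1 - sqrt1m y = - (sqrt1m y - 1) by ncring.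
  rewrite cnormN; apply: (lim_to_le (sqrt1m_lim y1)); exists 0%N => n _.
  have -> : 1 - sqrt_it y n - 1 = - sqrt_it y n by ncring.
  rewrite cnormN (le_trans (sqrt_it_norm n y1)) //.
  by have /andP[] := sqrt_sc_bound R n.
- rewrite scaleM rr sqrt1m_sqr // subKr scaleCA mulfV ?gt_eqF // scale1C //.
- move=> z az; rewrite -scalerAl -scalerAr sqrt1m_comm // /y.
  by rewrite mulrBl mulrBr mul1r mulr1 -scalerAl -scalerAr az.
Qed.

Lemma norm_pos a (c : R) : star a = a -> 0 <= c -> ‖[c%:C *: 1 - a]‖ <= c -> pos a.
Proof.
rewrite le_eqVlt => sa /predU1P[<-|c0] h.
  by move: h; rewrite scale0r sub0r cnormN => /cnorm_le0 ->; exact: pos0.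
by have [s [ss _ e _]] := norm_pos_sqrt sa c0 h; exists s.
Qed.

Lemma pos_psqrt a : pos a ->
  exists s, [/\ pos s, a = s * s & forall z, a * z = z * a -> s * z = z * s].
Proof.
move=> pa; have n1 : 0 < ‖[a]‖ + 1 by have := cnorm_ge0 a; lra.
have [|s [ss h e c]] := norm_pos_sqrt (pos_star pa) n1.
  by apply: pos_norm => //; lra.
by exists s; split=> //; exact: norm_pos ss (sqrtr_ge0 _) h.
Qed.

Lemma pos_sqrt a : pos a ->
  exists s, [/\ star s = s, a = s * s & forall z, a * z = z * a -> s * z = z * s].
Proof. by move=> /pos_psqrt[s [/pos_star]]; exists s. Qed.

Lemma posD a b : pos a -> pos b -> pos (a + b).
Proof.
move=> pa pb; apply: (@norm_pos _ (‖[a]‖ + ‖[b]‖)); first by rewrite starD !pos_star.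
  by rewrite addr_ge0 ?cnorm_ge0.
have -> : (‖[a]‖ + ‖[b]‖)%:C *: 1 - (a + b)
  = (‖[a]‖%:C *: 1 - a) + (‖[b]‖%:C *: 1 - b).
  by rewrite (rmorphD (real_complex R)) scalerDl; ncring.
by rewrite (le_trans (cnormD _ _)) // lerD // pos_norm.
Qed.

Lemma pos_sum I (r : seq I) (P : pred I) (F : I -> A) :
  (forall i, P i -> pos (F i)) -> pos (\sum_(i <- r | P i) F i).
Proof. by move=> h; elim/big_ind: _ => //; [exact: pos0|exact: posD]. Qed.

Lemma pos_ubound a (c : R) : star a = a -> ‖[a]‖ <= c -> pos (c%:C *: 1 - a).
Proof.
move=> sa ac; have c0 : 0 <= c by exact: le_trans (cnorm_ge0 a) ac.
apply: (norm_pos _ c0); first by rewrite starB starZr star1 sa.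
by rewrite opprB addrC subrK.
Qed.

Lemma posM a b : pos a -> pos b -> a * b = b * a -> pos (a * b).
Proof.
move=> /pos_sqrt[s [ss -> cs]] /pos_sqrt[t [st -> ct]] ab.
have st' : s * t = t * s by rewrite ct // cs.
exists (s * t); first by rewrite starM ss st.
have -> : s * t * (s * t) = s * (t * s) * t by ncring.
by rewrite -st'; ncring.
Qed.

(** For [d > c] the product [(d - a) * (d + a)] is positive; with its root [s], the pair [a], [s]
    lies on the circle of radius [d]. *)
Lemma pos_ubound_norm a (c : R) : 0 <= c -> pos a -> pos (c%:C *: 1 - a) -> ‖[a]‖ <= c.
Proof.
move=> c0 pa pca; apply/ler_addgt0Pl => e e0.
set d := e + c; have d0 : 0 < d by rewrite /d; lra.
have pda : pos (d%:C *: 1 - a).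
  have -> : d%:C *: 1 - a = e%:C *: 1 + (c%:C *: 1 - a).
    by rewrite (rmorphD (real_complex R)) scalerDl addrA.
  by apply: posD => //; apply: pos_alg; exact: ltW.
have pda' : pos (d%:C *: 1 + a) by apply: posD => //; apply: pos_alg; exact: ltW.
have cda z : a * z = z * a -> d%:C *: (1 : A) * z = z * (d%:C *: 1).
  by rewrite -scalerAl -scalerAr mul1r mulr1.
have dd : (d%:C *: (1 : A)) * a = a * (d%:C *: 1) by exact: cda.
have dde : (d%:C *: (1 : A)) * (d%:C *: 1) = (d * d)%:C *: 1 by rewrite scaleM mulr1.
have /pos_sqrt [s [ss es cs]] : pos ((d%:C *: 1 - a) * (d%:C *: 1 + a)).
  apply: posM => //; set D := d%:C *: 1 in dd *.
  by rewrite !(mulrDl, mulrDr, mulrN, mulNr) dd; ncring.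
have e2 : a * a + s * s = (d * d)%:C *: 1.
  rewrite -es -dde; set D := d%:C *: 1 in dd *.
  have -> : (D - a) * (D + a) = D * D + (D * a - a * D) - a * a by ncring.
  by rewrite dd; ncring.
have as_ : a * s = s * a.
  apply/esym/cs; set D := d%:C *: 1 in dd *.
  have -> : (D - a) * (D + a) = D * D + (D * a - a * D) - a * a by ncring.
  by rewrite dd subrr addr0 mulrBl mulrBr -!mulrA dd !mulrA dd.
have di0 : 0 <= d^-1 by rewrite invr_ge0 ltW.
have : ‖[d^-1%:C *: a]‖ <= 1.
  apply: (@circle_norm _ (d^-1%:C *: s)); rewrite ?starZr ?ss ?pos_star //.
    by rewrite !scaleM as_.
  by rewrite !scaleM -scalerDr e2 scaleCA -invfM mulVf ?scale1C // mulf_neq0 ?gt_eqF.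
by rewrite cnorm_scale // mulrC ler_pdivrMr // mul1r.
Qed.

Lemma pos_le_norm a b : pos a -> pos (b - a) -> ‖[a]‖ <= ‖[b]‖.
Proof.
move=> pa pba; have pb : pos b by rewrite -(subrK a b); exact: posD.
apply: pos_ubound_norm (cnorm_ge0 b) pa _.
have -> : ‖[b]‖%:C *: 1 - a = (‖[b]‖%:C *: 1 - b) + (b - a) by ncring.
by apply: posD => //; apply: pos_ubound (lexx _); exact: pos_star.
Qed.

Lemma pos_pow b n : pos b -> pos (b ^+ n).
Proof.
move=> pb; elim: n => [|n IH]; first by rewrite expr0; exists 1; rewrite ?star1 ?mulr1.
by rewrite exprS; apply: posM => //; rewrite -exprS exprSr.
Qed.

Lemma pos_1m b : star b = b -> ‖[b]‖ <= 1 -> pos (1 - b).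
Proof. by move=> sb b1; rewrite -(scale1C 1); exact: pos_ubound. Qed.

Lemma pos_1m_norm b : pos b -> ‖[b]‖ <= 1 -> ‖[1 - b]‖ <= 1.
Proof. by move=> pb b1; have := pos_norm pb b1; rewrite scale1C. Qed.

Lemma pow_comm b n m : b ^+ n * (1 - b ^+ m) = (1 - b ^+ m) * b ^+ n.
Proof. by rewrite mulrBr mulrBl mulr1 mul1r -!exprD addnC. Qed.

(** The elements [b ^+ j * (1 - b)] for [j <= n] add up to [1 - b ^+ n.+1], and each dominates the
    last one; so [n + 1] times the last is at most 1. *)
Lemma powX_small b n : pos b -> ‖[b]‖ <= 1 -> ‖[b ^+ n * (1 - b)]‖ <= n.+1%:R^-1.
Proof.
move=> pb b1; have sb := pos_star pb.
have p1 m : pos (1 - b ^+ m).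
  apply: pos_1m; first by rewrite starX sb.
  by apply: le_trans (cnormX _ _) _; rewrite exprn_ile1 ?cnorm_ge0.
have pd j : (j <= n)%N -> pos ((b ^+ j - b ^+ n) * (1 - b)).
  move=> jn; have -> : b ^+ j - b ^+ n = b ^+ j * (1 - b ^+ (n - j)).
    by rewrite mulrBr mulr1 -exprD subnKC.
  apply: posM; last first.
  - have c1 k : b ^+ k * (1 - b) = (1 - b) * b ^+ k.
      by rewrite mulrBr mulrBl mulr1 mul1r -exprS exprSr.
    have c2 k : (1 - b ^+ k) * (1 - b) = (1 - b) * (1 - b ^+ k).
      have -> : (1 - b ^+ k) * (1 - b) = 1 - b - b ^+ k * (1 - b) by ncring.
      by rewrite c1; ncring.
    by rewrite -mulrA c2 [LHS]mulrA c1 mulrA.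
  - by have := p1 1%N; rewrite expr1.
  - by apply: posM; [exact: pos_pow|exact: p1|exact: pow_comm].
have n0 : (0 : R) < n.+1%:R by rewrite ltr0n.
have n0' := ltW n0.
have pbn : pos (b ^+ n * (1 - b)).
  by have := p1 1%N; rewrite expr1 => h; apply: posM; [exact: pos_pow|done|rewrite -[in LHS](expr1 b) pow_comm expr1].
have tele m : \sum_(j < m) (b ^+ j * (1 - b)) = 1 - b ^+ m.
  elim: m => [|m IH]; first by rewrite big_ord0 expr0 subrr.
  by rewrite big_ord_recr /= IH mulrBr mulr1 -exprSr addrA subrK.
have : ‖[n.+1%:R%:C *: (b ^+ n * (1 - b))]‖ <= 1.
  apply: pos_ubound_norm => //; first by apply: pos_scale => //; exact: ltW.
  rewrite scale1C; have -> : 1 - n.+1%:R%:C *: (b ^+ n * (1 - b))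
     = b ^+ n.+1 + \sum_(j < n.+1) ((b ^+ j - b ^+ n) * (1 - b)).
    under eq_bigr do rewrite mulrBl.
    rewrite sumrB tele sumr_const card_ord addrA addrCA subrr addr0; congr (_ - _).
    by rewrite (rmorph_nat (real_complex R)) scaler_nat.
  apply: posD; first exact: pos_pow.
  by apply: pos_sum => i _; apply: pd; rewrite -ltnS.
by rewrite cnorm_scale // -ler_pdivlMl // mulr1.
Qed.

End Positive.

(** * Positivity of [star x * x], Neumann series and polar decomposition *)

Section Polar.
Variables (R : realType) (A : cstarAlgType R).
Implicit Types a b s t x y z : A.

(** The classical argument compares the spectra of [star y * y] and [y * star y]. Here, normalised
    to [‖[t]‖ = 1], the element [n = y * star y] is a positive contraction, so [‖[n * (1 - n)]‖ <= 1
    / 2]; but [n * (1 - n) = y * (1 + t * t) * star y] has the norm of [(1 + t * t) * (t * t)],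
    which is at least 1. *)
Lemma neg_square_eq0 y t : star t = t -> star y * y = - (t * t) -> y = 0.
Proof.
move=> st yy; have [t0|/eqP t0] := eqVneq t 0.
  apply: cnorm_eq0; have := cstar_identity y; rewrite yy t0 mulr0 oppr0 cnorm0.
  by move/esym/eqP; rewrite sqrf_eq0 => /eqP.
exfalso; pose c := ‖[t]‖^-1; have tp := cnorm_gt0 t0.
have c0 : 0 <= c by rewrite invr_ge0 ltW.
pose y1 : A := c%:C *: y; pose t1 : A := c%:C *: t.
have st1 : star t1 = t1 by rewrite starZr st.
have yy1 : star y1 * y1 = - (t1 * t1) by rewrite starZr !scaleM yy scalerN.
have t1n : ‖[t1]‖ = 1 by rewrite cnorm_scale // mulVf ?gt_eqF.
have tt1 : ‖[t1 * t1]‖ = 1 by rewrite cnorm_sqr_sa // t1n expr1n.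
have yn : ‖[y1]‖ = 1.
  apply/eqP; rewrite -sqrp_eq1 ?cnorm_ge0 // -cstar_identity yy1 cnormN tt1 //.
pose n := y1 * star y1.
pose p := 2^-1%:C *: (y1 + star y1); pose q := ('i * 2^-1%:C) *: (star y1 - y1).
have sp : star p = p by rewrite starZr starD starK addrC.
have sq : star q = q.
  have ci : conjc ('i * 2^-1%:C) = - ('i * 2^-1%:C) :> R[i].
    by apply/eqP; rewrite eq_complex /=; apply/andP; split; apply/eqP; ring.
  by rewrite starZ starB starK ci scaleNr -scalerN opprB.
(* [y1 * star y1 + star y1 * y1] is twice the sum of the squares of the real part [p] and the
   imaginary part [q]. *)
have nE : n = 2%:C *: (p * p + q * q) + t1 * t1.
  have pp : p * p = (2^-1 * 2^-1)%:C *: ((y1 + star y1) * (y1 + star y1)).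
    by rewrite scaleM.
  have qq : q * q = (2^-1 * 2^-1)%:C *: (- ((star y1 - y1) * (star y1 - y1))).
    rewrite -scalerAl -scalerAr scalerA mulrACA -expr2 sqr_i.
    by rewrite (rmorphM (real_complex R)) mulN1r scaleNr scalerN.
  rewrite pp qq -scalerDr scaleCA.
  have -> : (y1 + star y1) * (y1 + star y1) - (star y1 - y1) * (star y1 - y1)
    = (y1 * star y1 + star y1 * y1) + (y1 * star y1 + star y1 * y1) by ncring.
  have -> : 2 * (2^-1 * 2^-1) = 2^-1 :> R by field.
  by rewrite scalerDr scaler_half2 yy1 subrK.
have pn : pos n.
  rewrite nE; apply: posD; last exact: pos_sqr.
  by apply: pos_scale; rewrite ?ler0n //; apply: posD; exact: pos_sqr.
have n1 : ‖[n]‖ <= 1 by rewrite cstar_identityr yn expr1n.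
have := powX_small 1 pn n1; rewrite expr1.
have pt2 : pos (1 + t1 * t1).
  by apply: posD; [exists 1; rewrite ?star1 ?mulr1|exact: pos_sqr].
have [e [se ee ce]] := pos_sqrt pt2.
have et : e * t1 = t1 * e by apply: ce; ncring.
have -> : n * (1 - n) = (y1 * e) * star (y1 * e).
  rewrite starM se /n.
  have -> : y1 * e * (e * star y1) = y1 * (e * e) * star y1 by ncring.
  rewrite -ee; have -> : y1 * star y1 * (1 - y1 * star y1)
    = y1 * (1 - star y1 * y1) * star y1 by ncring.
  by rewrite yy1 opprK.
rewrite cstar_identityr -cstar_identity starM se.
have -> : e * star y1 * (y1 * e) = e * (star y1 * y1) * e by ncring.
rewrite yy1; have -> : e * - (t1 * t1) * e = - (e * t1 * (t1 * e)) by ncring.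
rewrite -et cnormN; have -> : e * t1 * (e * t1) = e * (t1 * e) * t1 by ncring.
rewrite -et; have -> : e * (e * t1) * t1 = (e * e) * (t1 * t1) by ncring.
rewrite -ee => h.
have : ‖[t1 * t1]‖ <= ‖[(1 + t1 * t1) * (t1 * t1)]‖.
  apply: pos_le_norm; first exact: pos_sqr.
  have -> : (1 + t1 * t1) * (t1 * t1) - t1 * t1 = (t1 * t1) * (t1 * t1) by ncring.
  by apply: pos_sqr; rewrite starM st1.
by rewrite tt1; lra.
Qed.

Lemma sa_cube_eq0 a : star a = a -> a * (a * a) = 0 -> a = 0.
Proof.
move=> sa h; have h4 : ‖[(a * a) * (a * a)]‖ = 0 by rewrite -mulrA h mulr0 cnorm0.
apply: cnorm_eq0; move: h4; rewrite cnorm_sqr_sa ?starM ?sa // cnorm_sqr_sa //.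
by move/eqP; rewrite !sqrf_eq0 => /eqP.
Qed.

(** [m0] is the modulus of [a = star x * x] and [f = m0 - a] is twice its negative part. As
    [a * f = - (f * m0)], the product [star (x * f) * (x * f)] is minus the square of [k * f], so
    [x * f = 0]; then [a * f = 0], [f = 0] and [a = m0]. *)
Theorem pos_starM x : pos (star x * x).
Proof.
set a := star x * x; have sa : star a = a by rewrite starM starK.
have [m0 [pm0 m0E cm0]] := pos_psqrt (pos_sqr sa).
have [k [sk kE ck]] := pos_sqrt pm0.
have am0 : m0 * a = a * m0 by apply: cm0; rewrite mulrA.
have ka : k * a = a * k by exact: ck.
have km0 : k * m0 = m0 * k by rewrite kE mulrA.
pose f := m0 - a.
have sf : star f = f by rewrite starB sa pos_star.
have ff : f * f = f * m0 + f * m0.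
  rewrite /f; have -> : (m0 - a) * (m0 - a) = m0 * m0 - m0 * a - a * m0 + a * a by ncring.
  rewrite am0 m0E; have -> : (m0 - a) * m0 = m0 * m0 - a * m0 by ncring.
  by ncring.
have af : a * f = - (f * m0).
  by rewrite /f mulrBr m0E; ncring.
have fE : x * f = 0.
  apply: (@neg_square_eq0 _ (k * f)).
    by rewrite starM sk sf /f mulrBl mulrBr ka km0.
  rewrite starM sf; have -> : f * star x * (x * f) = f * (a * f) by rewrite /a; ncring.
  have fk : f * k = k * f by rewrite /f mulrBl mulrBr ka km0.
  rewrite af mulrN kE; congr (- _).
  have -> : k * f * (k * f) = k * (f * k) * f by ncring.
  rewrite fk; have -> : k * (k * f) * f = k * k * (f * f) by ncring.
  have -> : f * (f * (k * k)) = f * ((f * k) * k) by ncring.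
  rewrite fk; have -> : f * (k * f * k) = (f * k) * (f * k) by ncring.
  rewrite fk; have -> : k * f * (k * f) = k * (f * k) * f by ncring.
  by rewrite fk; ncring.
have f0 : f = 0.
  apply: sa_cube_eq0 => //; have : a * f = 0 by rewrite /a -mulrA fE mulr0.
  by rewrite af => /eqP; rewrite oppr_eq0 => /eqP fm; rewrite ff fm addr0 mulr0.
by have -> : a = m0 by apply/eqP; rewrite eq_sym -subr_eq0 -/f f0.
Qed.

Lemma pos_conj x a : pos a -> pos (star x * a * x).
Proof.
move=> [s ss ->]; have -> : star x * (s * s) * x = star (s * x) * (s * x).
  by rewrite starM ss; ncring.
exact: pos_starM.
Qed.

(** The C*-identity settles the exponents [2 ^ k]; another exponent is squeezed by factoring
    [b ^+ (2 ^ n)] through [b ^+ n]. *)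
Lemma pos_norm1_pow b n : pos b -> ‖[b]‖ = 1 -> ‖[b ^+ n]‖ = 1.
Proof.
move=> pb b1; have sb := pos_star pb.
have h k : ‖[b ^+ (2 ^ k)]‖ = 1.
  elim: k => [|k IH]; first by rewrite expn0 expr1.
  by rewrite expnS mulnC muln2 -addnn exprD cnorm_sqr_sa ?starX ?sb // IH expr1n.
apply/eqP; rewrite eq_le (le_trans (cnormX _ _)) ?b1 ?expr1n //=.
have nk : (n <= 2 ^ n)%N by rewrite ltnW // ltn_expl.
have := h n; rewrite -{1}(subnKC nk) exprD => <-.
rewrite (le_trans (cnormM _ _)) // ler_piMr ?cnorm_ge0 //.
by rewrite (le_trans (cnormX _ _)) // b1 expr1n.
Qed.

Lemma sqrt1m_norm1 y : ‖[y]‖ <= 1 -> ‖[1 - sqrt1m y]‖ <= ‖[y]‖.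
Proof.
move=> y1; have -> : 1 - sqrt1m y = - (sqrt1m y - 1) by ncring.
rewrite cnormN; apply: (lim_to_le (sqrt1m_lim y1)); exists 0%N => n _.
have -> : 1 - sqrt_it y n - 1 = - sqrt_it y n by ncring.
rewrite cnormN; elim: n => [|n IH]; first by rewrite /= cnorm0 cnorm_ge0.
rewrite sqrt_itS cnorm_half.
have := cnormD y (sqrt_it y n * sqrt_it y n).
have := cnormM_le IH IH; have := cnorm_ge0 y; by nra.
Qed.

Lemma expr_small (c e : R) : 0 <= c < 1 -> 0 < e -> exists N, c ^+ N < e.
Proof.
move=> /andP[c0 c1] e0.
have : ((fun n : nat => c ^+ n) @ \oo --> (0 : R))%classic.
  by apply: cvg_expr; rewrite ger0_norm.
move=> /cvgrPdist_lt /(_ e e0)[N _ hN]; exists N.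
by have := hN N (leqnn N); rewrite /= sub0r normrN ger0_norm // exprn_ge0.
Qed.

Lemma neumann b : ‖[b]‖ < 1 -> exists c,
  [/\ c * (1 - b) = 1, (1 - b) * c = 1 & ‖[c]‖ <= (1 - ‖[b]‖)^-1].
Proof.
move=> b1; set B := ‖[b]‖ in b1 *; have B0 : 0 <= B by exact: cnorm_ge0.
have B1 : 0 < 1 - B by lra.
have B01 : 0 <= B < 1 by rewrite B0 b1.
pose g n := \sum_(k < n) b ^+ k; pose G n := \sum_(k < n) B ^+ k.
have gS n : g n.+1 = g n + b ^+ n by rewrite /g big_ord_recr.
have GS n : G n.+1 = G n + B ^+ n by rewrite /G big_ord_recr.
have G1 n : G n * (1 - B) = 1 - B ^+ n.
  elim: n => [|n IH]; first by rewrite /G big_ord0 mul0r expr0 subrr.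
  by rewrite GS mulrDl IH exprS; ring.
have g1 n : g n * (1 - b) = 1 - b ^+ n.
  elim: n => [|n IH]; first by rewrite /g big_ord0 mul0r expr0 subrr.
  by rewrite gS mulrDl IH exprSr; ncring.
have g2 n : (1 - b) * g n = 1 - b ^+ n.
  elim: n => [|n IH]; first by rewrite /g big_ord0 mulr0 expr0 subrr.
  by rewrite gS mulrDr IH exprS; ncring.
have gd n m : (n <= m)%N -> ‖[g m - g n]‖ <= G m - G n.
  elim: m => [|m IH]; first by rewrite leqn0 => /eqP ->; rewrite !subrr cnorm0.
  rewrite leq_eqVlt => /predU1P[->|]; first by rewrite !subrr cnorm0.
  rewrite ltnS => /IH h; rewrite gS GS; have := cnormX b m.
  have -> : g m + b ^+ m - g n = (g m - g n) + b ^+ m by ncring.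
  by have := cnormD (g m - g n) (b ^+ m); rewrite -/B; lra.
have Gb n m : G m - G n <= B ^+ n / (1 - B).
  rewrite ler_pdivlMr // mulrBl !G1; have : 0 <= B ^+ m by rewrite exprn_ge0.
  by lra.
have [c hc] : exists c, lim_to g c.
  apply: cauchy_lim => e e0.
  have [N hN] := expr_small B01 (mulr_gt0 e0 B1).
  exists N => m n Nm Nn.
  have key i j : (N <= i)%N -> (i <= j)%N -> ‖[g j - g i]‖ < e.
    move=> Ni ij; apply: le_lt_trans (gd _ _ ij) _.
    apply: le_lt_trans (Gb _ _) _; rewrite ltr_pdivrMr //.
    apply: le_lt_trans hN; rewrite ler_wiXn2l //; lra.
  by case/orP: (leq_total m n) => mn; [rewrite cnormBC|]; exact: key.
have bn e : 0 < e -> exists N, forall n, (N <= n)%N -> ‖[b ^+ n]‖ < e.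
  move=> e0; have [N hN] := expr_small B01 e0.
  exists N => n Nn; apply: le_lt_trans (cnormX _ _) _; apply: le_lt_trans hN.
  by rewrite -/B ler_wiXn2l //; lra.
have K : 0 < ‖[1 - b]‖ + 1 by have := cnorm_ge0 (1 - b); lra.
have lim1 x : lim_to (fun n => g n * x) (c * x).
  move=> e e0; have X : 0 < ‖[x]‖ + 1 by have := cnorm_ge0 x; lra.
  have [N hN] := hc _ (divr_gt0 e0 X); exists N => n /hN.
  rewrite ltr_pdivlMr // -mulrBl => h; apply: le_lt_trans (cnormM _ _) _.
  by apply: le_lt_trans h; rewrite ler_wpM2l ?cnorm_ge0 //; lra.
have lim2 x : lim_to (fun n => x * g n) (x * c).
  move=> e e0; have X : 0 < ‖[x]‖ + 1 by have := cnorm_ge0 x; lra.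
  have [N hN] := hc _ (divr_gt0 e0 X); exists N => n /hN.
  rewrite ltr_pdivlMr // mulrC -mulrBr => h; apply: le_lt_trans (cnormM _ _) _.
  by apply: le_lt_trans h; rewrite ler_wpM2r ?cnorm_ge0 //; lra.
have lim3 : lim_to (fun n => 1 - b ^+ n) 1.
  move=> e /bn[N hN]; exists N => n /hN.
  by rewrite addrC addrA addNr sub0r cnormN.
exists c; split.
- apply: (lim_to_uniq (lim1 (1 - b))) => e /lim3[N hN]; exists N => n /hN.
  by rewrite g1.
- apply: (lim_to_uniq (lim2 (1 - b))) => e /lim3[N hN]; exists N => n /hN.
  by rewrite g2.
- have := lim_to_le (y := 0) (c := (1 - B)^-1) hc; rewrite subr0; apply.
  exists 0%N => n _; have := gd 0%N n (leq0n n); rewrite /g big_ord0 => h.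
  apply: (le_trans h); rewrite (le_trans (Gb _ _)) // expr0 mul1r //.
Qed.

Lemma neumann_star b c : star b = b -> c * (1 - b) = 1 -> (1 - b) * c = 1 ->
  star c = c.
Proof.
move=> sb c1 c2; have e : (1 - b) * star c = 1.
  by rewrite -[1 - b]starK -starM starB star1 sb c1 star1.
by rewrite -[star c]mul1r -c1 -mulrA e mulr1.
Qed.

(* [p] is [(U*U)^(-1/2)] *)
Lemma inv_sqrt x (d : R) : d <= 2^-1 -> ‖[star x * x - 1]‖ <= d ->
  exists p, [/\ star p = p, p * (star x * x) * p = 1,
    (star x * x) * (p * p) = 1 & ‖[p - 1]‖ <= 2 * d].
Proof.
move=> d2 xd; pose y := 1 - star x * x.
have yd : ‖[y]‖ <= d by rewrite cnormBC.
have y1 : ‖[y]‖ <= 1 by lra.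
have sy : star y = y by rewrite starB star1 starM starK.
pose s := sqrt1m y; have ss : star s = s by exact: sqrt1m_star.
have sE : s * s = star x * x by rewrite sqrt1m_sqr // subKr.
pose b := 1 - s; have bd : ‖[b]‖ <= d by exact: le_trans (sqrt1m_norm1 y1) yd.
have sb : 1 - b = s by rewrite subKr.
have [|p [p1 p2 pn]] := @neumann b; first by lra.
have sp : star p = p by apply: neumann_star p1 p2; rewrite starB star1 ss.
rewrite sb in p1 p2; exists p; split=> //.
- rewrite -sE; have -> : p * (s * s) * p = (p * s) * (s * p) by ncring.
  by rewrite p1 p2 mulr1.
- rewrite -sE; have -> : s * s * (p * p) = s * (s * p) * p by ncring.
  by rewrite p2 mulr1.
have -> : p - 1 = p * b by rewrite mulrBr mulr1 p1.
apply: cnormM_le => //; apply: (le_trans pn).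
rewrite -[leRHS]invrK lef_pV2 ?posrE; lra.
Qed.

Lemma polar_isometry x (d : R) : d <= 2^-1 -> ‖[star x * x - 1]‖ <= d ->
  exists p, [/\ star p = p, isometry (x * p) & ‖[p - 1]‖ <= 2 * d].
Proof.
move=> d2 /(inv_sqrt d2)[p [sp h _ n]]; exists p; split=> //.
by rewrite /isometry starM sp -h; ncring.
Qed.

(** [x * star x] is unchanged when multiplied by the range projection [x * (p * p) * star x], and
    the last hypothesis gives it a left inverse; so this projection is 1. *)
Lemma polar_unitary x (d : R) : d <= 2^-1 -> ‖[star x * x - 1]‖ <= d ->
  ‖[x * star x - 1]‖ < 1 ->
  exists p, [/\ star p = p, unitary (x * p) & ‖[p - 1]‖ <= 2 * d].
Proof.
move=> d2 /(inv_sqrt d2)[p [sp h h' n]] hr; exists p; split=> //; split.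
  by rewrite starM sp -h; ncring.
have [|c [c1 c2 _]] := @neumann (1 - x * star x); first by rewrite cnormBC.
rewrite subKr in c1 c2; rewrite starM sp.
have -> : x * p * (p * star x) = (c * (x * star x)) * (x * (p * p) * star x).
  by rewrite c1; ncring.
have -> : c * (x * star x) * (x * (p * p) * star x)
  = c * x * ((star x * x) * (p * p)) * star x by ncring.
by rewrite h' mulr1 -mulrA c1.
Qed.

End Polar.

Section StarHom.
Variables (R : realType).

Section Hom.
Variables (A B : starAlgType R) (f : A -> B).
Hypothesis hf : star_hom f.
Lemma homZ a x : f (a *: x) = a *: f x.
Proof.
case: hf => l _ _; have h0 : f 0 = 0.
  have := l 1 0 0; rewrite !scale1r addr0 => e.
  by apply: (addrI (f 0)); rewrite addr0 -e.
by have := l a x 0; rewrite h0 !addr0.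
Qed.
Lemma homD x y : f (x + y) = f x + f y.
Proof. by case: hf => l _ _; have := l 1 x y; rewrite !scale1r. Qed.
Lemma hom0 : f 0 = 0. Proof. by rewrite -(scale0r 0) homZ scale0r. Qed.
Lemma homN x : f (- x) = - f x. Proof. by rewrite -scaleN1r homZ scaleN1r. Qed.
Lemma homB x y : f (x - y) = f x - f y. Proof. by rewrite homD homN. Qed.
Lemma homM x y : f (x * y) = f x * f y. Proof. by case: hf. Qed.
Lemma homS x : f (star x) = star (f x). Proof. by case: hf. Qed.
Lemma hom_sum I (r : seq I) (P : pred I) (F : I -> A) :
  f (\sum_(i <- r | P i) F i) = \sum_(i <- r | P i) f (F i).
Proof. exact: (big_morph _ homD hom0). Qed.
End Hom.

Lemma hom_comp (A B C : starAlgType R) (f : A -> B) (g : B -> C) :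
  star_hom f -> star_hom g -> star_hom (g \o f).
Proof.
move=> hf hg; split=> [a x y|x y|x] /=.
- by rewrite !(homD, homZ).
- by rewrite !homM.
- by rewrite !homS.
Qed.

(** A unital star-homomorphism preserves the circle relation between a self-adjoint contraction [a]
    and the root of [1 - a * a]. The C*-identity reduces the general case to this one. *)
Lemma hom_contractive (A B : cstarAlgType R) (f : A -> B) (x : A) :
  star_hom f -> f 1 = 1 -> ‖[f x]‖ <= ‖[x]‖.
Proof.
move=> hf f1.
have sa a : star a = a -> ‖[a]‖ <= 1 -> ‖[f a]‖ <= 1.
  move=> sa a1; have aa : ‖[a * a]‖ <= 1 by apply: cnormM_le1.
  have saa : star (a * a) = a * a by rewrite starM sa.
  apply: (@circle_norm _ _ _ (f (sqrt1m (a * a)))); rewrite -?(homS hf) ?sa ?sqrt1m_star //.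
    by rewrite -!(homM hf) sqrt1m_comm // mulrA.
  by rewrite -!(homM hf) -(homD hf) sqrt1m_sqr // addrC subrK.
have [->|/eqP x0] := eqVneq x 0; first by rewrite hom0 // !cnorm0.
have xp := cnorm_gt0 x0.
rewrite -(@ler_pXn2r _ 2) ?nnegrE ?cnorm_ge0 // -!cstar_identity -(homS hf) -(homM hf).
set a := star x * x; have ap : 0 < ‖[a]‖ by rewrite cstar_identity exprn_gt0.
have ai0 : 0 <= ‖[a]‖^-1 by rewrite invr_ge0 ltW.
have := sa (‖[a]‖^-1%:C *: a); rewrite (homZ hf) !cnorm_scale // mulVf ?gt_eqF //.
rewrite starZr starM starK -ler_pdivlMl ?invr_gt0 // invrK mulr1; exact.
Qed.

Lemma iso_inv (A B : starAlgType R) (f : A -> B) : star_iso f ->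
  exists g : B -> A, [/\ cancel f g, cancel g f, star_iso g, f 1 = 1 & g 1 = 1].
Proof.
move=> [hf [g fg gf]]; exists g.
have hg : star_hom g.
  split=> [a x y|x y|x]; apply: (can_inj fg).
  - by rewrite (homD hf) (homZ hf) !gf.
  - by rewrite (homM hf) !gf.
  - by rewrite (homS hf) !gf.
have f1 : f 1 = 1.
  transitivity (f 1 * f (g 1)); first by rewrite gf mulr1.
  by rewrite -(homM hf) mul1r gf.
by split=> //; [split=> //; exists f|rewrite -f1 fg].
Qed.

End StarHom.

(** * States obtained by excision *)

Section ComplexNorm.
Variable R : realType.
Implicit Types a b : R[i].

Lemma rcM (x y : R) : (x * y)%:C = x%:C * y%:C :> R[i].
Proof. exact: (rmorphM (real_complex R)). Qed.
Lemma rcB (x y : R) : (x - y)%:C = x%:C - y%:C :> R[i].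
Proof. exact: (rmorphB (real_complex R)). Qed.
Lemma rcN (x : R) : (- x)%:C = - x%:C :> R[i].
Proof. exact: (rmorphN (real_complex R)). Qed.
Definition nc a : R := complex.Re `|a|.

Lemma ncE a : `|a| = (nc a)%:C. Proof. by rewrite /nc normc_def. Qed.
Lemma nc_ge0 a : 0 <= nc a. Proof. exact: Re_norm_ge0. Qed.
Lemma ncD a b : nc (a + b) <= nc a + nc b.
Proof. by rewrite -lecR (rmorphD (real_complex R)) /= -!ncE ler_normD. Qed.
Lemma ncM a b : nc (a * b) = nc a * nc b.
Proof.
by have := normrM a b; rewrite !ncE -(rmorphM (real_complex R)) => -[].
Qed.
Lemma ncN a : nc (- a) = nc a. Proof. by rewrite /nc normrN. Qed.
Lemma nc0 : nc 0 = 0. Proof. by rewrite /nc normr0. Qed.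
Lemma nc1 : nc 1 = 1. Proof. by rewrite /nc normr1. Qed.
Lemma nc_eq0 a : nc a = 0 -> a = 0.
Proof. by move=> h; apply/eqP; rewrite -normr_eq0 ncE h. Qed.
Lemma nc_real (r : R) : nc r%:C = `|r|.
Proof. by rewrite /nc normc_def /= expr0n /= addr0 sqrtr_sqr. Qed.
Lemma nc_small a : (forall e, 0 < e -> nc a <= e) -> a = 0.
Proof.
move=> h; apply: nc_eq0; apply/eqP; rewrite eq_le nc_ge0 andbT.
by apply/ler_addgt0Pl => e /h; rewrite addr0.
Qed.
Lemma nc_i : nc 'i = 1.
Proof. by rewrite /nc normc_def /= expr0n expr1n /= add0r sqrtr1. Qed.
Lemma Re_le_nc a : `|complex.Re a| <= nc a.
Proof. by rewrite -lecR -ncE normc_ge_Re. Qed.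
Lemma Im_le_nc a : `|complex.Im a| <= nc a.
Proof. by have := Re_le_nc ('i * a); rewrite ncM nc_i mul1r; case: a => x y /=; rewrite mul0r mul1r sub0r normrN. Qed.
Lemma nc_le_ReIm a : nc a <= `|complex.Re a| + `|complex.Im a|.
Proof.
have -> : a = (complex.Re a)%:C + 'i * (complex.Im a)%:C by rewrite -complexE.
by rewrite (le_trans (ncD _ _)) // ncM nc_i mul1r !nc_real; case: a => x y /=; rewrite !(mul0r, mulr0, mul1r, addr0, add0r, subr0, oppr0).
Qed.
Lemma nc_sqr a : (nc a ^+ 2)%:C = a * conjc a.
Proof. by rewrite (rmorphXn (real_complex R)) /= -ncE sqr_normc. Qed.

Lemma real_cauchy (x : nat -> R) :
  (forall e, 0 < e -> exists N, forall m n, (N <= m)%N -> (N <= n)%N ->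
    `|x m - x n| < e) ->
  exists l, forall e, 0 < e -> exists N, forall n, (N <= n)%N -> `|x n - l| < e.
Proof.
move=> h; have /cauchy_cvgP : cauchy (x @ \oo)%classic.
  apply/cauchy_ballP => e e0; have [N hN] := h e e0.
  exists (x @` [set n | (N <= n)%N], x @` [set n | (N <= n)%N])%classic.
    by split; exists N => // n Nn; exists n.
  by move=> [_ _] [/= [m Nm <-] [n Nn <-]]; exact: hN.
case/cvg_ex => l /cvgrPdist_lt hl; exists l => e /hl[N _ hN]; exists N => n /hN /=.
by rewrite distrC.
Qed.

(** [P e l] is to be read as: [l] is correct up to [e]. As [P] is not assumed closed or monotone,
    the conclusion offers witnesses of [P] near the limit, not [P] of the limit. *)
Lemma complex_approx_limit (P : R -> R[i] -> Prop) :
  (forall e, 0 < e -> exists l, P e l) ->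
  (forall e e' l l', P e l -> P e' l' -> nc (l - l') <= e + e') ->
  exists l, forall e, 0 < e -> exists e' l', [/\ 0 < e', e' <= e, P e' l' & nc (l' - l) <= e].
Proof.
move=> ex un; pose ep n : R := n.+1%:R^-1.
have ep0 n : 0 < ep n by rewrite invr_gt0 ltr0n.
have eps e : 0 < e -> exists N, forall n, (N <= n)%N -> ep n < e.
  move=> e0; have [N hN] := inv_small e0; exists N => n Nn.
  apply: le_lt_trans hN; apply: (@le_trans _ _ N.+1%:R^-1).
    by rewrite lef_pV2 ?posrE ?ltr0n // ler_nat.
  by rewrite ler_peMl ?invr_ge0 ?ler0n // ler1n.
have /choice[L hL] n := ex _ (ep0 n).
have cau (f : R[i] -> R) : (forall a b, `|f a - f b| <= nc (a - b)) ->
    exists l, forall e, 0 < e -> exists N, forall n, (N <= n)%N -> `|f (L n) - l| < e.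
  move=> hf; apply: real_cauchy => e e0; have e2 : 0 < e / 2 by lra.
  have [N hN] := eps _ e2; exists N => m n /hN hm /hN hn.
  apply: le_lt_trans (hf _ _) _; have := un _ _ _ _ (hL m) (hL n); lra.
have [|x hx] := cau (@complex.Re R).
  by move=> [a a'] [b b']; have := Re_le_nc ((a +i* a') - (b +i* b')).
have [|y hy] := cau (@complex.Im R).
  by move=> [a a'] [b b']; have := Im_le_nc ((a +i* a') - (b +i* b')).
exists (x +i* y) => e e0; have e2 : 0 < e / 2 by lra.
have [N1 h1] := hx _ e2; have [N2 h2] := hy _ e2; have [N3 h3] := eps _ e0.
pose n := (N1 + (N2 + N3))%N; exists (ep n), (L n); split=> //.
- by apply/ltW/h3; rewrite /n; lia.
apply: le_trans (nc_le_ReIm _) _.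
have -> : complex.Re (L n - (x +i* y)) = complex.Re (L n) - x by case: (L n).
have -> : complex.Im (L n - (x +i* y)) = complex.Im (L n) - y by case: (L n).
have := h1 n (leq_addr _ _); have := h2 n (leq_trans (leq_addr _ _) (leq_addl _ _)).
by lra.
Qed.

End ComplexNorm.

Section Excision.
Variables (R : realType) (A : cstarAlgType R).
Implicit Types (e g x : A).

Lemma cnormZn (a : R[i]) x : ‖[a *: x]‖ = nc a * ‖[x]‖. Proof. exact: cnormZ. Qed.

(** One step of excision in the style of Akemann, Anderson and Pedersen. With [g] shifted to
    [X >= 1], the norms [L j] of [e ^+ j * X * e ^+ j] stay between 1 and [K], so some doubling of
    [j] hardly lowers them. At such a [j], a high power of the normalised
    [e ^+ (j + j) * X * e ^+ (j + j)] is almost absorbed by [e] and sees [X] as a scalar. *)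
Lemma excise_step e g (eps : R) : pos e -> ‖[e]‖ = 1 -> star g = g -> 0 < eps ->
  exists e' (l : R), [/\ pos e', ‖[e']‖ = 1, ‖[(1 - e) * e']‖ <= eps
    & ‖[e' * g * e' - l%:C *: (e' * e')]‖ <= eps].
Proof.
move=> pe e1 sg eps0; have se := pos_star pe.
set c := ‖[g]‖ + 1; pose X := c%:C *: 1 + g.
have X1 : pos (X - 1).
  have -> : X - 1 = ‖[g]‖%:C *: 1 - (- g).
    by rewrite /X /c (rmorphD (real_complex R)) scalerDl scale1C; ncring.
  by apply: pos_ubound; rewrite ?starN ?sg // cnormN.
have pX : pos X by rewrite -(subrK 1 X); apply: posD => //; exists 1; rewrite ?star1 ?mulr1.
set K := ‖[X]‖; have K0 : 0 <= K by exact: cnorm_ge0.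
have pn n := pos_pow n pe; have sn n := pos_star (pn n).
have en n : ‖[e ^+ n]‖ = 1 by exact: pos_norm1_pow.
pose L j := ‖[e ^+ j * X * e ^+ j]‖.
have L1 j : 1 <= L j.
  have <- : ‖[e ^+ j * e ^+ j]‖ = 1 by rewrite -exprD en.
  apply: pos_le_norm; first by rewrite -exprD.
  have -> : e ^+ j * X * e ^+ j - e ^+ j * e ^+ j = star (e ^+ j) * (X - 1) * e ^+ j.
    by rewrite sn; ncring.
  exact: pos_conj.
have LK j : L j <= K by rewrite /L; apply: cnormM_le1r; rewrite ?en //; apply: cnormM_le1; rewrite ?en.
pose t := Num.min 1 eps / (4 * (K + 1)).
have m0 : 0 < Num.min 1 eps by rewrite lt_min ltr01.
have K4 : 0 < 4 * (K + 1) by lra.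
have t0 : 0 < t by rewrite divr_gt0.
have tK : 4 * (K + 1) * t = Num.min 1 eps by rewrite mulrC divfK ?gt_eqF.
have tK1 : 4 * (K + 1) * t <= 1 by rewrite tK ge_min lexx.
have tKe : 4 * (K + 1) * t <= eps by rewrite tK ge_min lexx orbT.
have t1 : t <= 1 by nra.
have [k hk] : exists k : nat, k.+1%:R^-1 <= t ^+ 2 / 2.
  have tt : 0 < t ^+ 2 by rewrite exprn_gt0.
  have [N /ltW hN] := inv_small tt; exists N; rewrite ler_pdivlMr //.
  by rewrite mulrC.
(* Otherwise [L (2 ^ i)] would decay geometrically in [i], against the lower bound 1. *)
have [j [j1 hj]] : exists j, (0 < j)%N /\ (1 - t ^+ 2 / 2) * L j <= L (j + j)%N.
  apply: contrapT => no.
  have h i : L (2 ^ i)%N <= (1 - t ^+ 2 / 2) ^+ i * K.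
    elim: i => [|i IH]; first by rewrite expn0 expr0 mul1r.
    have [] := leP ((1 - t ^+ 2 / 2) * L (2 ^ i)%N) (L (2 ^ i + 2 ^ i)%N).
      by move=> h; exfalso; apply: no; exists (2 ^ i)%N; rewrite expn_gt0.
    rewrite expnS mul2n -addnn [_ ^+ i.+1]exprS => lt1; apply: le_trans (ltW lt1) _.
    by rewrite -[leRHS]mulrA; apply: ler_wpM2l => //; nra.
  have c01 : 0 <= 1 - t ^+ 2 / 2 < 1 by nra.
  have KK : 0 < (K + 1)^-1 by rewrite invr_gt0; lra.
  have [N hN] := expr_small c01 KK.
  have := h N; have := L1 (2 ^ N)%N.
  move: hN; rewrite -[X in _ < X]div1r ltr_pdivlMr; last by lra.
  have : 0 <= (1 - t ^+ 2 / 2) ^+ N by rewrite exprn_ge0 //; case/andP: c01.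
  by nra.
set h := e ^+ j; set z := e ^+ (j + j)%N.
have zh : z = h * h by rewrite /z exprD.
have sz : star z = z by exact: sn.
set L2 := L (j + j)%N in hj; have L20 : 0 < L2 by have := L1 (j + j)%N; rewrite -/L2; lra.
have Lj0 : 0 < L j by have := L1 j; lra.
have L2i : 0 <= L2^-1 by rewrite invr_ge0 ltW.
pose b := L2^-1%:C *: (z * X * z).
have pb : pos b.
  by apply: pos_scale => //; rewrite -{1}sz; exact: pos_conj.
have b1 : ‖[b]‖ = 1 by rewrite cnorm_scale // mulVf ?gt_eqF.
pose e' := b ^+ k; have pe' : pos e' by exact: pos_pow.
have se' := pos_star pe'.
have e'1 : ‖[e']‖ = 1 by exact: pos_norm1_pow.
have b1' : ‖[b]‖ <= 1 by rewrite b1.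
have d1 : ‖[e' * (1 - b)]‖ <= t ^+ 2 / 2 by exact: le_trans (powX_small k pb b1') hk.
have p1z n : pos (1 - e ^+ n) by apply: pos_1m; rewrite ?en.
have hb : z * X * z = L2%:C *: b by rewrite scaleCA mulfV ?gt_eqF // scale1C.
(* From [h * X * h <= L j] follows [L2 * b = z * X * z <= L j * z]. Since [e'] almost absorbs [b]
   and [L2 / L j] is nearly 1, it almost absorbs [z]. *)
have d2 : ‖[e' * (1 - z) * e']‖ <= t ^+ 2.
  have q1 : pos (e' * (1 - z) * e') by rewrite -{1}se'; apply: pos_conj; exact: p1z.
  have q2 : pos (e' * h * ((L j)%:C *: 1 - h * X * h) * (h * e')).
    have -> : e' * h * ((L j)%:C *: 1 - h * X * h) * (h * e')
       = star (h * e') * ((L j)%:C *: 1 - h * X * h) * (h * e').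
      by rewrite starM se' sn.
    apply/pos_conj/pos_ubound; rewrite ?lexx // !starM sn (pos_star pX); exact: mulrA.
  have q3 : e' * h * ((L j)%:C *: 1 - h * X * h) * (h * e')
     = (L j)%:C *: (e' * z * e') - L2%:C *: (e' * b * e').
    rewrite mulrBr mulrBl; congr (_ - _).
      by rewrite -scalerAr -scalerAl mulr1 zh; congr (_ *: _); ncring.
    transitivity (e' * (z * X * z) * e'); first by rewrite zh; ncring.
    by rewrite hb -scalerAr -scalerAl.
  have := pos_scale (ltW (_ : 0 < (L j)^-1)) q2; rewrite invr_gt0 => /(_ Lj0).
  rewrite q3 scalerBr !scaleCA mulVf ?gt_eqF // scale1C mulrC => q4.
  set y := e' * (1 - b) * e' + (1 - L2 / L j)%:C *: (e' * b * e').
  apply: (@le_trans _ _ ‖[y]‖).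
    apply: pos_le_norm => //.
    have -> : y - e' * (1 - z) * e' = e' * z * e' - (L2 / L j)%:C *: (e' * b * e').
      rewrite /y (rmorphB (real_complex R)) scalerBl scale1C; ncring.
    exact: q4.
  have r1 : 1 - L2 / L j <= t ^+ 2 / 2.
    by rewrite lerBlDr -lerBlDl ler_pdivlMr.
  have r0 : 0 <= 1 - L2 / L j.
    rewrite subr_ge0 ler_pdivrMr // mul1r /L2 /L.
    have -> : e ^+ (j + j) * X * e ^+ (j + j) = e ^+ j * (e ^+ j * X * e ^+ j) * e ^+ j.
      by rewrite exprD; ncring.
    by apply: cnormM_le1r; rewrite ?en //; apply: cnormM_le1; rewrite ?en.
  have w1 : ‖[e' * (1 - b) * e']‖ <= t ^+ 2 / 2 by apply: cnormM_le1r; rewrite ?e'1.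
  have w2 : ‖[(1 - L2 / L j)%:C *: (e' * b * e')]‖ <= t ^+ 2 / 2.
    rewrite cnorm_scale // -[leRHS]mulr1; apply: ler_pM => //; first exact: cnorm_ge0.
    by apply: cnormM_le1r; rewrite ?e'1 //; apply: cnormM_le1; rewrite ?e'1.
  by apply: le_trans (cnormD _ _) _; lra.
(* Whatever has a square below [1 - z] is almost killed by [e']; this serves for [1 - z] and for
   [1 - e]. *)
have d3 x : star x = x -> pos (1 - z - x * x) -> ‖[x * e']‖ <= t.
  move=> sx px; rewrite -(@ler_pXn2r _ 2) ?nnegrE ?cnorm_ge0 ?(ltW t0) // -cstar_identity.
  apply: le_trans d2; rewrite starM se' sx.
  have -> : e' * x * (x * e') = e' * (x * x) * e' by ncring.
  apply: pos_le_norm; first by rewrite -{1}se'; apply/pos_conj/pos_sqr.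
  have -> : e' * (1 - z) * e' - e' * (x * x) * e' = e' * (1 - z - x * x) * e' by ncring.
  by rewrite -{1}se'; exact: pos_conj.
have dz : ‖[(1 - z) * e']‖ <= t.
  apply: d3; first by rewrite starB star1 sn.
  have -> : 1 - z - (1 - z) * (1 - z) = z * (1 - z) by ncring.
  by apply: posM; [exact: pn|exact: p1z|ncring].
have de : ‖[(1 - e) * e']‖ <= t.
  apply: d3; first by rewrite starB star1 se.
  have -> : 1 - z - (1 - e) * (1 - e) = e * (1 - e) + e * (1 - e ^+ (j + j).-1).
    have zS : z = e * e ^+ (j + j).-1 by rewrite -exprS prednK // addn_gt0 j1.
    by rewrite zS; ncring.
  apply: posD; apply: posM => //.
  - by have := p1z 1%N; rewrite expr1.
  - by ncring.
  - by rewrite mulrBr mulrBl -exprS -exprSr mul1r mulr1.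
exists e', (L2 - c); split=> //; first by nra.
have -> : e' * g * e' - (L2 - c)%:C *: (e' * e')
  = e' * ((1 - z) * (X * e')) + (e' * z) * X * ((1 - z) * e')
    - L2%:C *: (e' * (1 - b) * e').
  have -> : L2%:C *: (e' * (1 - b) * e') = L2%:C *: (e' * e') - e' * (z * X * z) * e'.
    by rewrite hb -scalerAr -scalerAl -scalerBr; congr (_ *: _); ncring.
  have -> : (L2 - c)%:C *: (e' * e') = L2%:C *: (e' * e') - c%:C *: (e' * e').
    by rewrite (rmorphB (real_complex R)) scalerBl.
  have -> : e' * g * e' = e' * X * e' - c%:C *: (e' * e').
    have -> : e' * X * e' = c%:C *: (e' * e') + e' * g * e'.
      by rewrite mulrDr mulrDl -scalerAr -scalerAl mulr1.
    by ncring.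
  by ncring.
have n1 : ‖[e' * ((1 - z) * (X * e'))]‖ <= t * K.
  rewrite mulrA; apply: cnormM_le; last by apply: cnormM_le1r; rewrite ?e'1.
  by rewrite -cnorm_star starM se' starB star1 sn.
have n2 : ‖[e' * z * X * ((1 - z) * e')]‖ <= K * t.
  apply: cnormM_le => //; apply: cnormM_le1 => //.
  by apply: cnormM_le1; rewrite ?e'1 ?en.
have n3 : ‖[L2%:C *: (e' * (1 - b) * e')]‖ <= K * (t ^+ 2 / 2).
  rewrite cnorm_scale ?(ltW L20) //; apply: ler_pM => //; rewrite ?cnorm_ge0 ?(ltW L20) ?LK //.
  by apply: cnormM_le1r; rewrite ?e'1.
apply: le_trans (cnormB _ _) _; have := cnormD (e' * ((1 - z) * (X * e'))) (e' * z * X * ((1 - z) * e')).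
by nra.
Qed.

End Excision.

Section ExcisingSequences.
Variables (R : realType) (A : cstarAlgType R).
Implicit Types (g x a : A) (e : nat -> A) (w : A -> R[i]).

Definition near_scalar (u g : A) (l : R[i]) (eps : R) : Prop :=
  ‖[u * g * u - l *: (u * u)]‖ <= eps.

(** Replacing [v] by [v * u] on one side and [u * v] on the other costs [eta] each time, after which
    the estimate for [u] applies. Hence later elements of an excising sequence inherit the scalars
    of earlier ones. *)
Lemma near_scalar_refine (u v g : A) l eps eta :
  star v = v -> star u = u -> ‖[u]‖ <= 1 -> ‖[v]‖ <= 1 -> ‖[(1 - u) * v]‖ <= eta ->
  near_scalar u g l eps -> near_scalar v g l (eps + 2 * eta * (‖[g]‖ + nc l)).
Proof.
move=> sv su u1 v1 h; rewrite /near_scalar => k.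
have h' : ‖[v * (1 - u)]‖ <= eta by rewrite -cnorm_star starM sv starB star1 su.
have -> : v * g * v - l *: (v * v) = (v * (1 - u)) * (g * v)
    + (v * u) * g * ((1 - u) * v) + v * (u * g * u - l *: (u * u)) * v
    - l *: ((v * (1 - u)) * v + (v * u) * ((1 - u) * v)).
  have -> : v * (u * g * u - l *: (u * u)) * v = v * (u * g * u) * v - l *: (v * u * (u * v)).
    by rewrite mulrBr mulrBl -scalerAr -scalerAl; congr (_ - _ *: _); ncring.
  have -> : (v * (1 - u)) * v + (v * u) * ((1 - u) * v) = v * v - v * u * (u * v) by ncring.
  by rewrite scalerBr; ncring.
have n1 : ‖[(v * (1 - u)) * (g * v)]‖ <= eta * ‖[g]‖.
  by apply: cnormM_le => //; apply: cnormM_le1r.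
have n2 : ‖[(v * u) * g * ((1 - u) * v)]‖ <= ‖[g]‖ * eta.
  by apply: cnormM_le => //; apply: cnormM_le1 => //; apply: cnormM_le1.
have n3 : ‖[v * (u * g * u - l *: (u * u)) * v]‖ <= eps.
  by apply: cnormM_le1r => //; apply: cnormM_le1.
have n4 : ‖[l *: ((v * (1 - u)) * v + (v * u) * ((1 - u) * v))]‖ <= nc l * (eta + eta).
  rewrite cnormZn ler_wpM2l ?nc_ge0 // (le_trans (cnormD _ _)) // lerD //.
    exact: cnormM_le1r.
  by apply: cnormM_le1 => //; apply: cnormM_le1.
apply: le_trans (cnormB _ _) _.
have := cnormD ((v * (1 - u)) * (g * v) + (v * u) * g * ((1 - u) * v)) (v * (u * g * u - l *: (u * u)) * v).
have := cnormD ((v * (1 - u)) * (g * v)) ((v * u) * g * ((1 - u) * v)).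
by nra.
Qed.

Definition excisable e g := forall eps, 0 < eps ->
  exists l N, forall k, (N <= k)%N -> near_scalar (e k) g l eps.

Definition excising e w := [/\ forall k, pos (e k), forall k, ‖[e k]‖ = 1
  & forall g eps, 0 < eps -> exists N, forall k, (N <= k)%N ->
      near_scalar (e k) g (w g) eps].

Section Seq.
Variable e : nat -> A.
Hypotheses (pe : forall k, pos (e k)) (e1 : forall k, ‖[e k]‖ = 1).

Lemma cnorm_ee k : ‖[e k * e k]‖ = 1.
Proof. by rewrite cnorm_sqr_sa ?e1 ?expr1n //; exact: pos_star. Qed.

Lemma excisableD g g' : excisable e g -> excisable e g' -> excisable e (g + g').
Proof.
move=> h h' eps eps0; have e2 : 0 < eps / 2 by lra.
have [l [N hN]] := h _ e2; have [l' [N' hN']] := h' _ e2.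
exists (l + l'), (N + N')%N => k kN; rewrite /near_scalar.
have -> : e k * (g + g') * e k - (l + l') *: (e k * e k)
  = (e k * g * e k - l *: (e k * e k)) + (e k * g' * e k - l' *: (e k * e k)).
  by rewrite scalerDl; ncring.
apply: le_trans (cnormD _ _) _.
have := hN k (leq_trans (leq_addr _ _) kN); have := hN' k (leq_trans (leq_addl _ _) kN).
by rewrite /near_scalar; lra.
Qed.

Lemma excisableZ (c : R[i]) g : excisable e g -> excisable e (c *: g).
Proof.
move=> h eps eps0; have K : 0 < nc c + 1 by have := nc_ge0 c; lra.
have [l [N hN]] := h _ (divr_gt0 eps0 K); exists (c * l), N => k /hN.
rewrite /near_scalar ler_pdivlMr // => {}hN.
rewrite -scalerAr -scalerAl -scalerA -scalerBr cnormZn.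
have := cnorm_ge0 (e k * g * e k - l *: (e k * e k)); have := nc_ge0 c; nra.
Qed.

Lemma near_scalar_perturb u g g' l eps : ‖[u]‖ <= 1 ->
  near_scalar u g l eps -> near_scalar u g' l (eps + ‖[g' - g]‖).
Proof.
rewrite /near_scalar => u1 h.
have -> : u * g' * u - l *: (u * u) = (u * g * u - l *: (u * u)) + u * (g' - g) * u by ncring.
apply: le_trans (cnormD _ _) _; apply: lerD => //.
by apply: cnormM_le1r => //; apply: cnormM_le1.
Qed.

Lemma excisable_lim g : (forall eps, 0 < eps -> exists2 g', excisable e g' & ‖[g - g']‖ <= eps) ->
  excisable e g.
Proof.
move=> h eps eps0; have e2 : 0 < eps / 2 by lra.
have [g' hg' d] := h _ e2; have [l [N hN]] := hg' _ e2; exists l, N => k /hN hk.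
have ek : ‖[e k]‖ <= 1 by rewrite e1.
have := near_scalar_perturb g ek hk; rewrite /near_scalar => k1.
by apply: le_trans k1 _; lra.
Qed.

Lemma near_scalar_uniq k g l l' eps eps' :
  near_scalar (e k) g l eps -> near_scalar (e k) g l' eps' -> nc (l - l') <= eps + eps'.
Proof.
rewrite /near_scalar => h h'; have <- : ‖[(l - l') *: (e k * e k)]‖ = nc (l - l').
  by rewrite cnormZn cnorm_ee mulr1.
have -> : (l - l') *: (e k * e k) = (e k * g * e k - l' *: (e k * e k)) - (e k * g * e k - l *: (e k * e k)).
  by rewrite scalerBl; ncring.
by apply: le_trans (cnormB _ _) _; lra.
Qed.

Lemma excisable_excising : (forall g, excisable e g) -> exists w, excising e w.
Proof.
move=> h; suff /choice[w hw] : forall g, exists l, forall eps, 0 < eps ->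
    exists N, forall k, (N <= k)%N -> near_scalar (e k) g l eps by exists w.
move=> g; pose P eps l := exists N, forall k, (N <= k)%N -> near_scalar (e k) g l eps.
have [|e' e'' l l' [N hN] [N' hN']|l hl] := @complex_approx_limit _ P.
- by move=> eps eps0; have [l [N hN]] := h g _ eps0; exists l, N.
- have := hN _ (leq_addr N' N); have := hN' _ (leq_addl N N') => h2 h1.
  exact: near_scalar_uniq h1 h2.
exists l => eps eps0; have e2 : 0 < eps / 2 by lra.
have [e' [l' [e'0 e'e [N hN] d]]] := hl _ e2; exists N => k /hN; rewrite /near_scalar => h1.
have -> : e k * g * e k - l *: (e k * e k) = (e k * g * e k - l' *: (e k * e k)) + (l' - l) *: (e k * e k).
  by rewrite scalerBl; ncring.
by apply: le_trans (cnormD _ _) _; rewrite cnormZn cnorm_ee mulr1; lra.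
Qed.

End Seq.

Lemma separable_seq : separable A ->
  exists d : nat -> A, forall x eps, 0 < eps -> exists n, ‖[x - d n]‖ < eps.
Proof.
move=> [S [/countable_injP[f finj] clS]].
exists (fun n => xget 0 [set x | S x /\ f x = n]%classic) => x eps eps0.
have : norm_closure S x by rewrite clS.
case/(_ eps eps0) => y Sy xy; exists (f y).
have [|Sz fz] := @xgetPex _ 0 [set z | S z /\ f z = f y]%classic; first by exists y.
have -> // : xget 0 [set z | S z /\ f z = f y]%classic = y by apply: finj; rewrite ?inE.
Qed.

(** [excise_step] is iterated from [a] along the real and imaginary parts of a dense sequence. One
    treatment of an element fixes its scalar only up to the error of that step, so every element
    must be treated infinitely often. Starting at [a] keeps [w a] away from 0. *)
Theorem excising_exists a : separable A -> pos a -> ‖[a]‖ = 1 ->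
  exists e w, excising e w /\ nc (w a - 1) <= 2^-1.
Proof.
move=> /separable_seq[d hd] pa a1.
pose g n := if odd n then 2^-1%:C *: ('i *: (star (d n./2) - d n./2))
            else 2^-1%:C *: (d n./2 + star (d n./2)).
have sg n : star (g n) = g n.
  rewrite /g; case: odd; rewrite starZr.
    by rewrite starZ conjc_i starB starK scaleNr -scalerN opprB.
  by rewrite starD starK addrC.
(* The defects from step [k] on add up to [2 * eta k]. For [k = 0] this is 1/4, half of the final
   bound on [w a - 1]. *)
pose eta k : R := 2^-1 ^+ (k + 3).
have eta0 k : 0 < eta k by rewrite exprn_gt0 // invr_gt0.
(* The 2-adic valuation of [k + 1] takes each value for infinitely many [k]. If [u] is not positive
   of norm 1, the witness 0 is a dummy. *)
have stepP : forall ku : nat * A, exists v : A, pos ku.2 -> ‖[ku.2]‖ = 1 ->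
    exists l : R, [/\ pos v, ‖[v]‖ = 1, ‖[(1 - ku.2) * v]‖ <= eta ku.1
    & near_scalar v (g (logn 2 ku.1.+1)) l%:C (eta ku.1)].
  move=> [k u] /=; have [pu|pu] := pselect (pos u); last by exists 0.
  have [u1|u1] := eqVneq ‖[u]‖ 1; last by exists 0 => _ /eqP; rewrite (negbTE u1).
  have [v [l h]] := excise_step pu u1 (sg (logn 2 k.+1)) (eta0 k).
  by exists v => _ _; exists l.
have [F hF] := choice stepP.
pose e := fix e n := if n is m.+1 then F (m, e m) else a.
have eP k : pos (e k) /\ ‖[e k]‖ = 1.
  elim: k => [//|k [pk k1]] /=; have [l []] := hF (k, e k) pk k1; by [].
have pe k := (eP k).1; have e1 k := (eP k).2.
have eS k : exists l : R, ‖[(1 - e k) * e k.+1]‖ <= eta k /\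
    near_scalar (e k.+1) (g (logn 2 k.+1)) l%:C (eta k).
  by have [l [_ _ h1 h2]] := hF (k, e k) (pe k) (e1 k); exists l.
(* The last summand covers [m = k], where only the trivial bound 1 for [(1 - e k) * e k] is
   available. *)
have nest k m : (k <= m)%N -> ‖[(1 - e k) * e m]‖ <= 2 * eta k - 2 * eta m + (if k == m then 1 else 0).
  elim: m => [|m IH].
    rewrite leqn0 => /eqP ->; rewrite eqxx subrr add0r.
    apply: cnormM_le1r; rewrite ?e1 //; apply: pos_1m_norm; rewrite ?e1 //.
  rewrite leq_eqVlt => /predU1P[->|].
    rewrite eqxx subrr add0r.
    by apply: cnormM_le1r; rewrite ?e1 //; apply: pos_1m_norm; rewrite ?e1.
  rewrite ltnS => km; have [l [h1 _]] := eS m.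
  have es : eta m.+1 = eta m / 2 by rewrite /eta addSn exprS mulrC.
  have -> : (k == m.+1) = false by apply/negbTE; rewrite neq_ltn ltnS km.
  move: (IH km); have [->|_] := eqVneq k m => h2; first by rewrite es; have := eta0 m; lra.
  have -> : (1 - e k) * e m.+1 = ((1 - e k) * e m) * e m.+1 + (1 - e k) * ((1 - e m) * e m.+1) by ncring.
  apply: le_trans (cnormD _ _) _.
  have n1 : ‖[((1 - e k) * e m) * e m.+1]‖ <= 2 * eta k - 2 * eta m + 0.
    by apply: cnormM_le1r; rewrite ?e1.
  have n2 : ‖[(1 - e k) * ((1 - e m) * e m.+1)]‖ <= eta m.
    by apply: cnormM_le1 => //; apply: pos_1m_norm; rewrite ?e1.
  by rewrite es; lra.
have nest2 k m : (k < m)%N -> ‖[(1 - e k) * e m]‖ <= 2 * eta k.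
  move=> km; have := nest k m (ltnW km); have := eta0 m.
  by rewrite (ltn_eqF km); lra.
have exg n : excisable e (g n).
  move=> eps eps0; set M := ‖[g n]‖; have M0 : 0 <= M by exact: cnorm_ge0.
  have D0 : 0 < eps / (8 * (M + 1)) by rewrite divr_gt0 //; lra.
  have [k0 hk0] : exists k0, forall k, (k0 <= k)%N -> eta k <= Num.min 1 (eps / (8 * (M + 1))).
    have m0 : 0 < Num.min 1 (eps / (8 * (M + 1))) by rewrite lt_min ltr01.
    have h01 : 0 <= (2^-1 : R) < 1 by rewrite invr_ge0 ler0n /= invf_lt1 ?ltr1n.
    have [N hN] := expr_small h01 m0.
    exists N => k Nk; apply: le_trans (ltW hN); rewrite /eta.
    by apply: ler_wiXn2l; rewrite ?invr_ge0 ?ler0n ?(leq_trans Nk) ?leq_addr //; lra.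
  pose k := (2 ^ n * k0.*2.+1).-1.
  have kS : k.+1 = (2 ^ n * k0.*2.+1)%N by rewrite prednK // muln_gt0 expn_gt0.
  have kn : logn 2 k.+1 = n.
    by rewrite kS lognM ?expn_gt0 // pfactorK // [logn 2 _.*2.+1]logn_coprime ?addn0 // coprime2n /= odd_double.
  have k0k : (k0 <= k)%N by rewrite -ltnS kS; have := expn_gt0 2 n; nia.
  have [l [_ h]] := eS k; rewrite kn in h; exists l%:C, k.+2 => m km.
  have := hk0 _ k0k; rewrite le_min => /andP[ek1 ek2].
  have := hk0 _ (leqW k0k); rewrite le_min => /andP[ek1' ek2'].
  have se i := pos_star (pe i).
  have := near_scalar_refine (se m) (se k.+1) _ _ (nest2 _ _ km) h.
  rewrite !e1 => /(_ (lexx _) (lexx _)); rewrite /near_scalar => h3; apply: le_trans h3 _.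
  have lM : nc l%:C <= M + 1.
    rewrite -[nc _]mulr1 -{1}(cnorm_ee pe e1 k.+1) -cnormZn.
    move: h; rewrite /near_scalar => h.
    have n1 : ‖[e k.+1 * g n * e k.+1]‖ <= M.
      by apply: cnormM_le1r; rewrite ?e1 //; apply: cnormM_le1; rewrite ?e1.
    have := cnormB_ge (l%:C *: (e k.+1 * e k.+1)) (e k.+1 * g n * e k.+1).
    by rewrite cnormBC; lra.
  have es : eta k.+1 = eta k / 2 by rewrite /eta addSn exprS mulrC.
  have ep : eps / (8 * (M + 1)) * (8 * (M + 1)) = eps by rewrite divfK //; apply/lt0r_neq0; lra.
  rewrite -/M es; have := nc_ge0 l%:C; have := eta0 k; nra.
have exd n : excisable e (d n).
  have -> : d n = g n.*2 + 'i *: g n.*2.+1.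
    rewrite /g /= odd_double /= uphalf_double doubleK.
    have iE (x : A) : 'i *: (2^-1%:C *: ('i *: x)) = 2^-1%:C *: (- x).
      by rewrite !scalerA mulrAC -expr2 sqr_i mulN1r scaleNr scalerN.
    rewrite iE opprB -scalerDr.
    have -> : d n + star (d n) + (d n - star (d n)) = d n + d n by ncring.
    by rewrite scalerDr scaler_half2.
  by apply: excisableD => //; apply: excisableZ.
have [g0|w hw] := excisable_excising pe e1.
  by apply: excisable_lim => // eps /hd-/(_ g0)[n hn]; exists (d n) => //; exact: ltW.
exists e, w; split=> //; have [_ _ h] := hw.
have e8 : (0 : R) < 4^-1 by rewrite invr_gt0.
have [N hN] := h a _ e8; have hk := hN N.+1 (leqnSn N).
have := near_scalar_uniq pe e1 hk (_ : near_scalar (e N.+1) a 1 4^-1) => k1.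
apply: le_trans (k1 _) _; last by lra.
rewrite /near_scalar scale1r.
have -> : e N.+1 * a * e N.+1 - e N.+1 * e N.+1 = - (e N.+1 * ((1 - e 0%N) * e N.+1)).
  by rewrite /=; ncring.
rewrite cnormN; apply: cnormM_le1; first by rewrite e1.
apply: le_trans (nest2 _ _ (ltn0Sn N)) _; rewrite /eta /= add0n; lra.
Qed.

End ExcisingSequences.

(** * Commuting copies of an algebra in itself *)

Section Extension.
Variables (R : realType) (A B : cstarAlgType R) (G : A -> B -> Prop).
Hypotheses
  (GZD : forall (c : R[i]) x x' y y', G x y -> G x' y' -> G (c *: x + x') (c *: y + y'))
  (GM : forall x x' y y', G x y -> G x' y' -> G (x * x') (y * y'))
  (GS : forall x y, G x y -> G (star x) (star y))
  (Gdense : forall x e, 0 < e -> exists x' y', G x' y' /\ ‖[x - x']‖ < e)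
  (Gnorm : forall x y, G x y -> ‖[y]‖ <= ‖[x]‖).

Let Gc x y := forall e : R, 0 < e -> exists x' y', [/\ G x' y', ‖[x - x']‖ < e & ‖[y - y']‖ < e].

Let GcG x y : G x y -> Gc x y.
Proof. by move=> h e e0; exists x, y; rewrite !subrr !cnorm0. Qed.

Let GcZD (c : R[i]) x x' y y' : Gc x y -> Gc x' y' -> Gc (c *: x + x') (c *: y + y').
Proof.
move=> h h' e e0; have K : 0 < nc c + 1 by have := nc_ge0 c; lra.
have K2 : 0 < 2 * (nc c + 1) by lra.
have e2 : 0 < e / 2 by lra.
have [u [v [g u1 v1]]] := h _ (divr_gt0 e0 K2).
have [u' [v' [g' u1' v1']]] := h' _ e2.
exists (c *: u + u'), (c *: v + v'); split; first exact: GZD.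
- have -> : c *: x + x' - (c *: u + u') = c *: (x - u) + (x' - u') by rewrite scalerBr; ncring.
  apply: le_lt_trans (cnormD _ _) _; rewrite cnormZn.
  have := cnorm_ge0 (x - u); rewrite ltr_pdivlMr // in u1; have := nc_ge0 c; nra.
- have -> : c *: y + y' - (c *: v + v') = c *: (y - v) + (y' - v') by rewrite scalerBr; ncring.
  apply: le_lt_trans (cnormD _ _) _; rewrite cnormZn.
  have := cnorm_ge0 (y - v); rewrite ltr_pdivlMr // in v1; have := nc_ge0 c; nra.
Qed.

Let prod_close (C : cstarAlgType R) (x x' : C) (e : R) : 0 < e ->
  exists2 d : R, 0 < d & forall u u', ‖[x - u]‖ < d -> ‖[x' - u']‖ < d -> ‖[x * x' - u * u']‖ < e.
Proof.
move=> e0; pose K := ‖[x]‖ + ‖[x']‖ + 1.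
have n0 := cnorm_ge0 x; have n1 := cnorm_ge0 x'.
have K0 : 0 < K by rewrite /K; lra.
have d0 : 0 < Num.min 1 (e / (2 * K)) by rewrite lt_min ltr01 divr_gt0 //; lra.
exists (Num.min 1 (e / (2 * K))) => // u u'; rewrite !lt_min => /andP[h1 h2] /andP[h3 h4].
rewrite ltr_pdivlMr in h2; last by lra.
rewrite ltr_pdivlMr in h4; last by lra.
have -> : x * x' - u * u' = x * (x' - u') + (x - u) * u' by ncring.
have nu' : ‖[u']‖ <= ‖[x']‖ + 1.
  by have := cnormB_ge u' x'; rewrite cnormBC; lra.
apply: le_lt_trans (cnormD _ _) _.
have := cnormM x (x' - u'); have := cnormM (x - u) u'.
have := cnorm_ge0 (x' - u'); have := cnorm_ge0 (x - u); have := cnorm_ge0 u'.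
rewrite /K in h2 h4; nra.
Qed.

Let GcM x x' y y' : Gc x y -> Gc x' y' -> Gc (x * x') (y * y').
Proof.
move=> h h' e e0.
have [d d0 hd] := prod_close x x' e0; have [d' d'0 hd'] := prod_close y y' e0.
have m0 : 0 < Num.min d d' by rewrite lt_min d0.
have [u [v [g u1 v1]]] := h _ m0; have [u' [v' [g' u1' v1']]] := h' _ m0.
move: u1 v1 u1' v1'; rewrite !lt_min => /andP[a1 _] /andP[_ a2] /andP[a3 _] /andP[_ a4].
by exists (u * u'), (v * v'); split; [exact: GM|exact: hd|exact: hd'].
Qed.

Let GcS x y : Gc x y -> Gc (star x) (star y).
Proof.
move=> h e /h[u [v [g u1 v1]]]; exists (star u), (star v).
by rewrite -!starB !cnorm_star; split=> //; exact: GS.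
Qed.

Let GcN x y : Gc x y -> ‖[y]‖ <= ‖[x]‖.
Proof.
move=> h; apply/ler_addgt0Pl => e e0; have e2 : 0 < e / 2 by lra.
have [u [v [/Gnorm g u1 v1]]] := h _ e2.
by have := cnormB_ge y v; have := cnormB_ge u x; rewrite (cnormBC u); lra.
Qed.

Let GcB x x' y y' : Gc x y -> Gc x' y' -> Gc (x - x') (y - y').
Proof.
move=> h h'; have := GcZD (-1) h' h; rewrite !scaleN1r addrC [- y' + y]addrC; exact.
Qed.

Let Gex x : exists y, Gc x y.
Proof.
have /choice[u hu] : forall n : nat, exists p : A * B, G p.1 p.2 /\ ‖[x - p.1]‖ < n.+1%:R^-1.
  move=> n; have n0 : 0 < n.+1%:R^-1 :> R by rewrite invr_gt0 ltr0n.
  by have [u [v huv]] := Gdense x n0; exists (u, v).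
have ep e : 0 < e -> exists N, forall n, (N <= n)%N -> n.+1%:R^-1 < e :> R.
  move=> e0; have [N hN] := inv_small e0; exists N => n Nn.
  apply: le_lt_trans hN; apply: (@le_trans _ _ N.+1%:R^-1).
    by rewrite lef_pV2 ?posrE ?ltr0n // ler_nat.
  by rewrite ler_peMl ?invr_ge0 ?ler0n // ler1n.
have [l hl] : exists l, lim_to (fun n => (u n).2) l.
  apply: cauchy_lim => e e0; have e2 : 0 < e / 2 by lra.
  have [N hN] := ep _ e2; exists N => m n Nm Nn.
  have := GcN (GcB (GcG (hu m).1) (GcG (hu n).1)).
  have := cnorm_tri x (u m).1 (u n).1; rewrite [‖[(u m).1 - x]‖]cnormBC.
  have := lt_trans (hu m).2 (hN m Nm); have := lt_trans (hu n).2 (hN n Nn); lra.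
exists l => e e0; have [N hN] := ep _ e0; have [M hM] := hl _ e0.
exists (u (N + M)%N).1, (u (N + M)%N).2; split; first exact: (hu _).1.
  by apply: lt_trans (hu _).2 (hN _ _); exact: leq_addr.
by rewrite cnormBC; apply: hM; exact: leq_addl.
Qed.

Let Guniq x y y' : Gc x y -> Gc x y' -> y = y'.
Proof.
move=> h h'; apply/eqP; rewrite -subr_eq0; apply/eqP/cnorm_le0.
by have := GcN (GcB h h'); rewrite subrr cnorm0.
Qed.

(** [G] is the graph of a contractive star-homomorphism on a dense domain and [Gc] its closure. With
    a relation, values can be given on sums of tensors or words whose representation is not unique;
    [Gnorm] makes them well defined. *)
Lemma hom_extension : exists f : A -> B, [/\ star_hom f, forall x y, G x y -> f x = y
  & forall x, ‖[f x]‖ <= ‖[x]‖].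
Proof.
have [f hf] := choice Gex; exists f; split.
- split=> [c x y|x y|x]; apply: Guniq (hf _) _.
  + exact: GcZD.
  + exact: GcM.
  + exact: GcS.
- by move=> x y /GcG; exact: Guniq.
- by move=> x; exact: GcN.
Qed.

End Extension.

Section PosPart.
Variables (R : realType) (A : cstarAlgType R).

(** [f = m + x], with [m] the modulus of [x], is twice the positive part. With [k] the root of [m],
    [x * (f * f)] is the square of [k * f]; and [f * f = 2 * x * f] turns [x * (f * f) = 0] into
    [f = 0]. *)
Lemma pos_part (x : A) : star x = x -> exists f : A,
  [/\ star f = f, forall z, x * z = z * x -> f * z = z * f, pos (x * (f * f)),
    x * (f * f) = 0 -> f = 0 & f = 0 -> pos (- x)].
Proof.
move=> sx; have [m [pm mE cm]] := pos_psqrt (pos_sqr sx).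
have [k [sk kE ck]] := pos_sqrt pm.
have mx : m * x = x * m by apply: cm; rewrite mulrA.
have kx : k * x = x * k by exact: ck.
have km : k * m = m * k by rewrite kE mulrA.
pose f := m + x; have sf : star f = f by rewrite starD sx pos_star.
have ff : f * f = 2%:C *: (x * f).
  have -> : f * f = m * m + m * x + x * m + x * x by rewrite /f; ncring.
  rewrite -mE mx; have -> : x * f = x * m + x * x by rewrite /f; ncring.
  have -> : 2%:C = 1 + 1 :> R[i].
    by apply/eqP; rewrite eq_complex /=; apply/andP; split; apply/eqP; ring.
  by rewrite scalerDl scale1r; ncring.
exists f; split=> //.
- move=> z xz; rewrite /f mulrDl mulrDr xz cm //; by rewrite -mulrA xz mulrA xz mulrA.
- have xf : x * f = m * f.
    by rewrite /f !mulrDr -mE mx addrC.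
  have fk : f * k = k * f by rewrite /f mulrDl mulrDr km kx.
  have -> : x * (f * f) = (k * f) * (k * f).
    rewrite mulrA xf kE.
    have -> : k * f * (k * f) = k * (f * k) * f by ncring.
    by rewrite fk; ncring.
  by apply: pos_sqr; rewrite starM sk sf fk.
- move=> h; apply: sa_cube_eq0 => //; rewrite mulrA ff -scalerAl -mulrA h scaler0 //.
- by rewrite /f => /eqP; rewrite addr_eq0 => /eqP <-.
Qed.

Lemma pos_neg0 (z : A) (d : R) : 0 < d -> pos z -> pos (- (d%:C *: z)) -> z = 0.
Proof.
move=> d0 pz h; have := pos_le_norm (pos_scale (ltW d0) pz) (_ : pos (0 - _)).
rewrite sub0r => /(_ h); rewrite cnorm0 cnorm_scale ?(ltW d0) // => k.
by apply: cnorm_le0; rewrite -(pmulr_rle0 _ d0).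
Qed.

End PosPart.

Section TensorSums.
Variables (R : realType) (A B T : cstarAlgType R) (f : A -> T) (g : B -> T).
Hypotheses (hf : star_hom f) (hg : star_hom g) (cfg : forall a b, f a * g b = g b * f a).

Lemma tensor_sum_cat xs ys :
  tensor_sum f g (xs ++ ys) = tensor_sum f g xs + tensor_sum f g ys.
Proof. exact: big_cat. Qed.

Lemma tensor_sumZ (c : R[i]) xs :
  tensor_sum f g [seq (c *: p.1, p.2) | p <- xs] = c *: tensor_sum f g xs.
Proof.
rewrite /tensor_sum big_map scaler_sumr; apply: eq_bigr => p _ /=.
by rewrite (homZ hf) scalerAl.
Qed.

Lemma tensor_sumM xs ys :
  tensor_sum f g [seq (p.1 * q.1, p.2 * q.2) | p <- xs, q <- ys]
  = tensor_sum f g xs * tensor_sum f g ys.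
Proof.
rewrite /tensor_sum big_allpairs_dep mulr_suml; apply: eq_bigr => p _.
rewrite mulr_sumr; apply: eq_bigr => q _ /=.
by rewrite (homM hf) (homM hg) -!mulrA; congr (_ * _); rewrite !mulrA cfg.
Qed.

Lemma tensor_sumS xs :
  tensor_sum f g [seq (star p.1, star p.2) | p <- xs] = star (tensor_sum f g xs).
Proof.
rewrite /tensor_sum big_map star_sum; apply: eq_bigr => p _ /=.
by rewrite starM -(homS hf) -(homS hg) cfg.
Qed.

End TensorSums.

Section MinTensor.
Variables (R : realType) (A T : cstarAlgType R) (f g : A -> T).
Hypothesis fgT : is_min_cstar_tensor f g.

(** Through [th] the pair [f'], [g'] is again a C*-tensor product ([bil] gives the algebraic
    injectivity), so minimality bounds the norm of [f, g]-sums by that of [f', g']-sums. Applied to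
    [map th xs], and as [th] is an involution, this is the reverse inequality, the one needed for
    extension. It serves for the flip and for [id (x) ta]. *)
Lemma min_tensor_involution (f' g' : A -> T) (th : A * A -> A * A) :
  star_hom f' /\ f' 1 = 1 -> star_hom g' /\ g' 1 = 1 ->
  (forall a b, f' a * g' b = g' b * f' a) ->
  (forall p, f (th p).1 * g (th p).2 = f' p.1 * g' p.2) -> involutive th ->
  (forall (V : lmodType R[i]) (F : A -> A -> V), bilinear_map F ->
     exists F', bilinear_map F' /\ forall p, F' (th p).1 (th p).2 = F p.1 p.2) ->
  exists s : T -> T, [/\ star_hom s, forall a, s (f a) = f' a & forall b, s (g b) = g' b].
Proof.
move=> [hf' f'1] [hg' g'1] c' E thK bil.
have [[[hf f1] [hg g1] c inj dense] min] := fgT.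
have Es xs : tensor_sum f' g' xs = tensor_sum f g (map th xs).
  by rewrite /tensor_sum big_map; apply: eq_bigr => p _; rewrite E.
have Es' xs : tensor_sum f g xs = tensor_sum f' g' (map th xs).
  by rewrite Es -map_comp map_id_in // => p _ /=; rewrite thK.
have tens : is_cstar_tensor f' g'.
  split=> //.
    move=> xs; rewrite Es => /inj h V F /bil[F' [bF' EF]].
    by have := h V F' bF'; rewrite big_map; under eq_bigr do rewrite EF.
  rewrite -dense; congr norm_closure; apply/seteqP; split=> _ [xs _ <-].
    by exists (map th xs) => //; rewrite Es.
  by exists (map th xs) => //; rewrite -Es'.
have nrm xs : ‖[tensor_sum f' g' xs]‖ <= ‖[tensor_sum f g xs]‖.
  by rewrite Es; apply: le_trans (min _ _ _ tens _) _; rewrite -Es'.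
pose G x y := exists xs, x = tensor_sum f g xs /\ y = tensor_sum f' g' xs.
have [||||x _ [xs [-> ->]]|s [hs sG _]] := @hom_extension _ _ _ G; first 1 last.
- move=> _ _ _ _ [xs [-> ->]] [ys [-> ->]].
  by exists [seq (p.1 * q.1, p.2 * q.2) | p <- xs, q <- ys]; rewrite !tensor_sumM.
- move=> _ _ [xs [-> ->]]; exists [seq (star p.1, star p.2) | p <- xs].
  by rewrite !tensor_sumS.
- move=> x e e0; have : norm_closure (range (tensor_sum f g)) x by rewrite dense.
  by case/(_ e e0) => _ [xs _ <-] h; exists (tensor_sum f g xs), (tensor_sum f' g' xs); split=> //; exists xs.
- exact: nrm.
- exists s; split=> // [a|b]; apply: sG.
    by exists [:: (a, 1)]; rewrite /tensor_sum !big_seq1 /= g1 g'1 !mulr1.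
  by exists [:: (1, b)]; rewrite /tensor_sum !big_seq1 /= f1 f'1 !mul1r.
move=> cc _ _ _ _ [xs [-> ->]] [ys [-> ->]].
exists ([seq (cc *: p.1, p.2) | p <- xs] ++ ys).
by rewrite !tensor_sum_cat !tensor_sumZ.
Qed.

End MinTensor.

Section Aue.
Variable R : realType.

Definition aue (C : Type) (B : cstarAlgType R) (f g : C -> B) : Prop :=
  exists u : nat -> B, (forall n, unitary (u n)) /\
    forall c, lim_to (fun n => u n * f c * star (u n)) (g c).

Lemma aueP (C : starAlgType R) (B : cstarAlgType R) (f g : C -> B) :
  approx_unitarily_equiv f g -> aue f g.
Proof. by move=> [u [uu h]]; exists u; split=> // c; apply/lim_toP; exact: h. Qed.

Lemma aue_sym (C : Type) (B : cstarAlgType R) (f g : C -> B) : aue f g -> aue g f.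
Proof.
move=> [u [uu h]]; exists (fun n => star (u n)); split=> [n|c e e0].
  exact: unitary_star.
have [N hN] := h c e e0; exists N => n /hN; rewrite starK.
rewrite -(cnorm_conj _ (unitary_star (uu n))) starK; have [v1 v2] := uu n.
have -> : star (u n) * (u n * f c * star (u n) - g c) * u n
  = (star (u n) * u n) * f c * (star (u n) * u n) - star (u n) * g c * u n by ncring.
by rewrite v1 mul1r mulr1 cnormBC.
Qed.

Lemma aue_trans (C : Type) (B : cstarAlgType R) (g f h : C -> B) :
  aue f g -> aue g h -> aue f h.
Proof.
move=> [u [uu hu]] [v [uv hv]]; exists (fun n => v n * u n); split=> [n|c e e0].
  exact: unitaryM.
have e2 : 0 < e / 2 by lra.
have [N hN] := hu c _ e2; have [M hM] := hv c _ e2; exists (N + M)%N => n NMn.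
have := hN n (leq_trans (leq_addr _ _) NMn); have := hM n (leq_trans (leq_addl _ _) NMn).
rewrite -(cnorm_conj _ (uv n)).
rewrite -(cnorm_conj (u n * f c * _ - _) (uv n)).
move=> h1 h2; apply: le_lt_trans (cnorm_tri (v n * g c * star (v n)) _ _) _.
have -> : v n * u n * f c * star (v n * u n) - v n * g c * star (v n)
  = v n * (u n * f c * star (u n) - g c) * star (v n) by rewrite starM; ncring.
by move: h1; rewrite cnorm_conj //; lra.
Qed.

Definition uhom (A B : starAlgType R) (f : A -> B) := star_hom f /\ f 1 = 1.

Lemma uhom_comp (A B C : starAlgType R) (f : A -> B) (g : B -> C) :
  uhom f -> uhom g -> uhom (g \o f).
Proof. by move=> [hf f1] [hg g1]; split; [exact: hom_comp|rewrite /= f1 g1]. Qed.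

Lemma uhom_unitary (A B : starAlgType R) (f : A -> B) u : uhom f -> unitary u -> unitary (f u).
Proof. by move=> [hf f1] [h k]; split; rewrite -(homS hf) -(homM hf) ?h ?k f1. Qed.

Lemma uhom_norm (A B : cstarAlgType R) (f : A -> B) x : uhom f -> ‖[f x]‖ <= ‖[x]‖.
Proof. by move=> [hf f1]; exact: hom_contractive. Qed.

Lemma aue_map (C : Type) (A B : cstarAlgType R) (f g : C -> A) (h : A -> B) :
  uhom h -> aue f g -> aue (h \o f) (h \o g).
Proof.
move=> uh [u [uu hu]]; exists (h \o u); split=> [n|c e e0] /=.
  exact: uhom_unitary.
have [N hN] := hu c e e0; exists N => n /hN; apply: le_lt_trans.
by rewrite -(homS uh.1) -!(homM uh.1) -(homB uh.1); exact: uhom_norm.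
Qed.

Lemma aue_pre (C C' : Type) (B : cstarAlgType R) (f g : C -> B) (h : C' -> C) :
  aue f g -> aue (f \o h) (g \o h).
Proof. by move=> [u [uu hu]]; exists u; split=> // c; exact: hu. Qed.

Lemma aue_norm (C : Type) (B : cstarAlgType R) (f g : C -> B) c : aue f g -> ‖[f c]‖ = ‖[g c]‖.
Proof.
have key (f' g' : C -> B) : aue f' g' -> ‖[g' c]‖ <= ‖[f' c]‖.
  move=> [u [uu hu]]; rewrite -[g' c]subr0; apply: (lim_to_le (hu c)).
  by exists 0%N => n _; rewrite subr0 cnorm_conj.
by move=> h; apply/eqP; rewrite eq_le !key //; exact: aue_sym.
Qed.

Lemma uhom_id (A : starAlgType R) : uhom (@id A).
Proof. by split. Qed.

End Aue.

Section Core.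
Variable R : realType.

(** [al] and [be] are the two tensor factors and [ta] the flip, pulled back to [D] by the
    isomorphism with the tensor square. In the later sections tensors occur only as products
    [al a * be b]. *)
Record ssa_core (D : cstarAlgType R) (al be ta : D -> D) : Prop := SsaCore {
  core_al : uhom al;
  core_be : uhom be;
  core_ta : uhom ta;
  core_comm : forall a b, al a * be b = be b * al a;
  core_dense : forall x e, 0 < e -> exists xs, ‖[x - tensor_sum al be xs]‖ < e;
  core_inj : forall xs, tensor_sum al be xs = 0 -> alg_tensor_eq0 xs;
  core_ta_al : forall x, ta (al x) = be x;
  core_ta_be : forall x, ta (be x) = al x;
  core_aue_al : aue id al;
  core_aue_be : aue id be;
  core_aue_ta : aue id ta;
  core_aue_albe : aue al be }.

(* [id ~ al] gives [be = ta al ~ ta] and [be ~ al be ~ al ta]; the automorphism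
   [id (x) ta] turns the latter into [be ta ~ al ta], whose image under [ta]
   is [al ta ~ al]. *)
Theorem ssa_core_exists (D : cstarAlgType R) : strongly_self_absorbing D ->
  exists al be ta : D -> D, ssa_core al be ta.
Proof.
move=> [_ [DD [i1 [i2 [ten [phi [isop phii1]]]]]]].
have [[u1 u2 c inj dense] min] := ten.
have [[h1 i11] [h2 i21]] := (u1, u2).
have [psi [phiK psiK isopsi phi1 psi1]] := iso_inv isop.
have uphi : uhom phi by split=> //; exact: isop.1.
have upsi : uhom psi by split=> //; exact: isopsi.1.
have [||||s [hs s1 s2]] := @min_tensor_involution _ _ _ i1 i2 ten i2 i1 (fun p => (p.2, p.1)) u2 u1.
- by move=> a b; rewrite c.
- by move=> p /=; rewrite c.
- by case.
- move=> V F [l1 l2]; exists (fun a b => F b a); split; last by [].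
  by split=> [b|a]; [exact: l2|exact: l1].
have us : uhom s by split=> //; rewrite -i11 s1 i21.
pose al := psi \o i1; pose be := psi \o i2; pose ta := psi \o s \o phi.
have ual : uhom al by apply: uhom_comp.
have ube : uhom be by apply: uhom_comp.
have uta : uhom ta by do 2!apply: uhom_comp => //.
have taal x : ta (al x) = be x by rewrite /ta /al /= psiK s1.
have tabe x : ta (be x) = al x by rewrite /ta /be /= psiK s2.
have cab a b : al a * be b = be b * al a by rewrite /al /be /= -!(homM isopsi.1) c.
have sumE xs : tensor_sum al be xs = psi (tensor_sum i1 i2 xs).
  rewrite /tensor_sum (hom_sum isopsi.1); apply: eq_bigr => p _.
  by rewrite (homM isopsi.1).
have dn x e : 0 < e -> exists xs, ‖[x - tensor_sum al be xs]‖ < e.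
  move=> e0; have : norm_closure (range (tensor_sum i1 i2)) (phi x) by rewrite dense.
  case/(_ e e0) => _ [xs _ <-] h; exists xs; apply: le_lt_trans h.
  rewrite sumE -{1}(phiK x) -(homB isopsi.1); exact: uhom_norm.
have injab xs : tensor_sum al be xs = 0 -> alg_tensor_eq0 xs.
  rewrite sumE => h; apply: inj; apply: (can_inj psiK).
  by rewrite h (hom0 isopsi.1).
have cont_ext (f g : D -> D) : uhom f -> uhom g -> (forall xs, f (tensor_sum al be xs) = g (tensor_sum al be xs)) -> f =1 g.
  move=> uf ug e x; apply/eqP; rewrite -subr_eq0; apply/eqP/cnorm_small => eps eps0.
  have e2 : 0 < eps / 2 by lra.
  have [xs hx] := dn x _ e2.
  have -> : f x - g x = f (x - tensor_sum al be xs) - g (x - tensor_sum al be xs).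
    by rewrite (homB uf.1) (homB ug.1) e; ncring.
  apply: le_trans (cnormB _ _) _.
  have := uhom_norm (x - tensor_sum al be xs) uf; have := uhom_norm (x - tensor_sum al be xs) ug; lra.
(* That [ta] is an involution is what allows [id (x) ta] to be built by the same lemma as the
   flip. *)
have taK x : ta (ta x) = x.
  have ut2 : uhom (ta \o ta) by apply: uhom_comp.
  apply: (cont_ext (ta \o ta) id ut2 (uhom_id _)) => xs /=.
  rewrite /tensor_sum !(hom_sum uta.1); apply: eq_bigr => p _.
  by rewrite !(homM uta.1) taal tabe tabe taal.
have ui2t : uhom (i2 \o ta) by apply: uhom_comp.
have [||||q [hq q1 q2]] := @min_tensor_involution _ _ _ i1 i2 ten i1 (i2 \o ta) (fun p => (p.1, ta p.2)) u1 ui2t.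
- by move=> a b; rewrite /= c.
- by [].
- by case=> a b; rewrite /= taK.
- move=> V F [l1 l2]; exists (fun a b => F a (ta b)); split; last by move=> p /=; rewrite taK.
  split=> [b|a]; first exact: l1.
  by move=> cc x y /=; rewrite (homD uta.1) (homZ uta.1) l2.
pose ps := psi \o q \o phi.
have uq : uhom q by split=> //; rewrite -i11 q1.
have ups : uhom ps by do 2!apply: uhom_comp => //.
have psal x : ps (al x) = al x by rewrite /ps /al /= psiK q1.
have psbe x : ps (be x) = be (ta x) by rewrite /ps /be /= psiK q2.
have E (f g f' g' : D -> D) : f =1 f' -> g =1 g' -> aue f g -> aue f' g'.
  by move=> /funext -> /funext ->.
have a1 : aue id al by apply: E (aue_map upsi (aueP phii1)) => // x /=; rewrite phiK.
have a2 : aue ta be by apply: E (aue_map uta a1) => // x /=; exact: taal.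
have a3 : aue be (al \o be) by exact: (aue_pre be a1).
have a4 : aue (al \o ta) (al \o be) by exact: aue_map ual a2.
have a5 : aue (al \o ta) be by apply: aue_trans a4 (aue_sym a3).
have a6 : aue (al \o ta) (be \o ta).
  by apply: E (aue_map ups a5) => x /=; [exact: psal|exact: psbe].
have a7 : aue (be \o ta) be by apply: aue_trans (aue_sym a6) a5.
have a8 : aue (al \o ta) al.
  by apply: E (aue_map uta a7) => x /=; exact: tabe.
have a9 : aue al be by apply: aue_trans (aue_sym a8) a5.
have a10 : aue id be by exact: aue_trans a1 a9.
have a11 : aue id ta by exact: aue_trans a10 (aue_sym a2).
by exists al, be, ta; split.
Qed.

End Core.

(** * The norm of an elementary tensor *)

Section CrossNorm.
Variables (R : realType) (D : cstarAlgType R) (al be ta : D -> D).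
Hypotheses (sepD : separable D) (co : ssa_core al be ta).

Let hal := (core_al co).1.
Let hbe := (core_be co).1.
Let cab := core_comm co.

Lemma al_norm x : ‖[al x]‖ = ‖[x]‖. Proof. by rewrite -(aue_norm x (core_aue_al co)). Qed.
Lemma be_norm x : ‖[be x]‖ = ‖[x]‖. Proof. by rewrite -(aue_norm x (core_aue_be co)). Qed.

Lemma uhom_pos (A B : cstarAlgType R) (f : A -> B) a : star_hom f -> pos a -> pos (f a).
Proof. by move=> hf [s ss ->]; exists (f s); rewrite ?(homM hf) // -(homS hf) ss. Qed.

Lemma excising_star0 (e : nat -> D) w : excising e w -> linear (w : D -> R[i]^o).
Proof.
move=> [pe e1 h] c x y; apply/eqP; rewrite -subr_eq0; apply/eqP/nc_small => eps eps0.
set K := nc c + 3; have K0 : 0 < K by have := nc_ge0 c; rewrite /K; lra.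
have d0 := divr_gt0 eps0 K0; set d := eps / K in d0.
have [N1 h1] := h x _ d0; have [N2 h2] := h y _ d0; have [N3 h3] := h (c *: x + y) _ d0.
pose k := (N1 + (N2 + N3))%N.
have {}h1 := h1 k (leq_addr _ _).
have {}h2 := h2 k (leq_trans (leq_addr _ _) (leq_addl _ _)).
have {}h3 := h3 k (leq_trans (leq_addl _ _) (leq_addl _ _)).
have h4 : near_scalar (e k) (c *: x + y) (c * w x + w y) (nc c * d + d).
  rewrite /near_scalar; have -> : e k * (c *: x + y) * e k - (c * w x + w y) *: (e k * e k)
     = c *: (e k * x * e k - w x *: (e k * e k)) + (e k * y * e k - w y *: (e k * e k)).
    by rewrite scalerBr scalerA scalerDl mulrDr mulrDl -scalerAr -scalerAl; ncring.
  apply: le_trans (cnormD _ _) _; rewrite cnormZn lerD // ler_wpM2l ?nc_ge0 //.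
have := near_scalar_uniq pe e1 h3 h4.
have -> : d + (nc c * d + d) = d * (nc c + 2) by ring.
move=> h5; apply: (le_trans h5); have : d * K = eps by rewrite /d divfK ?gt_eqF.
rewrite /K; nra.
Qed.

(** The bilinear map [(x, y) |-> w x *: y] vanishes on the pair by algebraic injectivity, and the
    excised state is chosen with [w a != 0]. *)
Lemma al_be_eq0 (a b : D) : al a * be b = 0 -> pos a -> a = 0 \/ b = 0.
Proof.
move=> h pa; have [a0|/eqP a0] := eqVneq a 0; [by left|right].
have np := cnorm_gt0 a0; have ni : 0 <= ‖[a]‖^-1 by rewrite invr_ge0 ltW.
have [|e [w [exw wa]]] := excising_exists sepD (pos_scale ni pa).
  by rewrite cnorm_scale // mulVf ?gt_eqF.
have lw := excising_star0 exw.
have tz : tensor_sum al be [:: (a, b)] = 0 by rewrite /tensor_sum big_seq1.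
have bl : bilinear_map (fun x y : D => w x *: y).
  split=> [y|x] c u v /=; last by rewrite scalerDr !scalerA mulrC.
  by rewrite lw scalerDl scalerA.
have := core_inj co tz bl.
rewrite big_seq1 /= => /eqP; rewrite scaler_eq0 => /orP[|/eqP//] /eqP w0.
exfalso; move: wa; have w00 : w 0 = 0.
  by have := lw 1 0 0; rewrite !scale1r addr0 => /eqP; rewrite -subr_eq0 opprD addrA subrr sub0r oppr_eq0 => /eqP.
have := lw (‖[a]‖^-1)%:C a 0; rewrite !addr0 w00 w0 addr0 => ->.
by rewrite scaler0 sub0r ncN nc1; lra.
Qed.

(** If the norm [c] were below 1, take [r] with [c < r * r < 1] and the parts [f], [g] of [p], [q]
    above the level [r]. On [z = al (f * f) * be (g * g)] the product is at least [r * r] and at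
    most [c], so [z = 0], against [al_be_eq0]. *)
Lemma cross_norm_pos p q : pos p -> pos q -> ‖[p]‖ = 1 -> ‖[q]‖ = 1 -> 1 <= ‖[al p * be q]‖.
Proof.
move=> pp pq p1 q1; rewrite leNgt; apply/negP; set c := ‖[_]‖ => c1.
have c0 : 0 <= c by exact: cnorm_ge0.
pose r := Num.sqrt ((1 + c) / 2).
have rr : r * r = (1 + c) / 2 by apply: sqrtrM_id; lra.
have r0 : 0 <= r by exact: sqrtr_ge0.
have r1 : r < 1 by rewrite ltNge; apply/negP => ?; nra.
have sp := pos_star pp; have sq := pos_star pq.
have cutE (u : D) : pos u -> ‖[u]‖ = 1 -> exists f, [/\ star f = f, u * f = f * u,
    pos (u * (f * f) - r%:C *: (f * f)) & f <> 0].
  move=> pu u1; have [|f [sf cf pf _ f0]] := @pos_part _ _ (u - r%:C *: 1).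
    by rewrite starB starZr star1 pos_star.
  exists f; split=> //.
  - by apply/esym/cf; rewrite mulrBl mulrBr -scalerAl -scalerAr mul1r mulr1.
  - have -> : u * (f * f) - r%:C *: (f * f) = (u - r%:C *: 1) * (f * f) by rewrite mulrBl -scalerAl mul1r.
    by [].
  - move=> /f0; rewrite opprB => /(pos_ubound_norm r0 pu); rewrite u1; lra.
have [f [sf cf pf f0]] := cutE p pp p1; have [g [sg cg pg g0]] := cutE q pq q1.
have pff : pos (f * f) by exact: pos_sqr.
have pgg : pos (g * g) by exact: pos_sqr.
have pal a : pos a -> pos (al a) by exact: uhom_pos.
have pbe a : pos a -> pos (be a) by exact: uhom_pos.
have pab a b : pos a -> pos b -> pos (al a * be b).
  by move=> pa pb; apply: posM; [exact: pal|exact: pbe|exact: cab].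
pose z := al (f * f) * be (g * g).
have pz : pos z by exact: pab.
have pqg : pos (q * (g * g)).
  by apply: posM => //; rewrite mulrA cg -mulrA cg mulrA.
pose PQ := al p * be q.
have pPQ : pos PQ by exact: pab.
have cz : PQ * z = z * PQ.
  have fp : f * f * p = p * (f * f) by rewrite -mulrA -cf mulrA -cf mulrA.
  have gq : g * g * q = q * (g * g) by rewrite -mulrA -cg mulrA -cg mulrA.
  rewrite /PQ /z.
  have -> : al p * be q * (al (f * f) * be (g * g)) = al p * (be q * al (f * f)) * be (g * g) by ncring.
  have -> : al (f * f) * be (g * g) * (al p * be q) = al (f * f) * (be (g * g) * al p) * be q by ncring.
  rewrite -!cab; have -> : al p * (al (f * f) * be q) * be (g * g) = (al p * al (f * f)) * (be q * be (g * g)) by ncring.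
  have -> : al (f * f) * (al p * be (g * g)) * be q = (al (f * f) * al p) * (be (g * g) * be q) by ncring.
  by rewrite -!(homM hal) -!(homM hbe) fp gq.
have PQz : PQ * z = al (p * (f * f)) * be (q * (g * g)).
  rewrite /PQ /z (homM hal p) (homM hbe q).
  have -> : al p * be q * (al (f * f) * be (g * g)) = al p * (be q * al (f * f)) * be (g * g) by ncring.
  by rewrite -cab; ncring.
have q1' : pos (PQ * z - (r * r)%:C *: z).
  have -> : PQ * z - (r * r)%:C *: z = al (p * (f * f) - r%:C *: (f * f)) * be (q * (g * g))
     + r%:C *: (al (f * f) * be (q * (g * g) - r%:C *: (g * g))).
    rewrite PQz (homB hal) (homB hbe) !(homZ hal) !(homZ hbe) mulrBl mulrBr -scalerAl -scalerAr.
    by rewrite scalerBr scaleCA /z; ncring.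
  by apply: posD; [exact: pab|apply: pos_scale => //; exact: pab].
have q2 : pos ((c%:C *: 1 - PQ) * z).
  apply: posM => //; first by apply: pos_ubound; [exact: pos_star|exact: lexx].
  by rewrite mulrBl mulrBr -scalerAl -scalerAr mul1r mulr1 cz.
have z0 : z = 0.
  apply: (@pos_neg0 _ _ _ (r * r - c)) => //; first by rewrite rr; lra.
  have -> : - ((r * r - c)%:C *: z) = (PQ * z - (r * r)%:C *: z) + (c%:C *: 1 - PQ) * z.
    by rewrite (rmorphB (real_complex R)) scalerBl mulrBl -scalerAl mul1r; ncring.
  exact: posD.
have sqr0 (a : D) : star a = a -> a * a = 0 -> a = 0.
  move=> sa h; apply: cnorm_eq0; apply/eqP.
  by rewrite -sqrf_eq0 -cnorm_sqr_sa // h cnorm0.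
by case: (al_be_eq0 z0 pff) => /sqr0; [move/(_ sf)/f0|move/(_ sg)/g0].
Qed.

Lemma cross_norm a b : ‖[al a * be b]‖ = ‖[a]‖ * ‖[b]‖.
Proof.
apply/eqP; rewrite eq_le; apply/andP; split.
  by apply: le_trans (cnormM _ _) _; rewrite al_norm be_norm.
have [->|/eqP a0] := eqVneq a 0; first by rewrite cnorm0 mul0r cnorm_ge0.
have [->|/eqP b0] := eqVneq b 0; first by rewrite cnorm0 mulr0 cnorm_ge0.
have ap := cnorm_gt0 a0; have bp := cnorm_gt0 b0.
rewrite -(@ler_pXn2r _ 2) ?nnegrE ?cnorm_ge0 ?mulr_ge0 ?cnorm_ge0 //.
rewrite exprMn -!cstar_identity starM.
have -> : star (be b) * star (al a) * (al a * be b) = al (star a * a) * be (star b * b).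
  have -> : star (be b) * star (al a) * (al a * be b) = star (be b) * (star (al a) * al a) * be b by ncring.
  by rewrite -(homS hal) -(homS hbe) -(homM hal) -cab -mulrA -(homM hbe).
set p := star a * a; set q := star b * b.
have pn : 0 < ‖[p]‖ by rewrite cstar_identity exprn_gt0.
have qn : 0 < ‖[q]‖ by rewrite cstar_identity exprn_gt0.
have pi : 0 <= ‖[p]‖^-1 by rewrite invr_ge0 ltW.
have qi : 0 <= ‖[q]‖^-1 by rewrite invr_ge0 ltW.
have := @cross_norm_pos (‖[p]‖^-1%:C *: p) (‖[q]‖^-1%:C *: q).
rewrite (homZ hal) (homZ hbe) scaleM !cnorm_scale ?mulr_ge0 // !mulVf ?gt_eqF //.
move=> /(_ (pos_scale pi (pos_starM a)) (pos_scale qi (pos_starM b)) erefl erefl).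
by rewrite -invfM -ler_pdivrMl ?invr_gt0 ?mulr_gt0 // invrK mulr1.
Qed.

End CrossNorm.

(** * States, null vectors and orthonormal families *)

Section States.
Variables (R : realType) (A : cstarAlgType R).

(* What is used of the GNS representation of a state: [w (star x * y)] is the
   inner product of the vectors of [x] and [y]. *)
Record state_on (w : A -> R[i]) : Prop := StateOn {
  st_lin : linear (w : A -> R[i]^o);
  st_star : forall x, w (star x) = conjc (w x);
  st_one : w 1 = 1;
  st_pos : forall x, exists2 r : R, 0 <= r & w (star x * x) = r%:C }.

Section FromExcising.
Variables (e : nat -> A) (w : A -> R[i]).
Hypothesis ex : excising e w.
Let pe : forall k, pos (e k). Proof. by case: ex. Qed.
Let e1 : forall k, ‖[e k]‖ = 1. Proof. by case: ex. Qed.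

Lemma excising_near g eps : 0 < eps -> exists N, forall k, (N <= k)%N -> near_scalar (e k) g (w g) eps.
Proof. by case: ex => _ _; exact. Qed.

Lemma excising_uniq g l : (forall eps, 0 < eps -> exists N, forall k, (N <= k)%N ->
   near_scalar (e k) g l eps) -> w g = l.
Proof.
move=> h; apply/eqP; rewrite -subr_eq0; apply/eqP/nc_small => eps eps0.
have e2 : 0 < eps / 2 by lra.
have [N hN] := h _ e2; have [M hM] := excising_near g e2.
have := near_scalar_uniq pe e1 (hM _ (leq_addl N M)) (hN _ (leq_addr M N)); lra.
Qed.

Lemma excising_state : state_on w.
Proof.
have st x : w (star x) = conjc (w x).
  apply: excising_uniq => eps /(excising_near x)[N hN]; exists N => k /hN.
  have sk := pos_star (pe k).
  rewrite /near_scalar -cnorm_star starB starZ !starM sk.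
  by have -> : e k * (star x * e k) = e k * star x * e k by ncring.
have ps x : exists2 r : R, 0 <= r & w (star x * x) = r%:C.
  have wr : w (star x * x) = (complex.Re (w (star x * x)))%:C.
    have := congr1 (@complex.Im R) (st (star x * x)); rewrite starM starK.
    case: (w _) => a b /= h; apply/eqP; rewrite eq_complex /= eqxx /=; apply/eqP; lra.
  exists (complex.Re (w (star x * x))) => //; rewrite leNgt; apply/negP => r0.
  move: wr; set r := complex.Re _ in r0 * => wr.
  have r2 : 0 < - r / 2 by lra.
  have [N hN] := excising_near (star x * x) r2.
  have := hN N (leqnn N); rewrite /near_scalar wr.
  have sk := pos_star (pe N).
  have -> : e N * (star x * x) * e N - r%:C *: (e N * e N) = star (x * e N) * (x * e N) + (- r)%:C *: (e N * e N).
    by rewrite starM sk rcN scaleNr; ncring.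
  have : ‖[(- r)%:C *: (e N * e N)]‖ <= ‖[star (x * e N) * (x * e N) + (- r)%:C *: (e N * e N)]‖.
    apply: pos_le_norm; first by apply: pos_scale; [lra|apply: pos_sqr].
    by rewrite addrK; exact: pos_starM.
  by rewrite cnorm_scale ?cnorm_ee //; lra.
split=> //; first exact: excising_star0 ex.
apply: excising_uniq => eps eps0; exists 0%N => k _.
by rewrite /near_scalar mulr1 scale1r subrr cnorm0 ltW.
Qed.

End FromExcising.

Section StateTheory.
Variable w : A -> R[i].
Hypothesis sw : state_on w.

Lemma stD x y : w (x + y) = w x + w y.
Proof. by have := st_lin sw 1 x y; rewrite !scale1r. Qed.
Lemma st0 : w 0 = 0.
Proof. by apply: (addrI (w 0)); rewrite -stD !addr0. Qed.
Lemma stZ c x : w (c *: x) = c * w x.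
Proof. by have := st_lin sw c x 0; rewrite st0 !addr0. Qed.
Lemma stN x : w (- x) = - w x.
Proof. by rewrite -scaleN1r stZ mulN1r. Qed.
Lemma stB x y : w (x - y) = w x - w y.
Proof. by rewrite stD stN. Qed.
Lemma st_sum I (r : seq I) (P : pred I) (F : I -> A) :
  w (\sum_(i <- r | P i) F i) = \sum_(i <- r | P i) w (F i).
Proof. exact: (big_morph _ stD st0). Qed.

Definition ip (x y : A) := w (star x * y).
Definition wn (x : A) : R := complex.Re (ip x x).

Lemma wn_ge0 x : 0 <= wn x.
Proof. by rewrite /wn /ip; have [r r0 ->] := st_pos sw x. Qed.
Lemma wnE x : ip x x = (wn x)%:C.
Proof. by rewrite /wn /ip; have [r r0 ->] := st_pos sw x. Qed.
Lemma ip_conj x y : ip y x = conjc (ip x y).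
Proof. by rewrite /ip -(st_star sw) starM starK. Qed.
Lemma ipDr x y z : ip x (y + z) = ip x y + ip x z. Proof. by rewrite /ip mulrDr stD. Qed.
Lemma ipBr x y z : ip x (y - z) = ip x y - ip x z. Proof. by rewrite /ip mulrBr stB. Qed.
Lemma ipZr c x y : ip x (c *: y) = c * ip x y. Proof. by rewrite /ip -scalerAr stZ. Qed.
Lemma ipDl x y z : ip (x + y) z = ip x z + ip y z.
Proof. by rewrite /ip starD mulrDl stD. Qed.
Lemma ipZl c x y : ip (c *: x) y = conjc c * ip x y.
Proof. by rewrite /ip starZ -scalerAl stZ. Qed.
Lemma ip_sumr I (r : seq I) (P : pred I) (F : I -> A) x :
  ip x (\sum_(i <- r | P i) F i) = \sum_(i <- r | P i) ip x (F i).
Proof. by rewrite /ip mulr_sumr st_sum. Qed.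
Lemma ip_mulr x y z : ip x (y * z) = ip (star y * x) z.
Proof. by rewrite /ip starM starK mulrA. Qed.
(** Cauchy-Schwarz in the degenerate case. The number [t] is chosen so that [x + t c z] would have
    squared norm exactly [-1]. *)
Lemma ip_null x z : wn z = 0 -> ip x z = 0.
Proof.
move=> z0; apply: contrapT => /eqP h; pose c := ip z x.
have cc : c * ip x z = (nc c ^+ 2)%:C by rewrite (ip_conj z x) nc_sqr.
have c0 : 0 < nc c.
  rewrite lt_neqAle nc_ge0 andbT eq_sym; apply/eqP => /nc_eq0 c0.
  by move: h; rewrite (ip_conj z x) -/c c0 /conjc /= oppr0 eqxx.
have c2 : 0 < nc c ^+ 2 by rewrite exprn_gt0.
pose t := - (wn x + 1) / (2 * nc c ^+ 2).
have tE : t * (2 * nc c ^+ 2) = - (wn x + 1) by rewrite /t divfK // gt_eqF //; lra.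
have := wn_ge0 (x + (t%:C * c) *: z); rewrite /wn !(ipDr, ipDl, ipZr, ipZl) (wnE z) z0.
rewrite !mulr0 addr0 (wnE x) -mulrA cc.
have -> : conjc (t%:C * c) * ip z x = (t * nc c ^+ 2)%:C.
  have ct : conjc t%:C = t%:C :> R[i] by rewrite /conjc /= oppr0.
  have -> : conjc (t%:C * c) = t%:C * conjc c by rewrite -{2}ct; exact: rmorphM.
  by rewrite -/c [RHS]rcM nc_sqr; ring.
by rewrite -rcM /=; lra.
Qed.

Section Ortho.
Variables (I : finType) (g : I -> A).
Definition orthonormal := forall i j, ip (g i) (g j) = (i == j)%:R.
(** Equality is required only modulo null vectors of [w], which is all that [ip] detects. *)
Definition in_span z := exists c : I -> R[i], wn (z - \sum_i c i *: g i) = 0.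
Hypothesis og : orthonormal.

Lemma ortho_coef (c : I -> R[i]) j : ip (g j) (\sum_i c i *: g i) = c j.
Proof.
rewrite ip_sumr (bigD1 j) //= ipZr og eqxx mulr1 big1 ?addr0 // => i /negbTE ij.
by rewrite ipZr og eq_sym ij mulr0.
Qed.

Lemma in_span_ip z x : in_span z -> ip x z = \sum_i ip x (g i) * ip (g i) z.
Proof.
move=> [c hc]; have e y : ip y z = ip y (\sum_i c i *: g i).
  by apply/eqP; rewrite -subr_eq0 -ipBr; apply/eqP/ip_null.
rewrite e ip_sumr; apply: eq_bigr => i _; rewrite ipZr e ortho_coef mulrC //.
Qed.

Lemma in_span_ipl z x : in_span z -> ip z x = \sum_i ip z (g i) * ip (g i) x.
Proof.
move=> hz; rewrite ip_conj (in_span_ip x hz) rmorph_sum; apply: eq_bigr => i _.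
by rewrite (ip_conj (g i) z) (ip_conj x (g i)) mulrC; exact: rmorphM.
Qed.

End Ortho.

Definition onf (n : nat) (g : nat -> A) := orthonormal (fun i : 'I_n => g i).

(** The given family is extended without being changed. This allows a later family to start with the
    vector 1. *)
Lemma gram_schmidt (zs : seq A) n g : onf n g ->
  exists m h, [/\ (n <= m)%N, onf m h, forall i, (i < n)%N -> h i = g i
    & forall z, z \in zs -> in_span (fun i : 'I_m => h i) z].
Proof.
elim: zs n g => [|z zs IH] n g og; first by exists n, g.
have [m [h [nm oh hg hs]]] := IH n g og.
pose p := \sum_(i < m) ip (h i) z *: h i; pose y := z - p.
have yh (i : 'I_m) : ip (h i) y = 0.
  by rewrite /y ipBr /p (ortho_coef oh (fun i : 'I_m => ip (h i) z)) subrr.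
have [y0|y0] := eqVneq (wn y) 0.
  exists m, h; split=> // x; rewrite inE => /orP[/eqP ->|]; last exact: hs.
  by exists (fun i : 'I_m => ip (h i) z).
have yp : 0 < wn y by rewrite lt_neqAle eq_sym y0 wn_ge0.
pose s := Num.sqrt (wn y); have s0 : 0 < s by rewrite sqrtr_gt0.
have ss : s * s = wn y by apply: sqrtrM_id; exact: wn_ge0.
pose h' i := if (i < m)%N then h i else (s^-1)%:C *: y.
have h'i (i : 'I_m) : h' i = h i by rewrite /h' ltn_ord.
have h'm : h' m = (s^-1)%:C *: y by rewrite /h' ltnn.
have cs : conjc (s^-1)%:C = (s^-1)%:C :> R[i] by rewrite /conjc /= oppr0.
have sp x : in_span (fun i : 'I_m => h i) x -> in_span (fun i : 'I_m.+1 => h' i) x.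
  move=> [c hc]; exists (fun i : 'I_m.+1 => oapp c 0 (insub (nat_of_ord i))).
  rewrite big_ord_recr /= insubN ?ltnn //= scale0r addr0 -hc; congr (wn (x - _)).
  by apply: eq_bigr => i _; rewrite /= h'i valK.
exists m.+1, h'; split.
- exact: leqW.
- move=> i j; have [im|im] := ltnP i m; have [jm|jm] := ltnP j m.
  + by rewrite /h' im jm (oh (Ordinal im) (Ordinal jm)).
  + have -> : nat_of_ord j = m by apply/eqP; rewrite eqn_leq jm -ltnS ltn_ord.
    rewrite h'm /h' im ipZr (yh (Ordinal im)) mulr0.
    by have -> : (i == j) = false by apply/negbTE; rewrite -val_eqE /= neq_ltn (leq_trans im jm).
  + have -> : nat_of_ord i = m by apply/eqP; rewrite eqn_leq im -ltnS ltn_ord.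
    rewrite h'm /h' jm ipZl ip_conj (yh (Ordinal jm)) rmorph0 mulr0.
    by have -> : (i == j) = false by apply/negbTE; rewrite -val_eqE /= neq_ltn (leq_trans jm im) orbT.
  + have iE : nat_of_ord i = m by apply/eqP; rewrite eqn_leq im -ltnS ltn_ord.
    have jE : nat_of_ord j = m by apply/eqP; rewrite eqn_leq jm -ltnS ltn_ord.
    have -> : i = j by apply/val_inj; rewrite /= iE jE.
    rewrite eqxx jE.
    rewrite h'm ipZl ipZr wnE cs -!rcM -ss.
    by have -> : s^-1 * (s^-1 * (s * s)) = 1 by field; rewrite gt_eqF.
- by move=> i ni; rewrite /h' (leq_trans ni nm) hg.
move=> x; rewrite inE => /orP[/eqP ->|/hs]; last exact: sp.
exists (fun i : 'I_m.+1 => if (i < m)%N then ip (h i) z else s%:C).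
rewrite big_ord_recr /= ltnn h'm scaleCA mulfV ?gt_eqF // scale1C.
have -> : \sum_(i < m) (if (i < m)%N then ip (h i) z else s%:C) *: h' i = p.
  by apply: eq_bigr => i _; rewrite ltn_ord h'i.
by rewrite /y addrC subrK subrr /wn /ip mulr0 st0.
Qed.

End StateTheory.

End States.

(** * Bounded sequences modulo null sequences *)

Section SequenceAlgebra.
Variables (R : realType) (A : cstarAlgType R).
Implicit Types x y z : nat -> A.

Definition bnd x := exists M : R, forall n, ‖[x n]‖ <= M.
Definition null x := forall e : R, 0 < e -> exists N, forall n, (N <= n)%N -> ‖[x n]‖ < e.

Lemma bndP x : bnd x -> exists2 M : R, 0 < M & forall n, ‖[x n]‖ <= M.
Proof.
move=> [M hM]; exists (M + 1) => [|n]; last by have := hM n; lra.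
by have := hM 0%N; have := cnorm_ge0 (x 0%N); lra.
Qed.

Lemma bndD x y : bnd x -> bnd y -> bnd (fun n => x n + y n).
Proof. by move=> [M hM] [K hK]; exists (M + K) => n; apply: le_trans (cnormD _ _) _; exact: lerD. Qed.
Lemma bndM x y : bnd x -> bnd y -> bnd (fun n => x n * y n).
Proof. by move=> [M hM] [K hK]; exists (M * K) => n; exact: cnormM_le. Qed.
Lemma bndZ (c : R[i]) x : bnd x -> bnd (fun n => c *: x n).
Proof. by move=> [M hM]; exists (nc c * M) => n; rewrite cnormZn ler_wpM2l ?nc_ge0. Qed.
Lemma bndN x : bnd x -> bnd (fun n => - x n).
Proof. by move=> [M hM]; exists M => n; rewrite cnormN. Qed.
Lemma bndS x : bnd x -> bnd (fun n => star (x n)).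
Proof. by move=> [M hM]; exists M => n; rewrite cnorm_star. Qed.
Lemma bndB x y : bnd x -> bnd y -> bnd (fun n => x n - y n).
Proof. by move=> hx hy; apply: bndD => //; exact: bndN. Qed.
Lemma bndc (a : A) : bnd (fun=> a). Proof. by exists ‖[a]‖. Qed.
Lemma bnd_iso x : (forall n, isometry (x n)) -> bnd x.
Proof. by move=> h; exists 1 => n; rewrite cnorm_isometry. Qed.
Lemma nullD x y : null x -> null y -> null (fun n => x n + y n).
Proof.
move=> h k e e0; have e2 : 0 < e / 2 by lra.
have [N hN] := h _ e2; have [M hM] := k _ e2; exists (N + M)%N => n nm.
apply: le_lt_trans (cnormD _ _) _.
by have := hN n (leq_trans (leq_addr _ _) nm); have := hM n (leq_trans (leq_addl _ _) nm); lra.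
Qed.
Lemma null_ext x y : (forall n, x n = y n) -> null x -> null y.
Proof. by move=> /funext ->. Qed.
Lemma null_le x (f : nat -> R) : (forall n, ‖[x n]‖ <= f n) ->
  (forall e, 0 < e -> exists N, forall n, (N <= n)%N -> f n < e) -> null x.
Proof. by move=> h k e /k[N hN]; exists N => n /hN; exact: le_lt_trans. Qed.
Lemma nullMl x y : bnd x -> null y -> null (fun n => x n * y n).
Proof.
move=> /bndP[M M0 hM] h e e0; have [N hN] := h _ (divr_gt0 e0 M0); exists N => n /hN.
rewrite ltr_pdivlMr // mulrC => k; apply: le_lt_trans (cnormM _ _) _.
by apply: le_lt_trans k; rewrite ler_wpM2r ?cnorm_ge0.
Qed.
Lemma nullS x : null x -> null (fun n => star (x n)).
Proof. by move=> h e /h[N hN]; exists N => n /hN; rewrite cnorm_star. Qed.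
Lemma nullMr x y : null x -> bnd y -> null (fun n => x n * y n).
Proof.
move=> h k; apply: (@null_ext (fun n => star (star (y n) * star (x n)))) => [n|].
  by rewrite starM !starK.
by apply/nullS/nullMl; [exact: bndS|exact: nullS].
Qed.
Lemma nullN x : null x -> null (fun n => - x n).
Proof. by move=> h e /h[N hN]; exists N => n /hN; rewrite cnormN. Qed.
Lemma null0 : null (fun=> 0).
Proof. by move=> e e0; exists 0%N => n _; rewrite cnorm0. Qed.

Definition bseq := {x : nat -> A | `[< bnd x >]}.
HB.instance Definition _ := Choice.on bseq.

Definition bs_eq (x y : bseq) : bool := `[< null (fun n => val x n - val y n) >].

Lemma bs_refl : reflexive bs_eq.
Proof. by move=> x; apply/asboolP; apply: null_ext null0 => n; rewrite subrr. Qed.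
Lemma bs_sym : symmetric bs_eq.
Proof.
by move=> x y; apply/asboolP/asboolP => /nullN h; apply: null_ext h => n; rewrite opprB.
Qed.
Lemma bs_trans : transitive bs_eq.
Proof.
move=> y x z /asboolP h /asboolP k; apply/asboolP; apply: null_ext (nullD h k) => n.
by rewrite addrA subrK.
Qed.
Canonical bs_equiv := EquivRel bs_eq bs_refl bs_sym bs_trans.
(** Only a star-algebra is built on this quotient: identities are proved here, norm estimates on
    representatives. *)
Definition seqalg := {eq_quot bs_equiv}%qT.
HB.instance Definition _ := Choice.on seqalg.
HB.instance Definition _ := EqQuotient.on seqalg.

Lemma asbnd0 : `[< bnd (fun=> 0) >]. Proof. by apply/asboolP; exact: bndc. Qed.
Definition bs0 : bseq :=
  exist (fun x : nat -> A => is_true `[< bnd x >]) (fun=> 0) asbnd0.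
Definition mkb x : bseq := insubd bs0 x.
Lemma mkbE x : bnd x -> val (mkb x) = x.
Proof. by move=> h; rewrite /mkb val_insubd ifT //; apply/asboolP. Qed.

Definition qc x : seqalg := (\pi_seqalg (mkb x))%qT.

Lemma qcP x y : bnd x -> bnd y -> qc x = qc y <-> null (fun n => x n - y n).
Proof.
move=> hx hy; rewrite /qc; split.
  by move=> /eqP; rewrite eqmodE => /asboolP; rewrite !mkbE.
by move=> h; apply/eqP; rewrite eqmodE; apply/asboolP; rewrite !mkbE.
Qed.

Definition qr (q : seqalg) : nat -> A := val (repr q).
Lemma qr_bnd q : bnd (qr q). Proof. by apply/asboolP; exact: (valP (repr q)). Qed.
Lemma qrK q : qc (qr q) = q.
Proof.
rewrite /qc -[RHS]reprK; congr (\pi_seqalg _)%qT; apply/val_inj.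
by rewrite mkbE //; exact: qr_bnd.
Qed.
Lemma qcK x : bnd x -> null (fun n => qr (qc x) n - x n).
Proof. by move=> h; apply/qcP => //; [exact: qr_bnd|rewrite qrK]. Qed.

Definition qadd (p q : seqalg) := qc (fun n => qr p n + qr q n).
Definition qmul (p q : seqalg) := qc (fun n => qr p n * qr q n).
Definition qopp (p : seqalg) := qc (fun n => - qr p n).
Definition qscale (c : R[i]) (p : seqalg) := qc (fun n => c *: qr p n).
Definition qstar (p : seqalg) := qc (fun n => star (qr p n)).

Lemma qaddE x y : bnd x -> bnd y -> qadd (qc x) (qc y) = qc (fun n => x n + y n).
Proof.
move=> hx hy; apply/qcP; [exact: bndD (qr_bnd _) (qr_bnd _)|exact: bndD|].
apply: null_ext (nullD (qcK hx) (qcK hy)) => n; ncring.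
Qed.
Lemma qmulE x y : bnd x -> bnd y -> qmul (qc x) (qc y) = qc (fun n => x n * y n).
Proof.
move=> hx hy; apply/qcP; [exact: bndM (qr_bnd _) (qr_bnd _)|exact: bndM|].
apply: null_ext (nullD (nullMr (qcK hx) (qr_bnd (qc y))) (nullMl hx (qcK hy))) => n; ncring.
Qed.
Lemma qoppE x : bnd x -> qopp (qc x) = qc (fun n => - x n).
Proof.
move=> hx; apply/qcP; [exact: bndN (qr_bnd _)|exact: bndN|].
apply: null_ext (nullN (qcK hx)) => n; ncring.
Qed.
Lemma qscaleE c x : bnd x -> qscale c (qc x) = qc (fun n => c *: x n).
Proof.
move=> hx; apply/qcP; [exact: bndZ (qr_bnd _)|exact: bndZ|].
apply: null_ext (nullMl (bndc c%:A) (qcK hx)) => n.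
by rewrite -scalerAl mul1r scalerBr.
Qed.
Lemma qstarE x : bnd x -> qstar (qc x) = qc (fun n => star (x n)).
Proof.
move=> hx; apply/qcP; [exact: bndS (qr_bnd _)|exact: bndS|].
by apply: null_ext (nullS (qcK hx)) => n; rewrite starB.
Qed.

Lemma qW (P : seqalg -> Prop) : (forall x, bnd x -> P (qc x)) -> forall q, P q.
Proof. by move=> h q; rewrite -(qrK q); apply: h; exact: qr_bnd. Qed.

Lemma qc_ext x y : (forall n, x n = y n) -> qc x = qc y.
Proof. by move=> /funext ->. Qed.

Local Ltac qelim := let x := fresh "x" in move=> x; elim/qW: x => ? ?.
Local Ltac qsolve := repeat qelim;
  rewrite ?(qaddE, qmulE, qoppE, qscaleE, qstarE) //;
  do ?[exact: bndD|exact: bndM|exact: bndN|exact: bndZ|exact: bndS|exact: bndc];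
  try (apply: qc_ext => ?).

Lemma qaddA : associative qadd. Proof. by qsolve; rewrite addrA. Qed.
Lemma qaddC : commutative qadd. Proof. by qsolve; rewrite addrC. Qed.
Lemma qadd0 : left_id (qc (fun=> 0)) qadd. Proof. by qsolve; rewrite add0r. Qed.
Lemma qaddN : left_inverse (qc (fun=> 0)) qopp qadd. Proof. by qsolve; rewrite addNr. Qed.
HB.instance Definition _ := GRing.isZmodule.Build seqalg qaddA qaddC qadd0 qaddN.

Lemma qmulA : associative qmul. Proof. by qsolve; rewrite mulrA. Qed.
Lemma qmul1 : left_id (qc (fun=> 1)) qmul. Proof. by qsolve; rewrite mul1r. Qed.
Lemma qmul1r : right_id (qc (fun=> 1)) qmul. Proof. by qsolve; rewrite mulr1. Qed.
Lemma qmulDl : left_distributive qmul qadd. Proof. by qsolve; rewrite mulrDl. Qed.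
Lemma qmulDr : right_distributive qmul qadd. Proof. by qsolve; rewrite mulrDr. Qed.
Lemma qone_neq0 : qc (fun=> 1) != qc (fun=> 0).
Proof.
apply/eqP => /qcP-/(_ (bndc _))-/(_ (bndc _)) h.
by have [N /(_ N (leqnn N))] := h 1 ltr01; rewrite subr0 cnorm1 ltxx.
Qed.
HB.instance Definition _ := GRing.Zmodule_isNzRing.Build seqalg
  qmulA qmul1 qmul1r qmulDl qmulDr qone_neq0.

Let qaddR (x y : seqalg) : x + y = qadd x y. Proof. by []. Qed.
Let qmulR (x y : seqalg) : x * y = qmul x y. Proof. by []. Qed.
Lemma qscaleA a b (v : seqalg) : qscale a (qscale b v) = qscale (a * b) v.
Proof. by move: v; rewrite ?(qaddR, qmulR); qsolve; rewrite scalerA. Qed.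
Lemma qscale1 : left_id 1 qscale. Proof. by rewrite ?(qaddR, qmulR); qsolve; rewrite scale1r. Qed.
Lemma qscaleDr : right_distributive qscale +%R.
Proof. by move=> a; qelim; qelim; rewrite !qaddR; qsolve; rewrite scalerDr. Qed.
Lemma qscaleDl (v : seqalg) : {morph qscale^~ v : a b / a + b}.
Proof. by move=> a b; elim/qW: v => v hv; rewrite !qaddR; qsolve; rewrite scalerDl. Qed.
HB.instance Definition _ := GRing.Zmodule_isLmodule.Build R[i] seqalg
  qscaleA qscale1 qscaleDr qscaleDl.

Let qscaleR (a : R[i]) (x : seqalg) : a *: x = qscale a x. Proof. by []. Qed.

Lemma qscaleAl (a : R[i]) (u v : seqalg) : a *: (u * v) = (a *: u) * v.
Proof. by elim/qW: u => u hu; elim/qW: v => v hv; rewrite ?(qscaleR, qaddR, qmulR); qsolve; rewrite scalerAl. Qed.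
HB.instance Definition _ := GRing.Lmodule_isLalgebra.Build R[i] seqalg qscaleAl.
Lemma qscaleAr (a : R[i]) (u v : seqalg) : a *: (u * v) = u * (a *: v).
Proof. by elim/qW: u => u hu; elim/qW: v => v hv; rewrite ?(qscaleR, qaddR, qmulR); qsolve; rewrite scalerAr. Qed.
HB.instance Definition _ := GRing.Lalgebra_isAlgebra.Build R[i] seqalg qscaleAr.

Lemma qstarK : involutive qstar. Proof. by rewrite ?(qscaleR, qaddR, qmulR); qsolve; rewrite starK. Qed.
Lemma qstarD : {morph qstar : x y / x + y}. Proof. by qelim; qelim; rewrite !qaddR; qsolve; rewrite starD. Qed.
Lemma qstarZ (a : R[i]) (x : seqalg) : qstar (a *: x) = conjc a *: qstar x.
Proof. by elim/qW: x => x hx; rewrite ?(qscaleR, qaddR, qmulR); qsolve; rewrite starZ. Qed.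
Lemma qstarM (x y : seqalg) : qstar (x * y) = qstar y * qstar x.
Proof. by elim/qW: x => x hx; elim/qW: y => y hy; rewrite ?(qscaleR, qaddR, qmulR); qsolve; rewrite starM. Qed.
HB.instance Definition _ := hasStar.Build R seqalg qstarK qstarD qstarZ qstarM.

Lemma qcD x y : bnd x -> bnd y -> qc (fun n => x n + y n) = qc x + qc y.
Proof. by move=> hx hy; rewrite -qaddE. Qed.
Lemma qcM x y : bnd x -> bnd y -> qc (fun n => x n * y n) = qc x * qc y.
Proof. by move=> hx hy; rewrite -qmulE. Qed.
Lemma qcN x : bnd x -> qc (fun n => - x n) = - qc x.
Proof. by move=> hx; rewrite -qoppE. Qed.
Lemma qcB x y : bnd x -> bnd y -> qc (fun n => x n - y n) = qc x - qc y.
Proof. by move=> hx hy; rewrite qcD ?qcN //; exact: bndN. Qed.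
Lemma qcZ c x : bnd x -> qc (fun n => c *: x n) = c *: qc x.
Proof. by move=> hx; rewrite -qscaleE. Qed.
Lemma qcS x : bnd x -> qc (fun n => star (x n)) = star (qc x).
Proof. by move=> hx; rewrite -qstarE. Qed.
Lemma qc1 : qc (fun=> 1) = 1. Proof. by []. Qed.
Lemma qc0 : qc (fun=> 0) = 0. Proof. by []. Qed.
Lemma qc_eq0 x : bnd x -> qc x = 0 <-> null x.
Proof.
move=> hx; rewrite -qc0; split=> [/qcP-/(_ hx)-/(_ (bndc 0)) h|h].
  by apply: null_ext h => n; rewrite subr0.
by apply/qcP => //; [exact: bndc|apply: null_ext h => n; rewrite subr0].
Qed.

Definition qk (a : A) : seqalg := qc (fun=> a).
Lemma qk_uhom : uhom qk.
Proof.
split=> //; split=> [c x y|x y|x]; rewrite /qk.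
- by rewrite qcD ?qcZ; first [exact: bndc | by apply: bndZ; exact: bndc | by []].
- by rewrite qcM; first [exact: bndc | by []].
- by rewrite qcS; first [exact: bndc | by []].
Qed.

End SequenceAlgebra.
Arguments seqalg {R} A.
Arguments qk {R A} a.

(** * Cuntz pairs *)

Section CuntzPairs.
Variables (R : realType) (B : starAlgType R).
Implicit Types t r : bool -> B.

Definition cuntz t := (forall i j, star (t i) * t j = (i == j)%:R) /\
  t true * star (t true) + t false * star (t false) = 1.

Lemma cuntz_iso t i : cuntz t -> isometry (t i).
Proof. by case=> h _; rewrite /isometry h eqxx. Qed.

Lemma cuntz_of_isometries (s1 s2 : B) : isometry s1 -> isometry s2 ->
  s1 * star s1 + s2 * star s2 = 1 -> cuntz (fun b => if b then s1 else s2).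
Proof.
move=> i1 i2 s; have o : star s1 * s2 = 0.
  have : star s1 * (s1 * star s1 + s2 * star s2) = star s1 by rewrite s mulr1.
  have -> : star s1 * (s1 * star s1 + s2 * star s2)
    = (star s1 * s1) * star s1 + (star s1 * s2) * star s2 by ncring.
  rewrite i1 mul1r => /eqP; rewrite addrC -subr_eq0 addrK => /eqP h.
  by rewrite -[LHS]mulr1 -i2 mulrA h mul0r.
split=> // -[] [] //=; by rewrite -[LHS]starK starM starK o star0.
Qed.

(** For [t = r] this is the shift endomorphism. For two Cuntz pairs, its fixed points are exactly
    the [x] with [t i * x = x * r i]. *)
Definition Lam t r (x : B) := t true * x * star (r true) + t false * x * star (r false).

Lemma LamMr t r x i : cuntz r -> Lam t r x * r i = t i * x.
Proof.
case=> h _; rewrite /Lam mulrDl -!mulrA !h.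
by case: i => /=; rewrite !mulr1 !mulr0 ?addr0 ?add0r.
Qed.

Lemma LamMl t r x i : cuntz t -> star (t i) * Lam t r x = x * star (r i).
Proof.
case=> h _; rewrite /Lam mulrDr !mulrA !h.
by case: i => /=; rewrite !mul1r !mul0r ?addr0 ?add0r.
Qed.

Lemma LamP t r r' x y : cuntz t -> star (Lam t r x) * Lam t r' y = Lam r r' (star x * y).
Proof.
case=> h _; rewrite /Lam starD !starM !starK.
transitivity (r true * star x * (star (t true) * t true) * y * star (r' true)
  + r true * star x * (star (t true) * t false) * y * star (r' false)
  + r false * star x * (star (t false) * t true) * y * star (r' true)
  + r false * star x * (star (t false) * t false) * y * star (r' false)).
  by ncring.
by rewrite !h /=; ncring.
Qed.

Lemma Lam0 t r : Lam t r 0 = 0. Proof. by rewrite /Lam !mulr0 !mul0r addr0. Qed.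
Lemma Lam1 t : cuntz t -> Lam t t 1 = 1. Proof. by case=> _; rewrite /Lam !mulr1. Qed.

Lemma iter_Lam0 t r n : iter n (Lam t r) 0 = 0.
Proof. by elim: n => //= n ->; rewrite Lam0. Qed.
Lemma iter_Lam1 t n : cuntz t -> iter n (Lam t t) 1 = 1.
Proof. by move=> ct; elim: n => //= n ->; rewrite Lam1. Qed.

Lemma iter_LamP t r r' x y n m : cuntz t ->
  star (iter n (Lam t r) x) * iter (n + m) (Lam t r') y
  = iter n (Lam r r') (star x * iter m (Lam t r') y).
Proof. by move=> ct; elim: n => //= n IH; rewrite LamP // IH. Qed.

Lemma iter_LamMl t r x n i : cuntz t ->
  star (t i) ^+ n * iter n (Lam t r) x = x * star (r i) ^+ n.
Proof.
move=> ct; elim: n x => [|n IH] x; first by rewrite !expr0 mul1r mulr1.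
by rewrite exprSr iterS -mulrA LamMl // mulrA IH exprSr mulrA.
Qed.

Lemma cuntz_pow t i n : cuntz t -> star (t i) ^+ n * t i ^+ n = 1.
Proof.
move=> ct; elim: n => [|n IH]; first by rewrite !expr0 mulr1.
by rewrite exprSr exprS mulrA -(mulrA _ (star (t i))) (cuntz_iso i ct) mulr1.
Qed.

Lemma cuntz_pow_le t i n k : cuntz t -> (k <= n)%N ->
  star (t i) ^+ (n - k) * t i ^+ n = t i ^+ k.
Proof. by move=> ct kn; rewrite -{2}(subnK kn) exprD mulrA cuntz_pow // mul1r. Qed.

(** Moving [star (t true) ^+ k] past the [k]-fold shift leaves the factor
    [star (t false) * t true ^+ k = 0]. The prefix [t true ^+ n] must therefore be at least as long
    as the shift, whence [k <= n]. *)
Lemma spike_ortho t r (y y' : B) n k : cuntz t -> (0 < k <= n)%N ->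
  star (t true ^+ n * t false * y) * iter k (Lam t r) (t true ^+ n * t false * y') = 0.
Proof.
move=> ct /andP[k0 kn]; rewrite !starM starX.
have -> : star (t true) ^+ n = star (t true) ^+ (n - k) * star (t true) ^+ k.
  by rewrite -exprD subnK.
rewrite -!mulrA iter_LamMl //.
have -> : star y * (star (t false) * (star (t true) ^+ (n - k)
    * (t true ^+ n * (t false * y') * star (r true) ^+ k)))
  = star y * (star (t false) * (star (t true) ^+ (n - k) * t true ^+ n))
    * (t false * y' * star (r true) ^+ k) by rewrite !mulrA.
have z : star (t false) * t true ^+ k = 0 by rewrite -(prednK k0) exprS mulrA ct.1 mul0r.
by rewrite cuntz_pow_le // z mulr0 mul0r.
Qed.

Lemma spike_iso t (y y' : B) n : cuntz t ->
  star (t true ^+ n * t false * y) * (t true ^+ n * t false * y') = star y * y'.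
Proof.
move=> ct; rewrite !starM starX.
have -> : star y * (star (t false) * star (t true) ^+ n) * (t true ^+ n * t false * y')
  = star y * (star (t false) * (star (t true) ^+ n * t true ^+ n) * t false) * y'.
  by rewrite !mulrA.
by rewrite cuntz_pow // mulr1 (cuntz_iso false ct) mulr1.
Qed.

Definition spike_sum t r (y : B) N :=
  \sum_(n < N) iter n (Lam t r) (t true ^+ N * t false * y).

(** Distinct translates are orthogonal, so only [N] of the [N * N] products survive. Hence division
    by the root of [N] yields an isometry, whereas the intertwining defect keeps only two terms. *)
Lemma spike_sumP t r r' y y' N : cuntz t ->
  star (spike_sum t r y N) * spike_sum t r' y' N
  = \sum_(n < N) iter n (Lam r r') (star y * y').
Proof.
move=> ct; rewrite /spike_sum star_sum mulr_suml; apply: eq_bigr => n _.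
rewrite mulr_sumr (bigD1 n) //= [X in _ + X]big1 ?addr0.
  by have := iter_LamP r r' (t true ^+ N * t false * y) (t true ^+ N * t false * y') n 0 ct; rewrite addn0 /= => ->; rewrite spike_iso.
move=> m; rewrite -val_eqE /= neq_ltn => /orP[mn|nm].
  rewrite -[LHS]starK starM starK -{1}(subnKC (ltnW mn)) iter_LamP //.
  by rewrite spike_ortho ?iter_Lam0 ?star0 // subn_gt0 mn (leq_trans (leq_subr _ _)) // ltnW // ltn_ord.
rewrite -{1}(subnKC (ltnW nm)) iter_LamP // spike_ortho ?iter_Lam0 //.
by rewrite subn_gt0 nm (leq_trans (leq_subr _ _)) // ltnW // ltn_ord.
Qed.

Lemma spike_sum_inter t r y N i : cuntz r ->
  t i * spike_sum t r y N - spike_sum t r y N * r i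
  = (iter N (Lam t r) (t true ^+ N * t false * y) - t true ^+ N * t false * y) * r i.
Proof.
move=> cr; rewrite /spike_sum; set w := _ * y.
have -> : t i * (\sum_(n < N) iter n (Lam t r) w) = (\sum_(n < N) iter n.+1 (Lam t r) w) * r i.
  by rewrite mulr_sumr mulr_suml; apply: eq_bigr => n _ /=; rewrite LamMr.
rewrite -mulrBl; congr (_ * _); rewrite -sumrB.
elim: N {w} (w) => [|N IH] w; first by rewrite big_ord0 subrr.
by rewrite big_ord_recr /= IH addrC addrA subrK.
Qed.

Lemma inter_star t r x i : cuntz t -> cuntz r -> (forall j, t j * x = x * r j) ->
  star (t i) * x = x * star (r i).
Proof.
move=> ct cr h; have -> : star (t i) * x = star (t i) * Lam t r x.
  by congr (_ * _); rewrite /Lam !h -!mulrA -mulrDr cr.2 mulr1.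
exact: LamMl.
Qed.

End CuntzPairs.

Section OrthoIsometries.
Variables (R : realType) (A : cstarAlgType R).

Definition orthiso (I : finType) (s : I -> A) := forall k l, star (s k) * s l = (k == l)%:R.

Lemma orthiso_cnorm (I : finType) (s : I -> A) k : orthiso s -> ‖[s k]‖ = 1.
Proof. by move=> h; apply: cnorm_isometry; rewrite /isometry h eqxx. Qed.

Lemma orthiso_mul (I : finType) (s x x' : I -> A) : orthiso s ->
  (\sum_k s k * x k * star (s k)) * (\sum_k s k * x' k * star (s k))
  = \sum_k s k * (x k * x' k) * star (s k).
Proof.
move=> h; rewrite mulr_suml; apply: eq_bigr => k _.
rewrite mulr_sumr (bigD1 k) //= big1 => [|l lk].
  by rewrite addr0 -!mulrA (mulrA (star (s k)) (s k)) h eqxx mul1r.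
by rewrite -!mulrA (mulrA (star (s k)) (s l)) h eq_sym (negbTE lk) mul0r !mulr0.
Qed.

Lemma orthiso_proj (I : finType) (s : I -> A) : orthiso s ->
  let E := \sum_k s k * star (s k) in [/\ star E = E, E * E = E & forall k, E * s k = s k].
Proof.
move=> h E; split.
- by rewrite star_sum; apply: eq_bigr => k _; rewrite starM starK.
- have e : E = \sum_k s k * 1 * star (s k) by apply: eq_bigr => k _; rewrite mulr1.
  by rewrite e orthiso_mul //; apply: eq_bigr => k _; rewrite mulr1.
move=> k; rewrite mulr_suml (bigD1 k) //= big1 => [|l lk].
  by rewrite addr0 -mulrA h eqxx mulr1.
by rewrite -mulrA h (negbTE lk) mulr0.
Qed.

(** [d ^+ 2 - star X * X] is positive: it splits into [d ^+ 2] on the complement of [E] and one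
    positive element per block. The bound does not grow with the number of blocks. *)
Lemma orthiso_sum_norm (I : finType) (s x : I -> A) (d : R) : orthiso s -> 0 <= d ->
  (forall k, ‖[x k]‖ <= d) -> ‖[\sum_k s k * x k * star (s k)]‖ <= d.
Proof.
move=> h d0 xd; set X := \sum_k _; have [sE EE _] := orthiso_proj h.
set E := \sum_k _ in sE EE.
rewrite -(@ler_pXn2r _ 2) ?nnegrE ?cnorm_ge0 // -cstar_identity.
have XX : star X * X = \sum_k s k * (star (x k) * x k) * star (s k).
  rewrite -orthiso_mul // star_sum; congr (_ * _); apply: eq_bigr => k _.
  by rewrite !starM starK mulrA.
apply: pos_ubound_norm; [by rewrite exprn_ge0|exact: pos_starM|].
have -> : (d ^+ 2)%:C *: 1 - star X * X = (d ^+ 2)%:C *: (1 - E)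
   + \sum_k s k * ((d ^+ 2)%:C *: 1 - star (x k) * x k) * star (s k).
  have -> : \sum_k s k * ((d ^+ 2)%:C *: 1 - star (x k) * x k) * star (s k)
     = (d ^+ 2)%:C *: E - star X * X.
    rewrite XX scaler_sumr -sumrB; apply: eq_bigr => k _.
    by rewrite mulrBr mulrBl -scalerAr -scalerAl mulr1.
  by rewrite scalerBr; ncring.
apply: posD.
  apply: pos_scale; first by rewrite exprn_ge0.
  exists (1 - E); first by rewrite starB star1 sE.
  have -> : (1 - E) * (1 - E) = 1 - E - E + E * E by ncring.
  by rewrite EE; ncring.
apply: pos_sum => k _; rewrite -{1}(starK (s k)); apply/pos_conj/pos_ubound.
  by rewrite starM starK.
by rewrite cstar_identity lerXn2r ?nnegrE ?cnorm_ge0.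
Qed.

Lemma cuntz_family (t : bool -> A) m : cuntz t ->
  orthiso (fun k : 'I_m => t true ^+ k * t false).
Proof.
move=> ct; have key k l : (k < l)%N -> star (t true ^+ k * t false) * (t true ^+ l * t false) = 0.
  move=> kl; rewrite starM starX -(subnKC (ltnW kl)) exprD.
  have -> : star (t false) * star (t true) ^+ k * (t true ^+ k * t true ^+ (l - k) * t false)
    = star (t false) * (star (t true) ^+ k * t true ^+ k) * t true ^+ (l - k) * t false by rewrite !mulrA.
  rewrite cuntz_pow // mulr1; have : (0 < l - k)%N by rewrite subn_gt0.
  by case: (l - k)%N => // n _; rewrite exprS mulrA ct.1 !mul0r.
move=> k l; have [<-|kl] := eqVneq k l.
  have := spike_iso 1 1 k ct; rewrite !mulr1 => ->; exact: star1.
have : nat_of_ord k != l by rewrite val_eqE.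
rewrite neq_ltn => /orP[|lk]; first exact: key.
by rewrite -[LHS]starK starM starK key // star0.
Qed.

Lemma spike_norms (t r : bool -> A) (y : A) n k : cuntz t -> cuntz r -> isometry y ->
  isometry (iter k (Lam t r) (t true ^+ n * t false * y)).
Proof.
move=> ct cr iy; rewrite /isometry.
have := iter_LamP r r (t true ^+ n * t false * y) (t true ^+ n * t false * y) k 0 ct.
by rewrite addn0 /= => ->; rewrite spike_iso // iy iter_Lam1.
Qed.

Lemma sqrt_inv_small (e : R) : 0 < e -> exists N, (0 < N)%N /\ (Num.sqrt N%:R)^-1 < e.
Proof.
move=> e0; have e2 : 0 < e ^+ 2 by rewrite exprn_gt0.
have [N hN] := inv_small e2; exists N.+1; split=> //.
have N0 : (0 : R) < N.+1%:R by rewrite ltr0n.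
have s0 : 0 < Num.sqrt N.+1%:R :> R by rewrite sqrtr_gt0.
rewrite -(@ltr_pXn2r _ 2) ?nnegrE ?invr_ge0 ?ltW ?(ltW s0) ?(ltW e0) // exprVn sqr_sqrtr ?ler0n //.
apply: le_lt_trans hN; rewrite ler_peMl ?invr_ge0 ?ler0n // ler1n //.
Qed.

(* The averages [N^(-1/2) \sum_n Lam^n (t true ^+ N * t false * y)] almost
   intertwine, by telescoping. *)
Lemma absorbing_isometries (t : bool -> A) m (r : 'I_m -> bool -> A) (e : R) : cuntz t ->
  (forall k, cuntz (r k)) -> 0 < e -> exists s : 'I_m -> A, orthiso s /\
    forall k i, ‖[t i * s k - s k * r k i]‖ <= e.
Proof.
move=> ct cr e0; have e2 : 0 < e / 2 by lra.
have [N [N0 hN]] := sqrt_inv_small e2.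
set c := (Num.sqrt N%:R)^-1 in hN; have c0 : 0 <= c by rewrite invr_ge0 sqrtr_ge0.
have cc : c * c = N%:R^-1 by rewrite /c -invfM sqrtrM_id ?ler0n.
pose y (k : 'I_m) := t true ^+ k * t false.
have oy : orthiso y by exact: cuntz_family.
exists (fun k => c%:C *: spike_sum t (r k) (y k) N); split=> [k l|k i].
  rewrite starZr scaleM spike_sumP // oy; have [<-|kl] := eqVneq k l.
    under eq_bigr do rewrite iter_Lam1 //.
    rewrite sumr_const card_ord -scaler_nat scalerA.
    have -> : (c * c)%:C * N%:R = 1 :> R[i].
      rewrite -(rmorph_nat (real_complex R)) -rcM cc mulVf //.
      by rewrite pnatr_eq0 -lt0n.
    by rewrite scale1r.
  by under eq_bigr do rewrite iter_Lam0; rewrite big1 // scaler0.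
rewrite -scalerAr -scalerAl -scalerBr spike_sum_inter // cnorm_scale //.
have iy : isometry (y k) by rewrite /isometry oy eqxx.
have n1 := cnorm_isometry (spike_norms N N ct (cr k) iy).
have n2 := cnorm_isometry (spike_norms N 0 ct (cr k) iy).
have : ‖[(iter N (Lam t (r k)) (t true ^+ N * t false * y k) - t true ^+ N * t false * y k) * r k i]‖ <= 2.
  apply: cnormM_le1r; last by rewrite cnorm_isometry //; exact: cuntz_iso.
  by apply: le_trans (cnormB _ _) _; rewrite n1; move: n2; rewrite /= => ->; lra.
by nra.
Qed.

Lemma inter_star_norm (t r : bool -> A) (x : A) (e : R) i : cuntz t -> cuntz r ->
  (forall j, ‖[t j * x - x * r j]‖ <= e) -> ‖[star (t i) * x - x * star (r i)]‖ <= 2 * e.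
Proof.
move=> ct cr h.
have -> : star (t i) * x - x * star (r i) = - (star (t i) *
   ((t true * x - x * r true) * star (r true) + (t false * x - x * r false) * star (r false))).
  have -> : (t true * x - x * r true) * star (r true) + (t false * x - x * r false) * star (r false)
    = Lam t r x - x * (r true * star (r true) + r false * star (r false)) by rewrite /Lam; ncring.
  by rewrite cr.2 mulr1 mulrBr LamMl // opprB.
rewrite cnormN; apply: cnormM_le1; first by rewrite cnorm_star cnorm_isometry //; exact: cuntz_iso.
have n j : ‖[(t j * x - x * r j) * star (r j)]‖ <= e.
  by apply: cnormM_le1r => //; rewrite cnorm_star cnorm_isometry //; exact: cuntz_iso.
by apply: le_trans (cnormD _ _) _; have := n true; have := n false; lra.
Qed.

End OrthoIsometries.

(** * Exact unitary intertwiners from absorption *)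

Section Intertwiners.
Variables (R : realType) (B : starAlgType R).
Implicit Types (r t q : bool -> B) (x y : B).

Definition inter x r t := forall i, t i * x = x * r i /\ star (t i) * x = x * star (r i).

Lemma inter_comp x y r t q : inter x r t -> inter y t q -> inter (y * x) r q.
Proof.
move=> h k i; have [h1 h2] := h i; have [k1 k2] := k i.
by split; rewrite mulrA ?k1 ?k2 -mulrA ?h1 ?h2 mulrA.
Qed.
Lemma inter_adj x r t : inter x r t -> inter (star x) t r.
Proof.
move=> h i; have [h1 h2] := h i; split.
  by rewrite -[r i]starK -starM -h2 starM starK.
by rewrite -starM -h1 starM.
Qed.
Lemma interD x y r t : inter x r t -> inter y r t -> inter (x + y) r t.
Proof.
move=> h k i; have [h1 h2] := h i; have [k1 k2] := k i.
by split; rewrite mulrDr mulrDl ?h1 ?h2 ?k1 ?k2.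
Qed.
Lemma interN x r t : inter x r t -> inter (- x) r t.
Proof. by move=> h i; have [h1 h2] := h i; split; rewrite mulrN mulNr ?h1 ?h2. Qed.
Lemma interB x y r t : inter x r t -> inter y r t -> inter (x - y) r t.
Proof. by move=> h k; apply: interD => //; exact: interN. Qed.
Lemma inter1 r : inter 1 r r.
Proof. by move=> i; rewrite !mulr1 !mul1r. Qed.

Lemma inter_cuntz x r t : cuntz r -> cuntz t -> (forall i, t i * x = x * r i) -> inter x r t.
Proof. by move=> cr ct h i; split=> //; exact: inter_star. Qed.

Section Swap.
Variables (s u T U : B).
Hypotheses (is_ : isometry s) (iu : isometry u) (uT : unitary T) (uU : unitary U).
Let p := 1 - s * star s.
Let p' := 1 - u * star u.
(** Read the hypotheses of [swap_inter] as direct sums: [r = be + r], [r ~ be + t] by [T],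
    [t = be' + t], [t ~ be' + r] by [U]. The formula is the composite
    [r ~ be + t = be + be' + t ~ be' + r ~ t]. *)
Definition swap := star U * (p' * star s + u * star T * (p + s * star u * star s)) * T.

Let ps : p * s = 0. Proof. by rewrite /p mulrBl mul1r -mulrA is_ mulr1 subrr. Qed.
Let sp : star s * p = 0. Proof. by rewrite /p mulrBr mulr1 mulrA is_ mul1r subrr. Qed.
Let p'u : p' * u = 0. Proof. by rewrite /p' mulrBl mul1r -mulrA iu mulr1 subrr. Qed.
Let up' : star u * p' = 0. Proof. by rewrite /p' mulrBr mulr1 mulrA iu mul1r subrr. Qed.
Let pp : p * p = p. Proof. by rewrite {2}/p mulrBr mulr1 mulrA ps mul0r subr0. Qed.
Let p'p' : p' * p' = p'. Proof. by rewrite {2}/p' mulrBr mulr1 mulrA p'u mul0r subr0. Qed.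
Let stp : star p = p. Proof. by rewrite /p starB star1 starM starK. Qed.
Let stp' : star p' = p'. Proof. by rewrite /p' starB star1 starM starK. Qed.

Lemma swap_unitary : unitary swap.
Proof.
have [T1 T2] := uT; have [U1 U2] := uU.
set a := p' * star s; set d := p + s * star u * star s; set b := u * star T * d.
have sd : star d = p + s * u * star s by rewrite /d starD !starM !starK stp !mulrA.
have dd : d * star d = 1.
  rewrite sd /d; transitivity (p * p + (p * s) * (u * star s) + s * star u * (star s * p)
      + s * star u * (star s * s) * (u * star s)); first by ncring.
  rewrite pp ps sp is_ mulr1 mul0r mulr0 !addr0.
  transitivity (p + s * (star u * u) * star s); first by ncring.
  by rewrite iu mulr1 subrK.
have dd' : star d * d = p + s * (u * star u) * star s.
  rewrite sd /d; transitivity (p * p + (p * s) * (star u * star s) + s * u * (star s * p)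
      + s * u * (star s * s) * (star u * star s)); first by ncring.
  by rewrite pp ps sp is_ mulr1 mul0r mulr0 !addr0; ncring.
have sa : star a = s * p' by rewrite starM starK stp'.
have sb : star b = star d * T * star u by rewrite !starM starK mulrA.
have ab : star a * b = 0.
  by rewrite sa /b; transitivity (s * (p' * u) * (star T * d)); [ncring|rewrite p'u mulr0 mul0r].
have ba : star b * a = 0 by rewrite -[star b * a]starK starM starK ab star0.
have aa : star a * a = s * p' * star s.
  by rewrite sa /a; transitivity (s * (p' * p') * star s); [ncring|rewrite p'p'].
have bb : star b * b = star d * d.
  rewrite sb /b; transitivity (star d * T * (star u * u) * (star T * d)); first by ncring.
  rewrite iu mulr1; transitivity (star d * (T * star T) * d); first by ncring.
  by rewrite T2 mulr1.
have aa' : a * star a = p'.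
  by rewrite sa /a; transitivity (p' * (star s * s) * p'); [ncring|rewrite is_ mulr1 p'p'].
have bb' : b * star b = u * star u.
  rewrite sb /b; transitivity (u * star T * (d * star d) * (T * star u)); first by ncring.
  rewrite dd mulr1; transitivity (u * (star T * T) * star u); first by ncring.
  by rewrite T1 mulr1.
have ab' : a * star b = 0.
  rewrite sb sd /a; transitivity (p' * ((star s * p) + (star s * s) * u * star s) * T * star u); first by ncring.
  by rewrite sp is_ add0r mul1r; transitivity ((p' * u) * (star s * T * star u)); [ncring|rewrite p'u mul0r].
have ba' : b * star a = 0 by rewrite -[b * star a]starK starM starK ab' star0.
have P1 : star (a + b) * (a + b) = 1.
  rewrite starD; transitivity (star a * a + star b * b + star a * b + star b * a); first by ncring.
  rewrite aa bb dd' ab ba /p' /p; ncring.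
have P2 : (a + b) * star (a + b) = 1.
  rewrite starD; transitivity (a * star a + b * star b + a * star b + b * star a); first by ncring.
  by rewrite aa' bb' ab' ba' /p'; ncring.
by apply: unitaryM => //; apply: unitaryM => //; exact: unitary_star.
Qed.

Lemma swap_inter r t (be be' : bool -> B) :
  (forall i, star s * be i = 0 /\ be i * s = 0) ->
  (forall i, star u * be' i = 0 /\ be' i * u = 0) ->
  (forall i, r i = be i + s * r i * star s) ->
  (forall i, T * r i * star T = be i + s * t i * star s) ->
  (forall i, t i = be' i + u * t i * star u) ->
  (forall i, U * t i * star U = be' i + u * r i * star u) ->
  inter swap r t.
Proof.
move=> hb hb' hr hT ht hU; have [T1 T2] := uT; have [U1 U2] := uU.
pose q i := T * r i * star T; pose q' i := U * t i * star U.
have Tq : inter T r q.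
  by move=> i; rewrite /q !starM starK -!mulrA !T1 !mulr1.
have Uq : inter U t q'.
  by move=> i; rewrite /q' !starM starK -!mulrA !U1 !mulr1.
have block (v : B) (g : bool -> B) (f f' : bool -> B) : isometry v ->
    (forall i, star v * g i = 0 /\ g i * v = 0) ->
    (forall i, f' i = g i + v * f i * star v) -> inter v f f'.
  move=> iv hg hf i; have [g1 g2] := hg i; rewrite hf starD !starM starK !mulrDl.
  rewrite g2 -!mulrA iv !mulr1 add0r; split=> //.
  by rewrite -[star (g i) * v]starK starM starK g1 star0 add0r.
have sq : inter s t q by apply: (block s be) => // i; rewrite /q hT.
have uu : inter u t t by apply: (block u be').
have uq' : inter u r q' by apply: (block u be') => // i; rewrite /q' hU.
have p'q : inter p' t q'.
  move=> i; have [g1 g2] := hb' i.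
  have e1 : q' i * p' = be' i.
    rewrite /q' hU mulrDl -[u * r i * _ * _]mulrA up' mulr0 addr0.
    by rewrite /p' mulrBr mulr1 mulrA g2 mul0r subr0.
  have e2 : p' * t i = be' i.
    rewrite ht mulrDr !mulrA p'u !mul0r addr0.
    by rewrite /p' mulrBl mul1r -mulrA g1 mulr0 subr0.
  have e3 : p' * q' i = be' i.
    rewrite /q' hU mulrDr !mulrA p'u !mul0r addr0.
    by rewrite /p' mulrBl mul1r -mulrA g1 mulr0 subr0.
  have e4 : t i * p' = be' i.
    rewrite ht mulrDl -[u * t i * _ * _]mulrA up' mulr0 addr0.
    by rewrite /p' mulrBr mulr1 mulrA g2 mul0r subr0.
  split; first by rewrite e1 e2.
  by rewrite -[p']stp' -!starM e3 e4.
rewrite /swap; apply: (inter_comp Tq); apply: (inter_comp _ (inter_adj Uq)).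
apply: interD; first exact: (inter_comp (inter_adj sq) p'q).
apply: (@inter_comp _ _ _ q); last exact: (inter_comp (inter_adj Tq) uq').
apply: interD.
  by apply: interB; [exact: inter1|exact: (inter_comp (inter_adj sq) sq)].
by apply: (inter_comp (inter_adj sq)); apply: (inter_comp (inter_adj uu) sq).
Qed.

End Swap.

Section Swindle.
Variables (s s' : B) (z z' : bool -> B).
Hypotheses (is_ : isometry s) (is' : isometry s') (cz : cuntz z) (cz' : cuntz z').

(** [s] embeds [r] in [t], say [t = r + c], and a Cuntz pair [z] commuting with [r] gives
    [r = r + r]; so [t = r + r + c = r + t], and symmetrically [r = t + r]. The two summands match
    the pieces of these decompositions crosswise. The co-isometries [V1], [V2] in [half] are the
    coordinates of one decomposition. *)
Definition swindle :=
  star (star (z' true) * star s') * (s * star (z false) * star s + (1 - s * star s))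
  + star (s' * star (z' false) * star s' + (1 - s' * star s')) * (star (z true) * star s).

Let half (v : B) (y : bool -> B) : isometry v -> cuntz y ->
  let V1 := star (y true) * star v in
  let V2 := v * star (y false) * star v + (1 - v * star v) in
  [/\ star V1 * V1 + star V2 * V2 = 1, V1 * star V1 = 1, V2 * star V2 = 1 & V1 * star V2 = 0].
Proof.
move=> iv cy V1 V2; have [oy sy] := cy.
have sV1 : star V1 = v * y true by rewrite starM !starK.
have sV2 : star V2 = v * y false * star v + (1 - v * star v).
  by rewrite starD !starM starB star1 starM !starK mulrA.
rewrite sV1 sV2 /V1 /V2; split.
- transitivity (v * y true * star (y true) * star v + v * y false * (star v * v) * star (y false) * star v
    + v * y false * (star v - (star v * v) * star v) + (v - v * (star v * v)) * star (y false) * star v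
    + (1 - v * star v - v * star v + v * (star v * v) * star v)); first by ncring.
  rewrite iv; transitivity (v * (y true * star (y true) + y false * star (y false)) * star v + 1 - v * star v); first by ncring.
  by rewrite sy; ncring.
- transitivity (star (y true) * (star v * v) * y true); first by ncring.
  by rewrite iv mulr1 oy.
- transitivity (v * star (y false) * (star v * v) * y false * star v
    + v * star (y false) * (star v - (star v * v) * star v) + (v - v * (star v * v)) * y false * star v
    + (1 - v * star v - v * star v + v * (star v * v) * star v)); first by ncring.
  rewrite iv; transitivity (v * (star (y false) * y false) * star v + 1 - v * star v); first by ncring.
  by rewrite oy; ncring.
- transitivity (star (y true) * (star v * v) * y false * star v
    + star (y true) * (star v - (star v * v) * star v)); first by ncring.
  rewrite iv; transitivity ((star (y true) * y false) * star v); first by ncring.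
  by rewrite oy mul0r.
Qed.

Lemma swindle_unitary : unitary swindle.
Proof.
have [V0 V1 V2 V12] := half is_ cz; have [W0 W1 W2 W12] := half is' cz'.
rewrite /swindle; move: V0 V1 V2 V12 W0 W1 W2 W12.
move: (star (z true) * star s) (s * star (z false) * star s + _)
  (star (z' true) * star s') (s' * star (z' false) * star s' + _)
  => v1 v2 w1 w2 V0 V1 V2 V12 W0 W1 W2 W12.
have V21 : v2 * star v1 = 0 by rewrite -[LHS]starK starM starK V12 star0.
have W21 : w2 * star w1 = 0 by rewrite -[LHS]starK starM starK W12 star0.
rewrite /unitary starD !starM !starK; split.
- transitivity (star v2 * (w1 * star w1) * v2 + star v2 * (w1 * star w2) * v1
    + star v1 * (w2 * star w1) * v2 + star v1 * (w2 * star w2) * v1); first by ncring.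
  by rewrite W1 W12 W21 W2; transitivity (star v1 * v1 + star v2 * v2); [ncring|].
- transitivity (star w1 * (v2 * star v2) * w1 + star w1 * (v2 * star v1) * w2
    + star w2 * (v1 * star v2) * w1 + star w2 * (v1 * star v1) * w2); first by ncring.
  by rewrite V1 V12 V21 V2; transitivity (star w1 * w1 + star w2 * w2); [ncring|].
Qed.

Lemma swindle_inter r t : inter s r t -> inter s' t r ->
  (forall j, inter (z j) r r) -> (forall j, inter (z' j) t t) -> inter swindle t r.
Proof.
move=> hs hs' hz hz'; have proj (x : B) f g : inter x f g -> inter (1 - x * star x) g g.
  by move=> h; apply: interB; [exact: inter1|exact: (inter_comp (inter_adj h) h)].
apply: interD.
- apply: (@inter_comp _ _ _ t).
    apply: interD; last exact: proj hs.
    by apply: (inter_comp (inter_adj hs)); apply: (inter_comp (inter_adj (hz _)) hs).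
  by apply: inter_adj; apply: (inter_comp (inter_adj hs') (inter_adj (hz' _))).
- apply: (@inter_comp _ _ _ r); first exact: (inter_comp (inter_adj hs) (inter_adj (hz _))).
  apply: inter_adj; apply: interD; last exact: proj hs'.
  by apply: (inter_comp (inter_adj hs')); apply: (inter_comp (inter_adj (hz' _)) hs').
Qed.

End Swindle.
End Intertwiners.

(** * Homotopic Cuntz pairs are unitarily equivalent modulo null sequences *)

Section Homotopy.
Variables (R : realType) (A : cstarAlgType R).

Lemma proj_norm_le1 (p : A) : star p = p -> p * p = p -> ‖[p]‖ <= 1.
Proof. by move=> sp pp; have := cnorm_sqr_sa sp; rewrite pp; have := cnorm_ge0 p; nra. Qed.

(* Conjugating by the cyclic shift of the copies of [s 1, .., s m.+1] inside
   [s 0] replaces [s 0] by [s m.+1] in one of its summands. *)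
Lemma chain_absorb (m : nat) (s : nat -> bool -> A) (d e : R) :
  (forall k, (k <= m.+1)%N -> cuntz (s k)) ->
  (forall k i, (k <= m)%N -> ‖[s k.+1 i - s k i]‖ <= d) -> 0 <= d -> 0 < e ->
  exists (w T : A) (be : bool -> A), [/\ isometry w, unitary T,
    forall i, star w * be i = 0 /\ be i * w = 0,
    forall i, ‖[s 0%N i - (be i + w * s 0%N i * star w)]‖ <= d + e
    & forall i, ‖[T * s 0%N i * star T - (be i + w * s m.+1 i * star w)]‖ <= e].
Proof.
move=> cs ds d0 e0; set M : R := m.+1%:R; have M0 : 0 < M by rewrite ltr0n.
(* [3 * M * e1 = e]: each of the [M] isometries contributes [e1] to the defect of [r i * E] and
   [2 * e1] to that of [E * r i]. *)
pose e1 := e / (3 * M); have e10 : 0 < e1 by rewrite divr_gt0 //; lra.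
have e1E : 3 * M * e1 = e by rewrite mulrC divfK //; apply/lt0r_neq0; lra.
set r := s 0%N; have cr : cuntz r by exact: cs.
pose sk (k : 'I_m.+1) := s k.+1.
have csk k : cuntz (sk k) by apply: cs; rewrite ltn_ord.
have [g [og hg]] := absorbing_isometries cr csk e10.
have [sE EE Eg] := orthiso_proj og; set E := \sum_k _ in sE EE Eg.
have gE k : star (g k) * E = star (g k) by rewrite -[in LHS]sE -starM Eg.
have F1 : (1 - E) * (1 - E) = 1 - E.
  have -> : (1 - E) * (1 - E) = 1 - E - E + E * E by ncring.
  by rewrite EE; ncring.
have Fn : ‖[1 - E]‖ <= 1 by apply: proj_norm_le1; rewrite ?starB ?star1 ?sE.
have Fg k : (1 - E) * g k = 0 by rewrite mulrBl mul1r Eg subrr.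
have gF k : star (g k) * (1 - E) = 0 by rewrite mulrBr mulr1 gE subrr.
have gn k : ‖[g k]‖ = 1 by exact: orthiso_cnorm.
have gsn k : ‖[star (g k)]‖ <= 1 by rewrite cnorm_star gn.
pose y i := \sum_k g k * sk k i * star (g k).
pose c i := (1 - E) * r i * (1 - E).
have sumM (F : 'I_m.+1 -> A) (b : R) : (forall k, ‖[F k]‖ <= b) -> ‖[\sum_k F k]‖ <= M * b.
  move=> hF; apply: le_trans (cnorm_sum _ _ _) _.
  apply: (le_trans (ler_sum _ (fun k _ => hF k))).
  by rewrite sumr_const card_ord -mulr_natl.
have hE1 i : ‖[r i * E - y i]‖ <= M * e1.
  have -> : r i * E - y i = \sum_k (r i * g k - g k * sk k i) * star (g k).
    by rewrite /E /y mulr_sumr -sumrB; apply: eq_bigr => k _; rewrite mulrBl mulrA.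
  by apply: sumM => k; apply: cnormM_le1r.
have hE2 i : ‖[E * r i - y i]‖ <= M * (2 * e1).
  have -> : E * r i - y i = \sum_k g k * (star (g k) * r i - sk k i * star (g k)).
    by rewrite /E /y mulr_suml -sumrB; apply: eq_bigr => k _; rewrite mulrBr !mulrA.
  apply: sumM => k; apply: cnormM_le1; first by rewrite gn.
  rewrite -cnorm_star starB !starM !starK; apply: inter_star_norm => //; exact: hg.
have yF i : y i * (1 - E) = 0.
  by rewrite mulr_suml big1 // => k _; rewrite -mulrA gF mulr0.
have hr i : ‖[r i - (y i + c i)]‖ <= e.
  have -> : r i - (y i + c i) = (r i * E - y i) + (E * r i - y i) * (1 - E).
    by rewrite [(E * r i - y i) * _]mulrBl yF subr0 /c; ncring.
  apply: le_trans (cnormD _ _) _.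
  have : ‖[(E * r i - y i) * (1 - E)]‖ <= M * (2 * e1) by apply: cnormM_le1r.
  by have := hE1 i; rewrite -e1E; lra.
pose T1 := \sum_k g (ordS k) * star (g k).
have T1g k : T1 * g k = g (ordS k).
  rewrite mulr_suml (bigD1 k) //= big1 => [|l lk]; last by rewrite -mulrA og (negbTE lk) mulr0.
  by rewrite addr0 -mulrA og eqxx mulr1.
have T1sg k : star T1 * g (ordS k) = g k.
  rewrite star_sum mulr_suml (bigD1 k) //= big1 => [|l lk].
    by rewrite addr0 starM starK -mulrA og eqxx mulr1.
  by rewrite starM starK -mulrA og (inj_eq (can_inj (@ordSK _))) (negbTE lk) mulr0.
have T1F : T1 * (1 - E) = 0.
  by rewrite mulr_suml big1 // => k _; rewrite -mulrA gF mulr0.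
have FT1 : (1 - E) * T1 = 0.
  by rewrite mulr_sumr big1 // => k _; rewrite mulrA Fg mul0r.
have sF : star (1 - E) = 1 - E by rewrite starB star1 sE.
have FT1s : (1 - E) * star T1 = 0 by rewrite -[LHS]starK starM starK sF T1F star0.
have T1sF : star T1 * (1 - E) = 0 by rewrite -[LHS]starK starM starK sF FT1 star0.
have TT1 : star T1 * T1 = E.
  by rewrite {2}/T1 mulr_sumr; apply: eq_bigr => k _; rewrite mulrA T1sg.
have TT2 : T1 * star T1 = E.
  rewrite {2}/T1 star_sum mulr_sumr /E [RHS](reindex_inj (can_inj (@ordSK _))) /=.
  by apply: eq_bigr => k _; rewrite starM starK mulrA T1g.
pose T := T1 + (1 - E).
have uT : unitary T.
  rewrite /unitary /T starD sF; split.
    transitivity (star T1 * T1 + star T1 * (1 - E) + (1 - E) * T1 + (1 - E) * (1 - E)); first by ncring.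
    by rewrite TT1 T1sF FT1 F1; ncring.
  transitivity (T1 * star T1 + T1 * (1 - E) + (1 - E) * star T1 + (1 - E) * (1 - E)); first by ncring.
  by rewrite TT2 T1F FT1s F1; ncring.
have Tg k : T * g k = g (ordS k) by rewrite mulrDl T1g Fg addr0.
have TF : T * (1 - E) = 1 - E by rewrite mulrDl T1F F1 add0r.
pose be i := \sum_(k | k != ord0) g k * s k i * star (g k) + c i.
have split0 (x : nat -> bool -> A) i :
    (forall k : 'I_m.+1, k != ord0 -> x k i = s k i) ->
    \sum_k g k * x k i * star (g k) + c i = be i + g ord0 * x 0%N i * star (g ord0).
  move=> h; rewrite (bigD1 ord0) //=.
  have -> : \sum_(k | k != ord0) g k * x k i * star (g k) = \sum_(k | k != ord0) g k * s k i * star (g k).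
    by apply: eq_bigr => k /h ->.
  by rewrite /be; ncring.
have TyT i : T * (y i + c i) * star T = be i + g ord0 * s m.+1 i * star (g ord0).
  have -> : T * (y i + c i) * star T = T * y i * star T + T * c i * star T by ncring.
  have -> : T * c i * star T = c i.
    rewrite /c; transitivity ((T * (1 - E)) * r i * star (T * star (1 - E))).
      by rewrite [star (T * _)]starM starK; ncring.
    by rewrite sF TF sF.
  have -> : T * y i * star T = \sum_k g (ordS k) * sk k i * star (g (ordS k)).
    rewrite /y mulr_sumr mulr_suml; apply: eq_bigr => k _.
    by rewrite -Tg starM !mulrA.
  rewrite (reindex_inj (can_inj (@ord_predK m.+1))) /=.
  (* Before the cyclic shift the slot [k] holds [s k.+1]; afterwards the slot [k > 0] holds [s k]
     and the slot 0 holds the end point [s m.+1]. *)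
  pose x (k : nat) := if k is 0 then s m.+1 else s k.
  have <- := @split0 x i; last by case=> -[].
  congr (_ + _); apply: eq_bigr => k _; rewrite ord_predK; congr (_ * _ * _).
  rewrite /sk /x /=; case: k => -[|k] km /=; [by rewrite modn_small|].
  by rewrite modnDr modn_small // ltnW.
exists (g ord0), T, be; split=> //.
- move=> i; split.
    rewrite /be mulrDr mulr_sumr big1 => [|k k0].
      by rewrite add0r /c !mulrA gF !mul0r.
    by rewrite !mulrA og eq_sym (negbTE k0) !mul0r.
  rewrite /be mulrDl mulr_suml big1 => [|k k0].
    rewrite add0r /c; transitivity ((1 - E) * r i * ((1 - E) * g ord0)); [by ncring|by rewrite Fg mulr0].
  by rewrite -!mulrA og (negbTE k0) !mulr0.
- move=> i; have <- := split0 (fun k => s k) i (fun _ _ => erefl).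
  apply: le_trans (cnorm_tri (y i + c i) _ _) _; rewrite addrC; apply: lerD => //.
  have -> : y i + c i - (\sum_(k < m.+1) g k * s k i * star (g k) + c i)
    = \sum_k g k * (s k.+1 i - s k i) * star (g k).
    rewrite opprD addrACA subrr addr0 /y -sumrB; apply: eq_bigr => k _.
    by rewrite mulrBr mulrBl.
  by apply: orthiso_sum_norm => // k; apply: ds; rewrite -ltnS ltn_ord.
- move=> i; rewrite -TyT.
  have -> : T * s 0%N i * star T - T * (y i + c i) * star T = T * (r i - (y i + c i)) * star T by rewrite /r; ncring.
  by rewrite cnorm_conj.
Qed.

(** A path of Cuntz pairs sampled with mesh [d]; a norm-continuous homotopy yields one for every
    [d]. *)
Definition chained (r t : bool -> A) (d : R) := exists m (s : nat -> bool -> A),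
  [/\ s 0%N = r, s m.+1 = t, forall k, (k <= m.+1)%N -> cuntz (s k)
  & forall k i, (k <= m)%N -> ‖[s k.+1 i - s k i]‖ <= d].

Lemma chained_sym r t d : chained r t d -> chained t r d.
Proof.
move=> [m [s [s0 sm cs ds]]]; exists m, (fun k => s (m.+1 - k)%N); split=> //.
- by rewrite subnn.
- by move=> k km; apply: cs; exact: leq_subr.
- move=> k i km; rewrite cnormBC subSS.
  have -> : (m.+1 - k)%N = (m - k).+1 by rewrite subSn.
  by apply: ds; exact: leq_subr.
Qed.

Definition qp (r : bool -> A) : bool -> seqalg A := fun i => qk (r i).

Lemma null_inv (x : nat -> A) : (forall n, ‖[x n]‖ <= 2 / n.+1%:R) -> null x.
Proof.
move=> h e e0; have [N hN] := inv_small e0; exists N => n Nn.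
apply: le_lt_trans (h n) _; apply: le_lt_trans hN.
by rewrite ler_wpM2l // lef_pV2 ?posrE ?ltr0n // ler_nat.
Qed.

Lemma bnd_unitary (u : nat -> A) : (forall n, unitary (u n)) -> bnd u.
Proof. by move=> h; apply: bnd_iso => n; exact: unitary_iso. Qed.

Lemma qc_iso (u : nat -> A) : (forall n, isometry (u n)) -> isometry (qc u).
Proof.
move=> h; have b := bnd_iso h; rewrite /isometry -qcS // -qcM //; last exact: bndS.
by rewrite -qc1; apply: qc_ext => n; exact: h.
Qed.

Lemma qc_unitary (u : nat -> A) : (forall n, unitary (u n)) -> unitary (qc u).
Proof.
move=> h; have b := bnd_unitary h; split.
  by apply: qc_iso => n; exact: unitary_iso.
rewrite -qcS // -qcM //; last exact: bndS.
by rewrite -qc1; apply: qc_ext => n; exact: (h n).2.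
Qed.

Lemma chained_absorb r t : (forall d, 0 < d -> chained r t d) ->
  exists (w T : nat -> A) (be : bool -> seqalg A),
    [/\ forall n, isometry (w n), forall n, unitary (T n),
     forall i, star (qc w) * be i = 0 /\ be i * qc w = 0,
     forall i, qp r i = be i + qc w * qp r i * star (qc w)
     & forall i, qc T * qp r i * star (qc T) = be i + qc w * qp t i * star (qc w)].
Proof.
move=> h; have H n : exists x : A * A * (bool -> A), [/\ isometry x.1.1, unitary x.1.2,
    forall i, star x.1.1 * x.2 i = 0 /\ x.2 i * x.1.1 = 0,
    forall i, ‖[r i - (x.2 i + x.1.1 * r i * star x.1.1)]‖ <= 2 / n.+1%:R
    & forall i, ‖[x.1.2 * r i * star x.1.2 - (x.2 i + x.1.1 * t i * star x.1.1)]‖ <= 2 / n.+1%:R].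
  have n0 : 0 < n.+1%:R^-1 :> R by rewrite invr_gt0 ltr0n.
  have [m [s [s0 sm cs ds]]] := h _ n0.
  have [w [T [be []]]] := chain_absorb cs ds (ltW n0) n0; rewrite s0 sm => a b c d e.
  exists (w, T, be); split=> // i; first by apply: le_trans (d i) _; rewrite [2 / _]mulr_natl mulr2n.
  by apply: le_trans (e i) _; rewrite ler_peMl ?ler1n // ltW.
have [x hx] := choice H.
pose w n := (x n).1.1; pose T n := (x n).1.2; pose be i n := (x n).2 i.
have iw n : isometry (w n) by have [] := hx n.
have uT n : unitary (T n) by have [] := hx n.
have bw := bnd_iso iw; have bT := bnd_unitary uT.
have bww (g : A) : bnd (fun n => w n * g * star (w n)).
  by apply: bndM; [apply: bndM => //; exact: bndc|exact: bndS].
have bbe i : bnd (be i).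
  exists (2 + (‖[r i]‖ + ‖[r i]‖)) => n; have [_ _ _ h1 _] := hx n.
  have : 2 / n.+1%:R <= 2 :> R by rewrite ler_piMr // invf_le1 ?ltr0n // ler1n.
  have n3 : ‖[w n * r i * star (w n)]‖ = ‖[r i]‖ by rewrite cnorm_isoMr ?cnorm_isoMl.
  have -> : be i n = r i - w n * r i * star (w n) - (r i - (be i n + w n * r i * star (w n))) by ncring.
  have := cnormB (r i - w n * r i * star (w n)) (r i - (be i n + w n * r i * star (w n))).
  by have := cnormB (r i) (w n * r i * star (w n)); rewrite n3; move: (h1 i : ‖[r i - (be i n + w n * r i * star (w n))]‖ <= _); move: (2 / _) => q k1 k2 k3 k4; lra.
have conjE (v : nat -> A) (g : A) : bnd v ->
    qc (fun n => v n * g * star (v n)) = qc v * qk g * star (qc v).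
  by move=> bv; rewrite qcM; [rewrite qcM //; [rewrite qcS|exact: bndc]|apply: bndM => //; exact: bndc|exact: bndS].
exists w, T, (fun i => qc (be i)); split=> //.
- move=> i; rewrite -qcS // -!qcM //; last exact: bndS.
  by rewrite -qc0; split; apply: qc_ext => n; have [_ _ h1 _ _] := hx n; have [] := h1 i.
- move=> i; rewrite /qp -conjE // -qcD //.
  apply/qcP; [exact: bndc|exact: bndD|apply: null_inv => n].
  by have [_ _ _ h1 _] := hx n; exact: h1.
- move=> i; rewrite /qp -!conjE // -qcD //.
  have bTT : bnd (fun n => T n * r i * star (T n)).
    by apply: bndM; [apply: bndM => //; exact: bndc|exact: bndS].
  apply/qcP => //; [exact: bndD|apply: null_inv => n].
  by have [_ _ _ _ h1] := hx n; exact: h1.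
Qed.

Definition qunitary_equiv (r t : bool -> A) := exists u : nat -> A,
  (forall n, unitary (u n)) /\ inter (qc u) (qp r) (qp t).

(** Absorption along the path and along the reversed path supplies the four relations that
    [swap_inter] asks for. *)
Lemma chained_equiv r t : (forall d, 0 < d -> chained r t d) -> qunitary_equiv r t.
Proof.
move=> h; have [w [T [be [iw uT b1 b2 b3]]]] := chained_absorb h.
have [|w' [T' [be' [iw' uT' b1' b2' b3']]]] := @chained_absorb t r.
  by move=> d /h; exact: chained_sym.
exists (fun n => swap (w n) (w' n) (T n) (T' n)); split.
  by move=> n; exact: swap_unitary.
have bs (v : nat -> A) : (forall n, isometry (v n)) -> bnd v by exact: bnd_iso.
have bw := bs _ iw; have bw' := bs _ iw'.
have bT := bnd_unitary uT; have bT' := bnd_unitary uT'.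
have bp (v : nat -> A) : bnd v -> bnd (fun n => 1 - v n * star (v n)).
  by move=> bv; apply: bndB; [exact: bndc|apply: bndM => //; exact: bndS].
have bsv (v : nat -> A) : bnd v -> bnd (fun n => star (v n)) by exact: bndS.
have -> : qc (fun n => swap (w n) (w' n) (T n) (T' n)) = swap (qc w) (qc w') (qc T) (qc T').
  have pE (v : nat -> A) : bnd v -> qc (fun n => 1 - v n * star (v n)) = 1 - qc v * star (qc v).
    by move=> bv; rewrite qcB ?qcM ?qcS //; [exact: bsv|exact: bndc|apply: bndM => //; exact: bsv].
  rewrite /swap.
  have B1 : bnd (fun n => w n * star (w' n) * star (w n)).
    by apply: bndM; [apply: bndM => //; exact: bsv|exact: bsv].
  have B2 : bnd (fun n => (1 - w n * star (w n)) + w n * star (w' n) * star (w n)).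
    by apply: bndD => //; exact: bp.
  have B3 : bnd (fun n => w' n * star (T n)) by apply: bndM => //; exact: bsv.
  have B4 : bnd (fun n => (1 - w' n * star (w' n)) * star (w n)).
    by apply: bndM; [exact: bp|exact: bsv].
  have B5 := bndM B3 B2; have B6 := bndD B4 B5; have B7 := bndM (bsv _ bT') B6.
  rewrite (qcM B7 bT) (qcM (bsv _ bT') B6) (qcD B4 B5) (qcM B3 B2).
  rewrite (qcM (bp _ bw') (bsv _ bw)) (qcM bw' (bsv _ bT)) (qcD (bp _ bw) B1).
  rewrite (qcM (bndM bw (bsv _ bw')) (bsv _ bw)) (qcM bw (bsv _ bw')).
  by rewrite (pE _ bw) (pE _ bw') (qcS bw) (qcS bw') (qcS bT) (qcS bT').
exact: (swap_inter (qc_iso iw) (qc_iso iw') (qc_unitary uT) (qc_unitary uT') b1 b1' b2 b3 b2' b3').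
Qed.

End Homotopy.

(** * The shift is asymptotically inner, and all Cuntz pairs are equivalent *)

Section FlipUnitary.
Variables (R : realType) (B : starAlgType R).
Implicit Types r t : bool -> B.

Lemma cuntz_unitary u r : unitary u -> cuntz r -> cuntz (fun i => u * r i).
Proof.
move=> [u1 u2] [o s]; split=> [i j|].
  by rewrite starM -mulrA (mulrA (star u)) u1 mul1r o.
rewrite !starM; transitivity (u * (r true * star (r true) + r false * star (r false)) * star u).
  by ncring.
by rewrite s mulr1.
Qed.

Lemma cuntz_map (C : starAlgType R) (f : B -> C) r : uhom f -> cuntz r -> cuntz (f \o r).
Proof.
move=> [hf f1] [o s]; split=> [i j|] /=.
  by rewrite -(homS hf) -(homM hf) o; case: (i == j); rewrite ?f1 ?(hom0 hf).
by rewrite -!(homS hf) -!(homM hf) -(homD hf) s.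
Qed.

Lemma inter_map (C : starAlgType R) (f : B -> C) x r t : uhom f ->
  inter x r t -> inter (f x) (f \o r) (f \o t).
Proof.
move=> [hf f1] h i; have [h1 h2] := h i; rewrite /= -!(homS hf) -!(homM hf).
by rewrite h1 h2.
Qed.

Definition flip_u r := Lam r r (r true) * star (r true) + Lam r r (r false) * star (r false).

Lemma flip_uM r i : cuntz r -> flip_u r * r i = Lam r r (r i).
Proof.
move=> [o _]; rewrite /flip_u mulrDl -!mulrA !o.
by case: i; rewrite /= !mulr1 !mulr0 ?addr0 ?add0r.
Qed.

Lemma flip_u_star r : star (flip_u r) = flip_u r.
Proof. by rewrite /flip_u /Lam !(starD, starM, starK); ncring. Qed.

Lemma flip_u_sqr r : cuntz r -> flip_u r * flip_u r = 1.
Proof.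
move=> cr; have h i : flip_u r * flip_u r * r i = r i.
  rewrite -mulrA flip_uM // {1}/Lam.
  have -> : flip_u r * (r true * r i * star (r true) + r false * r i * star (r false))
    = (flip_u r * r true) * r i * star (r true) + (flip_u r * r false) * r i * star (r false).
    by ncring.
  by rewrite !flip_uM // !LamMr // -!mulrA -mulrDr cr.2 mulr1.
by rewrite -[LHS]mulr1 -cr.2 mulrDr !mulrA !h.
Qed.

End FlipUnitary.

Section Rotation.
Variables (R : realType) (A : cstarAlgType R).

(** For a self-adjoint unitary [U], [(1 + U) / 2] and [(1 - U) / 2] are its spectral projections;
    [z = 1] gives 1 and [z = -1] gives [U], so a path on the circle joins them by unitaries. *)
Definition rotated (U : A) (z : R[i]) : A :=
  2^-1%:C *: (1 + U) + z *: (2^-1%:C *: (1 - U)).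

Lemma rotated_unitary (U : A) z : star U = U -> U * U = 1 -> conjc z * z = 1 ->
  unitary (rotated U z).
Proof.
move=> sU UU zz; rewrite /rotated.
set p := _ *: (1 + U); set q := 2^-1%:C *: (1 - U).
have pq : p + q = 1.
  by rewrite /p /q -scalerDr -[RHS]scaler_half2 -scalerDr; congr (_ *: _); ncring.
have sp : star p = p by rewrite /p starZr starD star1 sU.
have sq : star q = q by rewrite /q starZr starB star1 sU.
have pp : p * q = 0.
  rewrite /p /q scaleM; have -> : (1 + U) * (1 - U) = 1 - U * U by ncring.
  by rewrite UU subrr scaler0.
have qp : q * p = 0 by rewrite -[LHS]starK starM sp sq pp star0.
have p2 : p * p = p by rewrite -[RHS]mulr1 -pq mulrDr pp addr0.
have q2 : q * q = q by rewrite -[RHS]mulr1 -pq mulrDr qp add0r.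
clearbody p q; rewrite /unitary starD starZ sp sq !mulrDl !mulrDr.
by rewrite -!scalerAl -!scalerAr p2 q2 pp qp !scaler0 !addr0 !add0r !scalerA zz mulrC zz scale1r.
Qed.

Lemma rotated_dist (U : A) z z' : isometry U ->
  ‖[rotated U z - rotated U z']‖ <= nc (z - z').
Proof.
move=> iU; have -> : rotated U z - rotated U z' = (z - z') *: (2^-1%:C *: (1 - U)).
  by rewrite /rotated scalerBl opprD addrACA subrr add0r.
rewrite cnormZn ler_piMr ?nc_ge0 // cnorm_half.
by have := cnormB 1 U; rewrite cnorm1 (cnorm_isometry iU); lra.
Qed.

(** The points lie on the upper half circle with real parts spaced by [q]. Their imaginary parts may
    jump by the root of [2 * q], which is why [q] is of order [d ^+ 2]. *)
Lemma unit_chain (d : R) : 0 < d -> exists m (z : nat -> R[i]),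
  [/\ z 0%N = 1, z m.+1 = -1, forall k, (k <= m.+1)%N -> conjc (z k) * z k = 1
  & forall k, (k <= m)%N -> nc (z k.+1 - z k) <= d].
Proof.
move=> d0; have d2 : 0 < d ^+ 2 / 8 by rewrite divr_gt0 // exprn_gt0.
have d4 : 0 < d / 2 by lra.
have [N hN] := inv_small d2; have [M hM] := inv_small d4.
pose m := (N + M)%N; pose q : R := 2 / m.+1%:R.
have m0 : 0 < m.+1%:R :> R by rewrite ltr0n.
have q1 : q <= d ^+ 2 / 8.
  apply: le_trans (ltW hN); rewrite /q ler_wpM2l // lef_pV2 ?posrE ?ltr0n // ler_nat.
  by rewrite ltnS leq_addr.
have q2 : q <= d / 2.
  apply: le_trans (ltW hM); rewrite /q ler_wpM2l // lef_pV2 ?posrE ?ltr0n // ler_nat.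
  by rewrite ltnS leq_addl.
have q0 : 0 < q by rewrite divr_gt0.
have qm : q * m.+1%:R = 2 by rewrite divfK // gt_eqF.
pose x (k : nat) : R := 1 - q * k%:R; pose y k : R := Num.sqrt (1 - x k ^+ 2).
have xb k : (k <= m.+1)%N -> -1 <= x k <= 1.
  move=> km; have : (k%:R : R) <= m.+1%:R by rewrite ler_nat.
  by rewrite /x; have := ler0n R k; nra.
have y0 k : 0 <= y k by rewrite sqrtr_ge0.
have y2 k : (k <= m.+1)%N -> y k ^+ 2 = 1 - x k ^+ 2.
  by move=> /xb xk; rewrite sqr_sqrtr //; nra.
exists m, (fun k => x k +i* y k); split.
- by rewrite /x /y /x mulr0 subr0 expr1n subrr sqrtr0.
- rewrite /x /y /x qm; have -> : 1 - 2 = -1 :> R by lra.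
  by rewrite sqrrN expr1n subrr sqrtr0; apply/eqP; rewrite eq_complex /= oppr0 !eqxx.
- move=> k km; apply/eqP; rewrite eq_complex /=; have := y2 k km.
  by move=> h; apply/andP; split; apply/eqP; [nra|ring].
move=> k km; apply: (le_trans (nc_le_ReIm _)) => /=.
have x1 : x k.+1 - x k = - q by rewrite /x -natr1; ring.
have b1 := xb k (leqW km); have b2 := xb k.+1 km.
have h1 := y2 k (leqW km); have h2 := y2 k.+1 km.
have dy : (y k.+1 - y k) ^+ 2 <= d ^+ 2 / 4.
  have e : `|(y k.+1 - y k) * (y k.+1 + y k)| <= 2 * q.
    have -> : (y k.+1 - y k) * (y k.+1 + y k) = q * (x k + x k.+1).
      by transitivity (y k.+1 ^+ 2 - y k ^+ 2); [ring|rewrite h1 h2 -[q]opprK -x1; ring].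
    by rewrite normrM (gtr0_norm q0) mulrC ler_wpM2r ?(ltW q0) // ler_norml; lra.
  have : (y k.+1 - y k) ^+ 2 <= `|(y k.+1 - y k) * (y k.+1 + y k)|.
    rewrite normrM -real_normK ?num_real // expr2 ler_wpM2l //.
    by rewrite [X in _ <= X]ger0_norm ?addr_ge0 // ler_norml; have := y0 k; have := y0 k.+1; lra.
  by lra.
have : `|y k.+1 - y k| <= d / 2.
  rewrite -(@ler_pXn2r _ 2) ?nnegrE ?normr_ge0 ?(ltW d4) // real_normK ?num_real //.
  by apply: le_trans dy _; rewrite le_eqVlt; apply/orP; left; apply/eqP; field.
by rewrite x1 normrN (gtr0_norm q0); lra.
Qed.

Lemma chained_shift (r : bool -> A) d : cuntz r -> 0 < d ->
  chained r (fun i => Lam r r (r i)) d.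
Proof.
move=> cr d0; have [m [z [z0 zm z1 zd]]] := unit_chain d0.
have sU := flip_u_star r; have UU := flip_u_sqr cr.
exists m, (fun k i => rotated (flip_u r) (z k) * r i); split.
- apply/funext => i; rewrite z0 /rotated scale1r -scalerDr.
  have -> : 1 + flip_u r + (1 - flip_u r) = 1 + 1 by ncring.
  by rewrite scalerDr scaler_half2 mul1r.
- apply/funext => i; rewrite zm /rotated -flip_uM // scaleN1r -scalerBr.
  have -> : 1 + flip_u r - (1 - flip_u r) = flip_u r + flip_u r by ncring.
  by rewrite scalerDr scaler_half2.
- by move=> k /z1 h; apply: cuntz_unitary => //; exact: rotated_unitary.
move=> k i km; rewrite -mulrBl; apply: cnormM_le1r.
  by apply: le_trans (zd k km); apply: rotated_dist; rewrite /isometry sU.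
by rewrite cnorm_isometry //; exact: cuntz_iso.
Qed.

Lemma cuntz_Lam (r : bool -> A) : cuntz r -> cuntz (fun i => Lam r r (r i)).
Proof.
move=> cr; have -> : (fun i => Lam r r (r i)) = (fun i => flip_u r * r i).
  by apply/funext => i; rewrite flip_uM.
by apply: cuntz_unitary => //; rewrite /unitary flip_u_star flip_u_sqr.
Qed.

(* The shift [Lam r r] is asymptotically inner, and [r j] intertwines [r] with its shift. *)
Lemma commuting_cuntz (r : bool -> A) : cuntz r -> exists z : nat -> bool -> A,
  (forall n, cuntz (z n)) /\ forall j, inter (qc (fun n => z n j)) (qp r) (qp r).
Proof.
move=> cr; have [u [uu hu]] := chained_equiv (fun d => @chained_shift r d cr).
exists (fun n i => star (u n) * r i); split=> [n|j].
  by apply: cuntz_unitary => //; exact: unitary_star.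
have bu := bnd_unitary uu.
rewrite qcM ?qcS //; [|exact: bndS|exact: bndc].
apply: (@inter_comp _ _ _ _ _ (qp (fun i => Lam r r (r i)))); last exact: inter_adj.
apply: (inter_map (qk_uhom A)); apply: inter_cuntz => // [|i]; first exact: cuntz_Lam.
by rewrite LamMr.
Qed.

Lemma absorbing_seq (r t : bool -> A) : cuntz r -> cuntz t -> exists s : nat -> A,
  (forall n, isometry (s n)) /\ inter (qc s) (qp r) (qp t).
Proof.
move=> cr ct; have H n : exists s : A, isometry s /\ forall i, ‖[t i * s - s * r i]‖ <= 2 / n.+1%:R.
  have n0 : 0 < 2 / n.+1%:R :> R by rewrite divr_gt0 // ltr0n.
  have [s [os hs]] := @absorbing_isometries _ _ t 1 (fun=> r) _ ct (fun=> cr) n0.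
  by exists (s ord0); split=> [|i]; [rewrite /isometry os|exact: hs].
have [s hs] := choice H; have is_ n : isometry (s n) by have [] := hs n.
have bs := bnd_iso is_; exists s; split=> //.
have cq (v : bool -> A) : cuntz v -> cuntz (qp v) by move=> cv; apply: (cuntz_map (qk_uhom A)).
apply: inter_cuntz => [||i]; [exact: cq|exact: cq|].
rewrite /qp /qk -!qcM //; try exact: bndc.
apply/qcP; [apply: bndM => //; exact: bndc|apply: bndM => //; exact: bndc|].
by apply: null_inv => n; have [_] := hs n.
Qed.

Lemma qc_swindle (s s' : nat -> A) (z z' : nat -> bool -> A) :
  bnd s -> bnd s' -> (forall j, bnd (fun n => z n j)) -> (forall j, bnd (fun n => z' n j)) ->
  qc (fun n => swindle (s n) (s' n) (z n) (z' n))
  = swindle (qc s) (qc s') (fun j => qc (fun n => z n j)) (fun j => qc (fun n => z' n j)).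
Proof.
have hZ (v : nat -> A) (y : nat -> bool -> A) : bnd v -> (forall j, bnd (fun n => y n j)) ->
  [/\ bnd (fun n => star (y n true) * star (v n)),
     qc (fun n => star (y n true) * star (v n)) = star (qc (fun n => y n true)) * star (qc v),
     bnd (fun n => v n * star (y n false) * star (v n) + (1 - v n * star (v n)))
     & qc (fun n => v n * star (y n false) * star (v n) + (1 - v n * star (v n)))
       = qc v * star (qc (fun n => y n false)) * star (qc v) + (1 - qc v * star (qc v))].
  move=> bv byy; have bsv := bndS bv; have b1 := bndS (byy true); have b2 := bndS (byy false).
  have c1 := bndM bv b2; have c2 := bndM c1 bsv; have c3 := bndM bv bsv.
  have c4 := bndB (bndc 1) c3; have c5 := bndD c2 c4.
  split=> //; first exact: bndM.
    by rewrite (qcM b1 bsv) (qcS bv) (qcS (byy true)).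
  by rewrite (qcD c2 c4) (qcM c1 bsv) (qcM bv b2) (qcB (bndc 1) c3) (qcM bv bsv) (qcS bv) (qcS (byy false)).
move=> bs bs' bz bz'; have [v1 e1 v2 e2] := hZ s z bs bz; have [w1 f1 w2 f2] := hZ s' z' bs' bz'.
rewrite /swindle -e1 -e2 -f1 -f2 -(qcS w1) -(qcS w2) -(qcM (bndS w1) v2) -(qcM (bndS w2) v1).
by rewrite -(qcD (bndM (bndS w1) v2) (bndM (bndS w2) v1)).
Qed.

(** Isometries [s n], [s' n] and pairs [z n], [z' n] are exact in every coordinate; only the
    intertwining relations are asymptotic. So [W n] is a genuine unitary for each [n], and a far
    coordinate does what is required. *)
Theorem cuntz_pairs_equiv (r t : bool -> A) (e : R) : cuntz r -> cuntz t -> 0 < e ->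
  exists u, unitary u /\ forall i, ‖[u * r i * star u - t i]‖ <= e.
Proof.
move=> cr ct e0.
have [s [is_ hs]] := absorbing_seq cr ct; have [s' [is' hs']] := absorbing_seq ct cr.
have [z [cz hz]] := commuting_cuntz cr; have [z' [cz' hz']] := commuting_cuntz ct.
pose W n := swindle (s n) (s' n) (z n) (z' n).
have uW n : unitary (W n) by exact: swindle_unitary.
have bz (y : nat -> bool -> A) j : (forall n, cuntz (y n)) -> bnd (fun n => y n j).
  by move=> cy; apply: bnd_iso => n; exact: cuntz_iso.
have bW := bnd_unitary uW.
have h : inter (qc W) (qp t) (qp r).
  rewrite /W (qc_swindle (bnd_iso is_) (bnd_iso is') (fun j => bz _ j cz) (fun j => bz _ j cz')).
  exact: swindle_inter.
have H i : exists N, forall n, (N <= n)%N -> ‖[r i * W n - W n * t i]‖ < e.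
  have [h1 _] := h i; move: h1; rewrite /qp /qk -!qcM //; try exact: bndc.
  by move=> /qcP h1; apply: h1 => //; apply: bndM => //; exact: bndc.
have [N hN] := H true; have [M hM] := H false.
exists (star (W (N + M)%N)); split; first exact: unitary_star.
move=> i; have k : ‖[r i * W (N + M)%N - W (N + M)%N * t i]‖ <= e.
  by case: i; apply/ltW; [apply: hN; exact: leq_addr|apply: hM; exact: leq_addl].
set V := W _ in k *; have uV : unitary V by exact: uW.
rewrite starK; have -> : star V * r i * V - t i = star V * (r i * V - V * t i).
  by rewrite mulrBr !mulrA uV.1 mul1r.
by rewrite cnorm_isoMl //; apply: unitary_iso; exact: unitary_star.
Qed.

End Rotation.

(** * The norm of O2 *)

Section ScalarMatrices.
Variable R : realType.

(** A constant factor disappears on taking roots of order [2 ^ n]. *)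
Lemma pow2_le (a b C : R) : 0 <= a -> 0 <= b -> (forall n, a ^+ (2 ^ n) <= C * b ^+ (2 ^ n)) -> a <= b.
Proof.
move=> a0 b0 h; rewrite leNgt; apply/negP => ba; have a1 : 0 < a by exact: le_lt_trans ba.
have C0 : 0 < `|C| + 1 by have := normr_ge0 C; lra.
have q : 0 <= b / a < 1 by rewrite divr_ge0 //= ltr_pdivrMr // mul1r.
have [N hN] := expr_small q (divr_gt0 (ltr01 : 0 < 1 :> R) C0).
have [q0 q1] := andP q.
have : (b / a) ^+ (2 ^ N) < 1 / (`|C| + 1).
  apply: le_lt_trans hN; apply: ler_wiXn2l => //; first exact: ltW.
  by apply: ltnW; exact: ltn_expl.
rewrite expr_div_n ltr_pdivrMr ?exprn_gt0 // mulrAC ltr_pdivlMr // mul1r.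
have := h N; have : 0 <= b ^+ (2 ^ N) by rewrite exprn_ge0.
by have := ler_norm C; nra.
Qed.

(** The operator with matrix [m] from the space spanned by the isometries [h] to the one spanned by
    [f]. *)
Definition rmx (I J : finType) (A : starAlgType R) (f : I -> A) (h : J -> A) (m : I -> J -> R[i]) :=
  \sum_i \sum_j m i j *: (f i * star (h j)).

Lemma rmxM (I J K : finType) (A : cstarAlgType R) (f : I -> A) (h : J -> A) (g : K -> A) m m' :
  orthiso h -> rmx f h m * rmx h g m' = rmx f g (fun i k => \sum_j m i j * m' j k).
Proof.
move=> oh; rewrite /rmx mulr_suml; apply: eq_bigr => i _.
rewrite mulr_suml; under [RHS]eq_bigr do rewrite scaler_suml.
rewrite [RHS]exchange_big /=; apply: eq_bigr => j _.
rewrite mulr_sumr (bigD1 j) //= [X in _ + X]big1 ?addr0 => [|l lj].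
  rewrite mulr_sumr; apply: eq_bigr => k _.
  by rewrite -scalerAl -scalerAr scalerA -mulrA (mulrA (star (h j))) oh eqxx mul1r.
rewrite mulr_sumr big1 // => k _.
by rewrite -scalerAl -scalerAr -mulrA (mulrA (star (h j))) oh eq_sym (negbTE lj) mul0r mulr0 !scaler0.
Qed.

Lemma rmxS (I J : finType) (A : starAlgType R) (f : I -> A) (h : J -> A) m :
  star (rmx f h m) = rmx h f (fun j i => conjc (m i j)).
Proof.
rewrite /rmx star_sum; under eq_bigr do rewrite star_sum.
by rewrite exchange_big /=; do 2!apply: eq_bigr => ? _; rewrite starZ starM starK.
Qed.

Section Elements.
Variable (I : finType).
Implicit Types K : I -> I -> R[i].

Definition mxe (A : starAlgType R) (f : I -> A) K := rmx f f K.

Lemma mxe_coef (A : cstarAlgType R) (f : I -> A) K k l : orthiso f ->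
  star (f k) * mxe f K * f l = (K k l)%:A.
Proof.
move=> of_; rewrite /mxe /rmx mulr_sumr mulr_suml (bigD1 k) //= [X in _ + X]big1 ?addr0 => [|i ik].
  rewrite mulr_sumr mulr_suml (bigD1 l) //= [X in _ + X]big1 ?addr0 => [|i il].
    by rewrite -scalerAr -scalerAl mulrA of_ eqxx mul1r of_ eqxx.
  by rewrite -scalerAr -scalerAl mulrA of_ eqxx mul1r of_ (negbTE il) scaler0.
rewrite mulr_sumr mulr_suml big1 // => j _.
by rewrite -scalerAr -scalerAl mulrA of_ eq_sym (negbTE ik) !mul0r scaler0.
Qed.

Lemma mxe_coef_norm (A : cstarAlgType R) (f : I -> A) K k l : orthiso f ->
  nc (K k l) <= ‖[mxe f K]‖.
Proof.
move=> of_; have -> : nc (K k l) = ‖[(K k l)%:A : A]‖ by rewrite cnormZn cnorm1 mulr1.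
rewrite -(mxe_coef K k l of_); apply: cnormM_le1r; last by rewrite orthiso_cnorm.
by apply: cnormM_le1; rewrite ?cnorm_star ?orthiso_cnorm.
Qed.

(* A C*-norm is determined by its growth along powers of [star x * x], which
   for scalar matrices is governed by the entries. *)
Lemma mxe_norm_le (A B : cstarAlgType R) (f : I -> A) (g : I -> B) K :
  orthiso f -> orthiso g -> ‖[mxe f K]‖ <= ‖[mxe g K]‖.
Proof.
move=> of_ og; pose C : R := \sum_(k : I) \sum_(l : I) 1.
have bnd K' : ‖[mxe f K']‖ <= C * ‖[mxe g K']‖.
  apply: le_trans (cnorm_sum _ _ _) _; rewrite /C mulr_suml; apply: ler_sum => k _.
  apply: le_trans (cnorm_sum _ _ _) _; rewrite mulr_suml; apply: ler_sum => l _.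
  rewrite cnormZn mul1r; apply: le_trans (mxe_coef_norm K' k l og).
  rewrite ler_piMr ?nc_ge0 //; apply: cnormM_le1; rewrite ?cnorm_star ?orthiso_cnorm //.
have pw n : exists K', ‖[mxe f K]‖ ^+ (2 ^ n) = ‖[mxe f K']‖ /\
    ‖[mxe g K]‖ ^+ (2 ^ n) = ‖[mxe g K']‖.
  elim: n => [|n [K' [h1 h2]]]; first by exists K; rewrite !expr1.
  exists (fun k l => \sum_j conjc (K' j k) * K' j l).
  have e (E : cstarAlgType R) (h : I -> E) : orthiso h ->
      mxe h (fun k l => \sum_j conjc (K' j k) * K' j l) = star (mxe h K') * mxe h K'.
    by move=> oh; rewrite /mxe rmxS rmxM.
  by rewrite !e // !cstar_identity -h1 -h2 -!exprM expnSr.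
apply: (@pow2_le _ _ C); rewrite ?cnorm_ge0 // => n.
by have [K' [-> ->]] := pw n; exact: bnd.
Qed.

End Elements.
End ScalarMatrices.

(** * Words in a Cuntz pair and their scalar compressions *)

Section Words.
Variable R : realType.
Implicit Types a b c : seq bool.

Definition wd (A : starAlgType R) (r : bool -> A) a := foldr (fun i x => r i * x) 1 a.
Definition mon (A : starAlgType R) (r : bool -> A) (p : seq bool * seq bool) :=
  wd r p.1 * star (wd r p.2).

Lemma wd_cat (A : starAlgType R) (r : bool -> A) a b : wd r (a ++ b) = wd r a * wd r b.
Proof. by elim: a => /= [|i a ->]; rewrite ?mul1r ?mulrA. Qed.

Lemma wd_star_mul b c : exists (k : R[i]) p, forall (A : starAlgType R) (r : bool -> A), cuntz r ->
  star (wd r b) * wd r c = k *: mon r p.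
Proof.
elim: b c => [|i b IH] [|j c].
- by exists 1, ([::], [::]) => A r _; rewrite /mon /= !star1 scale1r.
- by exists 1, (j :: c, [::]) => A r _; rewrite /mon /= !star1 mul1r mulr1 scale1r.
- by exists 1, ([::], i :: b) => A r _; rewrite /mon /= mulr1 mul1r scale1r.
have [k [p hp]] := IH c; have [<-|ij] := eqVneq i j.
  exists k, p => A r cr; rewrite /= starM -mulrA (mulrA _ (r i)) cr.1 eqxx mul1r; exact: hp.
exists 0, ([::], [::]) => A r cr; rewrite /= starM -mulrA (mulrA _ (r j)) cr.1 (negbTE ij).
by rewrite mul0r mulr0 scale0r.
Qed.

Lemma mon_mul p q : exists (k : R[i]) s, forall (A : starAlgType R) (r : bool -> A), cuntz r ->
  mon r p * mon r q = k *: mon r s.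
Proof.
have [k [s hs]] := wd_star_mul p.2 q.1.
exists k, (p.1 ++ s.1, q.2 ++ s.2) => A r cr; rewrite /mon /= !wd_cat starM.
transitivity (wd r p.1 * (star (wd r p.2) * wd r q.1) * star (wd r q.2)); first by rewrite !mulrA.
by rewrite hs // /mon -scalerAr -scalerAl !mulrA.
Qed.

Lemma mon_star (A : starAlgType R) (r : bool -> A) p : star (mon r p) = mon r (p.2, p.1).
Proof. by rewrite /mon starM starK. Qed.

Definition spike (A : starAlgType R) (r : bool -> A) M := r true ^+ M * r false.

Lemma spike_isometry (A : starAlgType R) (r : bool -> A) M : cuntz r -> isometry (spike r M).
Proof. by move=> cr; have := spike_iso 1 1 M cr; rewrite /isometry /spike !mulr1 star1. Qed.

Lemma spike_wd a M : (size a <= M)%N -> exists b : bool, forall (A : starAlgType R) (r : bool -> A),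
  cuntz r -> star (wd r a) * spike r M = b%:R *: spike r (M - size a).
Proof.
elim: a M => [|i a IH] M aM.
  by exists true => A r _; rewrite /= star1 mul1r subn0 scale1r.
case: M aM => // M aM; have [b hb] := IH M aM.
case: i aM => aM; last first.
  exists false => A r cr; rewrite /= starM /spike exprS -!mulrA (mulrA (star (r false))).
  by rewrite cr.1 mul0r mulr0 scale0r.
exists b => A r cr; rewrite /= starM -mulrA.
have -> : star (r true) * spike r M.+1 = spike r M.
  by rewrite /spike exprS -mulrA mulrA cr.1 mul1r.
by rewrite hb // subSS.
Qed.

(** A spike at least as long as both words only shortens under letters [true] and is killed by a
    letter [false]. The compression is thus 0 or 1, the same for every Cuntz pair. *)
Lemma spike_mon p M : (size p.1 + size p.2 <= M)%N -> exists k : R[i],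
  forall (A : cstarAlgType R) (r : bool -> A), cuntz r ->
  star (spike r M) * mon r p * spike r M = k%:A.
Proof.
move=> pM; have p1 : (size p.1 <= M)%N by apply: leq_trans pM; exact: leq_addr.
have p2 : (size p.2 <= M)%N by apply: leq_trans pM; exact: leq_addl.
have [b1 h1] := spike_wd p1; have [b2 h2] := spike_wd p2.
exists (b1%:R * (b2%:R * ((M - size p.1)%N == (M - size p.2)%N)%:R)) => A r cr.
have -> : star (spike r M) * mon r p * spike r M
  = star (star (wd r p.1) * spike r M) * (star (wd r p.2) * spike r M).
  by rewrite /mon [star (star _ * _)]starM starK !mulrA.
rewrite h1 // h2 // starZ -scalerAl -scalerAr conjc_nat.
rewrite -!scalerA; congr (_ *: (_ *: _)).
set k := (M - _)%N; set l := (M - size p.2)%N.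
have := @cuntz_family _ _ r (k + l).+1 cr.
move=> /(_ (inord k) (inord l)); rewrite /spike !inordK ?ltnS ?leq_addr ?leq_addl // => ->.
rewrite -val_eqE /= !inordK ?ltnS ?leq_addr ?leq_addl //.
by case: (k == l); rewrite ?scale1r ?scale0r.
Qed.

Definition ev (A : starAlgType R) (r : bool -> A) (ps : seq (R[i] * (seq bool * seq bool))) :=
  \sum_(p <- ps) p.1 *: mon r p.2.

Lemma ev_spike a b ps : exists M0, forall M, (M0 <= M)%N -> exists k : R[i],
  forall (A : cstarAlgType R) (r : bool -> A), cuntz r ->
  star (spike r M) * (star (wd r a) * ev r ps * wd r b) * spike r M = k%:A.
Proof.
elim: ps => [|[c p] ps [M1 h1]].
  by exists 0%N => M _; exists 0 => A r _; rewrite /ev big_nil !(mulr0, mul0r) scale0r.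
have [k1 [s1 hs1]] := mon_mul ([::], a) p; have [k2 [s2 hs2]] := mon_mul s1 (b, [::]).
exists (M1 + (size s2.1 + size s2.2))%N => M MM.
have [k hk] := h1 M (leq_trans (leq_addr _ _) MM).
have [l hl] := spike_mon (leq_trans (leq_addl _ _) MM).
exists (c * (k1 * (k2 * l)) + k) => A r cr; rewrite /ev big_cons -/(ev r ps) /=.
rewrite mulrDr mulrDl mulrDr mulrDl hk // scalerDl; congr (_ + _).
have -> : star (wd r a) * (c *: mon r p) * wd r b = c *: (k1 *: (k2 *: mon r s2)).
  rewrite -hs2 // [k1 *: _]scalerAl -hs1 // /mon /= star1 mul1r mulr1.
  by rewrite -scalerAr -scalerAl.
by rewrite -!scalerAr -!scalerAl hl // !scalerA !mulrA.
Qed.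

End Words.

(** * The relations determine the norm *)

Section CuntzNorm.
Variable R : realType.

(** Averages of the shift orbit almost commute with [r]. [N] and [c] are chosen before [y], since
    [y] will be a spike whose length depends on [N]. *)
Lemma spike_central (A : cstarAlgType R) (r : bool -> A) (e : R) : cuntz r -> 0 < e ->
  exists N (c : R), forall y, isometry y -> let s := c%:C *: spike_sum r r y N in
    isometry s /\ forall i, ‖[r i * s - s * r i]‖ <= e.
Proof.
move=> cr e0; have e2 : 0 < e / 2 by lra.
have [N [N0 hN]] := sqrt_inv_small e2.
set c := (Num.sqrt N%:R)^-1 in hN; have c0 : 0 <= c by rewrite invr_ge0 sqrtr_ge0.
have cc : c * c = N%:R^-1 by rewrite /c -invfM sqrtrM_id ?ler0n.
exists N, c => y iy s; split=> [|i].
  rewrite /isometry /s starZr scaleM spike_sumP // iy.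
  under eq_bigr do rewrite iter_Lam1 //.
  rewrite sumr_const card_ord -scaler_nat scalerA.
  have -> : (c * c)%:C * N%:R = 1 :> R[i].
    rewrite -(rmorph_nat (real_complex R)) -rcM cc mulVf //.
    by rewrite pnatr_eq0 -lt0n.
  by rewrite scale1r.
rewrite /s -scalerAr -scalerAl -scalerBr spike_sum_inter // cnorm_scale //.
have n1 := cnorm_isometry (spike_norms N N cr cr iy).
have n2 := cnorm_isometry (spike_norms N 0 cr cr iy).
have : ‖[(iter N (Lam r r) (r true ^+ N * r false * y) - r true ^+ N * r false * y) * r i]‖ <= 2.
  apply: cnormM_le1r; last by rewrite cnorm_isometry //; exact: cuntz_iso.
  by apply: le_trans (cnormB _ _) _; rewrite n1; move: n2; rewrite /= => ->; lra.
by nra.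
Qed.

Lemma almost_central (A : cstarAlgType R) (r : bool -> A) ps (d : R) : cuntz r -> 0 < d ->
  exists2 e, 0 < e & forall s, isometry s -> (forall i, ‖[r i * s - s * r i]‖ <= e) ->
    ‖[ev r ps * s - s * ev r ps]‖ <= d.
Proof.
move=> cr d0; pose cen x := exists C : R, forall e s, isometry s ->
  (forall i, ‖[r i * s - s * r i]‖ <= e) -> ‖[x * s - s * x]‖ <= C * e.
have cenM x y : cen x -> cen y -> cen (x * y).
  move=> [C hC] [C' hC']; exists (‖[x]‖ * C' + C * ‖[y]‖) => e s is_ hs.
  have -> : x * y * s - s * (x * y) = x * (y * s - s * y) + (x * s - s * x) * y by ncring.
  apply: le_trans (cnormD _ _) _; rewrite [leRHS]mulrDl; apply: lerD.
    by rewrite -mulrA; apply: cnormM_le => //; exact: hC'.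
  by rewrite mulrAC; apply: cnormM_le => //; exact: hC.
have cenw a : cen (wd r a) /\ cen (star (wd r a)).
  elim: a => [|i a [h1 h2]] /=.
    by rewrite star1; split; exists 0 => e s _ _; rewrite mul1r mulr1 subrr cnorm0 mul0r.
  split; first by apply: cenM => //; exists 1 => e s _ /(_ i); rewrite mul1r.
  rewrite starM; apply: cenM => //; exists 2 => e s _ hs; exact: inter_star_norm.
have [C hC] : cen (ev r ps).
  elim: ps => [|[c p] ps [C hC]].
    by exists 0 => e s _ _; rewrite /ev big_nil mul0r mulr0 subrr cnorm0 mul0r.
  have [C' hC'] := cenM _ _ (cenw p.1).1 (cenw p.2).2.
  exists (nc c * C' + C) => e s is_ hs; rewrite /ev big_cons -/(ev r ps) /=.
  have -> : (c *: mon r p + ev r ps) * s - s * (c *: mon r p + ev r ps)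
    = c *: (mon r p * s - s * mon r p) + (ev r ps * s - s * ev r ps).
    by move: (mon r p) => m; rewrite scalerBr scalerAl scalerAr; ncring.
  apply: le_trans (cnormD _ _) _; rewrite [leRHS]mulrDl; apply: lerD; last exact: hC.
  by rewrite cnormZn -mulrA ler_wpM2l ?nc_ge0 //; exact: hC'.
have K0 : 0 < `|C| + 1 by have := normr_ge0 C; lra.
exists (d / (`|C| + 1)) => [|s is_ hs]; first exact: divr_gt0.
apply: le_trans (hC _ _ is_ hs) _; rewrite mulrC mulrAC ler_pdivrMr //.
by have := ler_norm C; nra.
Qed.

Lemma iter_Lam_wd (A : starAlgType R) (r : bool -> A) x a : cuntz r ->
  iter (size a) (Lam r r) x * wd r a = wd r a * x.
Proof.
move=> cr; elim: a => [|i a IH] /=; first by rewrite mulr1 mul1r.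
by rewrite mulrA LamMr // -!mulrA IH.
Qed.

Lemma iter_Lam_tuple (A : starAlgType R) (r : bool -> A) x n (a : n.-tuple bool) : cuntz r ->
  iter n (Lam r r) x * wd r a = wd r a * x.
Proof. by move=> cr; have := iter_Lam_wd x a cr; rewrite size_tuple. Qed.

Lemma sum_words (A : starAlgType R) (r : bool -> A) n : cuntz r ->
  \sum_(a : n.-tuple bool) wd r a * star (wd r a) = 1.
Proof.
move=> cr; elim: n => [|n IH].
  by rewrite (big_pred1 [tuple]) => [|a]; rewrite ?[a]tuple0 //= star1 mulr1.
rewrite (reindex (fun p : bool * n.-tuple bool => [tuple of p.1 :: p.2])) /=; last first.
  exists (fun a => (thead a, [tuple of behead a])) => [[i a] _|a _] /=.
    by congr (_, _); apply/val_inj.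
  by rewrite -tuple_eta.
rewrite -(pair_bigA _ (fun i (a : n.-tuple bool) => r i * wd r a * star (r i * wd r a))) /=.
have h i : \sum_(a : n.-tuple bool) r i * wd r a * star (r i * wd r a) = r i * star (r i).
  transitivity (r i * (\sum_(a : n.-tuple bool) wd r a * star (wd r a)) * star (r i)).
    by rewrite mulr_sumr mulr_suml; apply: eq_bigr => a _; rewrite starM !mulrA.
  by rewrite IH mulr1.
by rewrite big_bool /= !h cr.2.
Qed.

Lemma word_ortho (A : starAlgType R) (r : bool -> A) n (a b : n.-tuple bool) : cuntz r ->
  star (wd r a) * wd r b = (a == b)%:R.
Proof.
move=> cr; have: size (val a) = size (val b) by rewrite !size_tuple.
rewrite -val_eqE /=; elim: (val a) (val b) => [|i x IH] [|j y] //=; first by rewrite star1 mulr1.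
move=> [/IH h]; rewrite starM -mulrA (mulrA (star (r i))) cr.1.
case: eqVneq => [->|ij]; first by rewrite mul1r h eqseq_cons eqxx.
by rewrite mul0r mulr0 eqseq_cons (negbTE ij).
Qed.

(** Words of length less than [N], the basis of a truncated Fock space; [fock] realises it by words
    followed by a fixed isometry. *)
Definition block (N : nat) : finType := {n : 'I_N & n.-tuple bool}.

Definition fock (A : starAlgType R) (r : bool -> A) N (x : A) (k : block N) := wd r (tagged k) * x.

Lemma iter_spike (A : cstarAlgType R) (r : bool -> A) N (y : A) (n m : 'I_N) : cuntz r -> isometry y ->
  star (iter n (Lam r r) (spike r N * y)) * iter m (Lam r r) (spike r N * y) = (n == m)%:R.
Proof.
move=> cr iy; have key (k l : 'I_N) : (k < l)%N ->
    star (iter k (Lam r r) (spike r N * y)) * iter l (Lam r r) (spike r N * y) = 0.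
  move=> kl; rewrite -{1}(subnKC (ltnW kl)) iter_LamP // /spike spike_ortho ?iter_Lam0 //.
  by rewrite subn_gt0 kl (leq_trans (leq_subr _ _)) // ltnW // ltn_ord.
have [<-|nm] := eqVneq n m.
  have := iter_LamP r r (spike r N * y) (spike r N * y) n 0 cr; rewrite addn0 /= => ->.
  by rewrite /spike spike_iso // iy iter_Lam1.
have : nat_of_ord n != m by rewrite val_eqE.
rewrite neq_ltn => /orP[|mn]; first exact: key.
by rewrite -[LHS]starK starM starK key // star0.
Qed.

Lemma fock_ortho (A : cstarAlgType R) (r : bool -> A) N (y : A) : cuntz r -> isometry y ->
  orthiso (fock r (N := N) (spike r N * y)).
Proof.
move=> cr iy [n a] [m b]; rewrite /fock /=.
have e (k : nat) (c : k.-tuple bool) : wd r c * (spike r N * y) = iter k (Lam r r) (spike r N * y) * wd r c.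
  by rewrite iter_Lam_tuple.
rewrite !e starM -mulrA (mulrA (star (iter n _ _))) iter_spike //.
case: (eqVneq n m) b => [<-|nm] b.
  rewrite mul1r word_ortho // ; congr (_%:R); congr nat_of_bool.
  by apply/eqP/eqP => [->|/eqP]//; rewrite -tag_eqE /tag_eq /= eqxx tagged_asE => /eqP.
rewrite mul0r mulr0 -tag_eqE /tag_eq /= (negbTE nm) //.
Qed.

Lemma fock_sum (A : cstarAlgType R) (r : bool -> A) N (y : A) : cuntz r ->
  spike_sum r r y N = \sum_k fock r (N := N) (spike r N * y) k * star (wd r (tagged k)).
Proof.
move=> cr; rewrite -(sig_big_dep (fun=> true) (fun _ _ => true)
  (fun (n : 'I_N) (a : n.-tuple bool) => wd r a * (spike r N * y) * star (wd r a))) /=.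
apply: eq_bigr => n _; rewrite -[LHS]mulr1 -(sum_words n cr) mulr_sumr; apply: eq_bigr => a _.
by rewrite mulrA; congr (_ * _); exact: iter_Lam_tuple.
Qed.

(** An almost central isometry [s] in the range of the Fock projection [Q] recovers [ev r ps] from
    [star s * (Q * ev r ps * Q) * s] up to [d]. The compression [Q * ev r ps * Q] is a scalar matrix
    with entries independent of the Cuntz pair, so [mxe_norm_le] moves it to [t], where it is a
    compression of [ev t ps]. *)
Theorem cuntz_norm_le (A B : cstarAlgType R) (r : bool -> A) (t : bool -> B) ps :
  cuntz r -> cuntz t -> ‖[ev r ps]‖ <= ‖[ev t ps]‖.
Proof.
move=> cr ct; apply/ler_addgt0Pl => d d0.
have [e e0 he] := almost_central ps cr d0; have [N [c hc]] := spike_central cr e0.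
pose wl (k : block N) := tagged k ++ (nseq N true ++ [:: false]).
have wlE (E : starAlgType R) (v : bool -> E) k : wd v (wl k) = wd v (tagged k) * spike v N.
  rewrite !wd_cat /= mulr1 /spike; congr (_ * (_ * _)).
  by elim: N {c hc k wl} => //= n ->; rewrite exprS.
have H (q : block N * block N) : exists M0, forall M, (M0 <= M)%N -> exists k : R[i],
  forall (E : cstarAlgType R) (v : bool -> E), cuntz v ->
  star (spike v M) * (star (wd v (wl q.1)) * ev v ps * wd v (wl q.2)) * spike v M = k%:A.
  exact: ev_spike.
have [M0 hM0] := choice H; pose M := (\sum_q M0 q)%N.
pose P (q : block N * block N) (k : R[i]) := forall (E : cstarAlgType R) (v : bool -> E), cuntz v ->
  star (spike v M) * (star (wd v (wl q.1)) * ev v ps * wd v (wl q.2)) * spike v M = k%:A.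
have HP q : exists k, P q k by apply: hM0; rewrite /M (bigD1 q) //= leq_addr.
have [K hK] := choice HP.
pose f (E : cstarAlgType R) (v : bool -> E) := fock v (N := N) (spike v N * spike v M).
pose k2 k l := K (k, l).
have coef (E : cstarAlgType R) (v : bool -> E) k l : cuntz v ->
    star (f _ v k) * ev v ps * f _ v l = (k2 k l)%:A.
  move=> cv; by rewrite /k2 -(hK (k, l) E v cv) /f /fock /= !wlE !starM !mulrA.
have orf (E0 : cstarAlgType R) (v : bool -> E0) : cuntz v -> orthiso (f _ v).
  by move=> cv; apply: fock_ortho => //; exact: spike_isometry.
have comp (E0 : cstarAlgType R) (v : bool -> E0) : cuntz v ->
   let Q := \sum_k f _ v k * star (f _ v k) in Q * ev v ps * Q = mxe (f _ v) k2.
  move=> cv /=; rewrite mulr_suml mulr_suml; apply: eq_bigr => k _.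
  rewrite mulr_sumr; apply: eq_bigr => l _.
  have -> : f _ v k * star (f _ v k) * ev v ps * (f _ v l * star (f _ v l))
   = f _ v k * (star (f _ v k) * ev v ps * f _ v l) * star (f _ v l) by rewrite !mulrA.
  by rewrite coef // -scalerAr mulr1 -scalerAl.
have [is_ hs] := hc _ (spike_isometry M cr); set s := _ *: _ in is_ hs.
have [sQ QQ Qf] := orthiso_proj (orf _ _ cr); set Q := \sum_k _ in sQ QQ Qf.
have Qs : Q * s = s.
  rewrite /s -scalerAr fock_sum // mulr_sumr; congr (_ *: _); apply: eq_bigr => k _.
  by rewrite mulrA Qf.
have n1 : ‖[star s * ev r ps * s]‖ <= ‖[ev t ps]‖.
  have -> : star s * ev r ps * s = star s * (Q * ev r ps * Q) * s.
    by rewrite -{1 2}Qs starM sQ !mulrA.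
  apply: cnormM_le1r; last by rewrite cnorm_isometry.
  apply: cnormM_le1; first by rewrite cnorm_star cnorm_isometry.
  rewrite comp //; apply: le_trans (mxe_norm_le k2 (orf _ _ cr) (orf _ _ ct)) _.
  rewrite -comp //; have [sP PP _] := orthiso_proj (orf _ _ ct).
  have P1 := proj_norm_le1 sP PP; apply: cnormM_le1r => //; exact: cnormM_le1.
have n2 := he s is_ hs.
have -> : ev r ps = star s * ev r ps * s - star s * (ev r ps * s - s * ev r ps).
  rewrite mulrBr mulrA (mulrA (star s) s) is_ mul1r opprB addrC subrK //.
apply: le_trans (cnormB _ _) _; rewrite addrC; apply: lerD => //.
by apply: cnormM_le1 n2; rewrite cnorm_star cnorm_isometry.
Qed.

Lemma evD (A : starAlgType R) (r : bool -> A) c ps qs :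
  c *: ev r ps + ev r qs = ev r ([seq (c * p.1, p.2) | p <- ps] ++ qs).
Proof.
rewrite /ev big_cat big_map scaler_sumr /=; congr (_ + _).
by apply: eq_bigr => p _; rewrite scalerA.
Qed.

Lemma evS (A : starAlgType R) (r : bool -> A) ps :
  star (ev r ps) = ev r [seq (conjc p.1, (p.2.2, p.2.1)) | p <- ps].
Proof. by rewrite /ev star_sum big_map; apply: eq_bigr => p _; rewrite starZ mon_star. Qed.

Lemma evM ps qs : exists us, forall (A : starAlgType R) (r : bool -> A), cuntz r ->
  ev r ps * ev r qs = ev r us.
Proof.
elim: ps => [|[c p] ps [us hus]].
  by exists [::] => A r cr; rewrite /ev !big_nil mul0r.
have [vs hvs] : exists vs, forall (A : starAlgType R) (r : bool -> A), cuntz r ->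
  mon r p * ev r qs = ev r vs.
  elim: qs {us hus} => [|[d q] qs [vs hvs]].
    by exists [::] => A r cr; rewrite /ev !big_nil mulr0.
  have [k [s hs]] := mon_mul R p q; exists ((d * k, s) :: vs) => A r cr.
  by rewrite /ev !big_cons -!/(ev r _) mulrDr hvs // -scalerAr hs // scalerA.
exists ([seq (c * p.1, p.2) | p <- vs] ++ us) => A r cr.
by rewrite -evD -hvs // -hus // {1}/ev big_cons -/(ev r ps) /= mulrDl -scalerAl.
Qed.

Lemma ev_generated (A : cstarAlgType R) (r : bool -> A) : cuntz r ->
  cstar_generated_by [set r true; r false]%classic ->
  forall x (e : R), 0 < e -> exists ps, ‖[x - ev r ps]‖ < e.
Proof.
move=> cr gen x; pose S : set A := [set x | forall e : R, 0 < e -> exists ps, ‖[x - ev r ps]‖ < e]%classic.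
suff Sx : S x by exact: Sx.
rewrite (gen S) //; last first.
  move=> _ [->|->] e e0; [exists [:: (1, ([:: true], [::]))]|exists [:: (1, ([:: false], [::]))]];
  by rewrite /ev big_seq1 /mon /= star1 !mulr1 scale1r subrr cnorm0.
split.
- by move=> e e0; exists [::]; rewrite /ev big_nil subrr cnorm0.
- move=> c u v Su Sv e e0; have K : 0 < 2 * (nc c + 1) by have := nc_ge0 c; lra.
  have e2 : 0 < e / 2 by lra.
  have [ps hp] := Su _ (divr_gt0 e0 K); have [qs hq] := Sv _ e2.
  exists ([seq (c * p.1, p.2) | p <- ps] ++ qs); rewrite -evD.
  have -> : c *: u + v - (c *: ev r ps + ev r qs) = c *: (u - ev r ps) + (v - ev r qs).
    by rewrite scalerBr; ncring.
  apply: le_lt_trans (cnormD _ _) _; rewrite cnormZn.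
  have : nc c * ‖[u - ev r ps]‖ <= e / 2.
    move: hp; rewrite ltr_pdivlMr // => hp; have := nc_ge0 c.
    by have := cnorm_ge0 (u - ev r ps); nra.
  by lra.
- move=> u v Su Sv e e0.
  have K : 0 < 2 * (‖[u]‖ + 1) by have := cnorm_ge0 u; lra.
  have [qs hq] := Sv _ (divr_gt0 e0 K).
  have L : 0 < 2 * (‖[ev r qs]‖ + 1) by have := cnorm_ge0 (ev r qs); lra.
  have [ps hp] := Su _ (divr_gt0 e0 L); have [us hus] := evM ps qs.
  exists us; rewrite -hus //.
  have -> : u * v - ev r ps * ev r qs = u * (v - ev r qs) + (u - ev r ps) * ev r qs by ncring.
  apply: le_lt_trans (cnormD _ _) _.
  move: hq hp; rewrite !ltr_pdivlMr // => hq hp.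
  have := cnormM u (v - ev r qs); have := cnormM (u - ev r ps) (ev r qs).
  have := cnorm_ge0 u; have := cnorm_ge0 (v - ev r qs); have := cnorm_ge0 (u - ev r ps).
  by have := cnorm_ge0 (ev r qs); nra.
- move=> u Su e /Su[ps hp]; exists [seq (conjc p.1, (p.2.2, p.2.1)) | p <- ps].
  by rewrite -evS -starB cnorm_star.
- move=> u hu e e0; have e2 : 0 < e / 2 by lra.
  have [v Sv uv] := hu _ e2; have [ps hp] := Sv _ e2; exists ps.
  by apply: le_lt_trans (cnorm_tri v _ _) _; lra.
Qed.

Theorem cuntz_embedding (A B : cstarAlgType R) (r : bool -> A) (t : bool -> B) :
  cuntz r -> cstar_generated_by [set r true; r false]%classic -> cuntz t ->
  exists i : A -> B, [/\ uhom i, forall j, i (r j) = t j & forall x, ‖[i x]‖ = ‖[x]‖].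
Proof.
move=> cr gen ct; pose G x y := exists ps, x = ev r ps /\ y = ev t ps.
have dense := ev_generated cr gen.
have [|||||i [hi ri ni]] := @hom_extension R A B G.
- move=> c x x' y y' [ps [-> ->]] [qs [-> ->]].
  by exists ([seq (c * p.1, p.2) | p <- ps] ++ qs); rewrite !evD.
- move=> x x' y y' [ps [-> ->]] [qs [-> ->]]; have [us h] := evM ps qs.
  by exists us; rewrite -!h.
- move=> x y [ps [-> ->]]; exists [seq (conjc p.1, (p.2.2, p.2.1)) | p <- ps].
  by rewrite -!evS.
- by move=> x e /(dense x)[ps hp]; exists (ev r ps), (ev t ps); split=> //; exists ps.
- by move=> x y [ps [-> ->]]; exact: cuntz_norm_le.
have ev1 (E : cstarAlgType R) (v : bool -> E) : ev v [:: (1, ([::], [::]))] = 1.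
  by rewrite /ev big_seq1 /mon /= star1 mulr1 scale1r.
have evr (E : cstarAlgType R) (v : bool -> E) j : ev v [:: (1, ([:: j], [::]))] = v j.
  by rewrite /ev big_seq1 /mon /= star1 !mulr1 scale1r.
exists i; split.
- by split=> //; apply: ri; exists [:: (1, ([::], [::]))]; rewrite !ev1.
- by move=> j; apply: ri; exists [:: (1, ([:: j], [::]))]; rewrite !evr.
move=> x; apply/eqP; rewrite eq_le ni /=; apply/ler_addgt0Pl => e e0.
have e2 : 0 < e / 2 by lra.
have [ps hp] := dense x _ e2; have iE : i (ev r ps) = ev t ps by apply: ri; exists ps.
have h1 := cuntz_norm_le ps cr ct; have h2 := ni (ev r ps - x).
move: h2; rewrite (homB hi) iE [in leRHS]cnormBC => h2.
have := cnormB_ge x (ev r ps); have := cnormB_ge (ev t ps) (i x); lra.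
Qed.

End CuntzNorm.

(** * A Cuntz pair in D *)

Section UnitClass.
Variables (R : realType) (D : cstarAlgType R).

Lemma adjD m k (x y : 'M[D]_(m, k)) : adj (x + y) = adj x + adj y.
Proof. by apply/matrixP => i j; rewrite !mxE starD. Qed.
Lemma adjB m k (x y : 'M[D]_(m, k)) : adj (x - y) = adj x - adj y.
Proof. by apply/matrixP => i j; rewrite !mxE starB. Qed.
Lemma adj1 m : adj (1%:M : 'M[D]_m) = 1%:M.
Proof. by apply/matrixP => i j; rewrite !mxE eq_sym; case: eqP; rewrite ?star1 ?star0. Qed.

(** Vanishing in the Grothendieck group means that [1 + p] is equivalent to [p] for some projection
    [p] of size [n]. Cut the partial isometry down to [p] to get [W0] and a partial isometry on [p];
    adding [1 - p] to the latter gives [W1], and the row of the two identifies [n + 1] copies of the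
    unit with [n]. *)
Lemma K0_unit_eq0 : K0_class (unit_proj D) = 0 :> K0 D -> exists n (W0 : 'M[D]_(n, 1)) (W1 : 'M[D]_n),
  [/\ adj W0 *m W0 = 1%:M, adj W1 *m W1 = 1%:M, adj W0 *m W1 = 0
    & W0 *m adj W0 + W1 *m adj W1 = 1%:M].
Proof.
move=> /eqP/groth_piP[r /=]; rewrite !add0r addr0 -(mvn_piK r); move: (repr r) => p.
move=> h; have {h} : mvn (dsum (unit_proj D) p) p.
  by apply/mvn_piP; rewrite -mvn_add_pi.
move=> /asboolP[V]; set n := psize p => -[V1 V2].
pose P := pmx p; have PP : P *m P = P := pmx_idem p; have aP : adj P = P := pmx_adj p.
have {}V1 : adj (V : 'M[D]_(n, 1 + n)) *m (V : 'M[D]_(n, 1 + n)) = block_mx 1%:M 0 0 P := V1.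
have {}V2 : (V : 'M[D]_(n, 1 + n)) *m adj (V : 'M[D]_(n, 1 + n)) = P := V2.
move: V V1 V2 => V; rewrite -[V : 'M[D]_(n, 1 + n)]hsubmxK.
set X := lsubmx _; set Y := rsubmx _.
have adjr : adj (row_mx X Y) = col_mx (adj X) (adj Y) by rewrite /adj tr_row_mx map_col_mx.
rewrite adjr mul_col_row mul_row_col => /eq_block_mx[XX XY YX YY] S.
pose X' := P *m X; pose Y' := P *m Y *m P.
have S1 : adj X *m P *m X = 1%:M.
  by rewrite -S mulmxDr mulmxDl !mulmxA XX mul1mx XX XY !mul0mx addr0.
have S2 : adj Y *m P *m Y = P.
  by rewrite -S mulmxDr mulmxDl !mulmxA YX !mul0mx add0r YY -mulmxA YY PP.
have S3 : adj X *m P *m Y = 0.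
  by rewrite -S mulmxDr mulmxDl !mulmxA XX mul1mx XY !mul0mx addr0.
have [Q [aQ PQ QP QQ PQ1]] : exists Q : 'M[D]_n,
    [/\ adj Q = Q, P *m Q = 0, Q *m P = 0, Q *m Q = Q & P + Q = 1%:M].
  have PQ : P *m (1%:M - P) = 0 by rewrite mulmxBr mulmx1 PP subrr.
  exists (1%:M - P); split=> //; last by rewrite addrC subrK.
  - by rewrite adjB adj1 aP.
  - by rewrite mulmxBl mul1mx PP subrr.
  - by rewrite mulmxBl mul1mx PQ subr0.
exists n, X', (Y' + Q).
have aX' : adj X' = adj X *m P by rewrite adjM aP.
have aY' : adj Y' = P *m adj Y *m P by rewrite !adjM aP mulmxA.
split.
- by rewrite aX' /X' mulmxA -(mulmxA (adj X)) PP.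
- rewrite adjD aQ aY' mulmxDl !mulmxDr QQ /Y'.
  have -> : P *m adj Y *m P *m (P *m Y *m P) = P *m (adj Y *m (P *m P) *m Y) *m P by rewrite !mulmxA.
  rewrite PP S2 PP PP -[P *m adj Y *m P *m Q]mulmxA PQ mulmx0 addr0 !mulmxA QP !mul0mx add0r PQ1.
  by [].
- rewrite mulmxDr aX' /Y' -[_ *m P *m Q]mulmxA PQ mulmx0 addr0.
  by rewrite !mulmxA -(mulmxA (adj X)) PP S3 mul0mx.
- rewrite adjD aQ aY' aX' mulmxDl !mulmxDr QQ /X' /Y'.
  have S4 : X *m adj X + Y *m P *m adj Y = P.
    transitivity ((X *m adj X + Y *m adj Y) *m (X *m adj X + Y *m adj Y)); last by rewrite S.
    rewrite mulmxDl !mulmxDr !mulmxA.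
    rewrite -(mulmxA X (adj X) X) XX mulmx1 -(mulmxA X (adj X) Y) XY mulmx0 mul0mx addr0.
    by rewrite -(mulmxA Y (adj Y) X) YX mulmx0 mul0mx add0r -(mulmxA Y (adj Y) Y) YY.
  rewrite -[P *m Y *m P *m Q]mulmxA PQ mulmx0 addr0.
  rewrite !mulmxA QP !mul0mx add0r addrA -(mulmxA (P *m Y)) PP.
  have -> : P *m X *m adj X *m P + P *m Y *m P *m adj Y *m P = P *m (X *m adj X + Y *m P *m adj Y) *m P.
    by rewrite mulmxDr mulmxDl !mulmxA.
  by rewrite S4 PP PP.
Qed.

End UnitClass.

Section Columns.
Variables (R : realType) (D : cstarAlgType R) (n : nat) (W0 : 'M[D]_(n, 1)) (W1 : 'M[D]_n).
Hypotheses (W00 : adj W0 *m W0 = 1%:M) (W11 : adj W1 *m W1 = 1%:M)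
  (W01 : adj W0 *m W1 = 0).

(** [W0] is wandering for the isometry [W1], so the orbit [W1 ^ k W0] is orthonormal. *)
Lemma orthonormal_columns : exists u : nat -> 'I_n -> D,
  forall k l, \sum_i star (u k i) * u l i = (k == l)%:R.
Proof.
pose v k := iter k (mulmx W1) W0; exists (fun k i => v k i 0).
have cancel (k : nat) x : adj (v k) *m iter k (mulmx W1) x = adj W0 *m x.
  elim: k x => //= k IH x; rewrite adjM !mulmxA -(mulmxA (adj (v k)) (adj W1) W1) W11 mulmx1.
  exact: IH.
have lt k l : (k < l)%N -> adj (v k) *m v l = 0.
  move=> kl; rewrite /v -(subnKC (ltnW kl)) iterD cancel; have : (0 < l - k)%N by rewrite subn_gt0.
  by case: (l - k)%N => // m _ /=; rewrite mulmxA W01 mul0mx.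
move=> k l; transitivity ((adj (v k) *m v l) 0 0).
  by rewrite mxE; apply: eq_bigr => i _; rewrite !mxE.
case: (ltngtP k l) => [kl|lk|<-]; last by rewrite cancel W00 mxE eqxx.
- by rewrite lt // mxE.
- by rewrite -[_ *m _]adjK adjM adjK lt // adj0 mxE.
Qed.

Hypothesis WW : W0 *m adj W0 + W1 *m adj W1 = 1%:M.

(* The [W]'s identify [D^(n+1)] with [D^n], and [T] embeds [D^n] in [D]; hence
   [D^2] is identified with [D]. *)
Lemma cuntz_of_columns (T : 'I_n -> D) : (forall i j, star (T i) * T j = (i == j)%:R) ->
  exists r : bool -> D, cuntz r.
Proof.
move=> oT; pose S : 'M[D]_(1, n) := \row_i T i.
have SS : adj S *m S = 1%:M.
  by apply/matrixP => i j; rewrite !mxE big_ord_recl big_ord0 !mxE addr0 oT.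
pose a := S *m W0; pose c := S *m W1 *m adj S; pose q : 'M[D]_1 := 1%:M - S *m adj S.
have qS : q *m S = 0 by rewrite mulmxBl mul1mx -mulmxA SS mulmx1 subrr.
have aq : adj q = q by rewrite adjB adj1 adjM adjK.
have Sq : adj S *m q = 0 by rewrite -[LHS]adjK adjM adjK aq qS adj0.
have qq : q *m q = q by rewrite {2}/q mulmxBr mulmx1 mulmxA qS mul0mx subr0.
have aa : adj a *m a = 1%:M by rewrite adjM mulmxA -(mulmxA (adj W0)) SS mulmx1.
have ac : adj a *m c = 0.
  by rewrite adjM /c !mulmxA -(mulmxA (adj W0)) SS mulmx1 W01 mul0mx.
have aqq : adj a *m q = 0 by rewrite adjM -[_ *m _ *m q]mulmxA Sq mulmx0.
have adc : adj c = S *m adj W1 *m adj S by rewrite !adjM adjK mulmxA.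
have cc : adj c *m c = S *m adj S.
  rewrite adc /c; have -> : S *m adj W1 *m adj S *m (S *m W1 *m adj S)
    = S *m (adj W1 *m (adj S *m S) *m W1) *m adj S by rewrite !mulmxA.
  by rewrite SS mulmx1 W11 mulmx1.
have cq : adj c *m q = 0 by rewrite adc -[_ *m _ *m q]mulmxA Sq mulmx0.
have qc_ : q *m c = 0 by rewrite /c !mulmxA qS !mul0mx.
have ca : a *m adj a + c *m adj c = S *m adj S.
  rewrite adc /a adjM /c; have -> : S *m W1 *m adj S *m (S *m adj W1 *m adj S)
    = S *m (W1 *m (adj S *m S) *m adj W1) *m adj S by rewrite !mulmxA.
  rewrite SS mulmx1; have -> : S *m W0 *m (adj W0 *m adj S) = S *m (W0 *m adj W0) *m adj S by rewrite !mulmxA.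
  by rewrite -mulmxDl -mulmxDr WW mulmx1.
have qac : c *m q = 0 by rewrite /c -[_ *m _ *m q]mulmxA Sq mulmx0.
have E (x y : 'M[D]_1) : (adj x *m y) 0 0 = star (x 0 0) * y 0 0.
  by rewrite mxE big_ord_recl big_ord0 !mxE addr0.
have E' (x y : 'M[D]_1) : (x *m adj y) 0 0 = x 0 0 * star (y 0 0).
  by rewrite mxE big_ord_recl big_ord0 !mxE addr0.
have adcq : adj (c + q) = adj c + q by rewrite adjD aq.
have Sq1 : S *m adj S + q = 1%:M by rewrite addrC subrK.
clearbody q.
exists (fun b => if b then a 0 0 else (c + q) 0 0).
have o1 : star (a 0 0) * (c + q) 0 0 = 0.
  by rewrite -E mulmxDr ac aqq addr0 mxE.
split=> [[] []|] /=.
- by rewrite -E aa mxE eqxx.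
- exact: o1.
- by rewrite -[LHS]starK starM starK o1 star0.
- by rewrite -E adcq mulmxDl !mulmxDr cc cq qc_ qq addr0 add0r Sq1 mxE eqxx.
- have : a *m adj a + (c + q) *m adj (c + q) = 1%:M.
    rewrite adcq mulmxDl !mulmxDr qac qq -[q *m adj c]adjK [adj (q *m _)]adjM adjK aq qac adj0.
    by rewrite addr0 add0r addrA ca Sq1.
  by move=> /matrixP/(_ 0 0); rewrite [LHS]mxE [RHS]mxE eqxx !E'.
Qed.

End Columns.

Section Relations.
Variables (R : realType) (D : cstarAlgType R).

(** The first element is corrected by polar decomposition, the second is cut off from its range and
    then corrected. The bound 1/8 gives [‖[p]‖ <= 5 / 4], a cross term below 1/6, and a defect of
    the second element below 1/2. *)
Lemma orth_isometries_of_approx (Z : bool -> D) :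
  (forall i j, ‖[star (Z i) * Z j - (i == j)%:R]‖ <= 8^-1) ->
  exists s : bool -> D, forall i j, star (s i) * s j = (i == j)%:R.
Proof.
move=> h; have h2 : (8^-1 : R) <= 2^-1 by lra.
have [p [sp ip np]] := polar_isometry h2 (h true true).
set S := Z true * p in ip.
have q1 : (1 - S * star S) * (1 - S * star S) = 1 - S * star S.
  transitivity (1 - S * star S - S * star S + S * (star S * S) * star S); first by ncring.
  by rewrite ip mulr1; ncring.
pose Y := (1 - S * star S) * Z false.
have SZ : ‖[star S * Z false]‖ <= 1 / 6.
  rewrite /S starM sp -mulrA; have n1 : ‖[p]‖ <= 5 / 4.
    by have := cnormB_ge p 1; rewrite cnorm1; lra.
  have := h true false; rewrite /= subr0 => n2.
  by apply: le_trans (cnormM_le n1 n2) _; lra.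
have YY : ‖[star Y * Y - 1]‖ <= 2^-1.
  have -> : star Y * Y - 1 = (star (Z false) * Z false - 1) - star (star S * Z false) * (star S * Z false).
    rewrite /Y [star (_ * Z false)]starM starB star1 [star (S * _)]starM starK.
    transitivity (star (Z false) * ((1 - S * star S) * (1 - S * star S)) * Z false - 1); first by ncring.
    by rewrite q1 [star (star S * _)]starM starK; ncring.
  apply: le_trans (cnormB _ _) _; have := h false false; rewrite /= => n1.
  rewrite cstar_identity; have := cnorm_ge0 (star S * Z false); nra.
have [p' [sp' ip' _]] := polar_isometry (lexx _) YY.
have SY : star S * (Y * p') = 0.
  transitivity ((star S - (star S * S) * star S) * Z false * p'); first by rewrite /Y; ncring.
  by rewrite ip mul1r subrr !mul0r.
exists (fun b => if b then S else Y * p') => -[] [] //=.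
by rewrite -[LHS]starK starM starK SY star0.
Qed.

Lemma spikes_ortho (s : bool -> D) k l : (forall i j, star (s i) * s j = (i == j)%:R) ->
  star (s true ^+ k * s false) * (s true ^+ l * s false) = (k == l)%:R.
Proof.
move=> o; elim: k l => [|k IH] [|l].
- by rewrite expr0 mul1r o.
- rewrite expr0 mul1r exprS; transitivity (star (s false) * s true * (s true ^+ l * s false)).
    by rewrite !mulrA.
  by rewrite o mul0r.
- rewrite expr0 mul1r exprS !starM; transitivity (star (s false) * star (s true ^+ k) * (star (s true) * s false)).
    by rewrite !mulrA.
  by rewrite o mulr0.
rewrite eqSS -IH !exprS !starM.
transitivity (star (s false) * star (s true ^+ k) * (star (s true) * s true) * (s true ^+ l * s false)).
  by rewrite !mulrA.
by rewrite o mulr1.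
Qed.

End Relations.

(** * Orthogonal copies of a positive element, and of the unit *)

Section CuntzPairInCore.
Variables (R : realType) (D : cstarAlgType R) (al be ta : D -> D).
Hypotheses (sepD : separable D) (co : ssa_core al be ta) (nontriv : ~ star_isomorphic D R[i]^o).

Let hal := (core_al co).1.
Let hbe := (core_be co).1.
Let hta := (core_ta co).1.
Let al1 : al 1 = 1 := (core_al co).2.
Let be1 : be 1 = 1 := (core_be co).2.
Let cab := core_comm co.

Lemma pos1 : pos (1 : D). Proof. by exists 1; rewrite ?star1 ?mulr1. Qed.

(** If [al = be], then [x (x) 1 = 1 (x) x] for every [x]; slicing the first leg by a state makes [x]
    the scalar [w x], so [D] would be the complex numbers. *)
Lemma al_ne_be : exists a, star a = a /\ al a - be a <> 0.
Proof.
apply: contrapT => no; apply: nontriv.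
have sa a : star a = a -> al a = be a.
  by move=> h; apply: contrapT => k; apply: no; exists a; split=> // /eqP; rewrite subr_eq0 => /eqP.
have eqx x : al x = be x.
  have h1 : al (x + star x) = be (x + star x) by apply: sa; rewrite starD starK addrC.
  have h2 : al ('i *: (x - star x)) = be ('i *: (x - star x)).
    by apply: sa; rewrite starZ conjc_i starB starK scaleNr -scalerN opprB.
  have {}h2 : al (x - star x) = be (x - star x).
    move: h2; rewrite (homZ hal) (homZ hbe) => /(congr1 (fun y => - 'i *: y)).
    by rewrite !scalerA mulNr -expr2 sqr_i opprK !scale1r.
  have : al (x + x) = be (x + x).
    have -> : x + x = (x + star x) + (x - star x) by ncring.
    by rewrite (homD hal) (homD hbe) h1 h2.
  rewrite (homD hal) (homD hbe) => /(congr1 (fun y => 2^-1%:C *: y)).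
  by rewrite !scalerDr !scaler_half2.
have [e [w [ex _]]] := excising_exists sepD pos1 (cnorm1 D).
have sw := excising_state ex.
have sc x : x = w x *: 1.
  have z : tensor_sum al be [:: (x, 1); (1, - x)] = 0.
    by rewrite /tensor_sum big_cons big_seq1 /= al1 be1 (homN hbe) eqx mulr1 mul1r subrr.
  have bl : bilinear_map (fun u v : D => w u *: v).
    split=> [y|u] c a b /=; last by rewrite scalerDr !scalerA mulrC.
    by rewrite (st_lin sw) scalerDl scalerA.
  have := core_inj co z bl; rewrite big_cons big_seq1 /= (st_one sw) scale1r => /eqP.
  by rewrite subr_eq0 => /eqP.
have inj (c d : R[i]) : c *: (1 : D) = d *: 1 -> c = d.
  move=> /eqP; rewrite -subr_eq0 -scalerBl scaler_eq0 oner_eq0 orbF subr_eq0 => /eqP; exact.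
exists w; split; first split.
- exact: st_lin sw.
- by move=> x y; apply: inj; rewrite -sc {1}(sc x) {1}(sc y) -scalerAl -scalerAr mulr1 scalerA.
- by move=> x; rewrite (st_star sw).
exists (fun c => c *: 1) => x; first by rewrite -sc.
by rewrite (stZ sw) (st_one sw) mulr1.
Qed.

Definition orth_pair (a : D) := forall eps : R, 0 < eps -> exists y : bool -> D,
  (forall b, ‖[y b]‖ <= 1) /\ forall b c, ‖[star (y b) * y c - (b == c)%:R *: a]‖ <= eps.

(** A unitary that nearly implements the flip carries [F] to the orthogonal element [ta F], so [F]
    and [w N * F] have almost orthogonal ranges and the same square. *)
Lemma orth_pair_of_flip F : pos F -> ‖[F]‖ = 1 -> F * ta F = 0 -> orth_pair (F * F).
Proof.
move=> pF F1 FG eps e0; have [w [uw hw]] := core_aue_ta co; have sF := pos_star pF.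
have [N hN] := hw F _ e0; have {}hN := hN N (leqnn N); have [w1 w2] := uw N.
have ny : ‖[F * w N * F]‖ <= eps.
  have -> : F * w N * F = F * (w N * F * star (w N) - ta F) * w N.
    rewrite mulrBr FG subr0; transitivity (F * w N * F * (star (w N) * w N)); last by rewrite !mulrA.
    by rewrite w1 mulr1.
  apply: cnormM_le1r; last by rewrite cnorm_isometry //; exact: unitary_iso.
  by apply: cnormM_le1 (ltW hN); rewrite F1.
exists (fun b => if b then F else w N * F); split=> [[]|]; first by rewrite F1.
  by rewrite cnorm_isoMl ?F1 //; exact: unitary_iso.
move=> [] [] /=.
- by rewrite sF scale1r subrr cnorm0 ltW.
- by rewrite sF scale0r subr0 mulrA.
- by rewrite scale0r subr0 -cnorm_star !starM !starK sF mulrA.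
- have -> : star (w N * F) * (w N * F) = F * F.
    by rewrite starM sF; transitivity (F * (star (w N) * w N) * F); [rewrite !mulrA|rewrite w1 mulr1].
  by rewrite scale1r subrr cnorm0 ltW.
Qed.

(** [x = al a - be a] changes sign under the flip, which therefore exchanges its positive and
    negative parts. [F] is built from a nonzero one of them; [F * ta F = 0] because
    [z * (f * f) * (g * g)] and its negative are both positive. *)
Lemma orth_pair_exists : exists a, [/\ pos a, ‖[a]‖ = 1 & orth_pair a].
Proof.
have [a [sa x0]] := al_ne_be; set x := al a - be a in x0.
have sx : star x = x by rewrite starB -(homS hal) -(homS hbe) sa.
have tx : ta x = - x by rewrite (homB hta) (core_ta_al co) (core_ta_be co) opprB.
have [z [sz tz [f [sf cf pf f0 nf]]]] : exists z, [/\ star z = z, ta z = - z &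
    exists f, [/\ star f = f, forall y, z * y = y * z -> f * y = y * f, pos (z * (f * f)),
      z * (f * f) = 0 -> f = 0 & f <> 0]].
  have [f [sf cf pf f0 fx]] := pos_part sx.
  have sNx : star (- x) = - x by rewrite starN sx.
  have [g [sg cg pg g0 gx]] := pos_part sNx.
  have [f00|f00] := eqVneq f 0; last first.
    by exists x; split=> //; exists f; split=> //; exact/eqP.
  have [g00|g00] := eqVneq g 0; last first.
    exists (- x); split=> //; first by rewrite (homN hta) tx.
    by exists g; split=> //; exact/eqP.
  case: x0; apply: (@pos_neg0 _ _ _ 1) => //; first by rewrite -(opprK x); exact: gx.
  by rewrite scale1C; exact: fx.
pose g := ta f; have fz : f * z = z * f by exact: cf.
have gz : z * g = g * z.
  have := congr1 ta fz; rewrite !(homM hta) tz mulrN mulNr => /oppr_inj h; exact/esym.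
have fg : f * g = g * f by exact: cf.
pose F := z * (f * f); have G : ta F = - z * (g * g) by rewrite /F !(homM hta) tz.
have pG : pos (- z * (g * g)) by rewrite -G; exact: uhom_pos.
have pff : pos (f * f) by exact: pos_sqr.
have sg : star g = g by rewrite /g -(homS hta) sf.
have pgg : pos (g * g) by exact: pos_sqr.
have ffgg : f * f * (g * g) = g * g * (f * f).
  have fgg : f * (g * g) = g * g * f by rewrite (mulrA f) fg -(mulrA g f g) fg mulrA.
  by rewrite -(mulrA f f) fgg (mulrA f) fgg -(mulrA (g * g)).
have zgg : z * (g * g) = g * g * z by rewrite (mulrA z) gz -(mulrA g z g) gz mulrA.
have zff : z * (f * f) = f * f * z by rewrite (mulrA z) -fz -(mulrA f z f) -fz mulrA.
have Z0 : z * (f * f) * (g * g) = 0.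
  apply: (@pos_neg0 _ _ _ 1) => //.
    by apply: posM => //; rewrite -(mulrA z (f * f)) ffgg (mulrA z (g * g)) zgg -(mulrA (g * g)).
  rewrite scale1C; have -> : - (z * (f * f) * (g * g)) = (- z * (g * g)) * (f * f).
    by rewrite !mulNr -(mulrA z (f * f)) ffgg mulrA.
  by apply: posM => //; rewrite !mulNr mulrN -(mulrA z (g * g)) -ffgg (mulrA z (f * f)) zff -(mulrA (f * f)).
have FG : F * ta F = 0.
  rewrite G /F mulNr mulrN; have -> : z * (f * f) * (z * (g * g)) = z * (z * (f * f) * (g * g)).
    by rewrite (mulrA (z * (f * f)) z) -(mulrA z (f * f) z) -zff !mulrA.
  by rewrite Z0 mulr0 oppr0.
have F0 : F <> 0 by move=> /f0.
have nF := cnorm_gt0 F0; have ni : 0 <= ‖[F]‖^-1 by rewrite invr_ge0 ltW.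
pose F' := (‖[F]‖^-1)%:C *: F; have pF' : pos F' by exact: pos_scale.
have F'1 : ‖[F']‖ = 1 by rewrite cnorm_scale // mulVf // gt_eqF.
exists (F' * F'); split.
- by apply: pos_sqr; exact: pos_star.
- by rewrite cnorm_sqr_sa ?F'1 ?expr1n //; exact: pos_star.
apply: orth_pair_of_flip => //.
by rewrite /F' (homZ hta) -scalerAl -scalerAr FG !scaler0.
Qed.

Lemma al_be_starM a b a' b' :
  star (al a * be b) * (al a' * be b') = al (star a * a') * be (star b * b').
Proof.
rewrite starM -(homS hal) -(homS hbe) -cab.
transitivity (al (star a) * (be (star b) * al a') * be b'); first by rewrite !mulrA.
by rewrite -cab (homM hal) (homM hbe) !mulrA.
Qed.

Lemma tensor_near (p p0 q q0 : D) (e : R) : ‖[p - p0]‖ <= e -> ‖[q - q0]‖ <= e ->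
  ‖[q]‖ <= 1 -> ‖[p0]‖ <= 1 -> ‖[al p * be q - al p0 * be q0]‖ <= 2 * e.
Proof.
move=> hp hq q1 p1.
have -> : al p * be q - al p0 * be q0 = al (p - p0) * be q + al p0 * be (q - q0).
  by rewrite (homB hal) (homB hbe); ncring.
apply: le_trans (cnormD _ _) _; rewrite [2 * e]mulr_natl mulr2n; apply: lerD.
  by apply: cnormM_le1r; rewrite ?(be_norm co) ?(al_norm co).
by apply: cnormM_le1; rewrite ?(be_norm co) ?(al_norm co).
Qed.

(** The family grows by one under tensoring with a pair: [y true] is combined with all old elements,
    [y false] with the first one only. The cross norm keeps the new [a] of norm 1. *)
Lemma orth_family n : exists a, [/\ pos a, ‖[a]‖ = 1 & forall eps : R, 0 < eps -> exists x : nat -> D,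
  (forall i, (i <= n)%N -> ‖[x i]‖ <= 1) /\ forall i j, (i <= n)%N -> (j <= n)%N ->
    ‖[star (x i) * x j - (i == j)%:R *: a]‖ <= eps].
Proof.
elim: n => [|n [a [pa a1 ha]]].
  exists 1; split=> [||eps e0]; [exact: pos1|exact: cnorm1|exists (fun=> 1)]; split=> [i _|].
    by rewrite cnorm1.
  by move=> [|i] [|j] // _ _ /=; rewrite star1 mulr1 scale1r subrr cnorm0 ltW.
have [b [pb b1 hb]] := orth_pair_exists.
exists (al b * be a); split; first by apply: posM; [exact: uhom_pos|exact: uhom_pos|exact: cab].
  by rewrite (cross_norm sepD co) a1 b1 mulr1.
move=> eps e0; have e2 : 0 < eps / 2 by lra.
have [x [x1 hx]] := ha _ e2; have [y [y1 hy]] := hb _ e2.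
exists (fun i => if i is i'.+1 then al (y true) * be (x i') else al (y false) * be (x 0%N)).
pose pr i := if i is i'.+1 then (true, i') else (false, 0%N).
have prE i : (if i is i'.+1 then al (y true) * be (x i') else al (y false) * be (x 0%N))
   = al (y (pr i).1) * be (x (pr i).2) by case: i.
have prn i : (i <= n.+1)%N -> ((pr i).2 <= n)%N by case: i.
split=> [i /prn h|i j /prn hi /prn hj]; rewrite !prE.
  by apply: cnormM_le1; rewrite ?(al_norm co) ?(be_norm co) //; exact: x1.
rewrite al_be_starM.
have -> : (i == j)%:R *: (al b * be a)
   = al (((pr i).1 == (pr j).1)%:R *: b) * be (((pr i).2 == (pr j).2)%:R *: a).
  rewrite (homZ hal) (homZ hbe) -scalerAl -scalerAr scalerA; congr (_ *: _).
  by case: i hi {hj} => [|i] _; case: j => [|j] //=; rewrite ?mul1r ?mul0r ?eqSS.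
have -> : eps = 2 * (eps / 2) by field.
apply: tensor_near; [exact: hy|exact: hx| |].
  by apply: cnormM_le1; rewrite ?cnorm_star; exact: x1.
by rewrite cnormZn b1 mulr1; case: eqP; rewrite ?nc1 ?nc0.
Qed.

(* The columns [u k] spread the [n] copies of [a] over infinitely many. *)
Lemma orth_sequence n (u : nat -> 'I_n -> D) :
  (forall k l, \sum_i star (u k i) * u l i = (k == l)%:R) ->
  exists a, [/\ pos a, ‖[a]‖ = 1 & forall eps : R, 0 < eps -> exists Y : nat -> D,
    forall k l, ‖[star (Y k) * Y l - (k == l)%:R *: a]‖ <= eps].
Proof.
move=> hu; have [a [pa a1 ha]] := orth_family n.
exists (al a); split; [exact: uhom_pos|by rewrite (al_norm co)|move=> eps e0].
have u1 k i : ‖[u k i]‖ <= 1.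
  have : pos (1 - star (u k i) * u k i).
    have := hu k k; rewrite eqxx mulr1n (bigD1 i) //= => <-; rewrite addrAC subrr add0r.
    by apply: pos_sum => j _; exact: pos_starM.
  move=> h; have := @pos_ubound_norm _ _ _ 1 ler01 (pos_starM (u k i)).
  by rewrite scale1C => /(_ h); rewrite cstar_identity; have := cnorm_ge0 (u k i); nra.
have K0 : 0 < (n * n)%:R + 1 :> R by have := ler0n R (n * n); lra.
have [x [x1 hx]] := ha _ (divr_gt0 e0 K0); set d := eps / _ in hx.
exists (fun k => \sum_(i < n) al (x i) * be (u k i)) => k l.
have E : star (\sum_(i < n) al (x i) * be (u k i)) * (\sum_(i < n) al (x i) * be (u l i))
   = \sum_(i < n) \sum_(j < n) al (star (x i) * x j) * be (star (u k i) * u l j).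
  rewrite star_sum mulr_suml; apply: eq_bigr => i _; rewrite mulr_sumr.
  by apply: eq_bigr => j _; exact: al_be_starM.
have E' : (k == l)%:R *: al a = \sum_(i < n) \sum_(j < n) al ((i == j :> nat)%:R *: a) * be (star (u k i) * u l j).
  transitivity (al a * be (\sum_i star (u k i) * u l i)).
    by rewrite hu; case: (k == l); rewrite ?scale1r ?scale0r ?be1 ?mulr1 ?(hom0 hbe) ?mulr0.
  rewrite (hom_sum hbe) mulr_sumr; apply: eq_bigr => i _.
  rewrite (bigD1 i) //= eqxx scale1r big1 ?addr0 // => j ji.
  by rewrite eq_sym (negbTE ji : (val j == val i) = false) scale0r (hom0 hal) mul0r.
rewrite E E' -sumrB; apply: le_trans (cnorm_sum _ _ _) _.
have -> : eps = ((n * n)%:R + 1) * d by rewrite mulrC divfK // gt_eqF.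
apply: (@le_trans _ _ ((n * n)%:R * d)); last by rewrite ler_wpM2r ?lerDl ?divr_ge0 ?ltW.
have -> : (n * n)%:R * d = \sum_(i < n) \sum_(j < n) d.
  by rewrite mulr_natl !sumr_const !card_ord mulrnA.
apply: ler_sum => i _; rewrite -sumrB; apply: le_trans (cnorm_sum _ _ _) _; apply: ler_sum => j _.
rewrite -mulrBl -(homB hal); apply: cnormM_le1r.
  by rewrite (al_norm co); apply: hx; rewrite ltnW ?ltn_ord.
by rewrite (be_norm co); apply: cnormM_le1; rewrite ?cnorm_star.
Qed.

Section Slice.
Variables (e : nat -> D) (w : D -> R[i]).
Hypothesis ex : excising e w.

Definition slice (xs : seq (D * D)) := \sum_(p <- xs) w p.2 *: p.1.

Lemma slice_near xs (d : R) : 0 < d -> exists N, forall k, (N <= k)%N ->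
  ‖[be (e k) * tensor_sum al be xs * be (e k) - al (slice xs) * be (e k * e k)]‖ <= d.
Proof.
elim: xs d => [|[x y] xs IH] d d0.
  exists 0%N => k _; rewrite /tensor_sum /slice !big_nil (hom0 hal) mulr0 !mul0r subrr cnorm0; exact: ltW.
have d2 : 0 < d / 2 by lra.
have K0 : 0 < ‖[x]‖ + 1 by have := cnorm_ge0 x; lra.
have [N hN] := IH _ d2; have [_ _ ex3] := ex; have [M hM] := ex3 y _ (divr_gt0 d2 K0).
exists (N + M)%N => k km; have {}hN := hN k (leq_trans (leq_addr _ _) km).
have {}hM := hM k (leq_trans (leq_addl _ _) km).
rewrite /tensor_sum /slice !big_cons -/(tensor_sum al be xs) -/(slice xs) /=.
have -> : be (e k) * (al x * be y + tensor_sum al be xs) * be (e k) - al (w y *: x + slice xs) * be (e k * e k)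
  = al x * be (e k * y * e k - w y *: (e k * e k))
    + (be (e k) * tensor_sum al be xs * be (e k) - al (slice xs) * be (e k * e k)).
  rewrite (homD hal) (homZ hal) (homB hbe) (homZ hbe) !(homM hbe) mulrBr !mulrDr !mulrDl.
  have -> : be (e k) * (al x * be y) * be (e k) = al x * (be (e k) * be y * be (e k)).
    by rewrite mulrA -cab !mulrA.
  by rewrite -scalerAl -scalerAr opprD addrACA.
apply: le_trans (cnormD _ _) _; have -> : d = d / 2 + d / 2 by field.
apply: lerD => //; apply: le_trans (cnormM _ _) _; rewrite (al_norm co).
have n1 : ‖[be (e k * y * e k - w y *: (e k * e k))]‖ <= d / 2 / (‖[x]‖ + 1).
  by rewrite (be_norm co).
apply: (@le_trans _ _ ((‖[x]‖ + 1) * (d / 2 / (‖[x]‖ + 1)))); last by rewrite mulrC divfK ?gt_eqF.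
by apply: ler_pM; rewrite ?cnorm_ge0 // lerDl.
Qed.

(** Compressing by [be (e k)] replaces a tensor by [al (slice w xs) * be (e k * e k)], and the cross
    norm reads off the norm of the slice. *)
Lemma slice_norm xs : ‖[slice xs]‖ <= ‖[tensor_sum al be xs]‖.
Proof.
apply/ler_addgt0Pl => d d0; have [N hN] := slice_near xs d0; have {}hN := hN N (leqnn N).
have [pe e1 _] := ex.
have <- : ‖[al (slice xs) * be (e N * e N)]‖ = ‖[slice xs]‖.
  by rewrite (cross_norm sepD co) cnorm_sqr_sa ?e1 ?expr1n ?mulr1 //; exact: pos_star.
have n : ‖[be (e N) * tensor_sum al be xs * be (e N)]‖ <= ‖[tensor_sum al be xs]‖.
  by apply: cnormM_le1r; [apply: cnormM_le1|]; rewrite ?(be_norm co) ?e1.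
have := cnormB_ge (al (slice xs) * be (e N * e N)) (be (e N) * tensor_sum al be xs * be (e N)).
by rewrite [‖[al _ * _ - _]‖]cnormBC; lra.
Qed.

End Slice.

(* Slicing [W al(a) W^* ~ be(a)] by a state with [w a != 0]. *)
Lemma full_element a (eps : R) : pos a -> ‖[a]‖ = 1 -> 0 < eps ->
  exists L (A : nat -> D), ‖[\sum_(l < L) A l * a * star (A l) - 1]‖ <= eps.
Proof.
move=> pa a1 e0; have [e [w [ex wa]]] := excising_exists sepD pa a1.
have sw := excising_state ex; have [pe e1 _] := ex.
have e8 : 0 < eps / 8 by lra.
have [v [uv hv]] := core_aue_albe co; have [N hN] := hv a _ e8.
have {}hN := ltW (hN N (leqnn N)).
have e32 : 0 < eps / 32 by lra.
have e1m : 0 < Num.min (eps / 32) 1 by rewrite lt_min e32 ltr01.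
have [xs hxs] := core_dense co (v N) e1m; set W := tensor_sum al be xs in hxs.
have hW1 : ‖[v N - W]‖ <= eps / 32 by apply: le_trans (ltW hxs) _; rewrite ge_min lexx.
have hW2 : ‖[v N - W]‖ <= 1 by apply: le_trans (ltW hxs) _; rewrite ge_min lexx orbT.
have nv : ‖[v N]‖ = 1 by apply: cnorm_isometry; exact: unitary_iso.
have nW : ‖[W]‖ <= 2 by have := cnormB_ge W (v N); rewrite cnormBC nv; lra.
have hWW : ‖[W * al a * star W - be a]‖ <= eps / 4.
  have -> : W * al a * star W - be a = (v N * al a * star (v N) - be a)
     - ((v N - W) * (al a * star (v N)) + W * al a * star (v N - W)) by rewrite starB; ncring.
  apply: le_trans (cnormB _ _) _; have := hN => k.
  have al1' : ‖[al a]‖ <= 1 by rewrite (al_norm co) a1.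
  have k1 : ‖[(v N - W) * (al a * star (v N))]‖ <= eps / 32.
    by apply: cnormM_le1r => //; apply: cnormM_le1 => //; rewrite cnorm_star nv.
  have k2 : ‖[W * al a * star (v N - W)]‖ <= 2 * (eps / 32).
    by apply: cnormM_le; [apply: cnormM_le1r|rewrite cnorm_star].
  by have := cnormD ((v N - W) * (al a * star (v N))) (W * al a * star (v N - W)); lra.
(* An orthonormal basis for the adjoints of the second legs of [W] turns the slice of
   [W * al a * star W] into a sum of terms [A' l * a * star (A' l)] without cross terms. *)
have [m [g [_ og _ span]]] := @gram_schmidt _ _ w sw [seq star q.2 | q <- xs] 0 (fun=> 0) (fun i => False_ind _ (notF (ltn_ord i))).
have [r r0 wr] : exists2 r : R, 0 <= r & w a = r%:C.
  by case: pa => s ss ->; rewrite -{1}ss; exact: (st_pos sw).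
have r2 : 1 / 2 <= r.
  have E : r%:C - 1 = (r - 1)%:C :> R[i] by rewrite rcB.
  by move: wa; rewrite wr E nc_real ler_norml; lra.
pose A' l := \sum_(p <- xs) ip w (star p.2) (g l) *: p.1.
have near : ‖[\sum_(l < m) A' l * a * star (A' l) - r%:C *: 1]‖ <= eps / 4.
  pose ys := [seq (p.1 * a, p.2) | p <- xs]; pose zs := [seq (star p.1, star p.2) | p <- xs].
  pose us := (- 1, a) :: [seq (p.1 * q.1, p.2 * q.2) | p <- ys, q <- zs].
  have -> : \sum_(l < m) A' l * a * star (A' l) - r%:C *: 1 = slice w us.
    rewrite /slice /us big_cons /= wr scalerN addrC; congr (_ + _).
    transitivity (\sum_(p <- xs) \sum_(q <- xs) w (p.2 * star q.2) *: (p.1 * a * star q.1)); last first.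
      by rewrite big_allpairs_dep /ys /zs big_map; apply: eq_bigr => p _; rewrite big_map.
    transitivity (\sum_(l < m) \sum_(p <- xs) \sum_(q <- xs)
        (ip w (star p.2) (g l) * ip w (g l) (star q.2)) *: (p.1 * a * star q.1)).
      apply: eq_bigr => l _; rewrite /A' mulr_suml mulr_suml; apply: eq_bigr => p _.
      rewrite star_sum mulr_sumr; apply: eq_bigr => q _.
      by rewrite starZ -(ip_conj sw) -!scalerAl -scalerAr scalerA.
    rewrite exchange_big /=; apply: eq_bigr => p _; rewrite exchange_big /=.
    apply: eq_big_seq => q qx; rewrite -scaler_suml; congr (_ *: _).
    have := in_span_ip sw og (star p.2) (span (star q.2) (map_f (fun q => star q.2) qx)).
    by rewrite {1}/ip starK => ->.
  apply: le_trans (slice_norm ex us) _.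
  rewrite /us /tensor_sum big_cons -/(tensor_sum _ _ _) (tensor_sumM hal hbe cab) /=.
  have -> : tensor_sum al be ys = W * al a.
    rewrite /W /tensor_sum big_map mulr_suml; apply: eq_bigr => p _ /=.
    by rewrite (homM hal) -!mulrA cab.
  rewrite (tensor_sumS hal hbe cab) (homN hal) al1 mulN1r addrC; exact: hWW.
have r1 : 0 <= r^-1 by rewrite invr_ge0.
exists m, (fun l => (Num.sqrt r^-1)%:C *: A' l).
have -> : \sum_(l < m) (Num.sqrt r^-1)%:C *: A' l * a * star ((Num.sqrt r^-1)%:C *: A' l) - 1
   = r^-1%:C *: (\sum_(l < m) A' l * a * star (A' l) - r%:C *: 1).
  rewrite scalerBr scaleCA mulVf ?scale1C; last by apply/lt0r_neq0; lra.
  congr (_ - _); rewrite scaler_sumr; apply: eq_bigr => l _.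
  by rewrite -!scalerAl starZr -scalerAr scaleCA sqrtrM_id.
rewrite cnorm_scale //; apply: (@le_trans _ _ (2 * (eps / 4))); last by lra.
apply: ler_pM; rewrite ?cnorm_ge0 // -[2]invrK lef_pV2 ?posrE; lra.
Qed.

(** [Z b] pairs the block [b] of [L] orthogonal copies of [a] with the coefficients [A l], so
    [star (Z b) * Z c] is close to [(b == c)] times the sum of [A l * a * star (A l)], which is
    close to 1; two errors of 1/16 give the 1/8 needed. Two orthogonal isometries produce any
    number, hence an embedding of [n] copies of the unit for [cuntz_of_columns]. *)
Theorem core_cuntz_pair n (W0 : 'M[D]_(n, 1)) (W1 : 'M[D]_n) :
  adj W0 *m W0 = 1%:M -> adj W1 *m W1 = 1%:M -> adj W0 *m W1 = 0 ->
  W0 *m adj W0 + W1 *m adj W1 = 1%:M -> exists r : bool -> D, cuntz r.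
Proof.
move=> W00 W11 W01 WW.
have [u hu] := orthonormal_columns W00 W11 W01.
have [a [pa a1 ha]] := orth_sequence hu.
have e16 : (0 : R) < 16^-1 by lra.
have [L [A hA]] := full_element pa a1 e16.
pose C : R := \sum_(l < L) \sum_(l' < L) ‖[A l]‖ * ‖[star (A l')]‖.
have C0 : 0 <= C by apply: sumr_ge0 => l _; apply: sumr_ge0 => l' _; rewrite mulr_ge0 ?cnorm_ge0.
have C1 : 0 < C + 1 by lra.
have [Y hY] := ha _ (divr_gt0 e16 C1).
pose Z (b : bool) := \sum_(l < L) Y (b * L + l)%N * star (A l).
have [|s hs] := @orth_isometries_of_approx _ _ Z.
  move=> b c.
  have -> : star (Z b) * Z c - (b == c)%:R
     = \sum_(l < L) \sum_(l' < L) A l * (star (Y (b * L + l)%N) * Y (c * L + l')%N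
         - ((b * L + l)%N == (c * L + l')%N)%:R *: a) * star (A l')
       + (b == c)%:R *: (\sum_(l < L) A l * a * star (A l) - 1).
    have E (l l' : 'I_L) : ((b * L + l)%N == (c * L + l')%N) = (b == c) && (l == l').
      rewrite -val_eqE /=; have := ltn_ord l; have := ltn_ord l'.
      by case: b; case: c => /=; rewrite ?mul1n ?mul0n ?add0n ?eqn_add2l //; lia.
    rewrite scalerBr; have -> : (b == c)%:R *: 1 = (b == c)%:R :> D by rewrite scaler_nat.
    rewrite addrA; congr (_ - _); rewrite scaler_sumr -big_split /= star_sum mulr_suml.
    apply: eq_bigr => l _; rewrite /Z mulr_sumr.
    have -> : (b == c)%:R *: (A l * a * star (A l))
      = \sum_(l' < L) A l * (((b * L + l)%N == (c * L + l')%N)%:R *: a) * star (A l').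
      rewrite (bigD1 l) //= big1 => [|l' ll'].
        by rewrite addr0 E eqxx andbT -scalerAr -scalerAl.
      by rewrite E [l == _]eq_sym (negbTE ll') andbF scale0r mulr0 mul0r.
    rewrite -big_split /=; apply: eq_bigr => l' _; rewrite starM starK.
    by rewrite mulrBr mulrBl subrK !mulrA.
  apply: le_trans (cnormD _ _) _; have -> : (8^-1 : R) = 16^-1 + 16^-1 by field.
  apply: lerD; last first.
    by rewrite cnormZn; case: (b == c); rewrite /= ?nc1 ?nc0 ?mul1r ?mul0r //; lra.
  apply: (@le_trans _ _ (C * (16^-1 / (C + 1)))).
    rewrite /C mulr_suml; apply: le_trans (cnorm_sum _ _ _) _; apply: ler_sum => l _.
    rewrite mulr_suml; apply: le_trans (cnorm_sum _ _ _) _; apply: ler_sum => l' _.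
    rewrite mulrAC; apply: cnormM_le => //; apply: cnormM_le => //; exact: hY.
  by rewrite mulrA ler_pdivrMr //; nra.
apply: (cuntz_of_columns W00 W11 W01 WW (T := fun i : 'I_n => s true ^+ i * s false)) => i j.
by rewrite spikes_ortho.
Qed.

End CuntzPairInCore.

(** * Approximate homomorphisms into O2 *)

Section ProductState.
Variables (R : realType) (D : cstarAlgType R) (al be ta : D -> D).
Hypotheses (sepD : separable D) (co : ssa_core al be ta).
Variables (e : nat -> D) (w : D -> R[i]).
Hypothesis ex : excising e w.

Let hal := (core_al co).1.
Let hbe := (core_be co).1.
Let cab := core_comm co.

(** The elements [al (e k) * be (e k)] excise elementary tensors with the product value and, by the
    cross norm, have norm 1; density extends this to all of [D]. *)
Lemma product_state : exists E Om, excising E Om /\ forall a b, Om (al a * be b) = w a * w b.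
Proof.
have [pe e1 near] := ex; pose E k := al (e k) * be (e k).
have pE k : pos (E k) by apply: posM; [exact: uhom_pos|exact: uhom_pos|exact: cab].
have E1 k : ‖[E k]‖ = 1 by rewrite (cross_norm sepD co) e1 mulr1.
have elt a b (d : R) : 0 < d -> exists N, forall k, (N <= k)%N -> near_scalar (E k) (al a * be b) (w a * w b) d.
  move=> d0; pose K := ‖[b]‖ + nc (w a) + 1.
  have K0 : 0 < K by have := cnorm_ge0 b; have := nc_ge0 (w a); rewrite /K; lra.
  have [N hN] := near a _ (divr_gt0 d0 K0); have [M hM] := near b _ (divr_gt0 d0 K0).
  exists (N + M)%N => k km; have {}hN := hN k (leq_trans (leq_addr _ _) km).
  have {}hM := hM k (leq_trans (leq_addl _ _) km); move: hN hM; rewrite /near_scalar.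
  set p0 := w a *: (e k * e k); set q0 := w b *: (e k * e k); set d' := d / K => hp hq.
  have -> : E k * (al a * be b) * E k - (w a * w b) *: (E k * E k)
    = al (e k * a * e k - p0) * be (e k * b * e k) + al p0 * be (e k * b * e k - q0).
    have swap x y x' y' : al x * be y * (al x' * be y') = al (x * x') * be (y * y').
      by rewrite (homM hal) (homM hbe) -!mulrA; congr (_ * _); rewrite !mulrA cab.
    rewrite (homB hal) (homB hbe) mulrBl mulrBr addrA subrK /p0 /q0 !(homZ hal, homZ hbe).
    by rewrite -scalerAl -scalerAr scalerA /E !swap.
  apply: le_trans (cnormD _ _) _; apply: (@le_trans _ _ (d' * ‖[b]‖ + nc (w a) * d')); last first.
    have : d' * K = d by rewrite /d' divfK // gt_eqF.
    by have d'0 : 0 < d' := divr_gt0 d0 K0; rewrite /K; nra.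
  apply: lerD; apply: cnormM_le; rewrite ?(al_norm co) ?(be_norm co) //.
    by apply: cnormM_le1r; [apply: cnormM_le1|]; rewrite ?e1.
  by rewrite /p0 cnormZn (cnorm_ee pe e1) mulr1.
have exc g : excisable E g.
  apply: (excisable_lim E1) => d d0; have [xs hxs] := core_dense co g d0.
  exists (tensor_sum al be xs); last exact: ltW.
  rewrite /tensor_sum; elim: xs {hxs} => [|p xs IH].
    by rewrite big_nil => d' d'0; exists 0, 0%N => k _; rewrite /near_scalar mulr0 mul0r scale0r subrr cnorm0 ltW.
  rewrite big_cons; apply: excisableD => // d' /(elt p.1 p.2)[N hN].
  by exists (w p.1 * w p.2), N.
have [Om hOm] := excisable_excising pE E1 exc; exists E, Om; split=> // a b.
by apply: (excising_uniq hOm) => d /(elt a b).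
Qed.

(* Compressing by the almost orthonormal vectors [be (B j)] excised by the state. *)
Lemma compress_norm (I J : finType) (A : I -> D) (B : J -> D) (f : I -> D) (h : J -> D) xs :
  orthonormal w A -> orthonormal w B -> orthiso f -> orthiso h ->
  ‖[\sum_(p <- xs) \sum_i \sum_j w (star (A i) * p.2 * B j) *: (f i * p.1 * star (h j))]‖
  <= ‖[tensor_sum al be xs]‖.
Proof.
move=> oA oB of_ oh; have [pe e1 _] := ex.
(* [G] pairs the vectors [V] with the isometries [u] across the two legs. Then [star G * G] slices
   to the projection onto the ranges of [u], so [G] is almost contractive after excision, while the
   product [star (G I A f) * X * G J B h] slices to the compression. *)
pose G (K : finType) (V u : K -> D) := \sum_k al (star (u k)) * be (V k).
pose gs (K : finType) (V u : K -> D) := [seq (u k.1 * star (u k.2), star (V k.1) * V k.2) | k : K * K].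
have GE (K : finType) (V u : K -> D) : star (G K V u) * G K V u = tensor_sum al be (gs K V u).
  rewrite /G star_sum mulr_suml /tensor_sum /gs big_image /=.
  rewrite -(pair_bigA _ (fun k l => al (u k * star (u l)) * be (star (V k) * V l))) /=.
  apply: eq_bigr => k _; rewrite mulr_sumr; apply: eq_bigr => l _.
  by rewrite (al_be_starM co) starK.
have Gn (K : finType) (V u : K -> D) (d : R) : orthonormal w V -> orthiso u -> 0 < d ->
    exists N, forall k, (N <= k)%N -> ‖[G K V u * be (e k)]‖ <= 1 + d.
  move=> oV ou d0; have [N hN] := slice_near co ex (gs K V u) d0; exists N => k /hN.
  have -> : slice w (gs K V u) = \sum_k u k * star (u k).
    rewrite /slice /gs big_image /=.
    rewrite -(pair_bigA _ (fun k l => w (star (V k) * V l) *: (u k * star (u l)))) /=.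
    apply: eq_bigr => i _; rewrite (bigD1 i) //= big1 ?addr0 => [|j ji].
      by have := oV i i; rewrite /ip eqxx mulr1n => ->; rewrite scale1r.
    by have := oV i j; rewrite /ip => ->; rewrite eq_sym (negbTE ji) scale0r.
  have [sP PP _] := orthiso_proj ou; have P1 := proj_norm_le1 sP PP; move: P1.
  move: (\sum_k _) => P P1 hk.
  have sek : star (be (e k)) = be (e k) by rewrite -(homS hbe) pos_star.
  have n2 : ‖[G K V u * be (e k)]‖ ^+ 2 <= 1 + d.
    rewrite -cstar_identity starM sek.
    have -> : be (e k) * star (G K V u) * (G K V u * be (e k)) = be (e k) * tensor_sum al be (gs K V u) * be (e k).
      by rewrite -GE !mulrA.
    have n3 : ‖[al P * be (e k * e k)]‖ <= 1.
      by apply: cnormM_le1; rewrite ?(al_norm co) // (be_norm co) (cnorm_ee pe e1).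
    have := cnormB_ge (be (e k) * tensor_sum al be (gs K V u) * be (e k)) (al P * be (e k * e k)); lra.
  by have := cnorm_ge0 (G K V u * be (e k)); nra.
apply/ler_addgt0Pl => d d0; set X := tensor_sum al be xs.
pose C := 2 * ‖[X]‖ + ‖[X]‖ + 1; have X0 := cnorm_ge0 X.
have C0 : 0 < C by rewrite /C; lra.
pose d' := Num.min (d / (2 * C)) 1; have d'0 : 0 < d' by rewrite lt_min ltr01 andbT divr_gt0 //; lra.
have d'1 : d' <= 1 by rewrite ge_min lexx orbT.
have d'C : d' * C <= d / 2.
  have : d' <= d / (2 * C) by rewrite ge_min lexx.
  by rewrite ler_pdivlMr; [lra|lra].
pose ys := [seq (f q.2.1 * q.1.1 * star (h q.2.2), star (A q.2.1) * q.1.2 * B q.2.2) |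
              q <- [seq (p, k) | p <- xs, k <- enum {: I * J}]].
have ysE (T : zmodType) (F : D * D -> T) : \sum_(y <- ys) F y = \sum_(p <- xs) \sum_i \sum_j
    F (f i * p.1 * star (h j), star (A i) * p.2 * B j).
  rewrite /ys big_map big_allpairs_dep; apply: eq_bigr => p _.
  by rewrite big_enum /= -(pair_bigA _ (fun i j => F (f i * p.1 * star (h j), star (A i) * p.2 * B j))).
have <- : slice w ys = \sum_(p <- xs) \sum_i \sum_j w (star (A i) * p.2 * B j) *: (f i * p.1 * star (h j)).
  exact: ysE.
have yX : tensor_sum al be ys = star (G I A f) * X * G J B h.
  rewrite /tensor_sum ysE /X /tensor_sum [star (G I A f) * _]mulr_sumr mulr_suml; apply: eq_bigr => p _.
  rewrite /G star_sum mulr_suml mulr_suml; apply: eq_bigr => i _.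
  rewrite mulr_sumr; apply: eq_bigr => j _.
  have -> : star (al (star (f i)) * be (A i)) * (al p.1 * be p.2) = al (f i * p.1) * be (star (A i) * p.2).
    by rewrite (al_be_starM co) starK.
  rewrite (homM hal (f i * p.1)) (homM hbe (star (A i) * p.2)) -!mulrA; congr (_ * _).
  by rewrite !mulrA cab.
have [N hN] := slice_near co ex ys d'0.
have [N1 hN1] := Gn _ A f d' oA of_ d'0; have [N2 hN2] := Gn _ B h d' oB oh d'0.
pose k := (N + (N1 + N2))%N.
have {}hN := hN k (leq_addr _ _).
have {}hN1 := hN1 k (leq_trans (leq_addr _ _) (leq_addl _ _)).
have {}hN2 := hN2 k (leq_trans (leq_addl _ _) (leq_addl _ _)).
have <- : ‖[al (slice w ys) * be (e k * e k)]‖ = ‖[slice w ys]‖.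
  by rewrite (cross_norm sepD co) (cnorm_ee pe e1) mulr1.
have sek : star (be (e k)) = be (e k) by rewrite -(homS hbe) pos_star.
have n1 : ‖[be (e k) * tensor_sum al be ys * be (e k)]‖ <= (1 + d') * ‖[X]‖ * (1 + d').
  have -> : be (e k) * tensor_sum al be ys * be (e k) = star (G I A f * be (e k)) * X * (G J B h * be (e k)).
    by rewrite yX starM sek !mulrA.
  by apply: cnormM_le => //; apply: cnormM_le => //; rewrite cnorm_star.
have := cnormB_ge (al (slice w ys) * be (e k * e k)) (be (e k) * tensor_sum al be ys * be (e k)).
rewrite [‖[al _ * _ - _]‖]cnormBC => n2; move: d'C; rewrite /C; nra.
Qed.

End ProductState.

(** * Compressions to finitely many GNS vectors, realised in a Cuntz algebra *)

Section FiniteStage.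
Variables (R : realType) (D B : cstarAlgType R) (al be ta : D -> D).
Hypotheses (sepD : separable D) (co : ssa_core al be ta).
Variables (e : nat -> D) (w : D -> R[i]).
Hypothesis ex : excising e w.
Variables (E : nat -> D) (Om : D -> R[i]).
Hypotheses (exO : excising E Om) (OmE : forall a b, Om (al a * be b) = w a * w b).
Variables (i : B -> D) (t : bool -> B).
Hypotheses (ui : uhom i) (ni : forall x, ‖[i x]‖ = ‖[x]‖) (ct : cuntz t).

Let hal := (core_al co).1.
Let hbe := (core_be co).1.
Let cab := core_comm co.
Let sw := excising_state ex.
Let sO := excising_state exO.
Let al1 : al 1 = 1 := (core_al co).2.
Let be1 : be 1 = 1 := (core_be co).2.

Definition ray (k : nat) := t true ^+ k * t false.

Let ray_ortho k l : star (ray k) * ray l = (k == l)%:R.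
Proof. by apply: spikes_ortho; exact: ct.1. Qed.

Let ray_orthiso n : orthiso (fun k : 'I_n => ray k).
Proof. by move=> k l; rewrite ray_ortho. Qed.

(** The letter [t true] between the rays keeps the range of each [ray k * t false] free;
    [stage_free] uses this room. *)
Definition ray2 (k j : nat) := ray k * (t true * ray j).

Let ray2_orthiso m n : orthiso (fun p : 'I_m * 'I_n => ray2 p.1 p.2).
Proof.
move=> [k j] [l j'] /=; rewrite /ray2 [star (ray k * _)]starM [star (t true * _)]starM.
transitivity (star (ray j) * (star (t true) * (star (ray k) * ray l) * t true) * ray j').
  by rewrite !mulrA.
rewrite ray_ortho xpair_eqE -[k == l]/(k == l :> nat) -[j == j']/(j == j' :> nat).
case: (k == l :> nat); last by rewrite !(mulr0, mul0r).
by rewrite mulr1 (ct.1 true true) mulr1 ray_ortho.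
Qed.

Lemma rmx_norm (e' : nat -> D) (w' : D -> R[i]) (I J : finType) (A : I -> D) (C : J -> D)
    (f : I -> B) (h : J -> B) T : excising e' w' ->
  orthonormal w' A -> orthonormal w' C -> orthiso f -> orthiso h ->
  ‖[rmx f h (fun k l => w' (star (A k) * T * C l))]‖ <= ‖[T]‖.
Proof.
move=> ex' oA oC of_ oh; rewrite -ni.
have io (K : finType) (u : K -> B) : orthiso u -> orthiso (i \o u).
  move=> ou k l /=; rewrite -(homS ui.1) -(homM ui.1) ou.
  by case: (k == l); rewrite ?ui.2 ?(hom0 ui.1).
have := compress_norm sepD co ex' [:: (1, T)] oA oC (io _ _ of_) (io _ _ oh).
rewrite /tensor_sum !big_seq1 /= al1 mul1r (be_norm co) => h1; apply: le_trans h1.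
rewrite /rmx (hom_sum ui.1) le_eqVlt; apply/orP; left; apply/eqP; congr (‖[_]‖).
apply: eq_bigr => k _; rewrite (hom_sum ui.1); apply: eq_bigr => l _.
by rewrite (homZ ui.1) (homM ui.1) (homS ui.1) mulr1.
Qed.

(** Conjugation by [al (u n)], with [u] implementing the equivalence of the identity and [al], turns
    [al a] into [al (al a)] in the limit and fixes [be b]. *)
Lemma amplify_copy xs :
  ‖[tensor_sum (al \o al) be xs]‖ <= ‖[tensor_sum al be xs]‖.
Proof.
have [u [uu hu]] := core_aue_al co.
have h ys : lim_to (fun n => al (u n) * tensor_sum al be ys * star (al (u n))) (tensor_sum (al \o al) be ys).
  elim: ys => [|[a b] ys IH] d d0.
    by exists 0%N => n _; rewrite /tensor_sum !big_nil mulr0 mul0r subrr cnorm0.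
  have K0 : 0 < 2 * (‖[b]‖ + 1) by have := cnorm_ge0 b; lra.
  have d2 : 0 < d / 2 by lra.
  have [N hN] := IH _ d2; have [M hM] := hu a _ (divr_gt0 d0 K0).
  exists (N + M)%N => n nm; have {}hN := hN n (leq_trans (leq_addr _ _) nm).
  have {}hM := hM n (leq_trans (leq_addl _ _) nm).
  rewrite /tensor_sum !big_cons -!/(tensor_sum _ _ _) /=.
  have -> : al (u n) * (al a * be b + tensor_sum al be ys) * star (al (u n)) - (al (al a) * be b + tensor_sum (al \o al) be ys)
    = al (u n * a * star (u n) - al a) * be b + (al (u n) * tensor_sum al be ys * star (al (u n)) - tensor_sum (al \o al) be ys).
    rewrite (homB hal) !(homM hal) (homS hal) mulrBl mulrDr mulrDl.
    have -> : al (u n) * al a * star (al (u n)) * be b = al (u n) * (al a * be b) * star (al (u n)).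
      by rewrite -(homS hal) -!mulrA cab.
    by rewrite opprD addrACA.
  apply: le_lt_trans (cnormD _ _) _.
  have n1 : ‖[al (u n * a * star (u n) - al a) * be b]‖ <= d / 2.
    apply: le_trans (cnormM _ _) _; rewrite (al_norm co) (be_norm co).
    move: hM; rewrite ltr_pdivlMr // => hM; have := cnorm_ge0 (u n * a * star (u n) - al a).
    by have := cnorm_ge0 b; nra.
  lra.
rewrite -[X in ‖[X]‖ <= _]subr0; apply: (lim_to_le (h xs)); exists 0%N => n _; rewrite subr0.
by rewrite cnorm_conj //; apply: uhom_unitary => //; exact: core_al co.
Qed.

Section Stage.
Variables (ws : seq (D * D)) (M N : nat) (g eta : nat -> D).
Local Notation gM := (fun k : 'I_M.+1 => g k).
Local Notation eN := (fun j : 'I_N => eta j).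
(** The span conditions list the vectors that occur between two compressed factors. Under them the
    identities involving [star W] hold without truncation error. *)
Hypotheses (og : orthonormal w gM) (oe : orthonormal w eN) (g0 : g 0%N = 1)
  (sa : forall p, p \in ws -> in_span w gM (star p.1))
  (sb : forall p j, p \in ws -> in_span w gM (p.2 * eta (j : 'I_N)))
  (s1 : forall p, p \in ws -> in_span w eN (star p.2))
  (sab : forall p q, p \in ws -> q \in ws -> in_span w eN (star p.2 * star q.1)).
Let W := tensor_sum al be ws.
Hypothesis W1 : ‖[W]‖ <= 1.

(* [ray k] stands for the vector [g k], [ray2 k j] for [g k (x) eta j]. Then
   [stage_hom d] is the compression of left multiplication by [d], and [stage_int]
   that of [W^*] restricted to the second tensor leg. *)
Let c (k : 'I_M.+1) := ray k.
Let f (p : 'I_M.+1 * 'I_N) := ray2 p.1 p.2.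
Let oc : orthiso c := @ray_orthiso M.+1.
Let of_ : orthiso f := @ray2_orthiso M.+1 N.

Let coef T (p : 'I_M.+1 * 'I_N) (l : 'I_M.+1) := Om (star (al (g p.1) * be (eta p.2)) * T * be (g l)).
Let X T := rmx f c (coef T).
Definition stage_hom (d : D) : B := rmx c c (fun k l => w (star (g k) * d * g l)).
Definition stage_int : B := X (star W).
Let Z T := rmx c c (fun k l => Om (star (be (g k)) * T * be (g l))).

Let oA : orthonormal Om (fun p : 'I_M.+1 * 'I_N => al (g p.1) * be (eta p.2)).
Proof.
move=> [k j] [k' j']; rewrite /ip (al_be_starM co) OmE xpair_eqE.
by have := og k k'; have := oe j j'; rewrite /ip /= => -> ->; rewrite -natrM mulnb.
Qed.

Let oB : orthonormal Om (fun k : 'I_M.+1 => be (g k)).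
Proof.
move=> k l; have := og k l; rewrite /ip => <-.
by rewrite -(homS hbe) -(homM hbe) -[be _]mul1r -al1 OmE (st_one sw) mul1r.
Qed.

Let X_norm T : ‖[X T]‖ <= ‖[T]‖. Proof. exact: (rmx_norm T exO oA oB of_ oc). Qed.
Let Z_norm T : ‖[Z T]‖ <= ‖[T]‖. Proof. exact: (rmx_norm T exO oB oB oc oc). Qed.

Let WS : star W = \sum_(p <- ws) al (star p.1) * be (star p.2).
Proof. by rewrite /W -(tensor_sumS hal hbe cab) /tensor_sum big_map. Qed.

Let coefE d d' p l : coef (al d * star W * be d') p l
  = \sum_(q <- ws) w (star (g p.1) * d * star q.1) * w (star (eta p.2) * star q.2 * d' * g l).
Proof.
rewrite /coef WS mulr_sumr mulr_suml mulr_sumr mulr_suml (st_sum sO); apply: eq_bigr => q _.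
rewrite -OmE; congr (Om _).
have -> : al d * (al (star q.1) * be (star q.2)) * be d' = al (d * star q.1) * be (star q.2 * d').
  by rewrite (homM hal) (homM hbe) !mulrA.
by rewrite (al_be_starM co) -[_ * be (g l)]mulrA -(homM hbe) !mulrA.
Qed.

(** The second-leg coefficient is the inner product of [q.2 * eta j] with [d' * g l]; the former
    lies in the span by [sb], so inserting the basis [g] is exact. *)
Let XZ d d' : X (al d * star W) * stage_hom d' = X (al d * star W * be d').
Proof.
rewrite /X /stage_hom rmxM //; congr rmx; apply/funext => p; apply/funext => l.
rewrite coefE; have -> : coef (al d * star W) p = coef (al d * star W * be 1) p by rewrite be1 mulr1.
under eq_bigr do rewrite coefE mulr_suml.
rewrite exchange_big /=; apply: eq_big_seq => q qw.
under eq_bigr do rewrite -mulrA; rewrite -mulr_sumr; congr (_ * _).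
have := in_span_ipl sw og (d' * g l) (sb p.2 qw); rewrite /ip starM !mulrA => ->.
by apply: eq_bigr => k _; rewrite mulr1 !mulrA.
Qed.

(** [f (k, j)] starts with [c k], so such a matrix acts on the index [k] alone, that is, on the left
    tensor leg. *)
Let hom_left (K : 'I_M.+1 -> 'I_M.+1 -> R[i]) (m : 'I_M.+1 * 'I_N -> 'I_M.+1 -> R[i]) :
  rmx c c K * rmx f c m = rmx f c (fun p l => \sum_k K p.1 k * m (k, p.2) l).
Proof.
have pE (F : 'I_M.+1 * 'I_N -> B) : \sum_p F p = \sum_k \sum_j F (k, j).
  by rewrite pair_bigA; apply: eq_bigr => -[].
rewrite /rmx !pE /=.
rewrite mulr_suml; apply: eq_bigr => k _; rewrite mulr_suml.
transitivity (\sum_k' \sum_j \sum_l (K k k' * m (k', j) l) *: (f (k, j) * star (c l))).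
  apply: eq_bigr => k' _; rewrite mulr_sumr (bigD1 k') //= [X in _ + X]big1 ?addr0 => [|l lk].
    rewrite mulr_sumr; apply: eq_bigr => j _; rewrite mulr_sumr; apply: eq_bigr => l _.
    rewrite -scalerAl -scalerAr scalerA; congr (_ *: _); rewrite /f /ray2 /=.
    transitivity (c k * (star (c k') * c k') * (t true * ray j * star (c l))); first by rewrite !mulrA.
    by rewrite oc eqxx mulr1 /c !mulrA.
  rewrite mulr_sumr big1 // => j _; rewrite mulr_sumr big1 // => l' _.
  rewrite -scalerAl -scalerAr scalerA /f /ray2 /=.
  have -> : c k * star (c k') * (ray l * (t true * ray j) * star (c l'))
    = c k * (star (c k') * c l) * (t true * ray j * star (c l')) by rewrite !mulrA.
  by rewrite oc eq_sym (negbTE lk) mulr0 mul0r scaler0.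
rewrite exchange_big /=; apply: eq_bigr => j _; rewrite exchange_big /=; apply: eq_bigr => l _.
by rewrite scaler_suml.
Qed.

(** As in [XZ], but on the left leg: the vectors there are [star q.1], in the span by [sa]. *)
Let ZX d : stage_hom d * stage_int = X (al d * star W).
Proof.
rewrite /stage_int /X /stage_hom hom_left; congr rmx; apply/funext => p; apply/funext => l.
have -> : coef (al d * star W) p l = coef (al d * star W * be 1) p l by rewrite be1 mulr1.
have e0 k : coef (star W) (k, p.2) l = coef (al 1 * star W * be 1) (k, p.2) l.
  by rewrite al1 be1 mul1r mulr1.
rewrite coefE; under eq_bigr do rewrite e0 coefE mulr_sumr.
rewrite exchange_big /=; apply: eq_big_seq => q qw.
under eq_bigr do rewrite mulrA; rewrite -mulr_suml; congr (_ * _).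
have := in_span_ip sw og (star d * g p.1) (sa qw); rewrite /ip starM starK => ->.
by apply: eq_bigr => k _; rewrite mulr1.
Qed.

Lemma stage_int_norm : ‖[stage_int]‖ <= 1.
Proof. by apply: le_trans (X_norm _) _; rewrite cnorm_star. Qed.

Lemma stage_hom_linear : linear stage_hom.
Proof.
move=> a x y; rewrite /stage_hom /rmx scaler_sumr -big_split /=; apply: eq_bigr => k _.
rewrite scaler_sumr -big_split /=; apply: eq_bigr => l _.
by rewrite mulrDr mulrDl -scalerAr -scalerAl (st_lin sw) scalerDl scalerA.
Qed.

Lemma stage_hom_star d : stage_hom (star d) = star (stage_hom d).
Proof.
rewrite /stage_hom rmxS; congr rmx; apply/funext => k; apply/funext => l.
by rewrite -(st_star sw) !starM !starK !mulrA.
Qed.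

Lemma stage_hom_norm d : ‖[stage_hom d]‖ <= ‖[d]‖.
Proof. exact: (rmx_norm d ex og og oc oc). Qed.

Let X_int d : stage_int * stage_hom d = X (star W * be d).
Proof. by have := XZ 1 d; rewrite al1 mul1r. Qed.

Let XB T T' : X (T - T') = X T - X T'.
Proof.
rewrite /X /rmx -sumrB; apply: eq_bigr => p _; rewrite -sumrB; apply: eq_bigr => l _.
by rewrite /coef mulrBr mulrBl (stB sO) scalerBl.
Qed.
Let ZB T T' : Z (T - T') = Z T - Z T'.
Proof.
rewrite /Z /rmx -sumrB; apply: eq_bigr => p _; rewrite -sumrB; apply: eq_bigr => l _.
by rewrite mulrBr mulrBl (stB sO) scalerBl.
Qed.

Lemma stage_comm d :
  ‖[stage_int * stage_hom d - stage_hom d * stage_int]‖ <= ‖[star W * be d - al d * star W]‖.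
Proof. by rewrite X_int ZX -XB; exact: X_norm. Qed.

Lemma stage_int1 : stage_int * stage_hom 1 = stage_int.
Proof. by rewrite X_int be1 mulr1. Qed.
Lemma stage_hom1_int : stage_hom 1 * stage_int = stage_int.
Proof. by rewrite ZX al1 mul1r. Qed.

(** Only [d] has to be commuted past the compressed [star W], once outside and once inside the
    compression; the factor [d'] is handled exactly by [XZ]. *)
Lemma stage_mul d d' :
  ‖[stage_int * stage_hom d * stage_hom d' - stage_int * stage_hom (d * d')]‖
  <= 2 * (‖[star W * be d - al d * star W]‖ * ‖[d']‖).
Proof.
have -> : stage_int * stage_hom d * stage_hom d' - stage_int * stage_hom (d * d')
  = (stage_int * stage_hom d - stage_hom d * stage_int) * stage_hom d'
    - X ((star W * be d - al d * star W) * be d').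
  rewrite ZX (X_int d) (X_int (d * d')) (homM hbe) (mulrBl (stage_hom d')) XZ (mulrBl (be d')) XB.
  by rewrite (mulrA (star W)); ncring.
apply: le_trans (cnormB _ _) _; rewrite [2 * _]mulr_natl mulr2n; apply: lerD.
  by apply: cnormM_le; [exact: stage_comm|exact: stage_hom_norm].
by apply: le_trans (X_norm _) _; apply: le_trans (cnormM _ _) _; rewrite (be_norm co).
Qed.

Let Z1 : Z 1 = stage_hom 1.
Proof.
rewrite /Z /stage_hom; congr rmx; apply/funext => k; apply/funext => l.
by rewrite !mulr1 -(homS hbe) -(homM hbe) -[be _]mul1r -al1 OmE (st_one sw) mul1r.
Qed.

Let gram k l := \sum_p conjc (coef (star W) p k) * coef (star W) p l.
Let gramE : star stage_int * stage_int = rmx c c gram.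
Proof. by rewrite /stage_int /X rmxS rmxM. Qed.

(* Vectors [h] whose image under [W^*] lies in the span of the [al (g k) * be (eta j)]. *)
Let gram_span h l : (forall p, p \in ws -> in_span w eN (star p.2 * h)) -> in_span w gM h ->
  \sum_(k < M.+1) gram l k * ip w (g k) h = \sum_(k < M.+1) Om (star (be (g l)) * (W * star W) * be (g k)) * ip w (g k) h.
Proof.
move=> hN hM.
have cE p k : coef (star W) p k = \sum_(q <- ws) ip w (g p.1) (star q.1) * ip w (eta p.2) (star q.2 * g k).
  have -> : coef (star W) p k = coef (al 1 * star W * be 1) p k by rewrite al1 be1 mul1r mulr1.
  by rewrite coefE; apply: eq_bigr => q _; rewrite /ip !mulr1 !mulrA.
have cH p : \sum_(k < M.+1) coef (star W) p k * ip w (g k) h = \sum_(q <- ws) ip w (g p.1) (star q.1) * ip w (eta p.2) (star q.2 * h).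
  under eq_bigr do rewrite cE mulr_suml.
  rewrite exchange_big /=; apply: eq_big_seq => q qw.
  under eq_bigr do rewrite -mulrA; rewrite -mulr_sumr; congr (_ * _).
  by rewrite (ip_mulr) starK (in_span_ip sw og _ hM); apply: eq_bigr => k _; rewrite [in LHS]ip_mulr starK.
transitivity (\sum_(q' <- ws) \sum_(q <- ws) w (q'.1 * star q.1) * w (star (g l) * q'.2 * star q.2 * h)).
  rewrite /gram; under eq_bigr do rewrite mulr_suml.
  rewrite exchange_big /=; under eq_bigr do under eq_bigr do rewrite -mulrA.
  under eq_bigr do rewrite -mulr_sumr cH cE rmorph_sum mulr_suml.
  rewrite exchange_big /=; apply: eq_big_seq => q' qw'.
  under eq_bigr do rewrite mulr_sumr.
  rewrite exchange_big /=; apply: eq_big_seq => q qw.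
  have e1 := in_span_ip sw og (star q'.1) (sa qw).
  have e2 := in_span_ip sw oe (star q'.2 * g l) (hN q qw).
  have -> : w (q'.1 * star q.1) = ip w (star q'.1) (star q.1) by rewrite /ip starK.
  have -> : w (star (g l) * q'.2 * star q.2 * h) = ip w (star q'.2 * g l) (star q.2 * h).
    by rewrite /ip starM starK !mulrA.
  rewrite e1 e2 mulr_suml -(pair_bigA _ (fun (k : 'I_M.+1) (j : 'I_N) => conjc (ip w (g k) (star q'.1) * ip w (eta j) (star q'.2 * g l))
     * (ip w (g k) (star q.1) * ip w (eta j) (star q.2 * h)))) /=.
  apply: eq_bigr => k _; rewrite mulr_sumr; apply: eq_bigr => j _.
  by rewrite rmorphM /= -!(ip_conj sw) mulrACA.
apply/esym; have OE k : Om (star (be (g l)) * (W * star W) * be (g k))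
    = \sum_(q' <- ws) \sum_(q <- ws) w (q'.1 * star q.1) * w (star (g l) * q'.2 * star q.2 * g k).
  rewrite {1}/W /tensor_sum WS mulr_suml mulr_sumr mulr_suml (st_sum sO); apply: eq_bigr => q' _.
  rewrite mulr_sumr mulr_sumr mulr_suml (st_sum sO); apply: eq_bigr => q _; rewrite -OmE; congr (Om _).
  rewrite -(homS hbe) !(homM hal, homM hbe).
  transitivity (be (star (g l)) * al q'.1 * (be q'.2 * al (star q.1)) * (be (star q.2) * be (g k))).
    by rewrite !mulrA.
  rewrite -!cab; transitivity (al q'.1 * (be (star (g l)) * al (star q.1)) * (be q'.2 * be (star q.2) * be (g k))).
    by rewrite !mulrA.
  by rewrite -cab !mulrA.
under eq_bigr do rewrite OE mulr_suml.
rewrite exchange_big /=; apply: eq_bigr => q' _; under eq_bigr do rewrite mulr_suml.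
rewrite exchange_big /=; apply: eq_bigr => q _; under eq_bigr do rewrite -mulrA.
rewrite -mulr_sumr; congr (_ * _).
have := in_span_ip sw og (q.2 * star q'.2 * g l) hM; rewrite /ip !starM !starK !mulrA => ->.
by [].
Qed.

Let s_one : in_span w gM 1.
Proof.
exists (fun k => (k == ord0)%:R); rewrite (bigD1 ord0) //= big1 ?addr0 => [|k /negbTE ->].
  by rewrite g0 scale1r subrr /wn /ip mulr0 (st0 sw).
by rewrite scale0r.
Qed.

(** The left legs met in [stage_int] are the vectors [star q.1]. On these, by [gram_span] with
    [sab], [star stage_int * stage_int] acts as the compression of [W * star W], which is close to
    1. *)
Lemma stage_proj : ‖[star stage_int * stage_int * stage_int - stage_int]‖ <= ‖[W * star W - 1]‖.
Proof.
have eZ : star stage_int * stage_int * stage_int = Z (W * star W) * stage_int.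
  rewrite gramE /Z /stage_int /X !hom_left; congr rmx; apply/funext => p; apply/funext => l.
  have cE k : coef (star W) (k, p.2) l = \sum_(q <- ws) ip w (g k) (star q.1) * w (star (eta p.2) * star q.2 * g l).
    have -> : coef (star W) (k, p.2) l = coef (al 1 * star W * be 1) (k, p.2) l by rewrite al1 be1 mul1r mulr1.
    by rewrite coefE; apply: eq_bigr => q _; rewrite /ip !mulr1.
  under eq_bigr do rewrite cE mulr_sumr.
  under [RHS]eq_bigr do rewrite cE mulr_sumr.
  rewrite exchange_big [RHS]exchange_big /=; apply: eq_big_seq => q qw.
  under eq_bigr do rewrite mulrA; under [RHS]eq_bigr do rewrite mulrA.
  rewrite -!mulr_suml; congr (_ * _); apply: gram_span; last exact: sa.
  by move=> p' pw'; exact: sab.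
have -> : star stage_int * stage_int * stage_int - stage_int = Z (W * star W - 1) * stage_int.
  by rewrite eZ ZB mulrBl Z1 stage_hom1_int.
by apply: cnormM_le1r; [exact: Z_norm|exact: stage_int_norm].
Qed.

(** [t false] is [ray 0] and stands for [g 0 = 1]; this is [gram_span] for the vector 1, with
    [s1]. *)
Lemma stage_vector : ‖[star stage_int * stage_int * t false - t false]‖ <= ‖[W * star W - 1]‖.
Proof.
have c0 : t false = c ord0 by rewrite /c /ray expr0 mul1r.
have act (K : 'I_M.+1 -> 'I_M.+1 -> R[i]) : rmx c c K * c ord0 = \sum_k (\sum_(l < M.+1) K k l * ip w (g l) 1) *: c k.
  rewrite /rmx mulr_suml; apply: eq_bigr => k _; rewrite mulr_suml scaler_suml; apply: eq_bigr => l _.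
  rewrite -scalerAl -mulrA oc; have := og l ord0; rewrite /= g0 => ->.
  by case: (l == ord0); rewrite ?mulr1 ?mulr0 ?scaler0 ?scale0r.
have eZ : star stage_int * stage_int * c ord0 = Z (W * star W) * c ord0.
  rewrite gramE /Z !act; apply: eq_bigr => k _; congr (_ *: _); apply: gram_span => //.
  by move=> p pw; rewrite mulr1; exact: s1.
have e1 : Z 1 * c ord0 = c ord0.
  rewrite Z1 /stage_hom act (bigD1 ord0) //= [X in _ + X]big1 ?addr0 => [|k k0].
    rewrite (bigD1 ord0) //= big1 ?addr0 => [|l l0].
      by rewrite g0 star1 !mulr1 /ip star1 mulr1 (st_one sw) mulr1 scale1r.
    by have := og l ord0; rewrite /= g0 (negbTE l0) => ->; rewrite mulr0.
  rewrite big1 ?scale0r // => l _; rewrite mulr1 (og k l : w (star (g k) * g l) = _).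
  have := og l ord0; rewrite /= g0 => ->; case: (eqVneq k l) => [<-|]; last by rewrite mul0r.
  by rewrite (negbTE k0) mulr0.
rewrite c0; have -> : star stage_int * stage_int * c ord0 - c ord0 = Z (W * star W - 1) * c ord0.
  by rewrite eZ ZB mulrBl e1.
by apply: cnormM_le1r; [exact: Z_norm|rewrite orthiso_cnorm].
Qed.

(** [t false * t false] is [ray 0 * t false], while the ranges in [stage_int] lie under the elements
    [ray k * t true]. *)
Lemma stage_free : star stage_int * (t false * t false) = 0.
Proof.
rewrite /stage_int /X rmxS /rmx mulr_suml big1 // => l _; rewrite mulr_suml big1 // => p _.
rewrite -scalerAl -mulrA; have -> : star (f p) * (t false * t false) = 0.
  rewrite /f /ray2 [star (ray _ * _)]starM [star (t true * _)]starM -!mulrA (mulrA _ (t false) (t false)).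
  have := ray_ortho p.1 0; rewrite {2}/ray expr0 mul1r => ->.
  by case: (_ == _); rewrite ?mul1r ?mul0r ?mulr0 // (ct.1 true false) !mulr0.
by rewrite mulr0 scaler0.
Qed.

(** The second leg is compressed with the isometries [be (i (c k))], which commute with the
    coefficient [al p.1]. For this the tensor to be compressed must carry [al (al p.1)] in its first
    leg, and [amplify_copy] bounds its norm. *)
Lemma stage_amplify xs : ‖[tensor_sum al (be \o i \o stage_hom) xs]‖ <= ‖[tensor_sum al be xs]‖.
Proof.
apply: le_trans (amplify_copy xs).
have obc : orthiso (fun k => be (i (c k))).
  move=> k l; rewrite -(homS hbe) -(homS ui.1) -(homM hbe) -(homM ui.1) oc.
  by case: (k == l); rewrite ?ui.2 ?be1 ?(hom0 ui.1) ?(hom0 hbe).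
have := compress_norm sepD co ex [seq (al p.1, p.2) | p <- xs] og og obc obc.
have -> : tensor_sum al be [seq (al p.1, p.2) | p <- xs] = tensor_sum (al \o al) be xs.
  by rewrite /tensor_sum big_map.
move=> h; apply: le_trans h; rewrite big_map le_eqVlt; apply/orP; left; apply/eqP; congr (‖[_]‖).
rewrite /tensor_sum; apply: eq_bigr => p _ /=; rewrite /stage_hom /rmx (hom_sum ui.1) (hom_sum hbe) mulr_sumr.
apply: eq_bigr => k _; rewrite (hom_sum ui.1) (hom_sum hbe) mulr_sumr; apply: eq_bigr => l _.
rewrite (homZ ui.1) (homZ hbe) (homM ui.1) (homM hbe) (homS ui.1) (homS hbe) -scalerAr mulrA.
by rewrite cab.
Qed.

End Stage.
End FiniteStage.

(** * From a map multiplicative beside [X] to a unital homomorphism *)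

Section Dilation.
Variables (R : realType) (D A : starAlgType R) (X S c T1 T2 : A) (I : D -> A).
Hypotheses (linI : linear I) (starI : forall d, I (star d) = star (I d))
  (comm : forall d, X * I d = I d * X) (Xp : star X * X * X = X)
  (mulI : forall d d', X * I d * I d' = X * I (d * d')) (X1 : X * I 1 = X)
  (Xc : star X * X * c = c) (free : star X * (c * T2) = 0)
  (sS : star S = S) (SS : S * S = 1 - star X * X)
  (S_comm : forall z, star X * X * z = z * (star X * X) -> S * z = z * S)
  (S_id : forall z, star X * X * z = 0 -> S * z = z)
  (proper : forall z : A, star z * z = 0 -> z = 0)
  (cc : star c * c = 1) (T11 : star T1 * T1 = 1) (T22 : star T2 * T2 = 1)
  (T12 : star T1 * T2 = 0) (TT : T1 * star T1 + T2 * star T2 = 1).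

(* [v] is an isometry commuting with [I], on whose co-range [q] the map [I] is
   multiplicative; [Z] is an isometry with range [q]. *)
Lemma dilation_hom : exists Z, star Z * Z = 1 /\ uhom (fun d => star Z * I d * Z).
Proof.
have SX : S * X = 0.
  apply: proper; rewrite starM sS; transitivity (star X * (S * S) * X); first by rewrite !mulrA.
  by rewrite SS mulrBr mulr1 mulrBl -!mulrA (mulrA (star X) X) Xp subrr.
have Sc : S * c = 0.
  apply: proper; rewrite starM sS; transitivity (star c * (S * S) * c); first by rewrite !mulrA.
  by rewrite SS mulrBr mulr1 mulrBl -!mulrA (mulrA (star X) X) Xc subrr.
have XS : star X * S = 0 by rewrite -[LHS]starK starM starK sS SX star0.
set v := X + S; have sv : star v = star X + S by rewrite starD sS.
have vv : star v * v = 1.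
  rewrite sv /v; transitivity (star X * X + star X * S + S * X + S * S); first by ncring.
  by rewrite XS SX SS; ncring.
have commS d : star X * I d = I d * star X.
  by rewrite -[LHS]starK starM starK -starI -comm starM starI starK.
have XXI d : star X * X * I d = I d * (star X * X).
  by rewrite -mulrA comm mulrA commS mulrA.
have SI d : S * I d = I d * S by exact: S_comm.
have vI d : v * I d = I d * v by rewrite mulrDl mulrDr comm SI.
have vsI d : star v * I d = I d * star v by rewrite sv mulrDl mulrDr commS SI.
set f := c * T2; have ff : star f * f = 1.
  rewrite starM; transitivity (star T2 * (star c * c) * T2); first by rewrite !mulrA.
  by rewrite cc mulr1.
have vf : star v * f = 0 by rewrite sv mulrDl free /f mulrA Sc mul0r addr0.
have fv : star f * v = 0 by rewrite -[LHS]starK starM starK vf star0.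
set q := 1 - v * star v.
have qI d : q * I d = I d * q.
  by rewrite mulrBl mulrBr mul1r mulr1 -mulrA vsI mulrA vI mulrA.
have qv : q * v = 0 by rewrite mulrBl mul1r -mulrA vv mulr1 subrr.
have qf : q * f = f by rewrite mulrBl mul1r -mulrA vf mulr0 subr0.
have sq : star q = q by rewrite starB star1 starM starK.
have fq : star f * q = star f by rewrite -[LHS]starK starM starK sq qf.
have vq : star v * q = 0 by rewrite -[LHS]starK starM starK sq qv star0.
have qq : q * q = q by rewrite {2}/q mulrBr mulr1 mulrA qv mul0r subr0.
have qvv : q + v * star v = 1 by rewrite subrK.
(* The range of [f] lies under [q]. [a] sends the range of [v] to the [T1]-half of it, [b]
   compresses the range of [f] into the [T2]-half, and [g] is the remainder of [q]; their sum is an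
   isometry of 1 onto [q]. *)
clearbody q f; pose a := f * T1 * star v; pose b := f * T2 * star f; pose g := q - f * star f.
have gf : g * f = 0 by rewrite mulrBl qf -mulrA ff mulr1 subrr.
have fg : star f * g = 0 by rewrite mulrBr fq mulrA ff mul1r subrr.
have vg : star v * g = 0 by rewrite mulrBr vq mulrA vf mul0r subrr.
have sg : star g = g by rewrite starB sq starM starK.
have gg : g * g = g by rewrite {2}/g mulrBr mulrA gf mul0r subr0 mulrBl qq -mulrA fq.
have gff : g + f * star f = q by rewrite subrK.
clearbody g.
have sa : star a = v * star T1 * star f by rewrite !starM starK mulrA.
have sb : star b = f * star T2 * star f by rewrite !starM starK mulrA.
have aa : star a * a = v * star v.
  rewrite sa /a; transitivity (v * (star T1 * (star f * f) * T1) * star v); first by rewrite !mulrA.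
  by rewrite ff mulr1 T11 mulr1.
have ab : star a * b = 0.
  rewrite sa /b; transitivity (v * (star T1 * (star f * f) * T2) * star f); first by rewrite !mulrA.
  by rewrite ff mulr1 T12 mulr0 mul0r.
have ag : star a * g = 0 by rewrite sa -mulrA fg mulr0.
have bb : star b * b = f * star f.
  rewrite sb /b; transitivity (f * (star T2 * (star f * f) * T2) * star f); first by rewrite !mulrA.
  by rewrite ff mulr1 T22 mulr1.
have bg : star b * g = 0 by rewrite sb -mulrA fg mulr0.
have aa' : a * star a = f * (T1 * star T1) * star f.
  rewrite sa /a; transitivity (f * (T1 * (star v * v) * star T1) * star f); first by rewrite !mulrA.
  by rewrite vv mulr1.
have ab' : a * star b = 0.
  rewrite sb /a; transitivity (f * T1 * (star v * f) * star T2 * star f); first by rewrite !mulrA.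
  by rewrite vf mulr0 !mul0r.
have ag' : a * g = 0 by rewrite /a -mulrA vg mulr0.
have bb' : b * star b = f * (T2 * star T2) * star f.
  rewrite sb /b; transitivity (f * (T2 * (star f * f) * star T2) * star f); first by rewrite !mulrA.
  by rewrite ff mulr1.
have bg' : b * g = 0 by rewrite /b -mulrA fg mulr0.
have ba : star b * a = 0 by rewrite -[LHS]starK starM starK ab star0.
have ga : g * a = 0 by rewrite -[LHS]starK starM sg ag star0.
have gb : g * b = 0 by rewrite -[LHS]starK starM sg bg star0.
have ba' : b * star a = 0 by rewrite -[LHS]starK starM starK ab' star0.
have ga' : g * star a = 0 by rewrite -[LHS]starK starM starK sg ag' star0.
have gb' : g * star b = 0 by rewrite -[LHS]starK starM starK sg bg' star0.
pose Z := a + b + g.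
have ZZ : star Z * Z = 1.
  rewrite /Z !starD sg !mulrDl !mulrDr aa ab ag ba bb bg ga gb gg !(addr0, add0r).
  by rewrite -addrA [f * _ + g]addrC gff addrC.
have ZZ' : Z * star Z = q.
  rewrite /Z !starD sg !mulrDl !mulrDr aa' ab' ag' ba' bb' bg' ga' gb' gg !(addr0, add0r).
  by rewrite -mulrDl -mulrDr TT mulr1 addrC.
have qZ : q * Z = Z by rewrite -ZZ' -mulrA ZZ mulr1.
clearbody Z.
(* Such a [z] is fixed by right multiplication with [S], hence with [v] and [star v], hence with
   [v * star v = 1 - q]. *)
have key z : X * z = 0 -> z * X = 0 -> z * star X = 0 -> z * q = 0.
  move=> h1 h2 h3; have h4 : star X * X * z = 0 by rewrite -mulrA h1 mulr0.
  have h5 : S * z = z by exact: S_id.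
  have h6 : z * S = z by rewrite -S_comm // h4 mulrA h3 mul0r.
  have h7 : z * v = z by rewrite mulrDr h2 h6 add0r.
  have h8 : z * star v = z by rewrite sv mulrDr h3 h6 add0r.
  have : z * q + z = z by rewrite -[in RHS](mulr1 z) -qvv mulrDr [z * (v * _)]mulrA h7 h8.
  by move=> /(canRL (addrK z)); rewrite subrr.
have IIq d d' : I d * I d' * q = I (d * d') * q.
  apply/eqP; rewrite -subr_eq0 -mulrBl; apply/eqP.
  have XI e e' : X * (I e * I e' - I (e * e')) = 0 by rewrite mulrBr mulrA mulI subrr.
  have e : I d * I d' * X = X * (I d * I d') by rewrite -mulrA -comm mulrA -comm -mulrA.
  apply: key; first exact: XI.
    by rewrite mulrBl e -comm -mulrBr XI.
  by rewrite -[LHS]starK starM starK starB [star (I d * _)]starM -!starI [star (d * d')]starM XI star0.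
have I1q : I 1 * q = q.
  apply/esym/eqP; rewrite -subr_eq0 -[X in X - _]mul1r -mulrBl; apply/eqP.
  apply: key; first by rewrite mulrBr mulr1 X1 subrr.
    by rewrite mulrBl mul1r -comm X1 subrr.
  have X1s : star X * I 1 = star X by rewrite -[LHS]starK starM starK -starI star1 -comm X1.
  by rewrite mulrBl mul1r -commS X1s subrr.
exists Z; split=> //; split; first split.
- by move=> k x y; rewrite linI mulrDr mulrDl -scalerAr -scalerAl.
- move=> x y; transitivity (star Z * (I x * q * I y) * Z); last by rewrite -ZZ' !mulrA.
  by rewrite -(mulrA (I x)) qI (mulrA (I x)) IIq -!mulrA qZ.
- by move=> x; rewrite starI !starM starK mulrA.
by transitivity (star Z * (I 1 * q) * Z); [rewrite -!mulrA qZ|rewrite I1q -mulrA qZ].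
Qed.

End Dilation.

(** * Coordinatewise square roots in the sequence algebra *)

Section RootInSequences.
Variables (R : realType) (B : cstarAlgType R).
Implicit Types x y : nat -> B.

Lemma seqalg_proper (z : seqalg B) : star z * z = 0 -> z = 0.
Proof.
elim/qW: z => z bz; rewrite -qcS // -qcM //; last exact: bndS.
move=> /qc_eq0-/(_ (bndM (bndS bz) bz)) h; apply/qc_eq0 => // d d0.
have d2 : 0 < d ^+ 2 by rewrite exprn_gt0.
have [N hN] := h _ d2; exists N => n /hN; rewrite cstar_identity.
by rewrite ltr_pXn2r ?nnegrE ?cnorm_ge0 // ltW.
Qed.

Variable y : nat -> B.
Hypotheses (y1 : forall n, ‖[y n]‖ <= 1) (sy : forall n, star (y n) = y n).

Let by_ : bnd y. Proof. by exists 1. Qed.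
Let rt n := sqrt1m (y n).
Let brt : bnd rt.
Proof.
exists 2 => n; have := sqrt1m_norm1 (y1 n); have := cnormB_ge (rt n) 1; rewrite cnorm1 cnormBC.
by have := y1 n; rewrite /rt; lra.
Qed.
Let app k n := 1 - sqrt_it (y n) k.
Let bsi k : bnd (fun n => sqrt_it (y n) k).
Proof.
by exists 1 => n; apply: le_trans (sqrt_it_norm k (y1 n)) _; have /andP[] := sqrt_sc_bound R k.
Qed.
Let bapp k : bnd (app k). Proof. by apply: bndB; [exact: bndc|exact: bsi]. Qed.
Let qit k : seqalg B := qc (fun n => sqrt_it (y n) k).
Let qitS k : qit k.+1 = 2^-1%:C *: (qc y + qit k * qit k).
Proof.
have b2 := bndM (bsi k) (bsi k).
by rewrite /qit -(qcM (bsi k) (bsi k)) -(qcD by_ b2) -(qcZ _ (bndD by_ b2)).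
Qed.

Lemma qroot_star : star (qc rt) = qc rt.
Proof. by rewrite -qcS //; apply: qc_ext => n; exact: sqrt1m_star. Qed.

Lemma qroot_sqr : qc rt * qc rt = 1 - qc y.
Proof. by rewrite -qcM // -qc1 -qcB //; [apply: qc_ext => n; exact: sqrt1m_sqr|exact: bndc]. Qed.

Let close k n : ‖[rt n - app k n]‖ <= 2 / k.+1%:R. Proof. exact: sqrt1m_it. Qed.

(** The polynomial approximants of the root commute with [z] exactly in the quotient, and they
    approximate it uniformly over all coordinates. *)
Lemma qroot_comm (z : seqalg B) : qc y * z = z * qc y -> qc rt * z = z * qc rt.
Proof.
move=> h; have hk k : qit k * z = z * qit k.
  elim: k => [|k IH]; first by rewrite /qit /= qc0 mul0r mulr0.
  by rewrite qitS -scalerAl -scalerAr mulrDl mulrDr h -mulrA IH mulrA IH mulrA.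
have ha k : qc (app k) * z = z * qc (app k).
  by rewrite /app qcB //; [rewrite qc1 mulrBl mulrBr mul1r mulr1 hk|exact: bndc].
move: z ha {h hk}; elim/qW => z bz ha; rewrite -!qcM //; apply/qcP; [exact: bndM|exact: bndM|].
move=> d d0; have [K K0 hK] := bndP bz.
have d4 : 0 < d / (4 * K) by rewrite divr_gt0 //; lra.
have [k hk] := inv_small d4; have := ha k; rewrite -!qcM // => /qcP.
move=> /(_ (bndM (bapp k) bz) (bndM bz (bapp k))) h.
have d2 : 0 < d / 2 by lra.
have [N hN] := h _ d2; exists N => n /hN nn.
have -> : rt n * z n - z n * rt n = (rt n - app k n) * z n - z n * (rt n - app k n) + (app k n * z n - z n * app k n) by ncring.
apply: le_lt_trans (cnormD _ _) _.
have n1 : ‖[(rt n - app k n) * z n - z n * (rt n - app k n)]‖ <= d / (4 * K) * K + K * (d / (4 * K)).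
  apply: le_trans (cnormB _ _) _; have c := le_trans (close k n) (ltW hk).
  by apply: lerD; apply: cnormM_le.
have : d / (4 * K) * K + K * (d / (4 * K)) = d / 2 by field; apply: lt0r_neq0.
by lra.
Qed.

Lemma qroot_id (z : seqalg B) : qc y * z = 0 -> qc rt * z = z.
Proof.
move=> h; have hk k : qit k * z = 0.
  elim: k => [|k IH]; first by rewrite /qit /= qc0 mul0r.
  by rewrite qitS -scalerAl mulrDl h -mulrA IH mulr0 addr0 scaler0.
have ha k : qc (app k) * z = z.
  by rewrite /app qcB //; [rewrite qc1 mulrBl mul1r hk subr0|exact: bndc].
move: z ha {h hk}; elim/qW => z bz ha; rewrite -!qcM //; apply/qcP => //; first exact: bndM.
move=> d d0; have [K K0 hK] := bndP bz.
have d4 : 0 < d / (2 * K) by rewrite divr_gt0 //; lra.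
have [k hk] := inv_small d4; have := ha k; rewrite -!qcM // => /qcP.
move=> /(_ (bndM (bapp k) bz) bz) h.
have d2 : 0 < d / 2 by lra.
have [N hN] := h _ d2; exists N => n /hN nn.
have -> : rt n * z n - z n = (rt n - app k n) * z n + (app k n * z n - z n) by ncring.
apply: le_lt_trans (cnormD _ _) _.
have n1 : ‖[(rt n - app k n) * z n]‖ <= d / (2 * K) * K.
  by apply: cnormM_le => //; exact: le_trans (close k n) (ltW hk).
have : d / (2 * K) * K = d / 2 by field; apply: lt0r_neq0.
by lra.
Qed.

End RootInSequences.

Section ApproximateHoms.
Variables (R : realType) (D B : cstarAlgType R) (al be ta : D -> D).
Hypotheses (sepD : separable D) (co : ssa_core al be ta).
Variables (i : B -> D) (t : bool -> B).
Hypotheses (ui : uhom i) (ni : forall x, ‖[i x]‖ = ‖[x]‖) (ct : cuntz t).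

Let hal := (core_al co).1.
Let hbe := (core_be co).1.
Let cab := core_comm co.

Record stage (W : D) (x : B) (io : D -> B) : Prop := Stage {
  sg_norm : ‖[x]‖ <= 1;
  sg_lin : linear io;
  sg_star : forall d, io (star d) = star (io d);
  sg_bnd : forall d, ‖[io d]‖ <= ‖[d]‖;
  sg_comm : forall d, ‖[x * io d - io d * x]‖ <= ‖[star W * be d - al d * star W]‖;
  sg_one : x * io 1 = x;
  sg_mul : forall d d', ‖[x * io d * io d' - x * io (d * d')]‖
    <= 2 * (‖[star W * be d - al d * star W]‖ * ‖[d']‖);
  sg_proj : ‖[star x * x * x - x]‖ <= ‖[W * star W - 1]‖;
  sg_vec : ‖[star x * x * t false - t false]‖ <= ‖[W * star W - 1]‖;
  sg_free : star x * (t false * t false) = 0;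
  sg_amp : forall xs, ‖[tensor_sum al (be \o i \o io) xs]‖ <= ‖[tensor_sum al be xs]‖ }.

Lemma stage_exists ws : ‖[tensor_sum al be ws]‖ <= 1 ->
  exists x io, stage (tensor_sum al be ws) x io.
Proof.
move=> W1; have pos1D : pos (1 : D) by exists 1; rewrite ?star1 ?mulr1.
have [e [w [ex _]]] := excising_exists sepD pos1D (cnorm1 D).
have [E [Om [exO OmE]]] := product_state sepD co ex.
have sw := excising_state ex.
(* The choice is not circular: [eta] depends on the legs of [ws] only, and [g] on these legs and on
   [eta]. The family [g] is started at the vector 1. *)
pose zs := [seq star p.2 | p <- ws] ++ [seq star p.2 * star q.1 | p <- ws, q <- ws].
have [N [eta [_ oe _ he]]] := @gram_schmidt _ _ w sw zs 0 (fun=> 0) (fun i => False_ind _ (notF (ltn_ord i))).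
pose zs' := [seq star p.1 | p <- ws] ++ [seq p.2 * eta j | p <- ws, j <- iota 0 N].
have o1 : onf w 1 (fun=> 1).
  by move=> k l; rewrite /ip star1 mulr1 (st_one sw) !ord1 eqxx.
have [[|M] [g [M0 og g0 hg]]] := gram_schmidt sw zs' o1; first by [].
have sa p : p \in ws -> in_span w (fun k : 'I_M.+1 => g k) (star p.1).
  by move=> pw; apply: hg; rewrite mem_cat (map_f (fun p => star p.1) pw).
have sb p (j : 'I_N) : p \in ws -> in_span w (fun k : 'I_M.+1 => g k) (p.2 * eta j).
  move=> pw; apply: hg; rewrite mem_cat; apply/orP; right.
  by apply/allpairsP; exists (p, nat_of_ord j); rewrite mem_iota ltn_ord.
have s1 p : p \in ws -> in_span w (fun j : 'I_N => eta j) (star p.2).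
  by move=> pw; apply: he; rewrite mem_cat (map_f (fun p => star p.2) pw).
have sab p q : p \in ws -> q \in ws -> in_span w (fun j : 'I_N => eta j) (star p.2 * star q.1).
  by move=> pw qw; apply: he; rewrite mem_cat; apply/orP; right; apply/allpairsP; exists (p, q).
have {}g0 : g 0%N = 1 by rewrite g0.
exists (stage_int al be Om t ws M N g eta), (stage_hom w t M g); split.
- by eapply (@stage_int_norm _ _ _ _ _ _ sepD co _ _ ex); eassumption.
- by eapply stage_hom_linear; eassumption.
- by eapply stage_hom_star; eassumption.
- by eapply stage_hom_norm; eassumption.
- by eapply stage_comm; eassumption.
- by eapply stage_int1; eassumption.
- by eapply stage_mul; eassumption.
- by eapply (@stage_proj _ _ _ _ _ _ sepD co _ _ ex); eassumption.
- by eapply (@stage_vector _ _ _ _ _ _ sepD co _ _ ex); eassumption.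
- by eapply stage_free; eassumption.
- by move=> xs; eapply stage_amplify; eassumption.
Qed.

Lemma unitary_tensor v (d : R) : unitary v -> 0 < d -> exists ws,
  ‖[tensor_sum al be ws]‖ <= 1 /\ ‖[v - tensor_sum al be ws]‖ <= d.
Proof.
move=> uv d0; have d2 : 0 < d / 2 by lra.
have [xs hxs] := core_dense co v d2; set X := tensor_sum al be xs in hxs.
have nv : ‖[v]‖ = 1 by apply: cnorm_isometry; exact: unitary_iso.
have nX : ‖[X]‖ <= 1 + d / 2 by have := cnormB_ge X v; rewrite cnormBC nv; lra.
pose k := (1 + d / 2)^-1; have k0 : 0 < k by rewrite invr_gt0; lra.
have kk : k * (1 + d / 2) = 1 by rewrite mulVf //; apply/lt0r_neq0; lra.
exists [seq (k%:C *: p.1, p.2) | p <- xs]; rewrite tensor_sumZ -/X; last exact: hal.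
split; first by rewrite cnorm_scale ?(ltW k0) //; nra.
have -> : v - k%:C *: X = (v - X) + (1 - k)%:C *: X by rewrite rcB scalerBl scale1C; ncring.
apply: le_trans (cnormD _ _) _; rewrite cnorm_scale; last by nra.
have : (1 - k) * ‖[X]‖ <= (1 - k) * (1 + d / 2) by apply: ler_wpM2l => //; nra.
by move: hxs; move: (‖[v - X]‖) => a; lra.
Qed.

Let smallN (f : nat -> R) (C : R) : (forall d, 0 < d -> exists N, forall n, (N <= n)%N -> f n < d) ->
  0 <= C -> forall d, 0 < d -> exists N, forall n, (N <= n)%N -> C * f n < d.
Proof.
move=> h C0 d d0; have C1 : 0 < C + 1 by lra.
have [N hN] := h _ (divr_gt0 d0 C1); exists N => n /hN; rewrite ltr_pdivlMr //.
by case: (ltP (f n) 0); nra.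
Qed.

(** Unitaries implementing the equivalence of [al] and [be] are replaced by finite tensors of norm
    at most 1. Of unitarity only [W n * star (W n)] close to 1 is recorded, as the stages
    require. *)
Lemma flip_tensors : exists ws : nat -> seq (D * D), let W n := tensor_sum al be (ws n) in
  [/\ forall n, ‖[W n]‖ <= 1,
      forall d : R, 0 < d -> exists N, forall n, (N <= n)%N -> ‖[W n * star (W n) - 1]‖ < d
    & forall a (d : R), 0 < d -> exists N, forall n, (N <= n)%N ->
        ‖[star (W n) * be a - al a * star (W n)]‖ < d].
Proof.
have [v [uv hv]] := core_aue_albe co.
have H n : exists ws, ‖[tensor_sum al be ws]‖ <= 1 /\ ‖[v n - tensor_sum al be ws]‖ <= 2 / n.+1%:R.
  by apply: unitary_tensor => //; rewrite divr_gt0 // ltr0n.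
have [ws hws] := choice H; exists ws => W.
have W1 n : ‖[W n]‖ <= 1 by have [] := hws n.
have vW n : ‖[v n - W n]‖ <= 2 / n.+1%:R by have [] := hws n.
have nv n : ‖[v n]‖ <= 1 by rewrite cnorm_isometry //; exact: unitary_iso.
have sm (d : R) : 0 < d -> exists N, forall n, (N <= n)%N -> ‖[v n - W n]‖ < d.
  exact: null_inv vW _.
split=> // [d d0|a d d0].
  have d2 : 0 < d / 2 by lra.
  have [N hN] := sm _ d2; exists N => n /hN h.
  have -> : W n * star (W n) - 1 = - ((v n - W n) * star (W n) + v n * star (v n - W n)).
    by rewrite -(uv n).2 starB; ncring.
  rewrite cnormN; apply: le_lt_trans (cnormD _ _) _.
  have h1 : ‖[(v n - W n) * star (W n)]‖ <= ‖[v n - W n]‖ by apply: cnormM_le1r; rewrite ?cnorm_star.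
  have h2 : ‖[v n * star (v n - W n)]‖ <= ‖[v n - W n]‖ by apply: cnormM_le1; rewrite ?cnorm_star.
  by lra.
have A0 : 0 < 4 * (‖[a]‖ + 1) by have := cnorm_ge0 a; lra.
have d2 : 0 < d / 2 by lra.
have [N hN] := sm _ (divr_gt0 d0 A0); have [M hM] := hv a _ d2.
exists (N + M)%N => n nm; have {}hN := hN n (leq_trans (leq_addr _ _) nm).
have {}hM := hM n (leq_trans (leq_addl _ _) nm).
have -> : star (W n) * be a - al a * star (W n)
  = al a * star (v n - W n) - star (v n - W n) * be a - star (v n) * (v n * al a * star (v n) - be a).
  have -> : star (v n) * (v n * al a * star (v n) - be a) = (star (v n) * v n) * al a * star (v n) - star (v n) * be a.
    by ncring.
  by rewrite (uv n).1 starB; ncring.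
apply: le_lt_trans (cnormB _ _) _.
have h1 : ‖[star (v n) * (v n * al a * star (v n) - be a)]‖ < d / 2.
  by rewrite cnorm_isoMl //; apply: unitary_iso; exact: unitary_star.
have h2 : ‖[al a * star (v n - W n)]‖ <= ‖[a]‖ * ‖[v n - W n]‖.
  by apply: cnormM_le; rewrite ?(al_norm co) ?cnorm_star.
have h3 : ‖[star (v n - W n) * be a]‖ <= ‖[v n - W n]‖ * ‖[a]‖.
  by apply: cnormM_le; rewrite ?(be_norm co) ?cnorm_star.
have := cnormB (al a * star (v n - W n)) (star (v n - W n) * be a).
move: hN; rewrite ltr_pdivlMr //; have := cnorm_ge0 a; have := cnorm_ge0 (v n - W n); nra.
Qed.

(** Along the flip tensors the defects of the stages vanish, so they give exact data for
    [dilation_hom] in the sequence algebra. A representative of the isometry [Z] is merely bounded,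
    by [K], whence the constant [C = K * K]. *)
Theorem approximate_homs : exists (rho : nat -> D -> B) (C : R),
  [/\ 0 <= C, forall d, bnd (rho^~ d), uhom (fun d => qc (rho^~ d))
    & forall n xs, ‖[tensor_sum al (be \o i \o rho n) xs]‖ <= C * ‖[tensor_sum al be xs]‖].
Proof.
have [ws [W1 WW Wf]] := flip_tensors.
have H n : exists p : B * (D -> B), stage (tensor_sum al be (ws n)) p.1 p.2.
  by have [x [io h]] := stage_exists (W1 n); exists (x, io).
have [p hp] := choice H.
pose x n := (p n).1; pose io d n := (p n).2 d.
have bx : bnd x by exists 1 => n; exact: sg_norm (hp n).
have bio d : bnd (io d) by exists ‖[d]‖ => n; exact: sg_bnd (hp n) d.
have bsx := bndS bx; have bxx := bndM bsx bx.
pose y n := star (x n) * x n.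
have y1 n : ‖[y n]‖ <= 1.
  by rewrite /y cstar_identity expr_le1 ?cnorm_ge0 //; exact: sg_norm (hp n).
have sy n : star (y n) = y n by rewrite /y starM starK.
pose X := qc x; pose I d := qc (io d); pose S := qc (fun n => sqrt1m (y n)).
have yE : qc y = star X * X by rewrite /y (qcM bsx bx) (qcS bx).
have le_null (f : nat -> B) (h : nat -> R) (K : R) : 0 <= K -> (forall n, ‖[f n]‖ <= K * h n) ->
    (forall d, 0 < d -> exists N, forall n, (N <= n)%N -> h n < d) -> null f.
  move=> K0 fh hh; apply: (null_le fh); exact: smallN.
have cq := cuntz_map (qk_uhom B) ct; have [oq sq] := cq.
have bt := bndc (t false).
have [||||||||||||||||||Z [ZZ uZ]] := @dilation_hom R D (seqalg B) X S (qk (t false)) (qk (t true)) (qk (t false)) I.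
- by move=> c d d'; rewrite /I -(qcZ c (bio d)) -(qcD (bndZ c (bio d)) (bio d')); apply: qc_ext => n; exact: sg_lin (hp n) c d d'.
- by move=> d; rewrite /I -(qcS (bio d)); apply: qc_ext => n; exact: sg_star (hp n) d.
- move=> d; rewrite /X /I -(qcM bx (bio d)) -(qcM (bio d) bx).
  apply/qcP; [exact: bndM|exact: bndM|].
  by apply: (le_null _ _ 1) (Wf d) => // n; rewrite mul1r; exact: sg_comm (hp n) d.
- rewrite -yE /X -(qcM bxx bx); apply/qcP; [exact: bndM|exact: bx|].
  by apply: (le_null _ _ 1) WW => // n; rewrite mul1r; exact: sg_proj (hp n).
- move=> d d'; rewrite /X /I -(qcM bx (bio d)) -(qcM (bndM bx (bio d)) (bio d')) -(qcM bx (bio (d * d'))).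
  apply/qcP; [apply: bndM => //; exact: bndM|exact: bndM|].
  apply: (le_null _ _ (2 * ‖[d']‖)) (Wf d) => [|n]; first by rewrite mulr_ge0 ?cnorm_ge0.
  by apply: le_trans (sg_mul (hp n) d d') _; rewrite -(mulrA 2) (mulrC ‖[d']‖).
- by rewrite /X /I -(qcM bx (bio 1)); apply: qc_ext => n; exact: sg_one (hp n).
- rewrite -yE /qk -(qcM bxx bt); apply/qcP; [exact: bndM|exact: bt|].
  by apply: (le_null _ _ 1) WW => // n; rewrite mul1r; exact: sg_vec (hp n).
- rewrite /X /qk -(qcS bx) -(qcM bt bt) -(qcM bsx (bndM bt bt)) -qc0.
  by apply: qc_ext => n; exact: sg_free (hp n).
- exact: qroot_star.
- by rewrite -yE; exact: qroot_sqr.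
- by move=> z; rewrite -yE; exact: qroot_comm.
- by move=> z; rewrite -yE; exact: qroot_id.
- exact: seqalg_proper.
- exact: (oq false false).
- exact: (oq true true).
- exact: (oq false false).
- exact: (oq true false).
- exact: sq.
pose z := qr Z; have bz : bnd z := qr_bnd Z; have [K K0 hK] := bndP bz.
pose rho n d := star (z n) * io d n * z n.
exists rho, (K * K); split; first by rewrite mulr_ge0 // ltW.
- by move=> d; apply: bndM => //; apply: bndM => //; exact: bndS.
- have -> : (fun d => qc (rho^~ d)) = (fun d => star Z * I d * Z).
    apply/funext => d; rewrite /rho (qcM (bndM (bndS bz) (bio d)) bz) (qcM (bndS bz) (bio d)) (qcS bz).
    by rewrite qrK.
  exact: uZ.
move=> n xs; have -> : tensor_sum al (be \o i \o rho n) xs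
  = star (be (i (z n))) * tensor_sum al (be \o i \o (p n).2) xs * be (i (z n)).
  rewrite /tensor_sum mulr_sumr mulr_suml; apply: eq_bigr => q _ /=.
  rewrite /rho !(homM ui.1) (homS ui.1) !(homM hbe) (homS hbe) !mulrA.
  by rewrite -(homS hbe) -cab.
have nb : ‖[be (i (z n))]‖ <= K by rewrite (be_norm co) ni.
apply: (@le_trans _ _ (K * ‖[tensor_sum al be xs]‖ * K)); last by rewrite mulrAC lexx.
by apply: cnormM_le => //; apply: cnormM_le; [rewrite cnorm_star|exact: sg_amp (hp n) xs].
Qed.

End ApproximateHoms.

(** * Intertwining *)

Lemma list_eventually (T : eqType) (F : seq T) (P : T -> nat -> Prop) :
  (forall x, x \in F -> exists N, forall n, (N <= n)%N -> P x n) ->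
  exists N, forall x n, x \in F -> (N <= n)%N -> P x n.
Proof.
elim: F => [|a F IH] h; first by exists 0%N.
have [N hN] := IH (fun x xF => h x (mem_behead (s := a :: F) xF)).
have [M hM] := h a (mem_head a F); exists (N + M)%N => x n; rewrite inE => /orP[/eqP ->|xF] nm.
  by apply: hM; exact: leq_trans (leq_addl _ _) nm.
by apply: hN => //; exact: leq_trans (leq_addr _ _) nm.
Qed.

Lemma list_bound (R : realType) (A : cstarAlgType R) (F : seq A) :
  exists2 M : R, 0 < M & forall x, x \in F -> ‖[x]‖ <= M.
Proof.
elim: F => [|a F [M M0 h]]; first by exists 1.
exists (M + ‖[a]‖); first by rewrite ltr_wpDr ?cnorm_ge0.
move=> x; rewrite inE => /orP[/eqP ->|/h]; first by rewrite lerDr ltW.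
by move=> xM; apply: le_trans xM _; rewrite lerDl cnorm_ge0.
Qed.

Section ConjugateIntoCuntz.
Variables (R : realType) (D B : cstarAlgType R) (al be ta : D -> D).
Hypotheses (sepD : separable D) (co : ssa_core al be ta).
Variables (i : B -> D) (t : bool -> B).
Hypotheses (ui : uhom i) (ni : forall x, ‖[i x]‖ = ‖[x]‖) (ct : cuntz t).

Let hal := (core_al co).1.
Let hbe := (core_be co).1.
Let cab := core_comm co.
Let al1 : al 1 = 1 := (core_al co).2.
Let be1 : be 1 = 1 := (core_be co).2.

Section Amplified.
Variables (th : nat -> D -> D) (C : R).
Hypotheses (C0 : 0 <= C) (thM : forall d d', null (fun n => th n d * th n d' - th n (d * d')))
  (thS : forall d, null (fun n => star (th n d) - th n (star d)))
  (th1 : null (fun n => th n 1 - 1))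
  (thc : forall n a d, al a * th n d = th n d * al a)
  (thn : forall n xs, ‖[tensor_sum al (th n) xs]‖ <= C * ‖[tensor_sum al be xs]‖).

(* [f] is asymptotically the image of [x] under [al a * be b |-> al a * th n b]. *)
Definition amplified (f : nat -> D) (x : D) := bnd f /\
  exists xs, tensor_sum al be xs = x /\ null (fun n => f n - tensor_sum al (th n) xs).

Lemma amplified_norm f x (d : R) : amplified f x -> 0 < d ->
  exists N, forall n, (N <= n)%N -> ‖[f n]‖ <= C * ‖[x]‖ + d.
Proof.
move=> [_ [xs [<- h]]] d0; have [N hN] := h _ d0; exists N => n /hN h1.
have := cnormB_ge (f n) (tensor_sum al (th n) xs); have := thn n xs; lra.
Qed.

Let thb d : bnd (th^~ d).
Proof.
exists (C * ‖[d]‖) => n; have := thn n [:: (1, d)].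
by rewrite /tensor_sum !big_seq1 /= al1 !mul1r (be_norm co).
Qed.

Let bts xs : bnd (fun n => tensor_sum al (th n) xs).
Proof. by exists (C * ‖[tensor_sum al be xs]‖) => n; exact: thn. Qed.

Let null_big (I : Type) (r : seq I) (F : I -> nat -> D) :
  (forall i, null (F i)) -> null (fun n => \sum_(i <- r) F i n).
Proof.
move=> h; elim: r => [|a r IH]; first by apply: null_ext (null0 D) => n; rewrite big_nil.
by apply: null_ext (nullD (h a) IH) => n; rewrite big_cons.
Qed.

Lemma amplified_al a : amplified (fun=> al a) (al a).
Proof.
split; first exact: bndc.
exists [:: (a, 1)]; rewrite /tensor_sum big_seq1 /= be1 mulr1; split=> //.
apply: null_ext (nullMl (bndc (- al a)) th1) => n.
by rewrite big_seq1 /= mulrBr mulr1 mulNr opprK addrC.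
Qed.

Lemma amplified_th d : amplified (th^~ d) (be d).
Proof.
split; first exact: thb.
exists [:: (1, d)]; rewrite /tensor_sum big_seq1 /= al1 mul1r; split=> //.
by apply: null_ext (null0 D) => n; rewrite big_seq1 /= al1 mul1r subrr.
Qed.

Lemma amplified_sum xs : amplified (fun n => tensor_sum al (th n) xs) (tensor_sum al be xs).
Proof.
by split=> //; exists xs; split=> //; apply: null_ext (null0 D) => n; rewrite subrr.
Qed.

Lemma amplifiedB f g x y : amplified f x -> amplified g y -> amplified (fun n => f n - g n) (x - y).
Proof.
move=> [bf [xs [<- hf]]] [bg [ys [<- hg]]]; split; first exact: bndB.
have e (h : D -> D) : tensor_sum al h [seq ((-1) *: p.1, p.2) | p <- ys] = - tensor_sum al h ys.
  by rewrite (tensor_sumZ h hal) scaleN1r.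
exists (xs ++ [seq ((-1) *: p.1, p.2) | p <- ys]); rewrite tensor_sum_cat e; split=> //.
apply: null_ext (nullD hf (nullN hg)) => n; rewrite tensor_sum_cat e; ncring.
Qed.

Lemma amplifiedM f g x y : amplified f x -> amplified g y -> amplified (fun n => f n * g n) (x * y).
Proof.
move=> [bf [xs [<- hf]]] [bg [ys [<- hg]]]; split; first exact: bndM.
exists [seq (p.1 * q.1, p.2 * q.2) | p <- xs, q <- ys]; rewrite tensor_sumM //; split=> //.
have h : null (fun n => tensor_sum al (th n) xs * tensor_sum al (th n) ys
    - tensor_sum al (th n) [seq (p.1 * q.1, p.2 * q.2) | p <- xs, q <- ys]).
  apply: (@null_ext _ _ (fun n => \sum_(p <- xs) \sum_(q <- ys)
      al (p.1 * q.1) * (th n p.2 * th n q.2 - th n (p.2 * q.2)))) => [n|].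
    rewrite /tensor_sum big_allpairs_dep mulr_suml -sumrB; apply: eq_bigr => p _.
    rewrite mulr_sumr -sumrB; apply: eq_bigr => q _ /=; rewrite mulrBr; congr (_ - _).
    by rewrite (homM hal) -!mulrA; congr (_ * _); rewrite !mulrA thc.
  by apply: null_big => p; apply: null_big => q; apply: nullMl => //; exact: bndc.
apply: null_ext (nullD (nullD (nullMr hf bg) (nullMl (bts xs) hg)) h) => n; ncring.
Qed.

Lemma amplifiedS f x : amplified f x -> amplified (fun n => star (f n)) (star x).
Proof.
move=> [bf [xs [<- hf]]]; split; first exact: bndS.
exists [seq (star p.1, star p.2) | p <- xs]; rewrite tensor_sumS //; split=> //.
have h : null (fun n => star (tensor_sum al (th n) xs) - tensor_sum al (th n) [seq (star p.1, star p.2) | p <- xs]).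
  apply: (@null_ext _ _ (fun n => \sum_(p <- xs) al (star p.1) * (star (th n p.2) - th n (star p.2)))) => [n|].
    rewrite /tensor_sum big_map star_sum -sumrB; apply: eq_bigr => p _ /=.
    rewrite mulrBr; congr (_ - _); rewrite (homS hal) starM.
    by rewrite -!starM thc.
  by apply: null_big => p; apply: nullMl => //; exact: bndc.
apply: null_ext (nullD (nullS hf) h) => n; rewrite starB; ncring.
Qed.

(** A tensor [W] near a unitary carrying [be d] to [al d] is rewritten with [th n] as its second
    leg. The bound [thn] transfers the defects of [W] to [T n] up to the factor [C] and a small
    error, and polar decomposition restores unitarity. *)
Lemma amplified_unitary (F : seq D) (eps : R) : 0 < eps ->
  exists N, forall n, (N <= n)%N -> exists u, unitary u /\
    forall d, d \in F -> ‖[u * th n d * star u - al d]‖ <= eps.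
Proof.
move=> e0; have [M M0 hM] := list_bound F.
have CM : 0 <= C * M by rewrite mulr_ge0 // ltW.
(* [4 * K] bounds the sum of the final errors in units of [dl]; the second bound on [dl] keeps the
   unitarity defect [r] below 1/4. *)
pose K := 12 * (C + 1) * (C * M) + 2 * (C * M) + C + 1; have K0 : 0 < K by rewrite /K; nra.
pose dl := Num.min (eps / (4 * K)) (8 * (C + 1))^-1.
have K4 : 0 < 4 * K by rewrite mulr_gt0.
have C8 : 0 < 8 * (C + 1) by rewrite mulr_gt0 // ltr_wpDl.
have dl0 : 0 < dl by rewrite lt_min divr_gt0 ?invr_gt0.
have dlC : dl * (8 * (C + 1)) <= 1.
  by rewrite -ler_pdivlMr // div1r /dl ge_min lexx orbT.
have dlK : dl * (4 * K) <= eps by rewrite -ler_pdivlMr // /dl ge_min lexx.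
have [v [uv hv]] := aue_sym (core_aue_albe co).
have [n0 hn0] : exists n0, forall d, d \in F -> ‖[v n0 * be d * star (v n0) - al d]‖ <= dl.
  have [|N hN] := @list_eventually _ F (fun d n => ‖[v n * be d * star (v n) - al d]‖ <= dl).
    by move=> d _; have [N hN] := hv d _ dl0; exists N => n /hN /ltW.
  by exists N => d /hN; exact.
set V := v n0 in hn0; have uV : unitary V := uv n0.
have nV : ‖[V]‖ <= 1 by rewrite cnorm_isometry //; exact: unitary_iso.
have [ws [W1 VW]] := unitary_tensor co uV dl0; set W := tensor_sum al be ws in W1 VW.
have sVW : ‖[star V - star W]‖ <= dl by rewrite -starB cnorm_star.
have WW1 : ‖[star W * W - 1]‖ <= 2 * dl.
  have -> : star W * W - 1 = - ((star V - star W) * W + star V * (V - W)) by rewrite -uV.1; ncring.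
  rewrite cnormN; apply: le_trans (cnormD _ _) _; rewrite [2 * _]mulr_natl mulr2n; apply: lerD.
    by apply: cnormM_le1r.
  by apply: cnormM_le1; rewrite ?cnorm_star.
have WW2 : ‖[W * star W - 1]‖ <= 2 * dl.
  have -> : W * star W - 1 = - ((V - W) * star W + V * (star V - star W)) by rewrite -uV.2; ncring.
  rewrite cnormN; apply: le_trans (cnormD _ _) _; rewrite [2 * _]mulr_natl mulr2n; apply: lerD.
    by apply: cnormM_le1r; rewrite ?cnorm_star.
  by apply: cnormM_le1.
have Wd d : d \in F -> ‖[W * be d * star W - al d]‖ <= (2 * M + 1) * dl.
  move=> dF; have nd : ‖[be d]‖ <= M by rewrite (be_norm co); exact: hM.
  have -> : W * be d * star W - al d = (V * be d * star V - al d)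
      - ((V - W) * be d * star W + V * be d * (star V - star W)) by ncring.
  apply: le_trans (cnormB _ _) _; have h1 := hn0 d dF.
  have h2 : ‖[(V - W) * be d * star W]‖ <= dl * M.
    by apply: cnormM_le1r; rewrite ?cnorm_star //; exact: cnormM_le.
  have h3 : ‖[V * be d * (star V - star W)]‖ <= M * dl.
    by apply: cnormM_le => //; exact: cnormM_le1.
  by have := cnormD ((V - W) * be d * star W) (V * be d * (star V - star W)); lra.
pose T n := tensor_sum al (th n) ws; have aT := amplified_sum ws; rewrite -/W in aT.
have aTs := amplifiedS aT; have a1 := amplified_al 1; rewrite al1 in a1.
have [N1 hN1] := amplified_norm (amplifiedB (amplifiedM aTs aT) a1) dl0.
have [N2 hN2] := amplified_norm (amplifiedB (amplifiedM aT aTs) a1) dl0.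
have [|N3 hN3] := @list_eventually _ F (fun d n =>
    ‖[T n * th n d * star (T n) - al d]‖ <= C * ((2 * M + 1) * dl) + dl).
  move=> d dF; have [N hN] := amplified_norm (amplifiedB (amplifiedM (amplifiedM aT (amplified_th d)) aTs) (amplified_al d)) dl0.
  exists N => n /hN h; apply: le_trans h _; rewrite lerD2r ler_wpM2l //; exact: Wd.
exists (N1 + (N2 + N3))%N => n nm.
have {}hN1 := hN1 n (leq_trans (leq_addr _ _) nm).
have {}hN2 := hN2 n (leq_trans (leq_trans (leq_addr _ _) (leq_addl _ _)) nm).
have {}hN3 d dF := hN3 d n dF (leq_trans (leq_trans (leq_addl _ _) (leq_addl _ _)) nm).
rewrite -/(T n) in hN1 hN2.
pose r := 2 * (C + 1) * dl.
have r1 : ‖[star (T n) * T n - 1]‖ <= r.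
  by apply: le_trans hN1 _; rewrite /r; have := ler_wpM2l C0 WW1; nra.
have r2 : ‖[T n * star (T n) - 1]‖ <= r.
  by apply: le_trans hN2 _; rewrite /r; have := ler_wpM2l C0 WW2; nra.
have r4 : r <= 4^-1 by rewrite /r; lra.
have r0 : 0 <= r by exact: le_trans (cnorm_ge0 _) r1.
have rh : r <= 2^-1 by lra.
have [|p [sp up np]] := polar_unitary rh r1; first by apply: le_lt_trans r2 _; lra.
exists (T n * p); split=> // d dF.
have nT : ‖[T n]‖ <= 2.
  have := cstar_identity (T n); have := cnormB_ge (star (T n) * T n) 1; rewrite cnorm1.
  by have := cnorm_ge0 (T n); nra.
have np2 : ‖[p]‖ <= 2 by have := cnormB_ge p 1; rewrite cnorm1; lra.
have nth : ‖[th n d]‖ <= C * M.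
  have := thn n [:: (1, d)]; rewrite /tensor_sum !big_seq1 /= al1 !mul1r (be_norm co) => h.
  by apply: le_trans h _; rewrite ler_wpM2l //; exact: hM.
have -> : T n * p * th n d * star (T n * p) - al d
  = T n * ((p - 1) * th n d * p + th n d * (p - 1)) * star (T n) + (T n * th n d * star (T n) - al d).
  by rewrite starM sp; ncring.
apply: le_trans (cnormD _ _) _.
have k1 : ‖[(p - 1) * th n d * p + th n d * (p - 1)]‖ <= 2 * r * (C * M) * 2 + C * M * (2 * r).
  apply: le_trans (cnormD _ _) _; apply: lerD; last exact: cnormM_le.
  by apply: cnormM_le => //; exact: cnormM_le.
have k2 : ‖[T n * ((p - 1) * th n d * p + th n d * (p - 1)) * star (T n)]‖
    <= 2 * (2 * r * (C * M) * 2 + C * M * (2 * r)) * 2.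
  by apply: cnormM_le; [exact: cnormM_le|rewrite cnorm_star].
have k3 := hN3 d dF.
apply: le_trans (lerD k2 k3) _; apply: le_trans _ dlK.
have -> : 2 * (2 * r * (C * M) * 2 + C * M * (2 * r)) * 2 + (C * ((2 * M + 1) * dl) + dl)
  = dl * (48 * (C + 1) * C * M + C * (2 * M + 1) + 1) by rewrite /r; ring.
rewrite ler_wpM2l ?(ltW dl0) // /K; nra.
Qed.

End Amplified.
(** [v] composes three approximate conjugations: from [d] to [al d], from [al d] to
    [be (i (rho N d))] by the unitary just built, and from there to [i (rho N d)]. *)
Theorem conjugate_into (F : seq D) (eps : R) : 0 < eps -> exists v, unitary v /\
  forall d, d \in F -> exists b, ‖[v * d * star v - i b]‖ <= eps.
Proof.
move=> e0; have [rho [C [C0 brho urho nrho]]] := approximate_homs sepD co ui ni ct.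
have [hrho rho1] := urho.
pose bi (b : B) := be (i b); have ubi : uhom bi := uhom_comp ui (core_be co).
have nullbi x : null x -> null (bi \o x).
  by move=> h d /h[N hN]; exists N => n /hN; apply: le_lt_trans; exact: uhom_norm.
pose th n d := bi (rho n d).
have thM d d' : null (fun n => th n d * th n d' - th n (d * d')).
  have : null (fun n => rho n d * rho n d' - rho n (d * d')).
    by apply: (proj1 (qcP (bndM (brho d) (brho d')) (brho (d * d')))); rewrite (qcM (brho d) (brho d')) -(homM hrho).
  by move=> /nullbi; apply: null_ext => n; rewrite /= (homB ubi.1) (homM ubi.1).
have thS d : null (fun n => star (th n d) - th n (star d)).
  have : null (fun n => star (rho n d) - rho n (star d)).
    by apply: (proj1 (qcP (bndS (brho d)) (brho (star d)))); rewrite (qcS (brho d)) -(homS hrho).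
  by move=> /nullbi; apply: null_ext => n; rewrite /= (homB ubi.1) (homS ubi.1).
have th1 : null (fun n => th n 1 - 1).
  have : null (fun n => rho n 1 - 1) by apply: (proj1 (qcP (brho 1) (bndc 1))); rewrite rho1.
  by move=> /nullbi; apply: null_ext => n; rewrite /= (homB ubi.1) ubi.2.
have thc n a d : al a * th n d = th n d * al a by exact: cab.
have e3 : 0 < eps / 3 by lra.
have [N hN] := amplified_unitary C0 thM thS th1 thc nrho F e3.
have [u [uu hu]] := hN N (leqnn N).
have [x [ux hx]] := aue_sym (core_aue_al co).
have [y [uy hy]] := aue_sym (core_aue_be co).
have [|n1 h1] := @list_eventually _ F (fun d n => ‖[x n * al d * star (x n) - d]‖ <= eps / 3).
  by move=> d _; have [M hM] := hx d _ e3; exists M => n /hM /ltW.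
have [|n2 h2] := @list_eventually _ F (fun d n => ‖[y n * th N d * star (y n) - i (rho N d)]‖ <= eps / 3).
  by move=> d _; have [M hM] := hy (i (rho N d)) _ e3; exists M => n /hM /ltW.
set X := x n1; set Y := y n2; have uX : unitary X := ux n1; have uY : unitary Y := uy n2.
exists (Y * star u * star X); split.
  by apply: unitaryM; [apply: unitaryM => //; exact: unitary_star|exact: unitary_star].
move=> d dF; exists (rho N d).
have k1 := h1 d n1 dF (leqnn _); have k2 := h2 d n2 dF (leqnn _); have k3 := hu d dF.
rewrite -/X in k1; rewrite -/Y in k2.
have -> : Y * star u * star X * d * star (Y * star u * star X) - i (rho N d)
  = - (Y * star u * star X * (X * al d * star X - d) * star (Y * star u * star X))
    - Y * (star u * (u * th N d * star u - al d) * u) * star Y + (Y * th N d * star Y - i (rho N d)).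
  rewrite !starM !starK; transitivity (- (Y * star u * (star X * X) * al d * (star X * X) * u * star Y)
     + Y * star u * star X * d * X * u * star Y - Y * (star u * u) * th N d * (star u * u) * star Y
     + Y * star u * al d * u * star Y + Y * th N d * star Y - i (rho N d)); last by ncring.
  by rewrite uX.1 uu.1; ncring.
have uv : unitary (Y * star u * star X).
  by apply: unitaryM; [apply: unitaryM => //; exact: unitary_star|exact: unitary_star].
apply: le_trans (cnormD _ _) _; have -> : eps = eps / 3 + eps / 3 + eps / 3 by field.
apply: lerD => //; apply: le_trans (cnormB _ _) _; rewrite cnormN cnorm_conj //.
apply: lerD => //; rewrite cnorm_conj //.
by have := cnorm_conj (u * th N d * star u - al d) (unitary_star uu); rewrite starK => ->.
Qed.

End ConjugateIntoCuntz.

(** * One-sided intertwining of the inclusion *)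

Section Intertwining.
Variables (R : realType) (D B : cstarAlgType R) (i : B -> D) (r : bool -> B).
Hypotheses (ui : uhom i) (ni : forall x, ‖[i x]‖ = ‖[x]‖) (cr : cuntz r)
  (gen : cstar_generated_by [set r true; r false]%classic)
  (into : forall (F : seq D) (eps : R), 0 < eps -> exists v, unitary v /\
     forall d, d \in F -> exists b, ‖[v * d * star v - i b]‖ <= eps)
  (sepD : separable D).

Lemma hom_ev (A C : starAlgType R) (f : A -> C) (t : bool -> A) ps : uhom f ->
  f (ev t ps) = ev (f \o t) ps.
Proof.
move=> [hf f1]; have hw a : f (wd t a) = wd (f \o t) a.
  by elim: a => //= j a IH; rewrite (homM hf) IH.
rewrite /ev (hom_sum hf); apply: eq_bigr => p _.
by rewrite (homZ hf) /mon (homM hf) (homS hf) !hw.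
Qed.

Lemma central_list (S : seq B) (eps : R) : 0 < eps -> exists2 e, 0 < e &
  forall u, isometry u -> (forall j, ‖[i (r j) * u - u * i (r j)]‖ <= e) ->
  forall s, s \in S -> ‖[i s * u - u * i s]‖ <= eps.
Proof.
move=> e0; elim: S => [|s S [e e_0 he]]; first by exists 1.
have e4 : 0 < eps / 4 by lra.
have [ps hps] := ev_generated cr gen s e4.
have [e' e'0 he'] := almost_central ps (cuntz_map ui cr) e4.
exists (Num.min e e') => [|u iu hu x]; first by rewrite lt_min e_0.
rewrite inE => /orP[/eqP ->|xS]; last first.
  by apply: he => // j; apply: le_trans (hu j) _; rewrite ge_min lexx.
have h : ‖[i (ev r ps) * u - u * i (ev r ps)]‖ <= eps / 4.
  by rewrite hom_ev //; apply: he' => // j; apply: le_trans (hu j) _; rewrite ge_min lexx orbT.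
have -> : i s * u - u * i s = i (s - ev r ps) * u - u * i (s - ev r ps) + (i (ev r ps) * u - u * i (ev r ps)).
  by rewrite (homB ui.1); ncring.
have n1 : ‖[i (s - ev r ps) * u]‖ <= eps / 4.
  by apply: cnormM_le1r; rewrite ?ni ?(ltW hps) // cnorm_isometry.
have n2 : ‖[u * i (s - ev r ps)]‖ <= eps / 4.
  by apply: cnormM_le1; rewrite ?ni ?(ltW hps) // cnorm_isometry.
have := cnormD (i (s - ev r ps) * u - u * i (s - ev r ps)) (i (ev r ps) * u - u * i (ev r ps)).
have := cnormB (i (s - ev r ps) * u) (u * i (s - ev r ps)); lra.
Qed.

(** [U] carries the pair [r] to [b], and [i U] is within [2 * d] of the unitary [V], so the polar
    correction of [U] takes place in [B]. Its defect [5 * d] gives [‖[p - 1]‖ <= 10 * d], and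
    [(1 + 2 * d) * 10 * d <= 12 * d] for [d <= 1 / 10]. *)
Lemma cuntz_perturb (bt : bool -> D) (b : bool -> B) (d : R) : cuntz bt -> 0 <= d -> d <= 10^-1 ->
  (forall j, ‖[bt j - i (b j)]‖ <= d) -> exists r', cuntz r' /\ forall j, ‖[r' j - b j]‖ <= 12 * d.
Proof.
move=> cb d0 d1 hb; pose U := b true * star (r true) + b false * star (r false).
have Ur j : U * r j = b j.
  rewrite mulrDl -!mulrA !cr.1; by case: j; rewrite /= mulr1 mulr0 ?addr0 ?add0r.
pose V := bt true * star (i (r true)) + bt false * star (i (r false)).
have cir := cuntz_map ui cr; have [o s] := cir; have [ob sb] := cb.
have VV : star V * V = 1.
  rewrite /V starD !starM !starK.
  transitivity (i (r true) * (star (bt true) * bt true) * star (i (r true))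
    + i (r true) * (star (bt true) * bt false) * star (i (r false))
    + i (r false) * (star (bt false) * bt true) * star (i (r true))
    + i (r false) * (star (bt false) * bt false) * star (i (r false))); first by ncring.
  by rewrite !ob /= !mulr1 !mulr0 !mul0r !addr0; exact: s.
have VV' : V * star V = 1.
  rewrite /V starD !starM !starK.
  transitivity (bt true * (star (i (r true)) * i (r true)) * star (bt true)
    + bt true * (star (i (r true)) * i (r false)) * star (bt false)
    + bt false * (star (i (r false)) * i (r true)) * star (bt true)
    + bt false * (star (i (r false)) * i (r false)) * star (bt false)); first by ncring.
  have o' j k : star (i (r j)) * i (r k) = (j == k)%:R := o j k.
  by rewrite !o' /= !mulr1 !mulr0 !mul0r !addr0.
have iU : i U = i (b true) * star (i (r true)) + i (b false) * star (i (r false)).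
  by rewrite /U (homD ui.1) !(homM ui.1) !(homS ui.1).
have nr j : ‖[star (i (r j))]‖ <= 1 by rewrite cnorm_star ni cnorm_isometry //; exact: cuntz_iso.
have nV : ‖[V]‖ = 1 by apply: cnorm_isometry.
have UV : ‖[V - i U]‖ <= 2 * d.
  have -> : V - i U = (bt true - i (b true)) * star (i (r true)) + (bt false - i (b false)) * star (i (r false)).
    by rewrite iU /V; ncring.
  apply: le_trans (cnormD _ _) _; rewrite [2 * d]mulr_natl mulr2n.
  by apply: lerD; apply: cnormM_le1r.
have nU : ‖[i U]‖ <= 1 + 2 * d by have := cnormB_ge (i U) V; rewrite cnormBC nV; lra.
have UU : ‖[star U * U - 1]‖ <= 5 * d.
  rewrite -ni (homB ui.1) (homM ui.1) (homS ui.1) ui.2.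
  have -> : star (i U) * i U - 1 = - (star (V - i U) * i U + star V * (V - i U)).
    by rewrite -VV starB; ncring.
  rewrite cnormN; apply: le_trans (cnormD _ _) _.
  have n1 : ‖[star (V - i U) * i U]‖ <= 2 * d * (1 + 2 * d) by apply: cnormM_le; rewrite ?cnorm_star.
  have n2 : ‖[star V * (V - i U)]‖ <= 2 * d by apply: cnormM_le1; rewrite ?cnorm_star ?nV.
  nra.
have UU' : ‖[U * star U - 1]‖ <= 5 * d.
  rewrite -ni (homB ui.1) (homM ui.1) (homS ui.1) ui.2.
  have -> : i U * star (i U) - 1 = - ((V - i U) * star (i U) + V * star (V - i U)).
    by rewrite -VV' starB; ncring.
  rewrite cnormN; apply: le_trans (cnormD _ _) _.
  have n1 : ‖[(V - i U) * star (i U)]‖ <= 2 * d * (1 + 2 * d) by apply: cnormM_le; rewrite ?cnorm_star.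
  have n2 : ‖[V * star (V - i U)]‖ <= 2 * d by apply: cnormM_le1; rewrite ?cnorm_star ?nV.
  nra.
have d5 : 5 * d <= 2^-1 by lra.
have [|p [sp up np]] := polar_unitary d5 UU; first by apply: le_lt_trans UU' _; lra.
exists (fun j => U * p * r j); split=> [|j]; first exact: cuntz_unitary.
have -> : U * p * r j - b j = U * ((p - 1) * r j) by rewrite -Ur; ncring.
have n1 : ‖[(p - 1) * r j]‖ <= 2 * (5 * d).
  by apply: cnormM_le1r => //; rewrite cnorm_isometry //; exact: cuntz_iso.
have n2 : ‖[U]‖ <= 1 + 2 * d by rewrite -ni.
apply: le_trans (cnormM_le n2 n1) _; nra.
Qed.

(** [v] moves [G] and also the pair [i (r j)] close to the image of [B]. There the moved pair is
    corrected to a Cuntz pair, and a unitary [z] of [B] brings it back to [r]. So [star u = i z * v]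
    almost fixes the generators, hence [S], and [i z] does not leave the image of [B]. *)
Lemma intertwining_step (S : seq B) (G : seq D) (eps : R) : 0 < eps -> exists u, [/\ unitary u,
  forall s, s \in S -> ‖[u * i s * star u - i s]‖ <= eps
  & forall d, d \in G -> exists b, ‖[star u * d * u - i b]‖ <= eps].
Proof.
move=> e0; have [e e_0 he] := central_list S e0.
(* 14 is 1 + 12 + 1: the errors of [b], of the corrected pair [r'], and of [z]. *)
pose d := Num.min eps (Num.min (e / 14) 10^-1).
have d0 : 0 < d by rewrite !lt_min e0 divr_gt0 //= invr_gt0.
have d1 : d <= eps by rewrite ge_min lexx.
have d2 : d <= e / 14 by rewrite !ge_min lexx orbT.
have d3 : d <= 10^-1 by rewrite !ge_min lexx !orbT.
have [v [uv hv]] := into (i (r true) :: i (r false) :: G) d0.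
have [v1 v2] := uv.
pose bt j := v * i (r j) * star v.
have cbt : cuntz bt.
  have [o s] := cuntz_map ui cr.
  have o' j k : star (i (r j)) * i (r k) = (j == k)%:R := o j k.
  split=> [j k|].
    rewrite /bt !starM starK; transitivity (v * (star (i (r j)) * (star v * v) * i (r k)) * star v); first by rewrite !mulrA.
    by rewrite v1 mulr1 o'; case: (j == k); rewrite ?mulr1 ?mulr0 ?mul0r.
  rewrite /bt !starM starK.
  transitivity (v * (i (r true) * (star v * v) * star (i (r true)) + i (r false) * (star v * v) * star (i (r false))) * star v); first by ncring.
  by rewrite v1 !mulr1; rewrite /= in s; rewrite s mulr1.
have hb j : exists b, ‖[bt j - i b]‖ <= d.
  by apply: hv; case: j; rewrite !inE eqxx ?orbT.
have [b hb'] := choice hb.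
have [r' [cr' hr']] := cuntz_perturb cbt (ltW d0) d3 hb'.
have [z [uz hz]] := cuntz_pairs_equiv cr' cr d0.
have uiz := uhom_unitary ui uz; have [z1 z2] := uiz.
have [u [uu su us]] : exists u, [/\ unitary u, star u = i z * v & u = star v * star (i z)].
  exists (star (i z * v)); rewrite starK; split=> //; last exact: starM.
  by apply: unitary_star; exact: unitaryM.
exists u; split=> //.
  have hj j : ‖[i (r j) * u - u * i (r j)]‖ <= e.
    have -> : i (r j) * u - u * i (r j) = u * (star u * i (r j) * u - i (r j)).
      have -> : u * (star u * i (r j) * u - i (r j)) = (u * star u) * i (r j) * u - u * i (r j) by ncring.
      by rewrite uu.2; ncring.
    rewrite cnorm_isoMl; last exact: unitary_iso.
    have -> : star u * i (r j) * u - i (r j) = i z * (bt j - i (b j)) * star (i z)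
        + i z * i (b j - r' j) * star (i z) + i (z * r' j * star z - r j).
      by rewrite su us !(homB ui.1) !(homM ui.1) (homS ui.1) /bt; ncring.
    apply: le_trans (cnormD _ _) _; have n0 := cnormD (i z * (bt j - i (b j)) * star (i z)) (i z * i (b j - r' j) * star (i z)).
    rewrite !cnorm_conj // ni in n0; rewrite [X in _ + X]ni.
    have k1 := hb' j; have k2 : ‖[b j - r' j]‖ <= 12 * d by rewrite cnormBC.
    by have k3 := hz j; lra.
  move=> s sS; have h := he u (unitary_iso uu) hj s sS.
  have -> : u * i s * star u - i s = - ((i s * u - u * i s) * star u).
    have -> : (i s * u - u * i s) * star u = i s * (u * star u) - u * i s * star u by ncring.
    by rewrite uu.2; ncring.
  by rewrite cnormN cnorm_isoMr //; exact: unitary_iso.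
move=> x xG; have [c hc] := hv x (mem_behead (s := _ :: _) (mem_behead (s := _ :: _) xG)).
exists (z * c * star z); rewrite su us !(homM ui.1) (homS ui.1).
have -> : i z * v * x * (star v * star (i z)) - i z * i c * star (i z) = i z * (v * x * star v - i c) * star (i z).
  by ncring.
by rewrite cnorm_conj //; exact: le_trans hc d1.
Qed.

End Intertwining.

Section OneSidedIntertwining.
Variables (R : realType) (D B : cstarAlgType R) (i : B -> D) (r : bool -> B).
Hypotheses (ui : uhom i) (ni : forall x, ‖[i x]‖ = ‖[x]‖) (cr : cuntz r)
  (gen : cstar_generated_by [set r true; r false]%classic)
  (into : forall (F : seq D) (eps : R), 0 < eps -> exists v, unitary v /\
     forall d, d \in F -> exists b, ‖[v * d * star v - i b]‖ <= eps)
  (sepD : separable D).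

Let h (n : nat) : R := 2^-1 ^+ n.
Let h0 n : 0 < h n. Proof. by rewrite exprn_gt0 // invr_gt0. Qed.
Let hS n : h n = h n.+1 + h n.+1. Proof. by rewrite /h exprS; field. Qed.
Let h_small (e : R) : 0 < e -> exists N, forall n, (N <= n)%N -> h n < e.
Proof.
move=> e0; have q : 0 <= (2^-1 : R) < 1 by apply/andP; split; lra.
have [N hN] := expr_small q e0; exists N => n Nn; apply: le_lt_trans hN.
by rewrite /h; apply: ler_wiXn2l => //; lra.
Qed.

Let tail_sum (f : nat -> D) n : (forall m, (n <= m)%N -> ‖[f m.+1 - f m]‖ <= h m) ->
  forall m, (n <= m)%N -> ‖[f m - f n]‖ <= h n + h n.
Proof.
move=> hf m nm; suff : ‖[f m - f n]‖ <= (h n + h n) - (h m + h m) by have := h0 m; lra.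
elim: m nm => [|m IH]; first by rewrite leqn0 => /eqP ->; rewrite !subrr cnorm0.
rewrite leq_eqVlt => /orP[/eqP ->|nm]; first by rewrite !subrr cnorm0.
have k1 := IH nm; have k2 := hf m nm; have := hS m.
by have := cnorm_tri (f m) (f m.+1) (f n); lra.
Qed.

Lemma intertwining_sequence : exists (w : nat -> D) (S : nat -> seq B) (d : nat -> D),
  [/\ forall n, unitary (w n), S 0%N = [:: r true; r false],
      forall x (e : R), 0 < e -> exists k, ‖[x - d k]‖ < e,
      forall n s m, s \in S n -> (n <= m)%N ->
        ‖[w m.+1 * i s * star (w m.+1) - w m * i s * star (w m)]‖ <= h m
    & forall n k, (k <= n)%N -> exists2 b, b \in S n.+1 &
        ‖[d k - w n.+1 * i b * star (w n.+1)]‖ <= h n].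
Proof.
have [d hd] := separable_seq sepD.
pose next (p : nat * (D * seq B)) (q : D * seq B) := unitary p.2.1 ->
  [/\ unitary q.1, forall s, s \in p.2.2 -> ‖[q.1 * i s * star q.1 - p.2.1 * i s * star p.2.1]‖ <= h p.1,
      {subset p.2.2 <= q.2} & forall k, (k <= p.1)%N -> exists2 b, b \in q.2 &
        ‖[d k - q.1 * i b * star q.1]‖ <= h p.1].
(* When the current element is not unitary the requirement is void and the state is returned
   unchanged. *)
have step p : exists q, next p q.
  case: p => n [w S]; have [uw|nw] := pselect (unitary w); last by exists (w, S).
  pose G := [seq star w * d k * w | k <- iota 0 n.+1].
  have [u [uu uS uG]] := intertwining_step ui ni cr gen into S G (h0 n).
  have Hb x : exists b, x \in G -> ‖[star u * x * u - i b]‖ <= h n.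
    by have [xG|xG] := boolP (x \in G); [have [b hb] := uG x xG; exists b|exists 0].
  have [bt hbt] := choice Hb.
  have [w1 w2] := uw; have [u1 u2] := uu.
  exists (w * u, S ++ [seq bt x | x <- G]) => _ /=; split.
  - exact: unitaryM.
  - move=> s sS; have -> : w * u * i s * star (w * u) - w * i s * star w = w * (u * i s * star u - i s) * star w.
      by rewrite starM; ncring.
    by rewrite cnorm_conj //; exact: uS.
  - by move=> s sS; rewrite mem_cat sS.
  - move=> k kn; have kG : star w * d k * w \in G.
      by apply/mapP; exists k => //; rewrite mem_iota.
    exists (bt (star w * d k * w)); first by rewrite mem_cat; apply/orP; right; exact: (map_f bt kG).
    have -> : d k - w * u * i (bt (star w * d k * w)) * star (w * u)
      = (w * u) * (star u * (star w * d k * w) * u - i (bt (star w * d k * w))) * star (w * u).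
      rewrite starM; transitivity ((w * (u * star u) * star w) * d k * (w * (u * star u) * star w)
         - w * u * i (bt (star w * d k * w)) * (star u * star w)).
        by rewrite u2 !mulr1 w2 mul1r mulr1.
      by move: (i _) => ib; ncring.
    by rewrite cnorm_conj; [exact: hbt|exact: unitaryM].
have [nx hnx] := choice step.
pose st := fix st n : D * seq B := if n is m.+1 then nx (m, st m) else (1, [:: r true; r false]).
have ust n : unitary (st n).1.
  by elim: n => [|n IH] /=; [exact: unitary1|have [] := hnx (n, st n) IH].
have sub n m : (n <= m)%N -> {subset (st n).2 <= (st m).2}.
  elim: m => [|m IH]; first by rewrite leqn0 => /eqP ->.
  rewrite leq_eqVlt => /orP[/eqP ->//|nm] s sn.
  by have [_ _ hs _] := hnx (m, st m) (ust m); apply: hs; exact: IH nm s sn.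
exists (fun n => (st n).1), (fun n => (st n).2), d; split=> //.
  move=> n s m sn nm; have [_ hs _ _] := hnx (m, st m) (ust m).
  by apply: hs; exact: sub nm s sn.
by move=> n k kn; have [_ _ _ hs] := hnx (n, st n) (ust n); exact: hs.
Qed.

(** The conjugates of the generators converge, and their limits form a Cuntz pair because [Psi] is a
    homomorphism into the sequence algebra. [cuntz_embedding] gives the isometric [psi] on these
    limits, and density identifies it with the pointwise limit. Its range is dense, since
    approximants frozen at stage [n] hardly move later, and closed, since [psi] is isometric. *)
Theorem intertwining_iso : star_isomorphic D B.
Proof.
have [w [S [d [uw S0 dense near app]]]] := intertwining_sequence.
have lims j : exists t, lim_to (fun n => w n * i (r j) * star (w n)) t.
  have rS : r j \in S 0%N by rewrite S0 !inE; case: j; rewrite eqxx ?orbT.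
  apply: cauchy_lim => e e0; have e4 : 0 < e / 4 by lra.
  have [N hN] := h_small e4; exists N => m n Nm Nn.
  have hh := tail_sum (f := fun n => w n * i (r j) * star (w n)) (n := N) (fun m _ => near 0%N _ m rS (leq0n _)).
  apply: le_lt_trans (cnorm_tri (w N * i (r j) * star (w N)) _ _) _.
  have k1 := hh m Nm; have k2 := hh n Nn; rewrite cnormBC in k2.
  by have := hN N (leqnn N); lra.
have [t ht] := choice lims.
have bw := bnd_unitary uw; have uqw := qc_unitary uw; have [q1 q2] := uqw.
pose Psi (b : B) := qc w * qk (i b) * star (qc w).
have uqk := qk_uhom D.
have uPsi : uhom Psi.
  have [hk k1] := uqk; split; last by rewrite /Psi ui.2 k1 mulr1.
  split=> [c x y|x y|x]; rewrite /Psi.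
  - rewrite (homD ui.1) (homZ ui.1) (homD hk) (homZ hk) mulrDr mulrDl.
    by rewrite -scalerAr -scalerAl.
  - rewrite (homM ui.1) (homM hk).
    transitivity (qc w * qk (i x) * (star (qc w) * qc w) * qk (i y) * star (qc w)); last by rewrite !mulrA.
    by rewrite q1 mulr1 !mulrA.
  - by rewrite (homS ui.1) (homS hk) !starM starK !mulrA.
have PsiE b : Psi b = qc (fun n => w n * i b * star (w n)).
  by rewrite /Psi /qk -(qcS bw) -(qcM bw (bndc (i b))) -(qcM (bndM bw (bndc (i b))) (bndS bw)).
have bconj b : bnd (fun n => w n * i b * star (w n)).
  by apply: bndM; [apply: bndM => //; exact: bndc|exact: bndS].
have qkP (a : D) f : bnd f -> qk a = qc f <-> lim_to f a.
  move=> bf; rewrite (qcP (bndc a) bf); split=> k e /k[N hN]; exists N => n /hN; by rewrite cnormBC.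
have Pr j : Psi (r j) = qk (t j) by rewrite PsiE; apply/esym/qkP => //; exact: ht.
have qk0 (a : D) : qk a = 0 -> a = 0.
  move=> /(qc_eq0 (bndc a)) k; apply: cnorm_small => e /k[N hN]; exact: ltW (hN N (leqnn N)).
have qk_inj (a b : D) : qk a = qk b -> a = b.
  move=> e; apply/eqP; rewrite -subr_eq0; apply/eqP/qk0.
  by rewrite (homB uqk.1) e subrr.
have ctt : cuntz t.
  have [o s] := cuntz_map uPsi cr; split=> [j k|]; apply: qk_inj.
    rewrite (homM uqk.1) (homS uqk.1) -!Pr; have := o j k; rewrite /= => ->.
    by case: (j == k); rewrite ?uqk.2 ?(hom0 uqk.1).
  by rewrite (homD uqk.1) !(homM uqk.1) !(homS uqk.1) -!Pr uqk.2; exact: s.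
have [psi [upsi pr npsi]] := cuntz_embedding cr gen ctt.
have psi_lim b : lim_to (fun n => w n * i b * star (w n)) (psi b).
  move=> e e0; have e4 : 0 < e / 4 by lra.
  have [ps hps] := ev_generated cr gen b e4.
  have : qk (psi (ev r ps)) = qc (fun n => w n * i (ev r ps) * star (w n)).
    rewrite -PsiE (hom_ev r ps uPsi) -[qk _]/((qk \o psi) _) (hom_ev r ps (uhom_comp upsi uqk)).
    by congr (ev _ ps); apply/funext => j /=; rewrite pr Pr.
  move=> /(qkP _ _ (bconj _)) k; have [N hN] := k _ e4; exists N => n /hN k1.
  have -> : w n * i b * star (w n) - psi b = w n * i (b - ev r ps) * star (w n)
    + (w n * i (ev r ps) * star (w n) - psi (ev r ps)) - psi (b - ev r ps).
    by rewrite (homB ui.1) (homB upsi.1); ncring.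
  apply: le_lt_trans (cnormB _ _) _; rewrite npsi.
  have := cnormD (w n * i (b - ev r ps) * star (w n)) (w n * i (ev r ps) * star (w n) - psi (ev r ps)).
  by rewrite (cnorm_conj _ (uw n)) ni; lra.
have rng x (e : R) : 0 < e -> exists b, ‖[x - psi b]‖ <= e.
  move=> e0; have e4 : 0 < e / 4 by lra.
  have [k hk] := dense x _ e4; have [N hN] := h_small e4; pose n := (N + k)%N.
  have [b bS hb] := app n k (leq_addl _ _); exists b.
  have tl := tail_sum (f := fun n => w n * i b * star (w n)) (n := n.+1) (fun m nm => near n.+1 b m bS nm).
  have k1 : ‖[psi b - w n.+1 * i b * star (w n.+1)]‖ <= h n.
    by apply: (lim_to_le (psi_lim b)); exists n.+1 => m /tl; rewrite (hS n).
  have := hN n (leq_addr _ _); rewrite cnormBC in k1.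
  have := cnorm_tri (d k) x (psi b); have := cnorm_tri (w n.+1 * i b * star (w n.+1)) (d k) (psi b).
  by lra.
have surj x : exists b, psi b = x.
  have H n : exists b, ‖[x - psi b]‖ <= h n by exact: rng.
  have [b hb] := choice H.
  have lb : lim_to (fun n => psi (b n)) x.
    by move=> e /h_small[N hN]; exists N => n /hN; rewrite cnormBC; apply: le_lt_trans.
  have [l hl] : exists l, lim_to b l.
    apply: cauchy_lim => e e0; have e2 : 0 < e / 2 by lra.
    have [N hN] := lb _ e2; exists N => m n /hN k1 /hN k2.
    rewrite -npsi (homB upsi.1); apply: le_lt_trans (cnorm_tri x _ _) _.
    by rewrite [‖[x - _]‖]cnormBC; lra.
  exists l; apply: (lim_to_uniq _ lb) => e /hl[N hN]; exists N => n /hN.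
  by rewrite -(homB upsi.1) npsi.
have [g hg] := choice surj.
have isopsi : star_iso psi.
  split; first exact: upsi.1.
  exists g => x; last exact: hg.
  apply/eqP; rewrite -subr_eq0; apply/eqP/cnorm_eq0; rewrite -npsi (homB upsi.1) hg subrr cnorm0 //.
by have [g' [_ _ isog _ _]] := iso_inv isopsi; exists g'.
Qed.

End OneSidedIntertwining.

Theorem proposition3p7 (R : realType) (D : cstarAlgType R)
  (separable_D : separable D)
  (ssa_D : strongly_self_absorbing D)
  (K0_unit_D : K0_class (unit_proj D) = 0 :> K0 D)
  (O2 : cstarAlgType R) (O2_Cuntz : is_Cuntz_O2 O2) :
  star_isomorphic D O2.
Proof.
have [al [be [ta co]]] := ssa_core_exists ssa_D.
have [n [W0 [W1 [W00 W11 W01 WW]]]] := K0_unit_eq0 K0_unit_D.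
have [t ct] := core_cuntz_pair separable_D co ssa_D.1 W00 W11 W01 WW.
have [s1 [s2 [i1 i2 s12 gen]]] := O2_Cuntz.
have cr := cuntz_of_isometries i1 i2 s12; set r := fun b => _ in cr.
have [i [ui _ ni]] := cuntz_embedding (r := r) cr gen ct.
apply: (intertwining_iso ui ni cr gen _ separable_D) => F eps.
exact: (conjugate_into separable_D co ui ni cr).
Qed.
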